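(* Let $\mathcal{N} \subseteq \mathcal{M}$ be an inclusion of II$_1$-factors with separable predual. The following conditions are equivalent: (i) $\mathcal{N} \subseteq \mathcal{M}$ is $C^*$-irreducible, (ii) $\mathcal{N} \subseteq \mathcal{M}$ has the relative Dixmier property, (iii) $\mathcal{N} \subseteq \mathcal{M}$ is irreducible (that is, $\mathcal{N}' \cap \mathcal{M} = \mathbb{C}$) with finite Jones index.
   Context: The inclusion $\mathcal{N}\subseteq\mathcal{M}$ is a unital inclusion of von Neumann algebras. A unital inclusion $\mathcal{B} \subseteq \mathcal{A}$ of $C^*$-algebras is called $C^*$-irreducible if each intermediate $C^*$-algebra $\mathcal{B} \subseteq \mathcal{D} \subseteq \mathcal{A}$ (including $\mathcal{B}$ and $\mathcal{A}$) is simple. It has the relative Dixmier property if $C_{\mathcal{B}}(a) \cap \mathbb{C}\cdot 1_{\mathcal{B}} \neq \emptyset$ for all $a \in \mathcal{A}$, where $C_{\mathcal{B}}(a)$ denotes the norm closure of the convex hull of $\{u^* a u : u \in \mathcal{U}(\mathcal{B})\}$ and $\mathcal{U}(\mathcal{B})$ is the unitary group of $\mathcal{B}$. In (i) and (ii) the von Neumann algebras are regarded as $C^*$-algebras. *)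

(* Defs.v *)
(* MathComp-Analysis.  The scalars are R[i] for R : realType; inner products
   are linear in the first variable.  C*-algebras and von Neumann algebras are
   concrete: sets of bounded operators H -> H on a complex Hilbert space. *)
From HB Require Import structures.
From mathcomp Require Import all_boot all_order all_algebra.
From mathcomp Require Import all_classical all_reals all_analysis.
From mathcomp Require Import complex.

Set Implicit Arguments.
Unset Strict Implicit.
Unset Printing Implicit Defensive.
Import Order.TTheory GRing.Theory Num.Theory.
Import numFieldNormedType.Exports.
Local Open Scope classical_set_scope.
Local Open Scope ring_scope.
Local Open Scope complex_scope.

HB.mixin Record CompleteNormedModule_isHilbert (R : realType) V
    of CompleteNormedModule R[i] V := {
  hdot : {dot V for @Num.conj R[i]} ;
  hdot_norm : forall x : V, `|x| ^+ 2 = hdot x x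
}.

#[short(type="hilbertType")]
HB.structure Definition Hilbert (R : realType) :=
  {V of CompleteNormedModule_isHilbert R V & CompleteNormedModule R[i] V}.

Section Operators.
Context {R : realType} {H : hilbertType R}.
Local Notation C := R[i].
Implicit Types (a b u v p : H -> H) (A B D I M N S : set (H -> H)).

Definition bounded_op a : Prop :=
  linear a /\ exists c : C, forall x, `|a x| <= c * `|x|.

(* [adjoint a b] says b = a^* (b is determined by a). *)
Definition adjoint a b : Prop := forall x y, hdot (a x) y = hdot x (b y).

(* For e >= 0: the operator norm of a is at most e. *)
Definition opnorm_le a (e : C) : Prop := forall x, `|a x| <= e * `|x|.

Definition op_closure S : set (H -> H) :=
  [set a | bounded_op a /\
     forall e : C, 0 < e -> exists2 b, S b & opnorm_le (a - b) e].

Definition scalar_ops : set (H -> H) :=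
  [set a | exists z : C, a = (fun x => z *: x)].

Definition subspace S : Prop :=
  S 0 /\ forall (z : C) a b, S a -> S b -> S (z *: a + b).

Definition star_closed S : Prop :=
  forall a, S a -> exists2 b, S b & adjoint a b.

(** C*-algebras *)

Definition cstar_algebra D : Prop :=
  [/\ D `<=` bounded_op, subspace D,
      forall a b, D a -> D b -> D (a \o b),
      star_closed D & op_closure D `<=` D].

Definition closed_ideal D I : Prop :=
  [/\ I `<=` D, subspace I,
      forall a b, D a -> I b -> I (a \o b) /\ I (b \o a)
    & op_closure I `<=` I].

Definition simple_cstar D : Prop :=
  forall I, closed_ideal D I -> I = [set 0] \/ I = D.

Definition cstar_irreducible B A : Prop :=
  forall D, cstar_algebra D -> B `<=` D -> D `<=` A -> simple_cstar D.

(* v is the adjoint of u and its inverse; u, v \in B. *)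
Definition unitary_in B u v : Prop :=
  [/\ B u, B v, adjoint u v, u \o v = id & v \o u = id].

Definition unitary_orbit B a : set (H -> H) :=
  [set b | exists u v, unitary_in B u v /\ b = v \o a \o u].

Definition convex_hull S : set (H -> H) :=
  [set a | exists (n : nat) (t : 'I_n -> C) (s : 'I_n -> (H -> H)),
     [/\ forall i, 0 <= t i, \sum_i t i = 1, forall i, S (s i)
       & a = \sum_i t i *: s i]].

Definition relative_Dixmier B A : Prop :=
  forall a, A a ->
    (op_closure (convex_hull (unitary_orbit B a)) `&` scalar_ops) !=set0.

(** Von Neumann algebras *)

Definition commutant A : set (H -> H) :=
  [set b | bounded_op b /\ forall a, A a -> a \o b = b \o a].

Definition von_neumann A : Prop :=
  star_closed A /\ commutant (commutant A) = A.

Definition factor A : Prop :=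
  von_neumann A /\ A `&` commutant A = scalar_ops.

Definition square_summable (xi : nat -> H) : Prop :=
  exists c : C, forall n, \sum_(i < n) `|xi i| ^+ 2 <= c.

(* The predual of A: the functionals a |-> \sum_n <a xi_n, eta_n> on A.  Only
   the values of f on A matter. *)
Definition normal_functional A (f : (H -> H) -> C) : Prop :=
  exists xi eta : nat -> H,
    [/\ square_summable xi, square_summable eta
      & forall a, A a ->
          series (fun n => hdot (a (xi n)) (eta n) : C^o) @ \oo
            --> (f a : C^o)].

(* A countable subset of the predual is dense for the norm of functionals on
   the unit ball of A. *)
Definition separable_predual A : Prop :=
  exists f : nat -> (H -> H) -> C,
    (forall n, normal_functional A (f n)) /\
    forall g, normal_functional A g -> forall e : C, 0 < e ->
      exists n, forall a, A a -> opnorm_le a 1 -> `|g a - f n a| <= e.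

(* Faithful normal tracial states; on a factor there is at most one. *)
Definition tracial_state A (tau : (H -> H) -> C) : Prop :=
  [/\ normal_functional A tau, tau id = 1,
      forall a b, A a -> A b -> adjoint a b -> 0 <= tau (b \o a),
      forall a b, A a -> A b -> adjoint a b -> tau (b \o a) = 0 -> a = 0
    & forall a b, A a -> A b -> tau (a \o b) = tau (b \o a)].

Definition infinite_dimensional A : Prop :=
  forall (n : nat) (s : 'I_n -> (H -> H)), exists2 a, A a &
    forall t : 'I_n -> C, a <> \sum_i t i *: s i.

Definition II1_factor A : Prop :=
  [/\ factor A, infinite_dimensional A & exists tau, tracial_state A tau].

Definition irreducible_inclusion N M : Prop :=
  commutant N `&` M = scalar_ops.

(* p is the orthogonal projection onto the closure of A xi. *)
Definition cyclic_projection A (xi : H) p : Prop :=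
  [/\ bounded_op p,
      forall x, closure [set a xi | a in A] (p x)
    & forall x a, A a -> hdot (x - p x) (a xi) = 0].

(* l is the Murray-von Neumann coupling constant dim_A(H) of the II_1 factor A
   acting on H: tr_A([A' xi]) / tr_A'([A xi]) for xi != 0 if A' is finite (the
   quotient does not depend on xi), and +oo if A' is infinite. *)
Definition coupling_constant A (l : \bar R) : Prop :=
  ((forall tau', ~ tracial_state (commutant A) tau') /\ l = +oo%E) \/
  exists tau tau' xi p q,
    [/\ tracial_state A tau, tracial_state (commutant A) tau', xi != 0,
        cyclic_projection (commutant A) xi p /\ cyclic_projection A xi q
      & l = (complex.Re (tau p / tau' q))%:E].

End Operators.

Section JonesIndex.
Context {R : realType} {H : hilbertType R}.
Implicit Types (M N : set (H -> H)).

(* (K, pi, Omega) is the GNS triple of tau, i.e. K = L^2(M, tau) with M acting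
   by left multiplication and Omega the class of 1. *)
Definition GNS_triple M (tau : (H -> H) -> R[i]) (K : hilbertType R)
    (pi : (H -> H) -> (K -> K)) (Omega : K) : Prop :=
  [/\ (forall a, M a -> bounded_op (pi a)) /\ pi id = id,
      forall (z : R[i]) a b, M a -> M b -> pi (z *: a + b) = z *: pi a + pi b,
      forall a b, M a -> M b -> pi (a \o b) = pi a \o pi b,
      forall a b, M a -> M b -> adjoint a b -> adjoint (pi a) (pi b)
    & (forall a, M a -> hdot (pi a Omega) Omega = tau a) /\
      closure [set pi a Omega | a in M] = setT].

(* [M : N] = dim_N(L^2(M)); the GNS triple is unique up to unitary
   equivalence, so l is determined by N and M. *)
Definition Jones_index N M (l : \bar R) : Prop :=
  exists tau (K : hilbertType R) (pi : (H -> H) -> (K -> K)) (Omega : K),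
    [/\ tracial_state M tau, GNS_triple M tau pi Omega
      & coupling_constant (pi @` N) l].

Definition finite_Jones_index N M : Prop :=
  exists r : R, Jones_index N M r%:E.

End JonesIndex.

(* Main.v *)
(* (i) => irreducible: if [p] is a projection of [N' /\ M] other than 0 and 1, then
   the multiples of [p] are a proper ideal of [M /\ {p}'], which contains [N].
   (i) => finite index: on [L^2(M)] let [P = pi(N)'], [e] the projection onto the
   closure of [N Om], and [rho] right multiplication. If some [rho f], with [f] a
   nonzero projection of [M], is dominated by [e], then finitely many translates
   of [e] add up to 1 and [P] has a trace. Otherwise [e] is dominated by [rho f]
   for arbitrarily small [f], which yields vectors [y_k] of [M] with small right
   support on which [N] acts almost as on [Om]; the [x] of [M] such that
   [x n y_k -> 0] and [x^* n y_k -> 0] for all [n] of [N] give a proper nonzero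
   ideal of a C*-algebra between [N] and [M]. Separability is used here, to
   produce a nonzero such [x].
   (iii) => (ii): the trace of [P] gives the Pimsner-Popa inequality
   [lam y <= E_N(y)]. Irreducibility allows averaging [x - tau(x)] by unitaries of
   [N] to something of small trace norm; by Schwarz' inequality further averages
   are then dominated by averages of [E_N(|y|^2) / lam], an element of [N] of small
   trace, hence are small in norm.
   (ii) => (i): a nonzero ideal contains some [a^* a], whose averages converge to
   the scalar [tau(a^* a) > 0]. *)
From HB Require Import structures.
Require Import Defs.
From mathcomp Require Import all_boot all_order all_algebra.
From mathcomp Require Import all_classical all_reals all_analysis.
From mathcomp Require Import complex.
From mathcomp Require Import ring lra.

Set Implicit Arguments.
Unset Strict Implicit.
Unset Printing Implicit Defensive.
Import Order.TTheory GRing.Theory Num.Theory.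
Import numFieldNormedType.Exports.
Local Open Scope classical_set_scope.
Local Open Scope ring_scope.
Local Open Scope complex_scope.

(** * Scalars and Hilbert spaces *)

(** The dichotomy in (i) rests on comparison in the factor [P], at a stage where [P] has no known
    trace. The exhaustion behind comparison only needs an additive functional, bounded and
    nonnegative on projections, that is positive on nonzero projections below one of the two
    compared. For [e] this is [T |-> <T Om, Om>], because [Om] separates the part of [P] below [e].
    The same functional satisfies [<S e T Om, Om> = <T e S Om, Om>], which is why its translates add
    up to a trace. It follows that [P] is a factor, and the trace of [P] is thereby known on
    [rho(M)] and on [rho(N) e]. The constant [lam] is the trace of [e]. The analytic tools are
    square roots, one cut of a self-adjoint operator into its positive and negative parts, and
    limits along an ultrafilter. The expectation [E_N(y)] appears only as an [h] in [N] with
    [t(n y) = t(n h)] for all [n] in [N]. *)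

(* Decision procedure for linear identities in a module: both sides are
   reified as linear combinations of atoms and the coefficients compared. *)
Inductive lexp (K : Type) :=
  LVar of nat | LZero | LAdd of lexp K & lexp K | LOpp of lexp K
| LScale of K & lexp K.
Arguments LVar {K}. Arguments LZero {K}.

Section LinearExpressions.
Context {K : comPzRingType} {V : lmodType K}.

Fixpoint leval (env : seq V) (e : lexp K) : V := match e with
  | LVar i => nth 0 env i | LZero => 0
  | LAdd a b => leval env a + leval env b
  | LOpp a => - leval env a | LScale k a => k *: leval env a end.

Fixpoint lcoef (e : lexp K) (i : nat) : K := match e with
  | LVar j => if Nat.eqb j i then 1 else 0 | LZero => 0
  | LAdd a b => lcoef a i + lcoef b i
  | LOpp a => - lcoef a i | LScale k a => k * lcoef a i end.

Lemma levalE env e :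
  leval env e = \sum_(i < size env) lcoef e i *: nth 0 env i.
Proof.
elim: e => [j||a IHa b IHb|a IHa|k a IHa] /=.
- have [ji|ji] := ltnP j (size env); last first.
    rewrite nth_default// big1// => i _.
    case: ifP => [/PeanoNat.Nat.eqb_eq h|]; rewrite ?scale0r//.
    by move: (ltn_ord i); rewrite -h ltnNge ji.
  rewrite (bigD1 (Ordinal ji))//= PeanoNat.Nat.eqb_refl scale1r big1 ?addr0//.
  move=> i ij; case: ifP => [/PeanoNat.Nat.eqb_eq h|]; rewrite ?scale0r//.
  by case/eqP: ij; apply/val_inj.
- by rewrite big1// => i _; rewrite scale0r.
- by rewrite IHa IHb -big_split/=; apply: eq_bigr => i _; rewrite scalerDl.
- by rewrite IHa -sumrN; apply: eq_bigr => i _; rewrite scaleNr.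
- by rewrite IHa scaler_sumr; apply: eq_bigr => i _; rewrite scalerA.
Qed.

(** Unfolds by computation to a finite conjunction, so that [lmod] is left with one ring identity
    per atom. *)
Fixpoint lall (n : nat) (P : nat -> Prop) : Prop :=
  if n is n'.+1 then lall n' P /\ P n' else True.

Lemma lallP n P : lall n P -> forall i, (i < n)%N -> P i.
Proof.
elim: n => //= n IH [h hn] i; rewrite ltnS leq_eqVlt => /orP[/eqP ->//|].
exact: IH.
Qed.

Lemma leval_eq env e1 e2 :
  lall (size env) (fun i => lcoef e1 i = lcoef e2 i) ->
  leval env e1 = leval env e2.
Proof.
by move=> h; rewrite !levalE; apply: eq_bigr => i _; rewrite (lallP h).
Qed.

End LinearExpressions.

(* Atoms are compared syntactically first and then up to conversion, since the
   same product may occur with two different structure instances. *)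
Ltac lfind_syn x env k :=
  lazymatch env with
  | cons x _ => k
  | cons _ ?t => lfind_syn x t (S k)
  end.
Ltac lfind_conv x env k :=
  match env with
  | cons ?y _ => let _ := lazymatch O with _ => unify x y end in k
  | cons _ ?t => lfind_conv x t (S k)
  end.
Ltac lfind x env k :=
  match O with _ => lfind_syn x env k | _ => lfind_conv x env k end.
Ltac lmem x env :=
  match O with _ => let _ := lfind x env O in true | _ => false end.
Ltac lenv K env t :=
  lazymatch t with
  | (?a + ?b)%R => let e := lenv K env a in lenv K e b
  | (- ?a)%R => lenv K env a
  | (_ *: ?a)%R => lenv K env a
  | (0)%R => env
  | _ => let b := lmem t env in
         lazymatch b with true => env | false => constr:(cons t env) end
  end.
Ltac lreify K env t :=
  lazymatch t with
  | (?a + ?b)%R => let x := lreify K env a in let y := lreify K env b in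
                   constr:(@LAdd K x y)
  | (- ?a)%R => let x := lreify K env a in constr:(@LOpp K x)
  | (?k *: ?a)%R => let x := lreify K env a in constr:(@LScale K k x)
  | (0)%R => constr:(@LZero K)
  | _ => let k := lfind t env O in constr:(@LVar K k)
  end.
Ltac lmod_over K :=
  lazymatch goal with |- @eq ?V ?x ?y =>
    let e0 := lenv K (@nil V) x in
    let e := lenv K e0 y in
    let a := lreify K e x in let b := lreify K e y in
    refine (@leval_eq K _ e a b _);
    cbv [lall size lcoef Nat.eqb]; repeat split; try ring
  end.
Ltac lmod := match goal with S : realType |- _ => lmod_over (complex S) end.

Section Scalars.
Context {R : realType}.
Implicit Types z w : R[i].

(** Moduli, and below the norms [nm], are taken in [R] instead of [R[i]], where [lra] and [nra]
    apply. *)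
Definition cabs z : R := complex.Re `|z|.

Lemma cabsE z : `|z| = (cabs z)%:C.
Proof. by rewrite /cabs RRe_real // normr_real. Qed.

Lemma cabs_ge0 z : 0 <= cabs z.
Proof. by rewrite -lecR -cabsE normr_ge0. Qed.

Lemma cabs0 : cabs 0 = 0.
Proof. by rewrite /cabs normr0. Qed.

Lemma cabs_eq0 z : cabs z = 0 -> z = 0.
Proof. by move=> h; apply/normr0_eq0; rewrite cabsE h. Qed.

Lemma cabsM z w : cabs (z * w) = cabs z * cabs w.
Proof. by apply: complexI; rewrite rmorphM /= -!cabsE normrM. Qed.

Lemma cabsD z w : cabs (z + w) <= cabs z + cabs w.
Proof. by rewrite -lecR rmorphD /= -!cabsE ler_normD. Qed.

Lemma cabsN z : cabs (- z) = cabs z.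
Proof. by rewrite /cabs normrN. Qed.

Lemma cabs_conj z : cabs (conjc z) = cabs z.
Proof. by rewrite /cabs normcJ. Qed.

Lemma cabs_real (r : R) : cabs r%:C = `|r|.
Proof.
by rewrite /cabs normc_def /= expr0n /= addr0 sqrtr_sqr.
Qed.

Lemma sqr_cabs z : cabs z ^+ 2 = complex.Re z ^+ 2 + complex.Im z ^+ 2.
Proof. by apply: complexI; rewrite add_Re2_Im2 cabsE rmorphXn. Qed.

Lemma mul_conjc z : z * conjc z = (cabs z ^+ 2)%:C.
Proof. by rewrite -sqr_normc cabsE rmorphXn. Qed.

Lemma Re_le_cabs z : complex.Re z <= cabs z.
Proof.
by rewrite -lecR -cabsE (le_trans _ (normc_ge_Re z))// lecR ler_norm.
Qed.

Lemma ReD z w : complex.Re (z + w) = complex.Re z + complex.Re w.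
Proof. by case: z w => [? ?] []. Qed.

Lemma ReB z w : complex.Re (z - w) = complex.Re z - complex.Re w.
Proof. by case: z w => [? ?] []. Qed.

Lemma ReN z : complex.Re (- z) = - complex.Re z.
Proof. by case: z. Qed.

Lemma ReZ (r : R) z : complex.Re (r%:C * z) = r * complex.Re z.
Proof. by case: z => a b /=; rewrite mul0r subr0. Qed.

Lemma ReJ z : complex.Re (conjc z) = complex.Re z.
Proof. by case: z. Qed.

Lemma Re_sum I (r : seq I) (P : pred I) (F : I -> R[i]) :
  complex.Re (\sum_(i <- r | P i) F i) = \sum_(i <- r | P i) complex.Re (F i).
Proof. by apply: (big_morph _ ReD). Qed.

Lemma Re_ge0 z : 0 <= z -> 0 <= complex.Re z.
Proof. by rewrite lecE => /andP[]. Qed.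

Lemma Re_le z w : z <= w -> complex.Re z <= complex.Re w.
Proof. by rewrite lecE => /andP[]. Qed.

Lemma ge0_ReC z : 0 <= z -> z = (complex.Re z)%:C.
Proof. by move=> h; rewrite RRe_real // ger0_real. Qed.

Lemma cabs_ge0_id z : 0 <= z -> cabs z = complex.Re z.
Proof. by move=> h; rewrite /cabs ger0_norm. Qed.

Lemma Re_mulNi z : complex.Re (- 'i * z) = complex.Im z.
Proof. by case: z => a b /=; rewrite oppr0 mul0r mulN1r sub0r opprK. Qed.

(** A unimodular factor makes a number equal to its modulus; estimates of real parts thus become
    estimates of moduli, in [psd_CS] and [glim_bound]. *)
Lemma rotate z : exists w, cabs w = 1 /\ w * z = (cabs z)%:C.
Proof.
have [->|z0] := eqVneq z 0.
  by exists 1; rewrite mulr0 cabs0 /cabs normr1.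
have cz : cabs z != 0 by apply: contra_neq z0 => /cabs_eq0.
exists (conjc z * ((cabs z)^-1)%:C); split.
  by rewrite cabsM cabs_conj cabs_real ger0_norm ?invr_ge0 ?cabs_ge0// divff.
rewrite mulrAC [_ * z]mulrC mul_conjc -rmorphM /= expr2 -mulrA divff//.
by rewrite mulr1.
Qed.

Lemma conj_fixed_real z : conjc z = z -> z = (complex.Re z)%:C.
Proof.
case: z => a b /= [] h; congr (_ +i* _).
by apply/eqP; rewrite -[_ == _](@mulrn_eq0 _ b 2) mulr2n -{1}h addNr.
Qed.

End Scalars.

Section Dot.
Context {R : realType} {H : hilbertType R}.
Implicit Types x y w : H.

Definition nm x : R := complex.Re `|x|.

Lemma nmE x : `|x| = (nm x)%:C.
Proof. by rewrite /nm RRe_real // normr_real. Qed.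

Lemma nm_ge0 x : 0 <= nm x.
Proof. by rewrite -lecR -nmE normr_ge0. Qed.

Lemma nm0 : nm 0 = 0. Proof. by rewrite /nm normr0. Qed.

Lemma nm_eq0 x : nm x = 0 -> x = 0.
Proof. by move=> h; apply/normr0_eq0; rewrite nmE h. Qed.

Lemma nmD x y : nm (x + y) <= nm x + nm y.
Proof. by rewrite -lecR rmorphD /= -!nmE ler_normD. Qed.

Lemma nmN x : nm (- x) = nm x. Proof. by rewrite /nm normrN. Qed.

Lemma nmB x y : nm (x - y) = nm (y - x).
Proof. by rewrite -nmN opprB. Qed.

Lemma nmZ z x : nm (z *: x) = cabs z * nm x.
Proof. by apply: complexI; rewrite rmorphM /= -nmE normrZ cabsE nmE. Qed.

Lemma nmZr (r : R) x : nm (r%:C *: x) = `|r| * nm x.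
Proof. by rewrite nmZ cabs_real. Qed.

Lemma hdotDl x y w : hdot (x + y) w = hdot x w + hdot y w.
Proof. exact: linearDl. Qed.
Lemma hdotDr x y w : hdot x (y + w) = hdot x y + hdot x w.
Proof. exact: raddfD. Qed.
Lemma hdotNl x w : hdot (- x) w = - hdot x w.
Proof. exact: linearNl. Qed.
Lemma hdotNr x w : hdot x (- w) = - hdot x w.
Proof. exact: raddfN. Qed.
Lemma hdotBl x y w : hdot (x - y) w = hdot x w - hdot y w.
Proof. by rewrite hdotDl hdotNl. Qed.
Lemma hdotBr x y w : hdot x (y - w) = hdot x y - hdot x w.
Proof. by rewrite hdotDr hdotNr. Qed.
Lemma hdotZl z x w : hdot (z *: x) w = z * hdot x w.
Proof. exact: linearZl_LR. Qed.
Lemma hdotZr z x w : hdot x (z *: w) = conjc z * hdot x w.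
Proof. exact: linearZr_LR. Qed.
Lemma hdot0l w : hdot 0 w = 0. Proof. exact: linear0l. Qed.
Lemma hdot0r w : hdot w 0 = 0. Proof. exact: raddf0. Qed.
Lemma hdotC x y : hdot x y = conjc (hdot y x).
Proof. by rewrite {1}hermC expr0 mul1r. Qed.
Lemma hdot_suml I (r : seq I) (P : pred I) (F : I -> H) w :
  hdot (\sum_(i <- r | P i) F i) w = \sum_(i <- r | P i) hdot (F i) w.
Proof. exact: (big_morph (hdot^~ w) (fun x y => hdotDl x y w) (hdot0l w)). Qed.

Lemma hdotxx x : hdot x x = (nm x ^+ 2)%:C.
Proof. by rewrite -hdot_norm nmE rmorphXn. Qed.

Lemma nm_sq x : nm x ^+ 2 = complex.Re (hdot x x).
Proof. by rewrite hdotxx. Qed.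

Lemma nmD_sq x y :
  nm (x + y) ^+ 2 = nm x ^+ 2 + nm y ^+ 2 + 2 * complex.Re (hdot x y).
Proof.
rewrite !nm_sq hdotDl !hdotDr [hdot y x]hdotC !ReD ReJ.
ring.
Qed.

Lemma nmB_sq x y :
  nm (x - y) ^+ 2 = nm x ^+ 2 + nm y ^+ 2 - 2 * complex.Re (hdot x y).
Proof. by rewrite nmD_sq nmN hdotNr ReN; ring. Qed.

Lemma parallelogram x y :
  nm (x + y) ^+ 2 + nm (x - y) ^+ 2 = 2 * nm x ^+ 2 + 2 * nm y ^+ 2.
Proof. by rewrite nmB_sq nmD_sq; ring. Qed.

End Dot.

(* Instances: the inner product, [<a x, y>] with [a >= 0], and [tau (b^* a)]. *)
Section PsdForm.
Context {R : realType} {V : lmodType R[i]}.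
Variables (S : set V) (f : V -> V -> R[i]).

Definition psd_form : Prop :=
  [/\ forall z x y, S x -> S y -> S (z *: x + y),
      forall z x y w, S x -> S y -> S w -> f (z *: x + y) w = z * f x w + f y w,
      forall x y, S x -> S y -> f y x = conjc (f x y)
    & forall x, S x -> 0 <= f x x].

Hypothesis hf : psd_form.

Lemma psd_CS x y : S x -> S y ->
  cabs (f x y) ^+ 2 <= complex.Re (f x x) * complex.Re (f y y).
Proof.
case: hf => hS hl hc hp Sx Sy.
have [w [w1 wE]] := rotate (f x y).
(* Positivity of [f u u] at [u = t w x + y]; the unimodular [w] makes the cross term real. *)
have key (t : R) : 0 <= t ^+ 2 * complex.Re (f x x) +
    2 * t * cabs (f x y) + complex.Re (f y y).
  pose u := (t%:C * w) *: x + y.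
  have Su : S u by exact: hS.
  have := Re_ge0 (hp _ Su).
  have -> : f u u = (t%:C * w) * f x u + f y u by rewrite {1}/u hl.
  rewrite (hc u x)// (hc u y)// /u !hl//.
  rewrite !rmorphD !rmorphM /= -(hc _ _ Sx Sx) -(hc _ _ Sy Sy) (hc x y)//.
  rewrite conjcK.
  have ww : w * conjc w = 1 by rewrite mul_conjc w1 expr1n.
  set A := f x x; set B := f x y; set D := f y y.
  have -> : t%:C * w * (conjc t%:C * conjc w * A + B) +
     (conjc t%:C * conjc w * conjc B + D) =
     (t ^+ 2)%:C * A + t%:C * (w * B) + t%:C * conjc (w * B) + D.
    rewrite conjc_real rmorphXn rmorphM /= -[in RHS](mulr1 A) -ww; ring.
  rewrite wE conjc_real -!rmorphM /= -/B.
  rewrite !ReD ReZ /=.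
  by congr (0 <= _); ring.
set a := complex.Re (f x x); set c := complex.Re (f y y); set b := cabs (f x y).
have a0 : 0 <= a by exact/Re_ge0/hp.
have c0 : 0 <= c by exact/Re_ge0/hp.
have b0 : 0 <= b by exact: cabs_ge0.
have [a00|an0] := eqVneq a 0.
  have [b00|bn0] := eqVneq b 0; first by rewrite b00 a00; nra.
  (* For [a = 0] the quadratic in [t] is affine and takes the value -1 here. For [a > 0] it is
     evaluated at its minimum [- b / a]. *)
  have := key (- (c + 1) / (2 * b)); rewrite -/a -/b -/c a00 mulr0 add0r.
  have -> : 2 * (- (c + 1) / (2 * b)) * b + c = -1 by field.
  by rewrite ler0N1.
have := key (- b / a); rewrite -/a -/b -/c.
have -> : (- b / a) ^+ 2 * a + 2 * (- b / a) * b + c = c - b ^+ 2 / a by field.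
by rewrite subr_ge0 ler_pdivrMr ?lt0r ?an0 ?a0// mulrC.
Qed.

End PsdForm.

Section Dot2.
Context {R : realType} {H : hilbertType R}.
Implicit Types x y w : H.

Lemma hdot_psd : psd_form setT (fun x y : H => hdot x y).
Proof.
split.
- by [].
- by move=> z x y w _ _ _; rewrite hdotDl hdotZl.
- by move=> x y _ _; rewrite hdotC.
by move=> x _; rewrite hdotxx ler0c exprn_ge0// nm_ge0.
Qed.

Lemma CS x y : cabs (hdot x y) <= nm x * nm y.
Proof.
have := psd_CS hdot_psd (I : setT x) (I : setT y).
rewrite -!nm_sq -exprMn ler_pXn2r// ?nnegrE ?cabs_ge0//.
by rewrite mulr_ge0 ?nm_ge0.
Qed.

Lemma hdot_eq x y : (forall w, hdot x w = hdot y w) -> x = y.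
Proof.
move=> h; apply/eqP; rewrite -subr_eq0; apply/eqP/nm_eq0.
by apply/eqP; rewrite -sqrf_eq0 nm_sq hdotBl h subrr.
Qed.

Lemma hdot_eqr x y : (forall w, hdot w x = hdot w y) -> x = y.
Proof. by move=> h; apply: hdot_eq => w; rewrite hdotC h -hdotC. Qed.

Definition cvh (u : nat -> H) x :=
  forall e : R, 0 < e -> exists N, forall n, (N <= n)%N -> nm (u n - x) <= e.

Definition cauchyh (u : nat -> H) :=
  forall e : R, 0 < e -> exists N, forall n m, (N <= n)%N -> (N <= m)%N ->
    nm (u n - u m) <= e.

Lemma cauchyh_cvg u : cauchyh u -> exists x, cvh u x.
Proof.
move=> hu.
have cu : cauchy (u @ \oo).
  apply: cauchy_exP => e e0.
  have e0R : 0 < complex.Re e by move: e0; rewrite ltcE => /andP[].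
  have eE : e = (complex.Re e)%:C by rewrite RRe_real// gtr0_real.
  have [N hN] := hu (complex.Re e / 2) (divr_gt0 e0R (ltr0Sn _ _)).
  exists (u N); exists N => // n /= Nn.
  rewrite -ball_normE /= nmE eE ltcR.
  by apply: le_lt_trans (hN _ _ (leqnn N) Nn) _; lra.
have cvu : cvg (u @ \oo) by exact: cauchy_cvg.
exists (lim (u @ \oo)) => e e0.
have /cvgrPdist_le/(_ e%:C) := cvu; rewrite ltcR => /(_ e0)[N _ hN].
by exists N => n Nn; have := hN _ Nn; rewrite /= nmE lecR nmB.
Qed.

Lemma cvh_unique u x y : cvh u x -> cvh u y -> x = y.
Proof.
move=> ux uy; apply/eqP; rewrite -subr_eq0; apply/eqP/nm_eq0/eqP.
rewrite eq_le nm_ge0 andbT; apply/ler_addgt0Pl => e e0; rewrite addr0.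
have e2 : 0 < e / 2 by lra.
have [N hN] := ux _ e2; have [M hM] := uy _ e2.
have := hN _ (leq_maxl N M); have := hM _ (leq_maxr N M).
set v := u _ => h1 h2.
have -> : x - y = (v - y) - (v - x) by lmod.
by rewrite (le_trans (nmD _ _))// nmN; lra.
Qed.

End Dot2.

Lemma invn_small (R : realType) (e : R) : 0 < e ->
  exists N, forall n, (N <= n)%N -> (n.+1%:R)^-1 <= e.
Proof.
move=> e0; exists (Num.truncn e^-1) => n hn.
have n0 : 0 < n.+1%:R :> R by rewrite ltr0n.
rewrite -[e]invrK lef_pV2 ?posrE ?invr_gt0//.
rewrite ltW// (lt_le_trans (truncnS_gt _))// ler_nat ltnS//.
Qed.

Lemma le_eps (R : realType) (x y : R) :
  (forall e, 0 < e -> x <= y + e) -> x <= y.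
Proof. by move=> h; apply/ler_addgt0Pr => e; exact: h. Qed.

Lemma le_of_sqr (R : realType) (x y : R) : 0 <= y -> x ^+ 2 <= y ^+ 2 -> x <= y.
Proof. by move=> y0; rewrite leNgt => h; apply/negP => xy; nra. Qed.

(** * Nearest points, orthogonal projection and the Riesz representation *)

Section Nearest.
Context {R : realType} {V : Type}.
Variables (S : set V) (d : V -> R) (q : V -> V -> R).

(** Here [d] is a squared distance to a fixed point and [q] the squared distance of two points of
    [S]. With [m] the midpoint, the last hypothesis is the parallelogram identity, and it makes
    minimizing sequences Cauchy. Applied to subspaces, to convex hulls of orbits and to the effects
    of [N]. *)
Lemma minimizing_sequence x0 : S x0 -> (forall x, S x -> 0 <= d x) ->
  (forall x y, S x -> S y ->
     exists2 m, S m & q x y <= 2 * d x + 2 * d y - 4 * d m) ->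
  exists (delta : R) (u : nat -> V),
    [/\ forall x, S x -> delta <= d x, forall n, S (u n),
        forall n, d (u n) <= delta + n.+1%:R^-1
      & forall n m, q (u n) (u m) <= 2 * n.+1%:R^-1 + 2 * m.+1%:R^-1].
Proof.
move=> Sx0 d0 hq.
have hi : has_inf (d @` S).
  by split; [exists (d x0), x0 | exists 0 => _ [x Sx <-]; exact: d0].
pose delta := inf (d @` S).
have hd x : S x -> delta <= d x.
  by move=> Sx; apply: ge_inf; [case: hi | exists x].
have hu n : exists x, S x /\ d x <= delta + n.+1%:R^-1.
  have e0 : 0 < n.+1%:R^-1 :> R by rewrite invr_gt0 ltr0n.
  have [_ [x Sx <-] /ltW ?] := inf_adherent e0 hi.
  by exists x.
have [u hu'] := choice hu.
exists delta, u; split => // [n|n|n m]; try by case: (hu' n).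
have [Sn dn] := hu' n; have [Sm dm] := hu' m.
have [z Sz] := hq _ _ Sn Sm; have := hd _ Sz.
move: dn dm; set a := n.+1%:R^-1; set b := m.+1%:R^-1.
lra.
Qed.

End Nearest.

Section Projection.
Context {R : realType} {H : hilbertType R}.
Implicit Types (x y p : H) (S : set H).

Definition lsub S := S 0 /\ forall (z : R[i]) x y, S x -> S y -> S (z *: x + y).

Lemma lsubD S x y : lsub S -> S x -> S y -> S (x + y).
Proof. by case=> _ h Sx Sy; rewrite -[x]scale1r; exact: h. Qed.
Lemma lsubZ S (z : R[i]) x : lsub S -> S x -> S (z *: x).
Proof. by case=> h0 h Sx; rewrite -[_ *: _]addr0; exact: h. Qed.
Lemma lsubN S x : lsub S -> S x -> S (- x).
Proof. by move=> h Sx; rewrite -scaleN1r; exact: lsubZ. Qed.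
Lemma lsubB S x y : lsub S -> S x -> S y -> S (x - y).
Proof. by move=> h Sx Sy; apply: lsubD => //; exact: lsubN. Qed.

Definition clo S : set H :=
  [set p | forall e : R, 0 < e -> exists2 s, S s & nm (p - s) <= e].

Lemma sub_clo S : S `<=` clo S.
Proof. by move=> x Sx e e0; exists x => //; rewrite subrr nm0 ltW. Qed.

Lemma clo_closure S p : clo S p -> closure S p.
Proof.
move=> h B /nbhs_ballP[e /= e0 heB].
have e0R : 0 < complex.Re e by move: e0; rewrite ltcE => /andP[].
have eE : e = (complex.Re e)%:C by rewrite RRe_real// gtr0_real.
have [s Ss hs] := h (complex.Re e / 2) ltac:(lra).
exists s; split => //; apply: heB.
by rewrite -ball_normE /= nmE eE ltcR; apply: le_lt_trans hs _; lra.
Qed.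

Lemma closure_clo S p : closure S p -> clo S p.
Proof.
move=> h e e0.
have [] := h (ball p e%:C); first by apply: nbhsx_ballx; rewrite ltcR.
by move=> s [Ss]; rewrite -ball_normE /= nmE ltcR => /ltW hs; exists s.
Qed.

Lemma hhalfK (x : H) : 2^-1%:C *: x + 2^-1%:C *: x = x.
Proof. by rewrite -scalerDl -rmorphD /= (_ : 2^-1 + 2^-1 = 1 :> R) ?scale1r//; lra. Qed.

Lemma nm_double (x : H) : nm (x + x) = 2 * nm x.
Proof.
have -> : x + x = 2%:C *: x by rewrite rmorphD /= scalerDl scale1r.
by rewrite nmZr ger0_norm.
Qed.

Lemma lsub_clo S : lsub S -> lsub (clo S).
Proof.
move=> hS; split; first by apply: sub_clo; case: hS.
move=> z x y hx hy e e0.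
have c0 : 0 < cabs z + 1 by rewrite ltr_wpDl ?cabs_ge0.
have [s Ss h1] := hx (e / 2 / (cabs z + 1)) ltac:(by rewrite !divr_gt0).
have [t St h2] := hy (e / 2) ltac:(by rewrite divr_gt0).
exists (z *: s + t); first by apply: lsubD => //; apply: lsubZ.
have -> : z *: x + y - (z *: s + t) = z *: (x - s) + (y - t) by lmod.
rewrite (le_trans (nmD _ _))// nmZ.
move: h1; rewrite ler_pdivlMr// => h1.
have := nm_ge0 (x - s); have := cabs_ge0 z.
nra.
Qed.

Lemma clo_ortho S y p : (forall s, S s -> hdot y s = 0) -> clo S p ->
  hdot y p = 0.
Proof.
move=> h hp; apply: cabs_eq0; apply/eqP; rewrite eq_le cabs_ge0 andbT.
apply: le_eps => e e0; rewrite add0r.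
have c0 : 0 < nm y + 1 by rewrite ltr_wpDl ?nm_ge0.
have [s Ss h1] := hp (e / (nm y + 1)) (divr_gt0 e0 c0).
have -> : hdot y p = hdot y (p - s) by rewrite hdotBr (h s Ss) subr0.
rewrite (le_trans (CS _ _))//.
move: h1; rewrite ler_pdivlMr// => h1.
have := nm_ge0 (p - s); have := nm_ge0 y; nra.
Qed.

(** [S] need not be closed: [p] is the limit of a minimizing sequence, and varying it along [S]
    shows that [x - p] is orthogonal to [S]. *)
Lemma ortho_projection S x : lsub S ->
  exists p, clo S p /\ forall s, S s -> hdot (x - p) s = 0.
Proof.
move=> hS.
have [|z hz||delta [u [hd Su du qu]]] := @minimizing_sequence R H S
  (fun s => nm (x - s) ^+ 2) (fun s t => nm (s - t) ^+ 2) 0.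
- by case: hS.
- by rewrite exprn_ge0// nm_ge0.
- move=> s t Ss St; exists (2^-1%:C *: (s + t)).
    by apply: lsubZ => //; exact: lsubD.
  have := parallelogram (x - s) (x - t).
  have -> : x - s - (x - t) = t - s by lmod.
  have -> : x - s + (x - t) =
      (x - 2^-1%:C *: (s + t)) + (x - 2^-1%:C *: (s + t)).
    by rewrite -{1}(hhalfK s) -{1}(hhalfK t); lmod.
  by rewrite nm_double exprMn (nmB s t); lra.
have cu : cauchyh u.
  move=> e e0; have e2 : 0 < e ^+ 2 / 4 by rewrite divr_gt0// exprn_gt0.
  have [N hN] := invn_small e2; exists N => n m nN mN.
  apply: le_of_sqr; first exact: ltW.
  apply: le_trans (qu n m) _.
  have := hN _ nN; have := hN _ mN; set a := n.+1%:R^-1; set b := m.+1%:R^-1; lra.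
have [p hp] := cauchyh_cvg cu; exists p; split.
  move=> e e0; have [N hN] := hp _ e0; exists (u N) => //.
  by rewrite nmB hN.
have dp : nm (x - p) ^+ 2 <= delta.
  have key n e : 0 < e -> nm (u n - p) <= e -> nm (x - p) <= nm (x - u n) + e.
    move=> e0 h; have -> : x - p = (x - u n) + (u n - p) by lmod.
    by rewrite (le_trans (nmD _ _))// lerD2l.
  have nxu n : nm (x - u n) <= Num.sqrt (delta + n.+1%:R^-1).
    by rewrite -(ger0_norm (nm_ge0 _)) -sqrtr_sqr ler_wsqrtr.
  have d0 : 0 <= delta.
    apply: le_eps => e e0; have [N hN] := invn_small e0.
    apply: le_trans (exprn_ge0 2 (nm_ge0 (x - u N))) _.
    by rewrite (le_trans (du N))// lerD2l hN.
  have : nm (x - p) <= Num.sqrt delta.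
    apply: le_eps => e e0; have e2 : 0 < e / 2 by lra.
    have e4 : 0 < (e / 2) ^+ 2 by rewrite exprn_gt0.
    have [N hN] := invn_small e4; have [M hM] := hp _ e2.
    apply: le_trans (key _ _ e2 (hM _ (leq_maxl M N))) _.
    rewrite [e in leRHS]splitr addrA lerD2r (le_trans (nxu _))//.
    apply: le_of_sqr; first by rewrite addr_ge0 ?sqrtr_ge0 ?(ltW e2).
    rewrite sqr_sqrtr ?addr_ge0 ?invr_ge0//.
    have := hN _ (leq_maxr M N); have := sqrtr_ge0 delta; have := sqr_sqrtr d0.
    set a := _.+1%:R^-1; set b := Num.sqrt delta => h1 h2 h3; nra.
  by rewrite -(@ler_pXn2r _ 2) ?nnegrE ?nm_ge0 ?sqrtr_ge0// sqr_sqrtr.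
have Sp : clo S p.
  move=> e e0; have [N hN] := hp _ e0; exists (u N) => //.
  by rewrite nmB hN.
have dS s : clo S s -> delta <= nm (x - s) ^+ 2.
  move=> hs; apply: le_eps => e e0.
  pose c := 2 * nm (x - s) + 1.
  have c0 : 0 < c by rewrite ltr_wpDl// mulr_ge0// nm_ge0.
  have f0 : 0 < Num.min 1 (e / c) by rewrite lt_min ltr01 divr_gt0.
  have [t St ht] := hs _ f0; have := hd _ St.
  move: ht; rewrite le_min ler_pdivlMr// => /andP[t1 t2].
  have : nm (x - t) <= nm (x - s) + nm (s - t).
    by rewrite (_ : x - t = (x - s) + (s - t)) ?nmD//; lmod.
  have := nm_ge0 (x - t); have := nm_ge0 (x - s); have := nm_ge0 (s - t).
  rewrite /c in t2 *; nra.
move=> s Ss.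
(* If the real part [r] were positive, [p + t y] with [t = r / (|y|^2 + 1)] would be closer to [x]
   than [p]. Replacing [y] by [- y] and by ['i y] then gives orthogonality. *)
have hre y : S y -> complex.Re (hdot (x - p) y) <= 0.
  move=> Sy; rewrite leNgt; apply/negP => h.
  set r := complex.Re _ in h; set n := nm y ^+ 2.
  have n0 : 0 <= n by rewrite exprn_ge0// nm_ge0.
  pose t := r / (n + 1).
  have t0 : 0 < t by rewrite divr_gt0// ltr_wpDl.
  have := dS (p + t%:C *: y) (lsubD (lsub_clo hS) Sp (lsubZ _ (lsub_clo hS) (sub_clo Sy))).
  have -> : x - (p + t%:C *: y) = (x - p) - t%:C *: y by lmod.
  rewrite nmB_sq nmZr exprMn -/n hdotZr conjc_real ReZ -/r real_normK ?num_real//.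
  have : t * (n + 1) = r by rewrite /t divfK// gt_eqF// ltr_wpDl.
  move: dp; set D := nm (x - p) ^+ 2; nra.
have hre0 y : S y -> complex.Re (hdot (x - p) y) = 0.
  move=> Sy; apply/eqP; rewrite eq_le hre//=.
  by have := hre _ (lsubN hS Sy); rewrite hdotNr ReN oppr_le0.
apply/eqP; rewrite eq_complex /= hre0//= eqxx /=.
have := hre0 _ (lsubZ 'i hS Ss); rewrite hdotZr.
have -> : conjc 'i = - 'i :> R[i] by rewrite /conjc; simpc.
by rewrite Re_mulNi => ->.
Qed.

Lemma Riesz (f : H -> R[i]) (c : R) :
  (forall z x y, f (z *: x + y) = z * f x + f y) ->
  (forall x, cabs (f x) <= c * nm x) -> exists y, forall x, f x = hdot x y.
Proof.
move=> lf bf.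
have f0 : f 0 = 0.
  by apply: cabs_eq0; apply/eqP; rewrite eq_le cabs_ge0 (le_trans (bf _))// nm0 mulr0.
have fZ z x : f (z *: x) = z * f x by rewrite -[_ *: _]addr0 lf f0 addr0.
have [h|/existsNP[x0 fx0]] := pselect (forall x, f x = 0).
  by exists 0 => x; rewrite h hdot0r.
pose S := [set x | f x = 0].
have hS : lsub S.
  by split; [exact: f0 | move=> z x y hx hy; rewrite /S /= lf hx hy mulr0 addr0].
have [p [Sp hp]] := ortho_projection x0 hS.
have fp : f p = 0.
  apply: cabs_eq0; apply/eqP; rewrite eq_le cabs_ge0 andbT.
  apply: le_eps => e e0; rewrite add0r.
  have c0 : 0 < `|c| + 1 by rewrite ltr_wpDl.
  have [s Ss h1] := Sp (e / (`|c| + 1)) (divr_gt0 e0 c0).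
  have -> : f p = f (p - s).
    have {1}-> : p = 1 *: (p - s) + s by lmod.
    by rewrite lf Ss addr0 mul1r.
  rewrite (le_trans (bf _))//; move: h1; rewrite ler_pdivlMr// => h1.
  have := nm_ge0 (p - s); have := ler_norm c; nra.
pose w := x0 - p.
have fw : f w = f x0.
  by rewrite /w (_ : x0 - p = (-1) *: p + x0) ?lf ?fp ?mulr0 ?add0r//; lmod.
have fw0 : f w != 0 by rewrite fw; apply/eqP.
have w0 : hdot w w != 0.
  apply: contraNneq fw0; rewrite hdotxx => -[/eqP]; rewrite sqrf_eq0 => /eqP/nm_eq0 ->.
  by rewrite f0.
(* [w] is orthogonal to the kernel of [f], and [x - (f x / f w) w] lies in this kernel. *)
exists (conjc (f w / hdot w w) *: w) => x; rewrite hdotZr conjcK.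
have : S (x - (f x / f w) *: w).
  rewrite /S /= (_ : x - _ = (- (f x / f w)) *: w + x) ?lf; last by lmod.
  by rewrite mulNr divfK// addNr.
move=> /hp; rewrite -/w hdotC hdotBl hdotZl => /eqP; rewrite conjc_eq0 subr_eq0.
by move=> /eqP ->; rewrite mulrACA [f w * _]mulrC mulrACA; field; rewrite w0 fw0.
Qed.

End Projection.

(** * The ring of bounded operators *)

Section BopType.
Context {R : realType} (H : hilbertType R).

Definition is_bop : {pred H -> H} := fun a => `[< bounded_op a >].

Lemma bounded_opP (a : H -> H) :
  bounded_op a <-> linear a /\ exists2 c : R, 0 <= c & forall x, nm (a x) <= c * nm x.
Proof.
split=> -[la]; last first.
  by case=> c c0 h; split => //; exists c%:C => x; rewrite !nmE -rmorphM lecR.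
case=> c h; split => //; exists (cabs c); first exact: cabs_ge0.
move=> x; have := h x; rewrite !nmE => /Re_le /= => /le_trans; apply.
by rewrite mulrC ReZ mulrC ler_wpM2r ?nm_ge0// Re_le_cabs.
Qed.

Lemma is_bop_closed : subsemimod_closed is_bop.
Proof.
split; first split.
- apply/asboolP/bounded_opP; split.
    by move=> z x y; change ((0 : H) = z *: 0 + 0); rewrite scaler0 addr0.
  by exists 0 => // x; change (nm (0 : H) <= 0 * nm x); rewrite nm0 mul0r.
- move=> a b /asboolP/bounded_opP[la [c c0 ha]] /asboolP/bounded_opP[lb [d d0 hb]].
  apply/asboolP/bounded_opP; split.
    move=> z x y.
    change (a (z *: x + y) + b (z *: x + y) = z *: (a x + b x) + (a y + b y)).
    by rewrite la lb; lmod.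
  exists (c + d); first by rewrite addr_ge0.
  by move=> x; rewrite (le_trans (nmD _ _))// mulrDl lerD.
- move=> k a /asboolP/bounded_opP[la [c c0 ha]].
  apply/asboolP/bounded_opP; split.
    move=> z x y; change (k *: a (z *: x + y) = z *: (k *: a x) + k *: a y).
    by rewrite la; lmod.
  exists (cabs k * c); first by rewrite mulr_ge0 ?cabs_ge0.
  by move=> x; rewrite nmZ -mulrA ler_wpM2l ?cabs_ge0.
Qed.

(** Bounded operators as a type of their own, a module here and a ring below. The argument is
    carried out in it and is transported to sets of maps [H -> H] only at the end. *)
Record bop := Bop { opval :> H -> H; _ : is_bop opval }.

HB.instance Definition _ := [isSub for opval].
HB.instance Definition _ := [Choice of bop by <:].
HB.instance Definition _ :=
  GRing.SubChoice_isSubLmodule.Build R[i] (H -> H) is_bop bop is_bop_closed.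

End BopType.
Arguments opval {R H} _ _ : simpl never.

Section Bop.
Context {R : realType} {H : hilbertType R}.
Local Notation bop := (bop H).
Local Notation "k %:B" := (real_complex _ k *: (1 : bop)) (at level 2, format "k %:B").
Implicit Types (a b c : bop) (x y : H).

Lemma bopP a : bounded_op a.
Proof. by case: a => a ha; exact/asboolP. Qed.

Definition mkbop (a : H -> H) (ha : bounded_op a) : bop := Bop (asboolT ha).

Lemma bopext a b : (forall x, a x = b x) -> a = b.
Proof. by move=> h; apply/val_inj/funext. Qed.

Lemma bop_linear a : linear a. Proof. by case: (bopP a). Qed.

Lemma opDx a x y : a (x + y) = a x + a y.
Proof. by rewrite -{1}[x]scale1r bop_linear scale1r. Qed.
Lemma op0x a : a 0 = 0.
Proof. by apply: (addIr (a 0)); rewrite -opDx !add0r. Qed.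
Lemma opZx a z x : a (z *: x) = z *: a x.
Proof. by rewrite -[z *: x]addr0 bop_linear op0x addr0. Qed.
Lemma opNx a x : a (- x) = - a x.
Proof. by rewrite -scaleN1r opZx scaleN1r. Qed.
Lemma opBx a x y : a (x - y) = a x - a y.
Proof. by rewrite opDx opNx. Qed.

Lemma id_bounded : bounded_op (@id H).
Proof. by apply/bounded_opP; split => //; exists 1 => // x; rewrite mul1r. Qed.

Lemma comp_bounded a b : bounded_op (a \o b).
Proof.
have /bounded_opP[la [c c0 ha]] := bopP a; have /bounded_opP[lb [d d0 hb]] := bopP b.
apply/bounded_opP; split; first by move=> z x y /=; rewrite lb la.
exists (c * d); first by rewrite mulr_ge0.
by move=> x /=; rewrite (le_trans (ha _))// -mulrA ler_wpM2l.
Qed.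

Definition bone : bop := mkbop id_bounded.
Definition bmul a b : bop := mkbop (comp_bounded a b).

Fact bmulA : associative bmul. Proof. by move=> a b c; apply: bopext. Qed.
Fact bmul1l : left_id bone bmul. Proof. by move=> a; apply: bopext. Qed.
Fact bmul1r : right_id bone bmul. Proof. by move=> a; apply: bopext. Qed.
Fact bmulDl : left_distributive bmul +%R.
Proof. by move=> a b c; apply: bopext. Qed.
Fact bmulDr : right_distributive bmul +%R.
Proof. by move=> a b c; apply: bopext => x; exact: opDx. Qed.

HB.instance Definition _ := GRing.Zmodule_isPzRing.Build bop
  bmulA bmul1l bmul1r bmulDl bmulDr.

Lemma opD a b x : (a + b) x = a x + b x. Proof. by []. Qed.
Lemma opN a x : (- a) x = - a x. Proof. by []. Qed.
Lemma opB a b x : (a - b) x = a x - b x. Proof. by []. Qed.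
Lemma op0 x : (0 : bop) x = 0. Proof. by []. Qed.
Lemma op1 x : (1 : bop) x = x. Proof. by []. Qed.
Lemma opZ z a x : (z *: a) x = z *: a x. Proof. by []. Qed.
Lemma opM a b x : (a * b) x = a (b x). Proof. by []. Qed.
Lemma opL (z : R[i]) a b x : (z *: a + b) x = z *: a x + b x. Proof. by []. Qed.
Definition opE := (opL, opD, opN, op0, op1, opZ, opM).

Lemma scaleMl z a b : (z *: a) * b = z *: (a * b).
Proof. by apply: bopext => x; rewrite !opE. Qed.
Lemma scaleMr z a b : a * (z *: b) = z *: (a * b).
Proof. by apply: bopext => x; rewrite !opE opZx. Qed.

Lemma val_bmul a b : opval (a * b) = a \o b. Proof. by []. Qed.

(* Restated at [bop] so that rewriting yields one canonical form of each
   product, which [lmod] then recognizes syntactically. *)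
Lemma bmDl a b c : (a + b) * c = a * c + b * c. Proof. exact: mulrDl. Qed.
Lemma bmDr a b c : a * (b + c) = a * b + a * c. Proof. exact: mulrDr. Qed.
Lemma bmNl a b : (- a) * b = - (a * b). Proof. exact: mulNr. Qed.
Lemma bmNr a b : a * (- b) = - (a * b). Proof. exact: mulrN. Qed.
Lemma bm1r a : a * 1 = a. Proof. exact: mulr1. Qed.
Lemma bm1l a : 1 * a = a. Proof. exact: mul1r. Qed.
Lemma bm0r a : a * 0 = 0. Proof. exact: mulr0. Qed.
Lemma bm0l a : 0 * a = 0. Proof. exact: mul0r. Qed.
Lemma bmA a b c : a * (b * c) = a * b * c. Proof. exact: mulrA. Qed.

Definition bexp := (bmDl, bmDr, bmNl, bmNr, scaleMl, scaleMr, bm1r, bm1l,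
  bm0r, bm0l, bmA).

(** Only upper bounds of operator norms occur, never the norm as a number. *)
Definition bnd a (k : R) := forall x, nm (a x) <= k * nm x.

Lemma bop_bnd a : exists2 k : R, 0 <= k & bnd a k.
Proof. by have /bounded_opP[_ []] := bopP a => k k0 h; exists k. Qed.

Lemma bnd_le a (k l : R) : k <= l -> bnd a k -> bnd a l.
Proof. by move=> kl h x; rewrite (le_trans (h x))// ler_wpM2r ?nm_ge0. Qed.
Lemma bndD a b (k l : R) : bnd a k -> bnd b l -> bnd (a + b) (k + l).
Proof.
by move=> ha hb x; rewrite opE (le_trans (nmD _ _))// mulrDl lerD.
Qed.
Lemma bndN a (k : R) : bnd a k -> bnd (- a) k.
Proof. by move=> ha x; rewrite opE nmN. Qed.
Lemma bndB a b (k l : R) : bnd a k -> bnd b l -> bnd (a - b) (k + l).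
Proof. by move=> ha hb; apply: bndD => //; exact: bndN. Qed.
Lemma bndZ z a (k : R) : bnd a k -> bnd (z *: a) (cabs z * k).
Proof. by move=> ha x; rewrite opE nmZ -mulrA ler_wpM2l ?cabs_ge0. Qed.
Lemma bndM a b (k l : R) : 0 <= k -> bnd a k -> bnd b l -> bnd (a * b) (k * l).
Proof.
by move=> k0 ha hb x; rewrite opE (le_trans (ha _))// -mulrA ler_wpM2l.
Qed.
Lemma bnd1 : bnd 1 1. Proof. by move=> x; rewrite opE mul1r. Qed.
Lemma bnd0 k : 0 <= k -> bnd 0 k.
Proof. by move=> k0 x; rewrite opE nm0 mulr_ge0 ?nm_ge0. Qed.

Lemma bnd0_eq0 a : bnd a 0 -> a = 0.
Proof.
move=> h; apply: bopext => x; apply/nm_eq0/eqP.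
by rewrite eq_le nm_ge0 andbT -[leRHS](mul0r (nm x)).
Qed.

Lemma bnd_eps a (k : R) : (forall e, 0 < e -> bnd a (k + e)) -> bnd a k.
Proof.
move=> h x; apply: le_eps => e e0.
have c0 : 0 < nm x + 1 by rewrite ltr_wpDl ?nm_ge0.
have := h (e / (nm x + 1)) (divr_gt0 e0 c0) x.
have : e / (nm x + 1) * (nm x + 1) = e by rewrite divfK// gt_eqF.
have := divr_gt0 e0 c0; have := nm_ge0 x; set t := e / _; nra.
Qed.

Lemma adj_ex a : exists b, forall x y, hdot (a x) y = hdot x (b y).
Proof.
have [k k0 ha] := bop_bnd a.
have h y : exists z, forall x, hdot (a x) y = hdot x z.
  apply: (@Riesz _ _ (fun x => hdot (a x) y) (k * nm y)).
    by move=> z u v; rewrite bop_linear hdotDl hdotZl.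
  by move=> x; rewrite (le_trans (CS _ _))// mulrAC ler_wpM2r ?nm_ge0.
have [g hg] := choice h.
have hb : bounded_op g.
  apply/bounded_opP; split.
    move=> z u v; apply: hdot_eqr => x.
    by rewrite hdotDr hdotZr -!hg hdotDr hdotZr.
  exists k => // y.
  have := CS (a (g y)) y; rewrite hg hdotxx cabs_real ger0_norm ?exprn_ge0 ?nm_ge0//.
  have := ha (g y); have := nm_ge0 (g y); have := nm_ge0 y.
  have := nm_ge0 (a (g y)); set t := nm (g y); set s := nm y.
  move=> h1 s0 t0 h2 h3.
  have [->|tn0] := eqVneq t 0; first by rewrite mulr_ge0.
  have tp : 0 < t by rewrite lt0r tn0.
  rewrite -(ler_pM2l tp) -expr2 (le_trans h3)//.
  by rewrite mulrA [t * k]mulrC ler_wpM2r.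
by exists (mkbop hb) => x y; rewrite hg.
Qed.

Definition adj a : bop := projT1 (cid (adj_ex a)).

Lemma adjP a x y : hdot (a x) y = hdot x (adj a y).
Proof. by rewrite /adj; case: cid. Qed.
Lemma adjPr a x y : hdot (adj a x) y = hdot x (a y).
Proof. by rewrite hdotC -adjP -hdotC. Qed.
Lemma adj_uniq a b : (forall x y, hdot (a x) y = hdot x (b y)) -> b = adj a.
Proof. by move=> h; apply: bopext => y; apply: hdot_eqr => x; rewrite -h adjP. Qed.

Lemma adjK a : adj (adj a) = a.
Proof. by symmetry; apply: adj_uniq => x y; rewrite adjPr. Qed.
Lemma adjD a b : adj (a + b) = adj a + adj b.
Proof. by symmetry; apply: adj_uniq => x y; rewrite !opE hdotDl hdotDr !adjP. Qed.
Lemma adjN a : adj (- a) = - adj a.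
Proof. by symmetry; apply: adj_uniq => x y; rewrite !opE hdotNl hdotNr adjP. Qed.
Lemma adjB a b : adj (a - b) = adj a - adj b.
Proof. by rewrite adjD adjN. Qed.
Lemma adjM a b : adj (a * b) = adj b * adj a.
Proof. by symmetry; apply: adj_uniq => x y; rewrite !opE !adjP. Qed.
Lemma adjZ z a : adj (z *: a) = conjc z *: adj a.
Proof.
by symmetry; apply: adj_uniq => x y; rewrite !opE hdotZl hdotZr conjcK adjP.
Qed.
Lemma adj1 : adj 1 = 1. Proof. by symmetry; apply: adj_uniq. Qed.
Lemma adj0 : adj 0 = 0.
Proof. by symmetry; apply: adj_uniq => x y; rewrite !opE hdot0l hdot0r. Qed.
Lemma adjZr (r : R) a : adj (r%:C *: a) = r%:C *: adj a.
Proof. by rewrite adjZ conjc_real. Qed.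
Lemma adj_inj : injective adj. Proof. exact: can_inj adjK. Qed.
Lemma op_sum I (r : seq I) (P : pred I) (F : I -> bop) x :
  (\sum_(i <- r | P i) F i) x = \sum_(i <- r | P i) F i x.
Proof. by apply: (big_morph (fun a : bop => a x)). Qed.

Lemma bnd_adj a (k : R) : bnd a k -> bnd (adj a) k.
Proof.
move=> ha y.
have := CS (a (adj a y)) y; rewrite adjP hdotxx cabs_real ger0_norm ?exprn_ge0 ?nm_ge0//.
have := ha (adj a y); have := nm_ge0 (adj a y); have := nm_ge0 y.
set t := nm (adj a y); set s := nm y; set u := nm (a _) => s0 t0 h1 h2.
have [t00|tn0] := eqVneq t 0.
  move: (ha y) (nm_ge0 (a y)); rewrite t00 -/s; lra.
have tp : 0 < t by rewrite lt0r tn0.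
rewrite -(ler_pM2l tp) -expr2 (le_trans h2)//.
by rewrite mulrA [t * k]mulrC ler_wpM2r.
Qed.

(** In the order of [R[i]] this includes that the values are real, so a positive operator is
    self-adjoint, see [pos_adj]. *)
Definition pos a := forall x, 0 <= hdot (a x) x.

Lemma posD a b : pos a -> pos b -> pos (a + b).
Proof. by move=> ha hb x; rewrite opE hdotDl addr_ge0. Qed.
Lemma pos0 : pos 0. Proof. by move=> x; rewrite opE hdot0l. Qed.
Lemma pos1 : pos 1. Proof. by move=> x; rewrite opE hdotxx lecR exprn_ge0 ?nm_ge0. Qed.
Lemma posZ (r : R) a : 0 <= r -> pos a -> pos (r%:C *: a).
Proof. by move=> r0 ha x; rewrite opE hdotZl mulr_ge0// lecR. Qed.
Lemma pos_conj a b : pos a -> pos (adj b * a * b).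
Proof. by move=> ha x; rewrite !opE adjPr. Qed.
Lemma pos_conj' a b : pos a -> pos (b * a * adj b).
Proof. by move=> ha; rewrite -{1}[b]adjK; exact: pos_conj. Qed.
Lemma pos_adjM a : pos (adj a * a).
Proof. by rewrite -[adj a]mulr1; apply: pos_conj; exact: pos1. Qed.
Lemma pos_sum I (r : seq I) (P : pred I) (F : I -> bop) :
  (forall i, P i -> pos (F i)) -> pos (\sum_(i <- r | P i) F i).
Proof. by move=> h; elim/big_ind: _ => //; [exact: pos0|exact: posD]. Qed.

Lemma posB_trans a b c : pos (b - a) -> pos (c - b) -> pos (c - a).
Proof. by move=> h1 h2; rewrite -(subrK b c) -addrA; exact: posD. Qed.

(** Polarization with [x + y] and [x + 'i y]. *)
Lemma real_adj a : (forall x, complex.Im (hdot (a x) x) = 0) -> adj a = a.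
Proof.
move=> h; symmetry; apply: adj_uniq => x y; rewrite [RHS]hdotC.
have h1 := h (x + y); have h2 := h (x + 'i *: y).
move: h1 h2 (h x) (h y); rewrite !opDx !opZx !hdotDl !hdotDr !hdotZl !hdotZr.
case: (hdot (a x) x) => a1 a2; case: (hdot (a x) y) => b1 b2.
case: (hdot (a y) x) => c1 c2; case: (hdot (a y) y) => d1 d2 /=.
move=> h1 h2 h3 h4; subst a2 d2.
have -> : c1 = b1 by lra.
by have -> : b2 = - c2 by lra.
Qed.

Lemma pos_adj a : pos a -> adj a = a.
Proof. by move=> h; apply: real_adj => x; apply: ger0_Im. Qed.

Lemma sa_real a x : adj a = a -> hdot (a x) x = (complex.Re (hdot (a x) x))%:C.
Proof. by move=> h; apply: conj_fixed_real; rewrite -hdotC adjP h. Qed.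

Lemma pos_psd a : pos a -> psd_form setT (fun x y : H => hdot (a x) y).
Proof.
move=> h; split.
- by [].
- by move=> z x y w _ _ _; rewrite bop_linear hdotDl hdotZl.
- by move=> x y _ _; rewrite adjP pos_adj// hdotC.
by move=> x _; exact: h.
Qed.

Lemma pos_CS a x y : pos a -> cabs (hdot (a x) y) ^+ 2 <=
  complex.Re (hdot (a x) x) * complex.Re (hdot (a y) y).
Proof. by move=> h; apply: (psd_CS (pos_psd h)). Qed.

Lemma pos_ker a x : pos a -> hdot (a x) x = 0 -> a x = 0.
Proof.
move=> h h0; apply: hdot_eq => w; rewrite hdot0l; apply: cabs_eq0.
by apply/eqP; rewrite -sqrf_eq0 eq_le exprn_ge0 ?cabs_ge0// andbT
   (le_trans (pos_CS x w h))// h0 mul0r.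
Qed.

(** The Cauchy-Schwarz inequality of the form [<a x, y>] at [y = a x] gives [|a x|^4 <= <a x, x> <a
    a x, a x> <= k^2 |x|^2 |a x|^2]. *)
Lemma bnd_pos a (k : R) : 0 <= k -> pos a -> pos (k%:B - a) -> bnd a k.
Proof.
move=> k0 ha hk x.
have hq y : complex.Re (hdot (a y) y) <= k * nm y ^+ 2.
  have := Re_ge0 (hk y); rewrite !opE hdotDl hdotNl hdotZl ReB ReZ hdotxx /=.
  by rewrite subr_ge0.
have h1 := pos_CS x (a x) ha; move: h1; rewrite hdotxx cabs_real.
rewrite ger0_norm ?exprn_ge0 ?nm_ge0//.
have := hq x; have := hq (a x); have := Re_ge0 (ha x); have := Re_ge0 (ha (a x)).
have := nm_ge0 (a x); have := nm_ge0 x; set s := nm x; set t := nm (a x).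
set u := complex.Re _; set v := complex.Re _ => s0 t0 u0 v0 h1 h2 h3.
have [->|tn0] := eqVneq t 0; first by rewrite mulr_ge0.
have tp : 0 < t by rewrite lt0r tn0.
apply: le_of_sqr; first by rewrite mulr_ge0.
have t2 : 0 < t ^+ 2 by rewrite exprn_gt0.
rewrite -(ler_pM2l t2); apply: (@le_trans _ _ (v * u)); first by rewrite -expr2.
apply: (@le_trans _ _ ((k * s ^+ 2) * (k * t ^+ 2))); last by rewrite le_eqVlt; apply/orP; left; apply/eqP; ring.
by apply: ler_pM.
Qed.

Lemma sa_bnd_pos a (k : R) : adj a = a -> bnd a k -> pos (k%:B - a).
Proof.
move=> sa h x; rewrite !opE hdotDl hdotNl hdotZl hdotxx sa_real//.
rewrite -rmorphM -rmorphB /= lecR subr_ge0 (le_trans (Re_le_cabs _))//.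
by rewrite (le_trans (CS _ _))// expr2 mulrA ler_wpM2r ?nm_ge0.
Qed.

Lemma bnd_sq a (k : R) : 0 <= k -> bnd (adj a * a) (k ^+ 2) -> bnd a k.
Proof.
move=> k0 h x; apply: le_of_sqr; first by rewrite mulr_ge0 ?nm_ge0.
rewrite nm_sq -adjPr (le_trans (Re_le_cabs _))// (le_trans (CS _ _))//.
have := h x; rewrite opE; have := nm_ge0 x; set s := nm x; set t := nm _.
nra.
Qed.

Lemma bnd_sqr a (k : R) : 0 <= k -> bnd a k -> bnd (adj a * a) (k ^+ 2).
Proof. by move=> k0 h; apply: bndM => //; exact: bnd_adj. Qed.

End Bop.

Notation "k %:B" := (real_complex _ k *: (1 : bop _)) (at level 2, format "k %:B").
Ltac bring := rewrite ?bexp; lmod.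

(** * Norm limits and square roots *)

Lemma nondecreasing_cauchy (R : realType) (r : nat -> R) (k : R) :
  (forall n, r n <= r n.+1) -> (forall n, r n <= k) ->
  forall e, 0 < e -> exists N, forall n, (N <= n)%N -> r n - r N <= e.
Proof.
move=> hr hk e e0.
have hs : has_sup (range r).
  by split; [exists (r 0%N), 0%N | exists k => _ [n _ <-]].
have [_ [N _ <-] hN] := sup_adherent e0 hs; exists N => n _.
have : r n <= sup (range r) by apply: sup_upper_bound => //; exists n.
lra.
Qed.

Section NormLimits.
Context {R : realType} {H : hilbertType R}.
Local Notation bop := (bop H).
Implicit Types (a b c : bop) (u v : nat -> bop).

Definition bcvg u a := forall e : R, 0 < e ->
  exists N, forall n, (N <= n)%N -> bnd (u n - a) e.

Lemma bcvg_unique u a b : bcvg u a -> bcvg u b -> a = b.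
Proof.
move=> ua ub; apply/eqP; rewrite -subr_eq0; apply/eqP/bnd0_eq0/bnd_eps => e e0.
have [N hN] := ua (e / 2) ltac:(lra); have [M hM] := ub (e / 2) ltac:(lra).
have -> : a - b = (u (maxn N M) - b) - (u (maxn N M) - a) by lmod.
rewrite add0r [e]splitr; apply: bndB; [apply: hM|apply: hN].
  exact: leq_maxr.
exact: leq_maxl.
Qed.

Lemma bcvg_cst a : bcvg (fun=> a) a.
Proof. by move=> e e0; exists 0%N => n _; rewrite subrr; apply: bnd0; exact: ltW. Qed.

Lemma bcvgD u v a b : bcvg u a -> bcvg v b -> bcvg (fun n => u n + v n) (a + b).
Proof.
move=> ua ub e e0.
have [N hN] := ua (e / 2) ltac:(lra); have [M hM] := ub (e / 2) ltac:(lra).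
exists (maxn N M) => n; rewrite geq_max => /andP[nN nM].
have -> : u n + v n - (a + b) = (u n - a) + (v n - b) by lmod.
by rewrite [e]splitr; apply: bndD; [exact: hN|exact: hM].
Qed.

Lemma bcvgM u v a b : bcvg u a -> bcvg v b -> bcvg (fun n => u n * v n) (a * b).
Proof.
move=> ua ub e e0.
have [k k0 ka] := bop_bnd a; have [l l0 lb] := bop_bnd b.
pose d := Num.min 1 (e / (k + l + 1)).
have s0 : 0 < k + l + 1 by lra.
have d0 : 0 < d by rewrite lt_min ltr01 divr_gt0.
have d1 : d <= 1 by rewrite ge_min lexx.
have dE : d * (k + l + 1) <= e by rewrite -ler_pdivlMr// ge_min lexx orbT.
have [N hN] := ua d d0; have [M hM] := ub d d0.
exists (maxn N M) => n; rewrite geq_max => /andP[nN nM].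
have -> : u n * v n - a * b =
    (u n - a) * (v n - b) + (u n - a) * b + a * (v n - b) by bring.
apply: (@bnd_le _ _ _ (d * d + d * l + k * d)); first by nra.
apply: bndD; last by apply: bndM => //; exact: hM.
by apply: bndD; apply: (bndM (ltW d0)) => //; first [exact: hN | exact: hM].
Qed.

Lemma bcvgMl u a b : bcvg u a -> bcvg (fun n => b * u n) (b * a).
Proof. by apply: bcvgM; exact: bcvg_cst. Qed.
Lemma bcvgMr u a b : bcvg u a -> bcvg (fun n => u n * b) (a * b).
Proof. by move=> h; apply: bcvgM => //; exact: bcvg_cst. Qed.

Lemma bcvg_shift u a : bcvg u a -> bcvg (fun n => u n.+1) a.
Proof.
by move=> h e /h[N hN]; exists N => n nN; apply: hN; exact: leqW.
Qed.

Lemma bcvg_adj u a : bcvg u a -> bcvg (fun n => adj (u n)) (adj a).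
Proof.
by move=> h e /h[N hN]; exists N => n nN; rewrite -adjB; exact/bnd_adj/hN.
Qed.

Lemma bcvg_bnd u a (k : R) : bcvg u a -> (forall n, bnd (u n) k) -> bnd a k.
Proof.
move=> h hk; apply: bnd_eps => e /h[N hN].
have -> : a = u N - (u N - a) by lmod.
by apply: bndB => //; exact: hN.
Qed.

Lemma bcvg_complete u :
  (forall e : R, 0 < e -> exists N, forall n m, (N <= n)%N -> (N <= m)%N ->
     bnd (u n - u m) e) -> exists a, bcvg u a.
Proof.
move=> hu.
have hx x : exists y, cvh (fun n => u n x) y.
  apply: cauchyh_cvg => e e0.
  have c0 : 0 < nm x + 1 by rewrite ltr_wpDl ?nm_ge0.
  have [N hN] := hu _ (divr_gt0 e0 c0); exists N => n m nN mN.
  apply: le_trans (hN n m nN mN x) _.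
  by rewrite mulrAC ler_pdivrMr// ler_wpM2l ?(ltW e0)// lerDl.
have [f hf] := choice hx.
have lin : linear f.
  move=> z x y; apply: (cvh_unique (hf _)) => e e0.
  have c0 : 0 < cabs z + 1 by rewrite ltr_wpDl ?cabs_ge0.
  have [N hN] := hf x _ (divr_gt0 (divr_gt0 e0 (ltr0Sn R 1)) c0).
  have [M hM] := hf y (e / 2) ltac:(lra).
  exists (maxn N M) => n; rewrite geq_max => /andP[/hN h1 /hM h2].
  have -> : u n (z *: x + y) - (z *: f x + f y) =
     z *: (u n x - f x) + (u n y - f y) by rewrite opDx opZx; lmod.
  rewrite (le_trans (nmD _ _))// nmZ; move: h1; rewrite ler_pdivlMr// => h1.
  have := nm_ge0 (u n x - f x); have := cabs_ge0 z; nra.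
have close e : 0 < e -> exists N, forall n, (N <= n)%N ->
    forall x, nm (u n x - f x) <= e * nm x.
  move=> e0; have [N hN] := hu e e0; exists N => n nN x.
  apply: le_eps => d d0; have [M hM] := hf x d d0.
  have -> : u n x - f x = (u n - u (maxn N M)) x + (u (maxn N M) x - f x).
    by rewrite !opE; lmod.
  rewrite (le_trans (nmD _ _))// lerD ?hM ?leq_maxr//.
  by apply: hN => //; exact: leq_maxl.
have bf : bounded_op f.
  apply/bounded_opP; split => //.
  have [N hN] := close 1 ltr01; have [k k0 hk] := bop_bnd (u N).
  exists (k + 1) => [|x]; first lra.
  have -> : f x = u N x - (u N x - f x) by lmod.
  by rewrite (le_trans (nmD _ _))// nmN mulrDl lerD// hN.
exists (mkbop bf) => e /close[N hN]; exists N => n nN x.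
by rewrite !opE; exact: hN.
Qed.

End NormLimits.

Section Sqrt.
Context {R : realType} {H : hilbertType R}.
Local Notation bop := (bop H).
Implicit Types (a b c : bop).

(** Scalar majorant of the operator iteration [sit]: it is nondecreasing and bounded by 1, and its
    increments bound those of [sit] in norm. *)
Fixpoint rit (n : nat) : R := if n is n'.+1 then 2^-1 * (1 + rit n' ^+ 2) else 0.

Lemma rit01 n : 0 <= rit n <= 1.
Proof.
elim: n => [|n /andP[h1 h2]] /=; first by rewrite lexx ler01.
by apply/andP; split; nra.
Qed.

Lemma ritS n : rit n <= rit n.+1.
Proof. by have /andP[h1 h2] := rit01 n; rewrite /=; nra. Qed.

(** The limit [y] satisfies [y = (s + y^2) / 2], that is [(1 - y)^2 = 1 - s]: a square root of
    [1 - s] for [0 <= s <= 1]. *)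
Fixpoint sit (s : bop) (n : nat) : bop :=
  if n is n'.+1 then 2^-1%:C *: (s + sit s n' * sit s n') else 0.

Lemma half_half a : 2^-1%:C *: a + 2^-1%:C *: a = a.
Proof. by apply: bopext => x; rewrite !opE hhalfK. Qed.

Lemma sit_comm s c n : s * c = c * s -> sit s n * c = c * sit s n.
Proof.
move=> h; elim: n => [|n IH] /=; first by rewrite mul0r mulr0.
by rewrite scaleMl scaleMr mulrDl mulrDr h -mulrA IH mulrA IH mulrA.
Qed.

Lemma sit_bnd s n : bnd s 1 -> bnd (sit s n) (rit n).
Proof.
move=> hs; elim: n => [|n IH] /=; first exact: bnd0.
have /andP[h _] := rit01 n.
apply: (@bnd_le _ _ _ (cabs 2^-1%:C * (1 + rit n * rit n))).
  by rewrite cabs_real ger0_norm.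
by apply: bndZ; apply: bndD => //; exact: bndM.
Qed.

(** Consecutive iterates [x], [y] commute, so the next difference is half of [(y - x) (y + x)], just
    as for the scalars. *)
Lemma sit_diff s n : bnd s 1 -> bnd (sit s n.+1 - sit s n) (rit n.+1 - rit n).
Proof.
move=> hs; elim: n => [|n IH].
  rewrite subr0 [rit 0]/= subr0; exact: sit_bnd.
set y := sit s n.+1; set x := sit s n in IH *.
have cxy : x * y = y * x.
  by apply: sit_comm; symmetry; apply: sit_comm.
have ey2 : sit s n.+2 = 2^-1%:C *: (s + y * y) by [].
have ey1 : y = 2^-1%:C *: (s + x * x) by [].
have -> : sit s n.+2 - y = 2^-1%:C *: ((y - x) * (y + x)).
  have -> : (y - x) * (y + x) = y * y - x * x.
    move: cxy; clear; clearbody x y => cxy; rewrite !bexp cxy; lmod.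
  by rewrite ey2 {3}ey1; move: (y * y) (x * x) => p q; lmod.
apply: (@bnd_le _ _ _ (cabs 2^-1%:C * ((rit n.+1 - rit n) * (rit n.+1 + rit n)))).
  have -> : rit n.+2 = 2^-1 * (1 + rit n.+1 ^+ 2) by [].
  have {4}-> : rit n.+1 = 2^-1 * (1 + rit n ^+ 2) by [].
  rewrite cabs_real ger0_norm//; lra.
apply: bndZ; apply: bndM => //; first by rewrite subr_ge0 ritS.
by apply: bndD; exact: sit_bnd.
Qed.

Lemma sqrt_unit a : pos a -> pos (1 - a) ->
  exists b, [/\ pos b, b * b = a & forall c, a * c = c * a -> b * c = c * b].
Proof.
move=> pa p1a; pose s := 1 - a.
have hs : bnd s 1.
  apply: bnd_pos => //.
  by rewrite scale1r (_ : 1 - s = a)// /s; lmod.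
have sd m k : bnd (sit s (m + k) - sit s m) (rit (m + k) - rit m).
  elim: k => [|k IH]; first by rewrite addn0 !subrr; exact: bnd0.
  rewrite addnS.
  have -> : sit s (m + k).+1 - sit s m =
    (sit s (m + k).+1 - sit s (m + k)) + (sit s (m + k) - sit s m) by lmod.
  have -> : rit (m + k).+1 - rit m =
    (rit (m + k).+1 - rit (m + k)) + (rit (m + k) - rit m) by lra.
  by apply: bndD => //; exact: sit_diff.
have [y hy] : exists y, bcvg (sit s) y.
  apply: bcvg_complete => e e0.
  have [N hN] := nondecreasing_cauchy ritS
    (fun n => proj2 (andP (rit01 n))) (divr_gt0 e0 (ltr0Sn R 1)).
  have sN n : (N <= n)%N -> bnd (sit s n - sit s N) (e / 2).
    by move=> nN; rewrite -(subnKC nN); apply: bnd_le (sd _ _); rewrite subnKC// hN.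
  exists N => n m nN mN.
  have -> : sit s n - sit s m = (sit s n - sit s N) - (sit s m - sit s N) by lmod.
  by rewrite [e]splitr; apply: bndB; exact: sN.
have y2 : 2^-1%:C *: (s + y * y) = y.
  apply: (@bcvg_unique _ _ (fun n => sit s n.+1)); last exact: bcvg_shift.
  have -> : 2^-1%:C *: (s + y * y) = 2^-1%:B * (s + y * y).
    by rewrite scaleMl mul1r.
  have -> : (fun n => sit s n.+1) = (fun n => 2^-1%:B * (s + sit s n * sit s n)).
    by apply/funext => n /=; rewrite scaleMl mul1r.
  by apply: bcvgMl; apply: bcvgD; [exact: bcvg_cst | exact: bcvgM].
have sy : adj y = y.
  apply: (@bcvg_unique _ _ (fun n => adj (sit s n))); first exact: bcvg_adj.
  have -> // : (fun n => adj (sit s n)) = sit s.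
  apply/funext; elim=> [|n IH] /=; first by rewrite adj0.
  by rewrite adjZr adjD adjM IH /s adjB adj1 (pos_adj pa).
have by1 : bnd y 1.
  apply: (bcvg_bnd hy) => n; apply: bnd_le (sit_bnd _ hs).
  by case/andP: (rit01 n).
exists (1 - y); split.
- by have := sa_bnd_pos sy by1; rewrite scale1r.
- have e2 : y + y = s + y * y by rewrite -{1 2}y2 half_half.
  have -> : (1 - y) * (1 - y) = 1 - (y + y) + y * y by bring.
  by rewrite e2 /s; lmod.
move=> c hc.
have yc : y * c = c * y.
  apply: (@bcvg_unique _ _ (fun n => sit s n * c)); first exact: bcvgMr.
  have -> : (fun n => sit s n * c) = (fun n => c * sit s n).
    by apply/funext => n; apply: sit_comm; rewrite /s !bexp hc.
  exact: bcvgMl.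
by rewrite !bexp yc.
Qed.

(** The last clause places the root in every von Neumann algebra that contains [a]. *)
Lemma sqrt_ex a : pos a ->
  exists b, [/\ pos b, b * b = a & forall c, a * c = c * a -> b * c = c * b].
Proof.
move=> pa; have [k k0 hk] := bop_bnd a.
pose l := k + 1; have l0 : 0 < l by rewrite /l; lra.
have il : l^-1%:C * l%:C = 1 by rewrite -rmorphM /= mulVf// gt_eqF.
have [||b [pb b2 hb]] := @sqrt_unit (l^-1%:C *: a).
- by apply: posZ => //; rewrite invr_ge0 ltW.
- have -> : 1 - l^-1%:C *: a = l^-1%:C *: (l%:B - a).
    by rewrite scalerBr scalerA il scale1r.
  apply: posZ; first by rewrite invr_ge0 ltW.
  by apply: sa_bnd_pos; [exact: pos_adj | apply: bnd_le hk; rewrite /l; lra].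
pose r := Num.sqrt l.
have rr : r%:C * r%:C = l%:C by rewrite -rmorphM /= -expr2 sqr_sqrtr ?ltW.
exists (r%:C *: b); split.
- by apply: posZ => //; exact: sqrtr_ge0.
- by rewrite scaleMl scaleMr b2 !scalerA rr mulrC il scale1r.
by move=> c hc; rewrite scaleMl scaleMr hb// scaleMl scaleMr hc.
Qed.

End Sqrt.

(** * Projections, von Neumann algebras, polar decomposition *)

Section Extension.
Context {R : realType} {H : hilbertType R}.
Local Notation bop := (bop H).

Lemma projection_onto (S : set H) : lsub S -> exists p : bop,
  [/\ p * p = p, adj p = p, forall x, clo S (p x),
      forall x, clo S x -> p x = x
    & forall x, (forall s, S s -> hdot x s = 0) -> p x = 0].
Proof.
move=> hS.
have [f hf] := choice (fun x => ortho_projection x hS).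
have hfc x : clo S (f x) by case: (hf x).
have ho x s : clo S s -> hdot (x - f x) s = 0.
  by move=> hs; apply: (clo_ortho _ hs); case: (hf x).
have hclo := lsub_clo hS.
have uniq x y : clo S y -> (forall s, S s -> hdot (x - y) s = 0) -> f x = y.
  move=> hy hxy; apply/eqP; rewrite -subr_eq0; apply/eqP.
  have hd := lsubB hclo (hfc x) hy.
  apply/nm_eq0/eqP; rewrite -sqrf_eq0; apply/eqP/complexI; rewrite -hdotxx.
  have -> : hdot (f x - y) (f x - y) =
      hdot (x - y) (f x - y) - hdot (x - f x) (f x - y).
    rewrite -hdotBl (_ : x - y - (x - f x) = f x - y)//; lmod.
  by rewrite (ho x)// subr0 (clo_ortho hxy).
have bf : bounded_op f.
  apply/bounded_opP; split.
    move=> z x y; apply: uniq; first by apply: (proj2 hclo).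
    move=> s Ss; have -> : z *: x + y - (z *: f x + f y) =
      z *: (x - f x) + (y - f y) by lmod.
    by rewrite hdotDl hdotZl !(ho _ s (sub_clo Ss)) mulr0 addr0.
  exists 1 => // x; rewrite mul1r; apply: le_of_sqr; first exact: nm_ge0.
  have {2}-> : x = f x + (x - f x) by lmod.
  rewrite nmD_sq hdotC (ho x)// ReJ mulr0 addr0 lerDl.
  by rewrite exprn_ge0 ?nm_ge0.
have fix_ x : clo S x -> f x = x.
  by move=> hx; apply: uniq => // s _; rewrite subrr hdot0l.
exists (mkbop bf); split => //.
- by apply: bopext => x; exact: fix_.
- symmetry; apply: adj_uniq => x y; rewrite /=.
  have -> : hdot (f x) y = hdot (f x) (f y).
    apply/eqP; rewrite -subr_eq0 -hdotBr; apply/eqP.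
    by rewrite hdotC ho// conjc0.
  apply/eqP; rewrite -subr_eq0 -hdotBl; apply/eqP.
  have -> : f x - x = - (x - f x) by lmod.
  by rewrite hdotNl ho// oppr0.
move=> x hx; apply: uniq; first by exact: (proj1 hclo).
by move=> s; rewrite subr0; exact: hx.
Qed.

Lemma clo_ker (S : set H) (c : bop) x :
  (forall s, S s -> c s = 0) -> clo S x -> c x = 0.
Proof.
move=> hS hx; apply/nm_eq0/eqP; rewrite eq_le nm_ge0 andbT.
apply: le_eps => e e0; rewrite add0r; have [k k0 hk] := bop_bnd c.
have [s Ks hs] := hx (e / (k + 1)) ltac:(apply: divr_gt0; lra).
have -> : c x = c (x - s) by rewrite opBx (hS s Ks) subr0.
rewrite (le_trans (hk _))//; have : e / (k + 1) * (k + 1) = e by field; lra.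
move: hs (nm_ge0 (x - s)); set d := e / _; nra.
Qed.

(** Invariance of [S] gives [p c p = c p], and likewise for [adj c]; the adjoint of the second
    identity is [p c p = p c]. *)
Lemma projection_comm (S : set H) (p c : bop) : adj p = p ->
  (forall x, clo S (p x)) -> (forall x, clo S x -> p x = x) ->
  (forall s, S s -> S (c s)) -> (forall s, S s -> S (adj c s)) ->
  p * c = c * p.
Proof.
move=> sp pc pf hc hc'.
have key (d : bop) : (forall s, S s -> S (d s)) -> p * d * p = d * p.
  move=> hd; apply/eqP; rewrite -subr_eq0; apply/eqP.
  apply: bopext => x; rewrite op0.
  have -> : (p * d * p - d * p) x = (p * d - d) (p x) by rewrite !opE.
  apply: (clo_ker _ (pc x)) => s Ss; rewrite opB opM pf ?subrr//.
  exact/sub_clo/hd.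
rewrite -(key c)//; apply: adj_inj.
by rewrite !adjM sp mulrA key.
Qed.

(* A map prescribed on the dense part [g S] of a closed subspace extends to it
   by continuity and is set to be zero on the orthogonal complement. *)
Lemma extension (V : lmodType R[i]) (S : set V) (g h : V -> H) (k : R) :
  0 <= k -> S 0 -> (forall z x y, S x -> S y -> S (z *: x + y)) ->
  (forall z x y, S x -> S y -> g (z *: x + y) = z *: g x + g y) ->
  (forall z x y, S x -> S y -> h (z *: x + y) = z *: h x + h y) ->
  (forall s, S s -> nm (h s) <= k * nm (g s)) ->
  exists T : bop, [/\ bnd T k, forall s, S s -> T (g s) = h s
    & forall x, (forall s, S s -> hdot x (g s) = 0) -> T x = 0].
Proof.
move=> k0 S0 SS gl hl hgh.
have g0 : g 0 = 0.
  by have := gl (-1) 0 0 S0 S0; rewrite scaler0 addr0 scaleN1r addNr.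
have h0 : h 0 = 0.
  by have := hl (-1) 0 0 S0 S0; rewrite scaler0 addr0 scaleN1r addNr.
have SB s t : S s -> S t -> S (s - t).
  by move=> hs ht; rewrite -scaleN1r addrC; apply: SS.
have gB s t : S s -> S t -> g (s - t) = g s - g t.
  by move=> hs ht; rewrite -scaleN1r addrC gl// scaleN1r addrC.
have hB s t : S s -> S t -> h (s - t) = h s - h t.
  by move=> hs ht; rewrite -scaleN1r addrC hl// scaleN1r addrC.
pose G := [set g s | s in S].
have lG : lsub G.
  split; first by exists 0.
  by move=> z _ _ [s Ss <-] [t St <-]; exists (z *: s + t); rewrite ?gl//; apply: SS.
have [p [pp sp pc pf po]] := projection_onto lG.
(* The graph of the extension: [y] is a limit of [h s] along elements with [g s] tending to [p x].
   The estimate [hgh] makes this relation total and single-valued. *)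
pose rel x y := forall e : R, 0 < e ->
  exists s, [/\ S s, nm (g s - p x) <= e & nm (h s - y) <= e].
have relE x : exists y, rel x y.
  have hs n : exists s, S s /\ nm (g s - p x) <= n.+1%:R^-1.
    have [|_ [s Ss <-] hs] := pc x n.+1%:R^-1; first by rewrite invr_gt0.
    by exists s; rewrite nmB.
  have [s hs'] := choice hs.
  have [y hy] : exists y, cvh (fun n => h (s n)) y.
    apply: cauchyh_cvg => e e0.
    have e1 : 0 < e / 2 / (k + 1) by rewrite !divr_gt0//; lra.
    have [N hN] := invn_small e1; exists N => n m nN mN.
    have [Sn gn] := hs' n; have [Sm gm] := hs' m.
    rewrite -hB// (le_trans (hgh _ (SB _ _ Sn Sm)))// gB//.
    have -> : g (s n) - g (s m) = (g (s n) - p x) - (g (s m) - p x) by lmod.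
    have : nm (g (s n) - p x - (g (s m) - p x)) <= 2 * (e / 2 / (k + 1)).
      rewrite (le_trans (nmD _ _))// nmN.
      have := hN _ nN; have := hN _ mN; move: gn gm.
      set a := n.+1%:R^-1; set b := m.+1%:R^-1; lra.
    have : 2 * (e / 2 / (k + 1)) * (k + 1) = e by field; lra.
    have := nm_ge0 (g (s n) - p x - (g (s m) - p x)).
    set u := nm _; set v := 2 * _; nra.
  exists y => e e0; have [N hN] := invn_small e0; have [M hM] := hy e e0.
  exists (s (maxn N M)); have [Sn gn] := hs' (maxn N M); split=> //.
    by rewrite (le_trans gn)// hN// leq_maxl.
  by rewrite hM// leq_maxr.
have relb x y : rel x y -> nm y <= k * nm (p x).
  move=> hr; apply: le_eps => e e0.
  have e1 : 0 < e / (k + 1) by rewrite divr_gt0//; lra.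
  have [s [Ss h1 h2]] := hr _ e1.
  have h3 : nm y <= nm (h s) + nm (h s - y).
    have {1}-> : y = h s - (h s - y) by lmod.
    by rewrite (le_trans (nmD _ _))// nmN.
  have h4 : nm (g s) <= nm (p x) + nm (g s - p x).
    have {1}-> : g s = p x + (g s - p x) by lmod.
    exact: nmD.
  have := hgh _ Ss; have : e / (k + 1) * (k + 1) = e by field; lra.
  move: h1 h2; set d := e / _; nra.
have rell z x x' y y' : rel x y -> rel x' y' -> rel (z *: x + x') (z *: y + y').
  move=> r1 r2 e e0.
  have c0 : 0 < cabs z + 1 by rewrite ltr_wpDl ?cabs_ge0.
  have [s [Ss s1 s2]] := r1 (e / 2 / (cabs z + 1)) ltac:(by rewrite !divr_gt0).
  have [t [St t1 t2]] := r2 (e / 2) ltac:(lra).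
  exists (z *: s + t); split; first exact: SS.
    rewrite gl// bop_linear.
    have -> : z *: g s + g t - (z *: p x + p x') =
      z *: (g s - p x) + (g t - p x') by lmod.
    rewrite (le_trans (nmD _ _))// nmZ; move: s1; rewrite ler_pdivlMr// => s1.
    have := nm_ge0 (g s - p x); nra.
  rewrite hl//.
  have -> : z *: h s + h t - (z *: y + y') =
    z *: (h s - y) + (h t - y') by lmod.
  rewrite (le_trans (nmD _ _))// nmZ; move: s2; rewrite ler_pdivlMr// => s2.
  have := nm_ge0 (h s - y); nra.
have relu x y y' : rel x y -> rel x y' -> y = y'.
  move=> r1 r2; have := rell (-1) _ _ _ _ r2 r1; rewrite !scaleN1r addNr => /relb.
  rewrite op0x nm0 mulr0 => hle; apply/eqP; rewrite -subr_eq0 addrC; apply/eqP/nm_eq0.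
  by apply/eqP; rewrite eq_le hle nm_ge0.
have [f hf] := choice relE.
have bp : bnd p 1.
  apply: bnd_pos => //; first by rewrite -pp -{1}sp; exact: pos_adjM.
  have -> : 1%:B - p = adj (1 - p) * (1 - p).
    by rewrite adjB adj1 sp scale1r !bexp pp; lmod.
  exact: pos_adjM.
have bf : bounded_op f.
  apply/bounded_opP; split.
    by move=> z x y; apply: (relu (z *: x + y)) => //; exact: rell.
  exists k => // x; rewrite (le_trans (relb _ _ (hf x)))// ler_wpM2l//.
  by have := bp x; rewrite mul1r.
exists (mkbop bf); split.
- by move=> x; rewrite (le_trans (relb _ _ (hf x)))// ler_wpM2l//;
    have := bp x; rewrite mul1r.
- move=> s Ss; apply: (relu (g s)) => //= e e0; exists s; split => //.
    rewrite pf ?subrr ?nm0 ?ltW//; apply: sub_clo; exists s => //.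
  by rewrite subrr nm0 ltW.
move=> x hx; apply: (relu x) => //= e e0; exists 0; split => //.
  rewrite po ?g0 ?subrr ?nm0 ?ltW// => _ [s Ss <-]; exact: hx.
by rewrite h0 subrr nm0 ltW.
Qed.

End Extension.

Section Algebras.
Context {R : realType} {H : hilbertType R}.
Local Notation bop := (bop H).
Implicit Types (a b c p q : bop) (A B : set bop).

(* A defined constant, so that hints on membership have a head symbol. *)
Definition el A a : Prop := A a.

Definition comm A : set bop := [set b | forall a, el A a -> a * b = b * a].
Definition star A := forall a, el A a -> el A (adj a).

Definition vn A := star A /\ forall a, el (comm (comm A)) a -> el A a.

Lemma sub_bicomm A a : el A a -> el (comm (comm A)) a.
Proof. by move=> ha b hb; rewrite -hb. Qed.

Lemma vnP A : vn A -> forall a, el A a <-> (forall b, el (comm A) b -> b * a = a * b).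
Proof. by move=> [_ h] a; split => [/sub_bicomm//|]; exact: h. Qed.

Lemma comm_star A : star A -> star (comm A).
Proof.
move=> sA b hb a ha; apply: adj_inj; rewrite !adjM !adjK.
by rewrite hb//; exact: sA.
Qed.

Lemma vn_comm A : star A -> vn (comm A).
Proof.
move=> sA; split; first exact: comm_star.
by move=> b hb a ha; rewrite hb//; exact: sub_bicomm.
Qed.

Lemma vn_adj A a : vn A -> el A a -> el A (adj a).
Proof. by case=> h _; exact: h. Qed.
Lemma vn1 A : vn A -> el A 1.
Proof. by move=> h; apply/(vnP h) => b _; rewrite mulr1 mul1r. Qed.
Lemma vn0 A : vn A -> el A 0.
Proof. by move=> h; apply/(vnP h) => b _; rewrite mulr0 mul0r. Qed.
Lemma vnD A a b : vn A -> el A a -> el A b -> el A (a + b).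
Proof.
move=> hA /(vnP hA) ha /(vnP hA) hb; apply/(vnP hA) => c hc.
by rewrite mulrDl mulrDr ha// hb.
Qed.
Lemma vnN A a : vn A -> el A a -> el A (- a).
Proof. by move=> hA /(vnP hA) ha; apply/(vnP hA) => c hc; rewrite mulrN mulNr ha. Qed.
Lemma vnB A a b : vn A -> el A a -> el A b -> el A (a - b).
Proof. by move=> h ha hb; apply: vnD => //; exact: vnN. Qed.
Lemma vnM A a b : vn A -> el A a -> el A b -> el A (a * b).
Proof.
move=> hA /(vnP hA) ha /(vnP hA) hb; apply/(vnP hA) => c hc.
by rewrite mulrA ha// -mulrA hb// mulrA.
Qed.
Lemma vnZ A z a : vn A -> el A a -> el A (z *: a).
Proof. by move=> hA /(vnP hA) ha; apply/(vnP hA) => c hc; rewrite scaleMr scaleMl ha. Qed.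
Lemma vn_sum A I (r : seq I) (P : pred I) (F : I -> bop) : vn A ->
  (forall i, P i -> el A (F i)) -> el A (\sum_(i <- r | P i) F i).
Proof.
by move=> hA h; elim/big_ind: _ => //; [exact: vn0|move=> *; exact: vnD].
Qed.

(** The criterion by which roots and spectral projections of [a] are seen to lie in [A]. *)
Lemma vn_bicomm A a b : vn A -> el A a ->
  (forall c, a * c = c * a -> b * c = c * b) -> el A b.
Proof.
by move=> hA ha h; apply/(vnP hA) => c hc; rewrite h//; move/(vnP hA): ha => ->.
Qed.

Definition proj p := p * p = p /\ adj p = p.

Lemma proj_idem p : proj p -> p * p = p. Proof. by case. Qed.
Lemma proj_adj p : proj p -> adj p = p. Proof. by case. Qed.
Lemma proj_adjM p : proj p -> adj p * p = p. Proof. by case=> h ->. Qed.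
Lemma proj_pos p : proj p -> pos p.
Proof. by move=> h; rewrite -(proj_adjM h); exact: pos_adjM. Qed.
Lemma proj_one : proj 1. Proof. by split; rewrite ?mulr1 ?adj1. Qed.
Lemma projC p : proj p -> proj (1 - p).
Proof. by move=> [h1 h2]; split; rewrite ?adjB ?adj1 ?h2// !bexp h1; lmod. Qed.
Lemma projB p q : proj p -> proj q -> p * q = q -> proj (p - q).
Proof.
move=> [p1 p2] [q1 q2] pq; have qp : q * p = q by apply: adj_inj; rewrite adjM p2 q2.
by split; rewrite ?adjB ?p2 ?q2// !bexp p1 q1 pq qp; lmod.
Qed.
Lemma projD p q : proj p -> proj q -> p * q = 0 -> proj (p + q).
Proof.
move=> [p1 p2] [q1 q2] pq; have qp : q * p = 0 by apply: adj_inj; rewrite adjM p2 q2 adj0.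
by split; rewrite ?adjD ?p2 ?q2// !bexp p1 q1 pq qp; lmod.
Qed.
Lemma proj_bnd p : proj p -> bnd p 1.
Proof.
move=> hp; apply: bnd_pos => //; first exact: proj_pos.
by rewrite scale1r; apply: proj_pos; exact: projC.
Qed.

(* [p] is the projection onto the kernel of [|a| - a], on which [a = |a|];
   off it, [a = - |a|]. *)
Lemma spectral_cut a : adj a = a -> exists p,
  [/\ proj p, forall c, a * c = c * a -> p * c = c * p, pos (a * p)
    & pos (- (a * (1 - p)))].
Proof.
move=> sa; have pa : pos (a * a) by rewrite -{1}sa; exact: pos_adjM.
have [b [pb b2 hb]] := sqrt_ex pa.
have hb' c : a * c = c * a -> b * c = c * b.
  by move=> h; apply: hb; rewrite -mulrA h mulrA h mulrA.
have ba : b * a = a * b by exact: hb'.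
pose K := [set x | (b - a) x = 0].
have lK : lsub K.
  split; first exact: op0x.
  move=> z x y hx hy; have hx' : (b - a) x = 0 := hx.
  have hy' : (b - a) y = 0 := hy.
  by change ((b - a) (z *: x + y) = 0); rewrite bop_linear hx' hy' scaler0 addr0.
have [p [pp sp pc pf po]] := projection_onto lK.
have hp : proj p by split.
have Kx x : K x -> (b - a) x = 0 by [].
have pinv c x : a * c = c * a -> K x -> K (c x).
  move=> hc hKx; have hbc := hb' _ hc; have hx : (b - a) x = 0 := hKx.
  change ((b - a) (c x) = 0).
  have -> : (b - a) (c x) = c ((b - a) x).
    by rewrite -!opM; congr opval; rewrite !bexp hbc hc.
  by rewrite hx op0x.
have hpc c : a * c = c * a -> p * c = c * p.
  move=> hc; have hc' : a * adj c = adj c * a.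
    by apply: adj_inj; rewrite !adjM adjK sa.
  by apply: (projection_comm sp pc pf) => s; exact: pinv.
have hbp : p * b = b * p by exact: hpc.
exists p; split => //.
- have ap : a * p = b * p.
    apply: bopext => x; rewrite !opM; apply/eqP; rewrite eq_sym -subr_eq0.
    by rewrite -opB; apply/eqP; exact: (clo_ker Kx).
  have -> : a * p = adj p * b * p.
    by rewrite sp hbp -mulrA pp.
  exact: pos_conj.
(* [(b - a) (b + a) = 0], so the range of [b + a] lies in [K]. Off [p] this yields [a = - b]. *)
have pba : p * (b + a) = b + a.
  apply: bopext => x; rewrite opM pf//; apply: sub_clo.
  change ((b - a) ((b + a) x) = 0); rewrite -opM.
  have -> : (b - a) * (b + a) = 0 by rewrite !bexp ba b2; lmod.
  by [].
have z0 : (b + a) * (1 - p) = 0.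
  apply: adj_inj; rewrite adjM adjB adj1 sp adjD (pos_adj pb) sa.
  by rewrite adj0 mulrBl mul1r pba subrr.
have -> : - (a * (1 - p)) = adj (1 - p) * b * (1 - p).
  have e1 : - (a * (1 - p)) = b * (1 - p).
    by apply/eqP; rewrite eq_sym -subr_eq0 opprK -mulrDl z0.
  rewrite e1 adjB adj1 sp.
  have -> : (1 - p) * b = b * (1 - p) by rewrite mulrBl mulrBr hbp mul1r mulr1.
  by rewrite -mulrA (proj_idem (projC hp)).
exact: pos_conj.
Qed.

Lemma spectral_cut_vn A a : vn A -> el A a -> adj a = a -> exists p,
  [/\ proj p, el A p, p * a = a * p, pos (a * p) & pos (- (a * (1 - p)))].
Proof.
move=> hA ha /spectral_cut[p [h1 h2 h3 h4]]; exists p; split => //.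
  exact: vn_bicomm ha h2.
exact: h2.
Qed.

(** With [b = |a|], the operator [v] is the isometry [b x |-> a x] on the closed range of [b],
    extended by zero, and [q] is the projection onto that range. The last clauses say that [q] is
    the right support of [a] and that [v * adj v] acts as a left unit on [a]. *)
Lemma polar A a : vn A -> el A a -> exists v q,
  [/\ el A v, el A q, proj q, adj v * v = q
    & [/\ a * q = a, forall x, a x = 0 -> q x = 0, forall b, b * a = a -> b * v = v
     & v * adj v * a = a]].
Proof.
move=> hA ha; have [b [pb b2 hb]] := sqrt_ex (pos_adjM a).
have Ab : el A b.
  by apply: (vn_bicomm hA _ hb); apply: vnM => //; exact: vn_adj.
have nba x : nm (a x) = nm (b x).
  have e : nm (a x) ^+ 2 = nm (b x) ^+ 2.
    by rewrite !nm_sq -!adjPr (pos_adj pb) -!opM b2.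
  by apply/eqP; rewrite eq_le; apply/andP; split; apply: le_of_sqr;
    rewrite ?nm_ge0// e.
have lin (c : bop) : forall (z : R[i]) (x y : H), setT x -> setT y ->
    c (z *: x + y) = z *: c x + c y by move=> *; exact: bop_linear.
have le x : setT x -> nm (a x) <= 1 * nm (b x) by rewrite nba mul1r.
have [v [bv hv v0]] := extension ler01 I (fun _ _ _ _ _ => I) (lin b) (lin a) le.
pose S := range b.
have lS : lsub S.
  split; first by exists 0 => //; rewrite op0x.
  by move=> z _ _ [x _ <-] [y _ <-]; exists (z *: x + y) => //; rewrite bop_linear.
have [q [qq sq qc qf q0]] := projection_onto lS.
have vb : v * b = a by apply: bopext => x; rewrite opM hv.
have qb : q * b = b.
  by apply: bopext => x; rewrite opM qf//; apply: sub_clo; exists x.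
have bq : b * q = b by apply: adj_inj; rewrite adjM sq (pos_adj pb).
have orth x s : S s -> hdot ((1 - q) x) s = 0.
  move=> [y _ <-]; rewrite adjP adjB adj1 sq opB -[q (b y)]opM qb op1 subrr.
  exact: hdot0r.
have vq : v * q = v.
  apply/eqP; rewrite eq_sym -subr_eq0; apply/eqP/bopext => x.
  have -> : (v - v * q) x = v ((1 - q) x) by rewrite !opE opBx.
  by apply: v0 => s _; apply: orth; exists s.
have agree (c d : bop) : c * b = d * b -> c * q = d * q.
  move=> h; apply/eqP; rewrite -subr_eq0 -mulrBl; apply/eqP/bopext => x.
  rewrite opM op0; apply: (clo_ker _ (qc x)) => _ [y _ <-].
  by rewrite -opM mulrBl h subrr.
(* [c] is the root of [1 - adj v * v]. Since [v] is isometric on the range of [b], [c] vanishes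
   there, and [adj v * v] is the identity on that range. *)
have vv : adj v * v = q.
  have p1 : pos (1 - adj v * v).
    have sv : adj (adj v * v) = adj v * v by rewrite adjM adjK.
    have := sa_bnd_pos sv (bnd_sqr ler01 bv).
    by rewrite expr1n scale1r.
  have [c [pc c2 _]] := sqrt_ex p1.
  have cb : c * b = 0.
    apply: bopext => x; apply/nm_eq0/eqP; rewrite -sqrf_eq0 nm_sq.
    rewrite -adjPr adjM (pos_adj pc) (pos_adj pb) -opM.
    have -> : b * c * (c * b) = b * (1 - adj v * v) * b.
      by rewrite -c2 !mulrA.
    rewrite mulrBr mulr1 mulrBl.
    have -> : b * (adj v * v) * b = adj (v * b) * (v * b).
      by rewrite adjM (pos_adj pb) !mulrA.
    by rewrite vb -b2 subrr op0 hdot0l.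
  have : (adj v * v) * b = 1 * b.
    apply/eqP; rewrite -subr_eq0 -mulrBl -oppr_eq0 -mulNr opprB -c2 -mulrA cb.
    by rewrite mulr0.
  by move/agree; rewrite mul1r -mulrA vq.
have hAq c : el (comm A) c -> q * c = c * q.
  move=> hc; have cb : b * c = c * b by apply: hc.
  have hc' : b * adj c = adj c * b by apply: (comm_star (proj1 hA) hc).
  apply: (projection_comm sq qc qf) => _ [x _ <-].
    by exists (c x) => //; rewrite -!opM cb.
  by exists (adj c x) => //; rewrite -!opM hc'.
exists v, q; split => //; last split.
- apply/(vnP hA) => c hc; rewrite -vq mulrA.
  have -> : v * q * c = v * c * q by rewrite -!mulrA hAq.
  apply: agree; rewrite -!mulrA vb.
  have <- : b * c = c * b by apply: hc.
  by rewrite mulrA vb hc.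
- by apply/(vnP hA) => c hc; rewrite hAq.
- by rewrite -vb -mulrA bq.
- move=> x ax; apply: q0 => _ [s _ <-].
  have bx : b x = 0 by apply: nm_eq0; rewrite -nba ax nm0.
  by rewrite -[b s]/(b s) -{1}(pos_adj pb) -adjP bx hdot0l.
- by move=> c hc; rewrite -{1}vq -[RHS]vq mulrA; apply: agree; rewrite -mulrA vb.
by rewrite -{1}vb -!mulrA [adj v * _]mulrA vv qb.
Qed.

End Algebras.

(** * Generalized weak limits *)

Section GeneralizedLimit.
Context {R : realType}.

Definition bddR (u : nat -> R) := exists c, forall n, `|u n| <= c.

(** The limit is the supremum of the levels that [u] exceeds on a set of [U]; being an ultrafilter,
    [U] contains the complement of any set it omits. *)
Lemma ultra_lim (U : set_system nat) (u : nat -> R) : UltraFilter U -> bddR u ->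
  exists l, forall e, 0 < e -> U [set n | `|u n - l| <= e].
Proof.
move=> UU [c hc].
pose S := [set x | U [set n | x <= u n]].
have hs : has_sup S.
  split.
    by exists (- c); apply: filterE => n /=; move: (hc n); rewrite ler_norml => /andP[].
  exists c => x Sx; rewrite leNgt; apply/negP => cx.
  have [n /= xn] := filter_ex Sx.
  by move: (hc n); rewrite ler_norml => /andP[_]; lra.
exists (sup S) => e e0.
have [x Sx hx] := sup_adherent e0 hs.
have [Se|Se] := in_ultra_setVsetC [set n | sup S + e <= u n] UU.
  have : sup S + e <= sup S by apply: sup_upper_bound.
  lra.
apply: filterS (filterI Sx Se) => n /= [xn /negP]; rewrite -ltNge => h.
by rewrite ler_norml; apply/andP; split; lra.
Qed.

Lemma genlim_real : exists L : (nat -> R) -> R,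
  (forall r u v, bddR u -> bddR v -> L (fun n => r * u n + v n) = r * L u + L v) /\
  (forall u c N, bddR u -> (forall n, (N <= n)%N -> u n <= c) -> L u <= c).
Proof.
have [U [UU UF]] := @ultraFilterLemma nat \oo _.
have hL u : exists l, bddR u -> forall e, 0 < e -> U [set n | `|u n - l| <= e].
  by have [/(ultra_lim UU)[l hl]|h] := pselect (bddR u); [exists l | exists 0].
have [L HL] := choice hL; exists L; split.
  move=> r u v hu hv.
  have huv : bddR (fun n => r * u n + v n).
    move: hu hv => [c hc] [d hd]; exists (`|r| * c + d) => n.
    by rewrite (le_trans (ler_normD _ _))// normrM lerD// ler_wpM2l.
  apply/eqP; rewrite -subr_eq0 -normr_eq0 eq_le normr_ge0 andbT.
  apply: le_eps => e e0; rewrite add0r.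
  have r0 : 0 < `|r| + 1 by rewrite ltr_wpDl.
  pose d := e / (`|r| + 2).
  have d0 : 0 < d by rewrite divr_gt0// addr_gt0// ltr_wpDl.
  have dE : d * (`|r| + 2) = e by rewrite /d divfK// gt_eqF// ltr_wpDl.
  have [n /= [[h1 h2] h3]] :=
    filter_ex (filterI (filterI (HL u hu d d0) (HL v hv d d0)) (HL _ huv d d0)).
  set A := L _ in h3 *.
  have -> : A - (r * L u + L v) =
    - (r * u n + v n - A) + (r * (u n - L u) + (v n - L v)) by ring.
  rewrite (le_trans (ler_normD _ _))// normrN.
  have : `|r * (u n - L u) + (v n - L v)| <= `|r| * d + d.
    by rewrite (le_trans (ler_normD _ _))// normrM lerD// ler_wpM2l.
  move: h3 dE; lra.
move=> u c N hu hc; apply: le_eps => e e0.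
have [n /= [h1 h2]] := filter_ex (filterI (HL u hu e e0) (UF _ (nbhs_infty_ge N))).
by have := hc n h2; move: h1; rewrite ler_norml => /andP[]; lra.
Qed.

(* The limit along a nonprincipal ultrafilter: linear on bounded sequences, so
   that weak limits exist without passing to subsequences. *)
Definition glimR : (nat -> R) -> R := projT1 (cid genlim_real).

Lemma glimR_lin r u v : bddR u -> bddR v ->
  glimR (fun n => r * u n + v n) = r * glimR u + glimR v.
Proof. by rewrite /glimR; case: cid => L [h _] /=; exact: h. Qed.

Lemma glimR_le u c N : bddR u -> (forall n, (N <= n)%N -> u n <= c) -> glimR u <= c.
Proof. by rewrite /glimR; case: cid => L [_ h] /=; exact: h. Qed.

Definition glim (u : nat -> R[i]) : R[i] :=
  (glimR (fun n => complex.Re (u n))) +i* (glimR (fun n => complex.Im (u n))).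

Definition bdd (u : nat -> R[i]) := exists c : R, forall n, cabs (u n) <= c.

Implicit Types u v : nat -> R[i].

Lemma Re_abs (z : R[i]) : `|complex.Re z| <= cabs z.
Proof. by rewrite -lecR -cabsE; exact: normc_ge_Re. Qed.
Lemma Im_abs (z : R[i]) : `|complex.Im z| <= cabs z.
Proof.
have -> : complex.Im z = complex.Re (- 'i * z) by rewrite Re_mulNi.
by rewrite (le_trans (Re_abs _))// cabsM cabsN /cabs normc_def /= expr0n expr1n /= add0r sqrtr1 mul1r.
Qed.

Lemma bddRe u : bdd u -> bddR (fun n => complex.Re (u n)).
Proof. by case=> c h; exists c => n; exact: le_trans (Re_abs _) (h n). Qed.
Lemma bddIm u : bdd u -> bddR (fun n => complex.Im (u n)).
Proof. by case=> c h; exists c => n; exact: le_trans (Im_abs _) (h n). Qed.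

Lemma bddD u v : bdd u -> bdd v -> bdd (fun n => u n + v n).
Proof.
move=> [c hc] [d hd]; exists (c + d) => n.
by rewrite (le_trans (cabsD _ _))// lerD.
Qed.
Lemma bddZ z u : bdd u -> bdd (fun n => z * u n).
Proof. by move=> [c hc]; exists (cabs z * c) => n; rewrite cabsM ler_wpM2l ?cabs_ge0. Qed.
Lemma bdd_cst z : bdd (fun=> z). Proof. by exists (cabs z). Qed.
Lemma bdd_conj u : bdd u -> bdd (fun n => conjc (u n)).
Proof. by move=> [c hc]; exists c => n; rewrite cabs_conj. Qed.

Lemma bddR_cst (r : R) : bddR (fun=> r). Proof. by exists `|r|. Qed.
Lemma bddR0 : bddR (fun=> 0). Proof. exact: bddR_cst. Qed.
Lemma glimR0 : glimR (fun=> 0) = 0.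
Proof.
have := glimR_lin 1 bddR0 bddR0.
rewrite (_ : (fun=> 1 * 0 + 0) = fun=> (0:R)); last by apply/funext => n; rewrite mul1r addr0.
lra.
Qed.
Lemma glimRZ (r : R) (u' : nat -> R) : bddR u' -> glimR (fun n => r * u' n) = r * glimR u'.
Proof.
move=> h; have := glimR_lin r h bddR0; rewrite glimR0 addr0 => <-.
by congr glimR; apply/funext => n; rewrite addr0.
Qed.
Lemma glimRD (u' v' : nat -> R) : bddR u' -> bddR v' ->
  glimR (fun n => u' n + v' n) = glimR u' + glimR v'.
Proof.
move=> h1 h2; have := glimR_lin 1 h1 h2; rewrite mul1r => <-.
by congr glimR; apply/funext => n; rewrite mul1r.
Qed.

Lemma glimD u v : bdd u -> bdd v -> glim (fun n => u n + v n) = glim u + glim v.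
Proof.
move=> hu hv; rewrite /glim.
have -> : (fun n => complex.Re (u n + v n)) =
  fun n => complex.Re (u n) + complex.Re (v n) by apply/funext => n; rewrite ReD.
have -> : (fun n => complex.Im (u n + v n)) =
  fun n => complex.Im (u n) + complex.Im (v n).
  by apply/funext => n; case: (u n) (v n) => [? ?] [].
by rewrite !glimRD//; [exact: bddIm|exact: bddIm|exact: bddRe|exact: bddRe].
Qed.

Lemma glimZ z u : bdd u -> glim (fun n => z * u n) = z * glim u.
Proof.
move=> hu; rewrite /glim; case: z => a b.
have hr := bddRe hu; have hi := bddIm hu.
have -> : (fun n => complex.Re ((a +i* b) * u n)) =
  fun n => (- b) * complex.Im (u n) + a * complex.Re (u n).
  by apply/funext => n; case: (u n) => c d /=; ring.
have -> : (fun n => complex.Im ((a +i* b) * u n)) =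
  fun n => a * complex.Im (u n) + b * complex.Re (u n).
  by apply/funext => n; case: (u n) => c d /=; ring.
have bz r w : bddR w -> bddR (fun n => r * w n).
  by move=> [c hc]; exists (`|r| * c) => n; rewrite normrM ler_wpM2l.
rewrite !glimR_lin//; try exact: bz.
rewrite !glimRZ//.
by apply/eqP; rewrite eq_complex /=; apply/andP; split; apply/eqP; ring.
Qed.

Lemma glim_conj u : bdd u -> glim (fun n => conjc (u n)) = conjc (glim u).
Proof.
move=> hu; rewrite /glim /=; congr (_ +i* _).
  by congr glimR; apply/funext => n; rewrite ReJ.
have -> : (fun n => complex.Im (conjc (u n))) = fun n => (-1) * complex.Im (u n).
  by apply/funext => n; case: (u n) => c d /=; rewrite mulN1r.
by rewrite glimRZ ?mulN1r//; exact: bddIm.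
Qed.

Lemma glim_bound u c N : bdd u -> (forall n, (N <= n)%N -> cabs (u n) <= c) ->
  cabs (glim u) <= c.
Proof.
move=> hu hc; have [w [w1 wE]] := rotate (glim u).
have := glimZ w hu; rewrite wE => /(congr1 (@complex.Re _)) /= <-.
apply: (@glimR_le _ _ N); first by apply: bddRe; exact: bddZ.
by move=> n nN; rewrite (le_trans (Re_le_cabs _))// cabsM w1 mul1r hc.
Qed.

Lemma glim_cst z : glim (fun=> z) = z.
Proof.
have h1 (c : R) : glimR (fun=> c) = c.
  apply/eqP; rewrite eq_le (glimR_le (N := 0%N) (bddR_cst c))//=.
  rewrite -lerN2 -mulN1r -glimRZ; last exact: bddR_cst.
  apply: (glimR_le (N := 0%N)); last by move=> n _; rewrite mulN1r.
  exact: bddR_cst.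
by rewrite /glim !h1; case: z.
Qed.

Definition ccvg u (l : R[i]) := forall e : R, 0 < e ->
  exists N, forall n, (N <= n)%N -> cabs (u n - l) <= e.

Lemma glimB u v : bdd u -> bdd v -> glim (fun n => u n - v n) = glim u - glim v.
Proof.
move=> hu hv; have -> : (fun n => u n - v n) = fun n => u n + (-1) * v n.
  by apply/funext => n; rewrite mulN1r.
by rewrite glimD ?glimZ ?mulN1r//; exact: bddZ.
Qed.

Lemma glim_cvg u l : bdd u -> ccvg u l -> glim u = l.
Proof.
move=> hu hl; apply/eqP; rewrite -subr_eq0; apply/eqP/cabs_eq0/eqP.
rewrite eq_le cabs_ge0 andbT; apply: le_eps => e e0; rewrite add0r.
have [N hN] := hl e e0; rewrite -[l in _ - l]glim_cst -glimB//; last exact: bdd_cst.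
apply: (@glim_bound _ _ N) => //.
by apply: bddD => //; exact: bdd_cst.
Qed.

Lemma glim_ge0 u : bdd u -> (forall n, 0 <= u n) -> 0 <= glim u.
Proof.
move=> hu h; have -> : glim u = (glimR (fun n => complex.Re (u n)))%:C.
  rewrite /glim; congr (_ +i* _).
  by rewrite -[RHS]glimR0; congr glimR; apply/funext => n; apply/ger0_Im/h.
rewrite lecR -oppr_le0 -mulN1r -glimRZ; last exact: bddRe.
apply: (glimR_le (N := 0%N)).
  have [c hc] := bddRe hu; exists c => n; rewrite normrM normrN normr1 mul1r.
  exact: hc.
by move=> n _; rewrite mulN1r oppr_le0; exact: Re_ge0 (h n).
Qed.

End GeneralizedLimit.

(** * Weak limits of bounded sequences of operators *)

Section WeakLimits.
Context {R : realType} {H : hilbertType R}.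
Local Notation bop := (bop H).
Implicit Types (a b c : bop) (A : set bop) (u v : nat -> bop).

Definition wlim u a := forall x z, hdot (a x) z = glim (fun n => hdot (u n x) z).

Definition ubnd u (k : R) := forall n, bnd (u n) k.

Lemma ubnd_bdd u k x z : ubnd u k -> bdd (fun n => hdot (u n x) z).
Proof.
move=> h; exists (k * nm x * nm z) => n.
by rewrite (le_trans (CS _ _))// ler_wpM2r ?nm_ge0//; exact: h.
Qed.

Lemma wlim_ex u k : 0 <= k -> ubnd u k -> exists2 a, wlim u a & bnd a k.
Proof.
move=> k0 hu; have hb x z := ubnd_bdd x z hu.
have hy x : exists y, forall z, conjc (glim (fun n => hdot (u n x) z)) = hdot z y.
  apply: (@Riesz _ _ _ (k * nm x)).
    move=> w y z; rewrite -!glim_conj// -?glimZ -?glimD; try exact/bddZ/bdd_conj;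
      try exact/bdd_conj.
    by congr glim; apply/funext => n; rewrite hdotDr hdotZr rmorphD rmorphM /= conjcK.
  move=> z; rewrite cabs_conj; apply: (glim_bound (N := 0%N)) => // n _.
  by rewrite (le_trans (CS _ _))// ler_wpM2r ?nm_ge0//; exact: hu.
have [f hf] := choice hy.
have fE x z : hdot (f x) z = glim (fun n => hdot (u n x) z).
  by rewrite hdotC -hf conjcK.
have bf : bounded_op f.
  apply/bounded_opP; split.
    move=> w x y; apply: hdot_eq => z; rewrite hdotDl hdotZl !fE -glimZ//.
    rewrite -glimD//; last exact: bddZ.
    by congr glim; apply/funext => n; rewrite bop_linear hdotDl hdotZl.
  exists k => // x; have [->|x0] := eqVneq (nm (f x)) 0.
    by rewrite mulr_ge0// nm_ge0.
  have xp : 0 < nm (f x) by rewrite lt0r x0 nm_ge0.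
  rewrite -(ler_pM2r xp) -expr2.
  have -> : nm (f x) ^+ 2 = cabs (hdot (f x) (f x)).
    by rewrite hdotxx cabs_real ger0_norm// exprn_ge0 ?nm_ge0.
  rewrite fE; apply: (glim_bound (N := 0%N)) => // n _.
  by rewrite (le_trans (CS _ _))// ler_wpM2r ?nm_ge0//; exact: hu.
exists (mkbop bf) => // x.
have [->|x0] := eqVneq (nm (f x)) 0; first by rewrite /= mulr_ge0// nm_ge0.
have xp : 0 < nm (f x) by rewrite lt0r x0 nm_ge0.
rewrite /= -(ler_pM2r xp) -expr2.
have -> : nm (f x) ^+ 2 = cabs (hdot (f x) (f x)).
  by rewrite hdotxx cabs_real ger0_norm// exprn_ge0 ?nm_ge0.
rewrite fE; apply: (glim_bound (N := 0%N)) => // n _.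
by rewrite (le_trans (CS _ _))// ler_wpM2r ?nm_ge0//; exact: hu.
Qed.

Lemma wlim_unique u a b : wlim u a -> wlim u b -> a = b.
Proof. by move=> h1 h2; apply: bopext => x; apply: hdot_eq => z; rewrite h1 h2. Qed.

Lemma wlimMl u a b : wlim u a -> wlim (fun n => b * u n) (b * a).
Proof.
move=> h x z; rewrite opM adjP h; congr glim; apply/funext => n.
by rewrite opM [RHS]adjP.
Qed.
Lemma wlimMr u a b : wlim u a -> wlim (fun n => u n * b) (a * b).
Proof. by move=> h x z; exact: h. Qed.
Lemma wlim_cst a : wlim (fun=> a) a.
Proof. by move=> x z; rewrite glim_cst. Qed.
Lemma wlim_adj u a k : ubnd u k -> wlim u a -> wlim (fun n => adj (u n)) (adj a).
Proof.
move=> hu h x z; rewrite hdotC -adjP h -glim_conj; last exact: ubnd_bdd hu.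
by congr glim; apply/funext => n; rewrite -hdotC adjPr.
Qed.
Lemma wlimD u v a b k l : ubnd u k -> ubnd v l -> wlim u a -> wlim v b ->
  wlim (fun n => u n + v n) (a + b).
Proof.
move=> hu hv h1 h2 x z; rewrite opE hdotDl h1 h2 -glimD.
- by congr glim; apply/funext => n; rewrite opE hdotDl.
- exact: ubnd_bdd hu.
exact: ubnd_bdd hv.
Qed.

Lemma wlim_vn A u a : vn A -> (forall n, el A (u n)) -> wlim u a -> el A a.
Proof.
move=> hA hu h; apply/(vnP hA) => c hc.
apply: (wlim_unique (wlimMl c h)).
have -> : (fun n => c * u n) = (fun n => u n * c).
  by apply/funext => n; move/(vnP hA): (hu n) => ->.
exact: wlimMr.
Qed.

Lemma wlim_pos u a k : ubnd u k -> wlim u a -> (forall n, pos (u n)) -> pos a.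
Proof.
by move=> hu h hp x; rewrite h; apply: glim_ge0 => [|n]; [exact: ubnd_bdd hu|exact: hp].
Qed.

(** Exact identities for a weak limit come from products with fixed operators that are eventually
    constant. *)
Lemma wlim_eventually u a b N : wlim u a ->
  (forall n, (N <= n)%N -> u n = b) -> (exists k, ubnd u k) -> a = b.
Proof.
move=> h hN [k hk]; apply: bopext => x; apply: hdot_eq => z; rewrite h.
apply: glim_cvg; first exact: ubnd_bdd hk.
by move=> e e0; exists N => n nN; rewrite hN// subrr cabs0 ltW.
Qed.

End WeakLimits.

(** * Normal traces *)

Section NormalFunctionals.
Context {R : realType} {H : hilbertType R}.
Local Notation bop := (bop H).
Implicit Types (a b c : bop) (xi eta : nat -> H) (z : R[i]).

Definition sqsum xi := exists c : R, forall n, \sum_(i < n) nm (xi i) ^+ 2 <= c.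

Definition psum xi eta a n := \sum_(i < n) hdot (a (xi i)) (eta i).
(* Generalized limits make this linear in [a] on all bounded operators. *)
Definition nf xi eta a : R[i] := glim (psum xi eta a).
Definition mass xi eta n : R := \sum_(i < n) (nm (xi i) ^+ 2 + nm (eta i) ^+ 2).

Lemma massS xi eta n :
  mass xi eta n.+1 = mass xi eta n + (nm (xi n) ^+ 2 + nm (eta n) ^+ 2).
Proof. by rewrite /mass big_ord_recr. Qed.

Lemma mass0 xi eta : mass xi eta 0 = 0. Proof. exact: big_ord0. Qed.
Lemma psum0 xi eta a : psum xi eta a 0 = 0. Proof. exact: big_ord0. Qed.

Lemma massS_le xi eta n : mass xi eta n <= mass xi eta n.+1.
Proof. by rewrite massS lerDl addr_ge0// exprn_ge0 ?nm_ge0. Qed.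

Lemma mass_bound xi eta : sqsum xi -> sqsum eta ->
  exists d : R, forall n, mass xi eta n <= d.
Proof.
move=> [c hc] [d hd]; exists (c + d) => n.
by rewrite /mass big_split lerD//.
Qed.

Lemma psum_bound xi eta a (k : R) m n : 0 <= k -> bnd a k -> (m <= n)%N ->
  cabs (psum xi eta a n - psum xi eta a m) <= k * (mass xi eta n - mass xi eta m).
Proof.
move=> k0 hk /subnKC <-; elim: (n - m)%N => [|j IH].
  by rewrite addn0 !subrr cabs0 mulr0.
rewrite addnS massS; set N := (m + j)%N in IH *.
have -> : psum xi eta a N.+1 = psum xi eta a N + hdot (a (xi N)) (eta N).
  by rewrite /psum big_ord_recr.
rewrite addrAC (le_trans (cabsD _ _))// addrAC mulrDr lerD//.
rewrite (le_trans (CS _ _))//.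
have := hk (xi N); have := nm_ge0 (a (xi N)); have := nm_ge0 (xi N).
have := nm_ge0 (eta N).
set s := nm (eta N); set t := nm (xi N); set w := nm (a _) => s0 t0 w0 h.
apply: (@le_trans _ _ (k * t * s)); first by rewrite ler_wpM2r//.
rewrite -mulrA ler_wpM2l//; nra.
Qed.

Lemma psum_bdd xi eta a : sqsum xi -> sqsum eta -> bdd (psum xi eta a).
Proof.
move=> h1 h2; have [c hc] := mass_bound h1 h2; have [k k0 hk] := bop_bnd a.
exists (k * c) => n; have := psum_bound xi eta k0 hk (leq0n n).
rewrite psum0 mass0 !subr0 => /le_trans; apply.
by rewrite ler_wpM2l//; exact: hc.
Qed.

Lemma nf_lin xi eta z a b : sqsum xi -> sqsum eta ->
  nf xi eta (z *: a + b) = z * nf xi eta a + nf xi eta b.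
Proof.
move=> h1 h2; rewrite /nf -glimZ; last exact: psum_bdd.
rewrite -glimD; [|exact/bddZ/psum_bdd|exact: psum_bdd].
congr glim; apply/funext => n; rewrite /psum mulr_sumr -big_split/=.
by apply: eq_bigr => i _; rewrite opL hdotDl hdotZl.
Qed.

Lemma nf_tail xi eta : sqsum xi -> sqsum eta -> forall e : R, 0 < e ->
  exists N, forall a k, 0 <= k -> bnd a k ->
    cabs (nf xi eta a - psum xi eta a N) <= k * e.
Proof.
move=> h1 h2 e e0; have [c hc] := mass_bound h1 h2.
have [N hN] := nondecreasing_cauchy (massS_le xi eta) hc e0.
exists N => a k k0 hk.
rewrite -[psum xi eta a N]glim_cst -glimB; [|exact: psum_bdd|exact: bdd_cst].
apply: (@glim_bound _ _ _ N).
  by apply: bddD; [exact: psum_bdd | exact: bdd_cst].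
by move=> n nN; rewrite (le_trans (psum_bound xi eta k0 hk nN))// ler_wpM2l// hN.
Qed.

Lemma nf_bound xi eta : sqsum xi -> sqsum eta ->
  exists2 C : R, 0 <= C & forall a k, 0 <= k -> bnd a k -> cabs (nf xi eta a) <= C * k.
Proof.
move=> h1 h2; have [c hc] := mass_bound h1 h2; exists c.
  by apply: le_trans (hc 0%N); rewrite /mass big_ord0.
move=> a k k0 hk; apply: (@glim_bound _ _ _ 0%N); first exact: psum_bdd.
move=> n _; have := psum_bound xi eta k0 hk (leq0n n).
rewrite psum0 mass0 !subr0 => /le_trans; apply.
by rewrite mulrC ler_wpM2r//; exact: hc.
Qed.

(** The tails of the series are uniformly small on bounded sets, and each partial sum commutes with
    weak limits. *)
Lemma nf_wlim xi eta u a k : sqsum xi -> sqsum eta -> 0 <= k -> ubnd u k ->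
  bnd a k -> wlim u a -> nf xi eta a = glim (fun n => nf xi eta (u n)).
Proof.
move=> h1 h2 k0 hu ha hw.
apply/eqP; rewrite -subr_eq0; apply/eqP/cabs_eq0/eqP.
rewrite eq_le cabs_ge0 andbT; apply: le_eps => e e0; rewrite add0r.
have e1 : 0 < e / (2 * (k + 1)) by rewrite divr_gt0//; lra.
have [C C0 hC] := nf_bound h1 h2.
have [N hN] := nf_tail h1 h2 e1.
have bu : bdd (fun n => nf xi eta (u n)) by exists (C * k) => n; exact: hC.
have pa : psum xi eta a N = glim (fun n => psum xi eta (u n) N).
  rewrite /psum; elim: N {hN} => [|N IH].
    rewrite big_ord0 -[LHS](glim_cst 0); congr glim; apply/funext => n.
    by rewrite big_ord0.
  rewrite big_ord_recr/= IH hw -glimD; last exact: ubnd_bdd hu.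
    by congr glim; apply/funext => n; rewrite big_ord_recr.
  exists (k * mass xi eta N) => n; have := psum_bound xi eta k0 (hu n) (leq0n N).
  by rewrite psum0 mass0 !subr0.
have bp : bdd (fun n => psum xi eta (u n) N).
  exists (k * mass xi eta N) => n; have := psum_bound xi eta k0 (hu n) (leq0n N).
  by rewrite psum0 mass0 !subr0.
have -> : nf xi eta a - glim (fun n => nf xi eta (u n)) =
  (nf xi eta a - psum xi eta a N) -
  glim (fun n => nf xi eta (u n) - psum xi eta (u n) N).
  by rewrite glimB// pa; ring.
have h3 : cabs (glim (fun n => nf xi eta (u n) - psum xi eta (u n) N)) <=
    k * (e / (2 * (k + 1))).
  apply: (@glim_bound _ _ _ 0%N) => [|n _]; last exact: hN.
  by rewrite -[X in bdd X]/(fun n => nf xi eta (u n) + - psum xi eta (u n) N);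
    apply: bddD => //; have := bddZ (-1) bp; congr bdd; apply/funext => n;
    rewrite mulN1r.
rewrite (le_trans (cabsD _ _))// cabsN.
have := hN a k k0 ha.
have : e / (2 * (k + 1)) * (2 * (k + 1)) = e by field; lra.
move: h3 e1; set d := e / _; nra.
Qed.

End NormalFunctionals.

Section Trace.
Context {R : realType} {H : hilbertType R}.
Local Notation bop := (bop H).
Implicit Types (a b c p q x y : bop) (A : set bop) (z : R[i]).

(** [t] is linear, bounded and normal on all bounded operators; positivity, faithfulness and the
    trace property concern [A] only. This allows passage to a subalgebra with the same [t]. *)
Record tracial A (t : bop -> R[i]) : Prop := {
  tr_lin : forall z a b, t (z *: a + b) = z * t a + t b;
  tr1 : t 1 = 1;
  tr_pos2 : forall a, el A a -> 0 <= t (adj a * a);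
  tr_faith : forall a, el A a -> t (adj a * a) = 0 -> a = 0;
  trC : forall a b, el A a -> el A b -> t (a * b) = t (b * a);
  tr_wlim : forall u a k, 0 <= k -> ubnd u k -> bnd a k -> wlim u a ->
     t a = glim (fun n => t (u n));
  tr_bnd : exists2 C : R, 0 <= C & forall a k, 0 <= k -> bnd a k -> cabs (t a) <= C * k }.

Variables (A : set bop) (t : bop -> R[i]).
Hypotheses (hA : vn A) (ht : tracial A t).

Lemma tr0 : t 0 = 0.
Proof.
by have := tr_lin ht (-1) 0 0; rewrite scaler0 addr0 mulN1r addNr.
Qed.
Lemma trZ z a : t (z *: a) = z * t a.
Proof. by have := tr_lin ht z a 0; rewrite !addr0 tr0 addr0. Qed.
Lemma trD a b : t (a + b) = t a + t b.
Proof. by have := tr_lin ht 1 a b; rewrite scale1r mul1r. Qed.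
Lemma trN a : t (- a) = - t a.
Proof. by rewrite -scaleN1r trZ mulN1r. Qed.
Lemma trB a b : t (a - b) = t a - t b. Proof. by rewrite trD trN. Qed.
Lemma tr_sum I (r : seq I) (P : pred I) (F : I -> bop) :
  t (\sum_(i <- r | P i) F i) = \sum_(i <- r | P i) t (F i).
Proof. exact: (big_morph _ trD tr0). Qed.

Lemma sqrt_vn a : el A a -> pos a -> exists b, [/\ el A b, pos b & b * b = a].
Proof.
move=> ha pa; have [b [pb b2 hb]] := sqrt_ex pa; exists b; split => //.
exact: vn_bicomm ha hb.
Qed.

Lemma tr_pos a : el A a -> pos a -> 0 <= t a.
Proof.
move=> ha pa; have [b [hb pb <-]] := sqrt_vn ha pa.
by rewrite -{1}(pos_adj pb); exact: (tr_pos2 ht).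
Qed.

Lemma tr_pos_eq0 a : el A a -> pos a -> t a = 0 -> a = 0.
Proof.
move=> ha pa; have [b [hb pb <-]] := sqrt_vn ha pa.
by rewrite -{1}(pos_adj pb) => /(tr_faith ht hb) ->; rewrite mul0r.
Qed.

Lemma tr_sa a : el A a -> adj a = a -> t a = (complex.Re (t a))%:C.
Proof.
move=> ha sa; have [k k0 hk] := bop_bnd a.
have := tr_pos (vnB hA (vnZ k%:C hA (vn1 hA)) ha) (sa_bnd_pos sa hk).
rewrite trB trZ (tr1 ht) mulr1.
by case: (t a) => r s /=; rewrite lecE/= sub0r oppr_eq0 => /andP[/eqP -> _].
Qed.

Lemma tr_adj a : el A a -> t (adj a) = conjc (t a).
Proof.
move=> ha; have ha' := vn_adj hA ha.
have h1 := tr_sa (vnD hA ha ha') ltac:(by rewrite adjD adjK addrC).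
have h2 : adj ('i *: (a - adj a)) = 'i *: (a - adj a).
  rewrite adjZ adjB adjK; have -> : conjc 'i = - 'i :> R[i] by rewrite /conjc; simpc.
  by rewrite scaleNr -scalerN opprB.
have := tr_sa (vnZ 'i hA (vnB hA ha ha')) h2.
move: h1; rewrite trZ trB trD.
case: (t a) => r s; case: (t (adj a)) => r' s' /= [h3] [] h4.
by congr (_ +i* _); lra.
Qed.

(** The square of the 2-norm of the trace. *)
Definition q2 a : R := complex.Re (t (adj a * a)).

Lemma q2E a : el A a -> t (adj a * a) = (q2 a)%:C.
Proof. by move=> ha; rewrite /q2 -ge0_ReC//; exact: (tr_pos2 ht). Qed.
Lemma q2_ge0 a : el A a -> 0 <= q2 a.
Proof. by move=> ha; apply/Re_ge0/(tr_pos2 ht). Qed.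
Lemma q2_eq0 a : el A a -> q2 a = 0 -> a = 0.
Proof. by move=> ha h; apply: (tr_faith ht ha); rewrite q2E// h. Qed.
Lemma q20 : q2 0 = 0. Proof. by rewrite /q2 mulr0 tr0. Qed.
Lemma q2N a : q2 (- a) = q2 a.
Proof. by rewrite /q2 adjN mulNr mulrN opprK. Qed.
Lemma q2B a b : q2 (a - b) = q2 (b - a).
Proof. by rewrite -q2N opprB. Qed.
Lemma q2_adj a : el A a -> q2 (adj a) = q2 a.
Proof. by move=> ha; rewrite /q2 adjK (trC ht)//; exact: vn_adj. Qed.
Lemma q2Zr (r : R) a : q2 (r%:C *: a) = r ^+ 2 * q2 a.
Proof.
by rewrite /q2 adjZr scaleMl scaleMr scalerA -rmorphM trZ ReZ expr2.
Qed.

Lemma tr_psd : psd_form (el A) (fun a b => t (adj b * a)).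
Proof.
split.
- by move=> z a b ha hb; apply: vnD => //; exact: vnZ.
- by move=> z a b c ha hb hc; rewrite mulrDr trD scaleMr trZ.
- move=> a b ha hb; rewrite -tr_adj ?adjM ?adjK//.
  by apply: vnM => //; exact: vn_adj.
by move=> a; exact: (tr_pos2 ht).
Qed.

Lemma tr_CS a b : el A a -> el A b -> cabs (t (adj b * a)) ^+ 2 <= q2 a * q2 b.
Proof. by move=> ha hb; exact: (psd_CS tr_psd ha hb). Qed.

Lemma tr_CS' a b : el A a -> el A b -> cabs (t (b * a)) ^+ 2 <= q2 a * q2 b.
Proof.
move=> ha hb; have := tr_CS ha (vn_adj hA hb).
by rewrite adjK q2_adj.
Qed.

Lemma q2D a b : el A a -> el A b ->
  q2 (a + b) = q2 a + q2 b + 2 * complex.Re (t (adj b * a)).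
Proof.
move=> ha hb; rewrite /q2 adjD mulrDl !mulrDr !trD !ReD.
have -> : t (adj a * b) = conjc (t (adj b * a)).
  by rewrite -tr_adj ?adjM ?adjK//; apply: vnM => //; exact: vn_adj.
by rewrite ReJ; ring.
Qed.

Lemma q2_parallelogram a b : el A a -> el A b ->
  q2 (a + b) + q2 (a - b) = 2 * q2 a + 2 * q2 b.
Proof.
move=> ha hb; rewrite !q2D//; last exact: vnN.
by rewrite q2N adjN mulNr trN ReN; ring.
Qed.

Lemma q2_triangle a b : el A a -> el A b -> q2 (a + b) <= 2 * q2 a + 2 * q2 b.
Proof.
move=> ha hb; rewrite -q2_parallelogram// lerDl q2_ge0//; exact: vnB.
Qed.

Lemma q2_triangleB a b c : el A a -> el A b -> el A c ->
  q2 (a - c) <= 2 * q2 (a - b) + 2 * q2 (b - c).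
Proof.
move=> ha hb hc; have -> : a - c = (a - b) + (b - c) by lmod.
by apply: q2_triangle; exact: vnB.
Qed.

Lemma tr_le a b : el A a -> el A b -> pos (b - a) ->
  complex.Re (t a) <= complex.Re (t b).
Proof.
move=> ha hb h; rewrite -subr_ge0 -ReB -trB; apply/Re_ge0/tr_pos => //.
exact: vnB.
Qed.

Lemma q2_Ml a b (k : R) : 0 <= k -> el A a -> el A b -> bnd b k ->
  q2 (b * a) <= k ^+ 2 * q2 a.
Proof.
move=> k0 ha hb hk; have hba := vnM hA hb ha; have a' := vn_adj hA ha.
have b' := vn_adj hA hb.
rewrite /q2 -ReZ -trZ; apply: tr_le.
- by apply: vnM => //; exact: vn_adj.
- by apply: vnZ => //; exact: vnM.
have -> : (k ^+ 2)%:C *: (adj a * a) - adj (b * a) * (b * a) =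
    adj a * ((k ^+ 2)%:B - adj b * b) * a.
  by rewrite adjM; bring.
apply: pos_conj; apply: sa_bnd_pos; first by rewrite adjM adjK.
exact: bnd_sqr.
Qed.

Lemma q2_Mr a b (k : R) : 0 <= k -> el A a -> el A b -> bnd b k ->
  q2 (a * b) <= k ^+ 2 * q2 a.
Proof.
move=> k0 ha hb hk; have a' := vn_adj hA ha; have b' := vn_adj hA hb.
rewrite -q2_adj; last exact: vnM.
rewrite adjM -(q2_adj ha); apply: q2_Ml => //; exact: bnd_adj.
Qed.

Lemma q2_bnd a (k : R) : 0 <= k -> el A a -> bnd a k -> q2 a <= k ^+ 2.
Proof.
move=> k0 ha hk; rewrite -[a]mulr1; apply: le_trans (q2_Ml k0 (vn1 hA) ha hk) _.
by rewrite {1}/q2 adj1 mulr1 (tr1 ht) /= mulr1.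
Qed.

Lemma Re_tr_sq a b : el A a -> el A b ->
  complex.Re (t (b * a)) ^+ 2 <= q2 a * q2 b.
Proof.
move=> ha hb; apply: le_trans (tr_CS' ha hb).
by rewrite sqr_cabs lerDl sqr_ge0.
Qed.

Lemma ball_complete (u : nat -> bop) (k : R) : 0 <= k -> ubnd u k ->
  (forall n, el A (u n)) ->
  (forall e, 0 < e -> exists N, forall n m, (N <= n)%N -> (N <= m)%N ->
     q2 (u n - u m) <= e) ->
  exists y, [/\ el A y, bnd y k, wlim u y &
    forall e, 0 < e -> exists N, forall n, (N <= n)%N -> q2 (u n - y) <= e].
Proof.
move=> k0 hu Au hc; have [y wy by_] := wlim_ex k0 hu.
have Ay : el A y by exact: wlim_vn wy.
exists y; split => // e e0; have [N hN] := hc e e0; exists N => m mN.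
rewrite q2B; have Hm : el A (y - u m) by exact: vnB.
(* [|y - u_m|^2 = lim <u_n - u_m, y - u_m> <= sup |u_n - u_m| |y - u_m|] *)
have hlim : t (adj (y - u m) * (y - u m)) =
    glim (fun n => t (adj (y - u m) * (u n - u m))).
  have kk : 0 <= (k + k) * (k + k) by nra.
  apply: (tr_wlim ht kk).
  - move=> n; apply: bndM; first by lra.
      by apply/bnd_adj/bndB.
    by apply: bndB.
  - by apply: bndM; [lra| apply/bnd_adj/bndB | apply: bndB].
  apply: wlimMl; apply: (wlimD hu (v := fun=> - u m)) => //.
    by move=> n; apply/bndN; exact: hu.
  exact: wlim_cst.
have Q0 := q2_ge0 Hm.
have : cabs (t (adj (y - u m) * (y - u m))) <= Num.sqrt (e * q2 (y - u m)).
  rewrite hlim; apply: (@glim_bound _ _ _ N).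
    have [C C0 hC] := tr_bnd ht; exists (C * ((k + k) * (k + k))) => n.
    apply: hC; first by nra.
    by apply: bndM; [lra | apply/bnd_adj/bndB | apply: bndB].
  move=> n nN; apply: le_of_sqr; first exact: sqrtr_ge0.
  rewrite sqr_sqrtr ?mulr_ge0 ?(ltW e0)//.
  apply: le_trans (tr_CS (vnB hA (Au n) (Au m)) Hm) _.
  by rewrite ler_wpM2r// hN.
rewrite q2E// cabs_real ger0_norm// => h.
have := sqr_sqrtr (mulr_ge0 (ltW e0) Q0); have := sqrtr_ge0 (e * q2 (y - u m)).
move: h Q0; set Q := q2 _; set S := Num.sqrt _ => h1 h2 h3 h4.
have [->|Qn0] := eqVneq Q 0; first exact: ltW.
have Qp : 0 < Q by rewrite lt0r Qn0.
by rewrite -(ler_pM2r Qp); nra.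
Qed.

End Trace.

(** * Comparison of projections *)

Section PartialIsometries.
Context {R : realType} {H : hilbertType R}.
Local Notation bop := (bop H).
Implicit Types (a b c e f p q v w s T : bop) (A : set bop).

Lemma adjM_eq0 a : adj a * a = 0 -> a = 0.
Proof.
move=> h; apply: bopext => x; apply/nm_eq0/eqP.
by rewrite -sqrf_eq0 nm_sq -adjPr -opM h op0 hdot0l.
Qed.

Definition piso v := v * adj v * v = v.

Lemma piso_adj v : piso v -> piso (adj v).
Proof. by move=> h; apply: adj_inj; rewrite !adjM !adjK mulrA; exact: h. Qed.
Lemma piso_init v : piso v -> proj (adj v * v).
Proof.
by move=> h; split; [rewrite -mulrA [v * _]mulrA h | rewrite adjM adjK].
Qed.
Lemma piso_final v : piso v -> proj (v * adj v).
Proof. by move=> /piso_adj/piso_init; rewrite adjK. Qed.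
Lemma proj_piso v : proj (adj v * v) -> piso v.
Proof.
move=> hq; set q := adj v * v in hq.
have vq : v * (1 - q) = 0.
  apply: adjM_eq0; rewrite adjM (proj_adj (projC hq)).
  rewrite mulrA -[(1 - q) * adj v * v]mulrA -/q.
  by rewrite -mulrA mulrBr mulr1 (proj_idem hq) subrr mulr0.
apply/eqP; rewrite /piso -mulrA -/q eq_sym -subr_eq0.
by rewrite -[X in X - _]mulr1 -mulrBr vq.
Qed.
Lemma piso_bnd v : piso v -> bnd v 1.
Proof.
by move=> h; apply: bnd_sq => //; rewrite expr1n; apply/proj_bnd/piso_init.
Qed.
Lemma piso0 : piso 0. Proof. by rewrite /piso mulr0. Qed.

Lemma piso_eq0 v : piso v -> adj v * v = 0 -> v = 0.
Proof. by move=> h h0; rewrite -h -mulrA h0 mulr0. Qed.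

Lemma pisoD s w : piso s -> piso w -> adj s * w = 0 -> w * adj s = 0 ->
  [/\ piso (s + w), adj (s + w) * (s + w) = adj s * s + adj w * w
    & (s + w) * adj (s + w) = s * adj s + w * adj w].
Proof.
move=> hs hw h1 h2.
have h3 : adj w * s = 0 by apply: adj_inj; rewrite adjM adjK h1 adj0.
have h4 : s * adj w = 0 by apply: adj_inj; rewrite adjM adjK h2 adj0.
have e1 : adj (s + w) * (s + w) = adj s * s + adj w * w.
  by rewrite adjD mulrDl !mulrDr h1 h3 addr0 add0r.
have e2 : (s + w) * adj (s + w) = s * adj s + w * adj w.
  by rewrite adjD mulrDl !mulrDr h2 h4 addr0 add0r.
split => //; rewrite /piso e2 mulrDl !mulrDr hs hw.
by rewrite -!mulrA h1 h3 !mulr0 addr0 add0r.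
Qed.

(** The form in which factoriality enters comparison: in a factor no two nonzero projections are
    disjoint. *)
Definition fprop A := forall p q, el A p -> el A q -> proj p -> proj q ->
  p <> 0 -> q <> 0 -> exists T, el A T /\ q * T * p <> 0.

(** If [q A p = 0], the vectors killed by [q A] form a subspace invariant under [A] and under its
    commutant. The projection onto it is central, dominates [p] and is annihilated by [q]. *)
Lemma fprop_of_center A : vn A ->
  (forall z, proj z -> el A z -> el (comm A) z -> z = 0 \/ z = 1) -> fprop A.
Proof.
move=> hA hz p q Ap Aq hp hq p0 q0; apply: contrapT => h.
have {}h T : el A T -> q * T * p = 0.
  by move=> AT; apply: contrapT => hT; apply: h; exists T.
pose S := [set y | forall T, el A T -> (q * T) y = 0].
have lS : lsub S.
  split; first by move=> T _; exact: op0x.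
  by move=> z x y hx hy T AT; rewrite bop_linear hx// hy// scaler0 addr0.
have [z [zz sz zc zf _]] := projection_onto lS.
have hc := vn_comm (proj1 hA).
have AS c y : el A c -> S y -> S (c y).
  by move=> Ac Sy T AT; rewrite -opM -mulrA; apply: Sy; exact: vnM.
have A'S c y : el (comm A) c -> S y -> S (c y).
  move=> Ac Sy T AT; rewrite -opM -mulrA.
  have -> : q * (T * c) = c * (q * T) by rewrite mulrA Ac//; exact: vnM.
  by rewrite opM Sy// op0x.
have Az : el A z.
  apply/(vnP hA) => c Ac; symmetry.
  apply: (projection_comm sz zc zf) => y Sy; apply: A'S => //.
  exact: (vn_adj hc Ac).
have A'z : el (comm A) z.
  move=> c Ac; symmetry; apply: (projection_comm sz zc zf) => y Sy; apply: AS => //.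
  exact: (vn_adj hA Ac).
have zp : z * p = p.
  apply: bopext => x; rewrite opM zf//; apply: sub_clo => T AT.
  by rewrite -opM h// op0.
have [z0|z1] := hz z (conj zz sz) Az A'z; first by apply: p0; rewrite -zp z0 mul0r.
apply: q0; apply: bopext => x; rewrite op0.
have := zc x; rewrite z1 op1 => hx.
have -> : q x = (q * 1) x by rewrite mulr1.
by apply: (clo_ker _ hx) => s Ss; apply: Ss; exact: vn1.
Qed.

(** The polar part of a nonzero [q T p]. *)
Lemma piso_between A p q : vn A -> fprop A -> el A p -> el A q -> proj p ->
  proj q -> p <> 0 -> q <> 0 ->
  exists v, [/\ el A v, piso v, v <> 0, v * p = v & q * v = v].
Proof.
move=> hA hf Ap Aq hp hq p0 q0.
have [T [AT h]] := hf p q Ap Aq hp hq p0 q0.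
have Aa : el A (q * T * p) by apply: vnM => //; exact: vnM.
have [v [r [Av Ar hr vr [ar hker hl hva]]]] := polar hA Aa.
have hv : piso v by apply: proj_piso; rewrite vr.
exists v; split => //.
- by move=> v0; apply: h; rewrite -hva v0 !mul0r.
- have rp : r * (1 - p) = 0.
    apply: bopext => x; rewrite opM; apply: hker.
    by rewrite -opM -mulrA mulrBr mulr1 (proj_idem hp) subrr mulr0.
  apply/eqP; rewrite eq_sym -subr_eq0; apply/eqP.
  have -> : v - v * p = v * (r * (1 - p)).
    by rewrite mulrA -vr mulrA hv mulrBr mulr1.
  by rewrite rp mulr0.
by apply: hl; rewrite !mulrA (proj_idem hq).
Qed.

End PartialIsometries.

(** * Comparison of two projections by exhaustion *)

Section Comparison.
Context {R : realType} {H : hilbertType R}.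
Local Notation bop := (bop H).
Implicit Types (a b p q v w s T : bop).
Variables (A : set bop) (e f : bop) (om : bop -> R) (C : R).
Hypotheses (hA : vn A) (hf : fprop A) (Ae : el A e) (Af : el A f).
Hypotheses (pe : proj e) (pf : proj f).
Hypothesis omD : forall a b, om (a + b) = om a + om b.
Hypothesis om_ge0 : forall p, el A p -> proj p -> 0 <= om p <= C.
Hypothesis om_gt0 : forall p, el A p -> proj p -> p * e = p -> p <> 0 -> 0 < om p.

Let state s := [/\ el A s, piso s, s * e = s & f * s = s].
Let adm s w := [/\ el A w, piso w, w * (e - adj s * s) = w & (f - s * adj s) * w = w].

Let om0 : om 0 = 0.
Proof. by have := omD 0 0; rewrite addr0; lra. Qed.

(** A greedy choice: among the partial isometries between the remaining parts of [e] and [f], one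
    whose initial projection attains at least half of the supremum of [om]. Countably many steps
    then suffice. *)
Let step_ex s : exists w, state s -> adm s w /\
  forall w', adm s w' -> om (adj w' * w') <= 2 * om (adj w * w).
Proof.
have [hs|ns] := pselect (state s); last by exists 0.
have adm0 : adm s 0 by split; rewrite ?mul0r ?mulr0//; [exact: vn0|exact: piso0].
have omi w : adm s w -> 0 <= om (adj w * w) <= C.
  case=> Aw pw _ _; apply: om_ge0; last exact: piso_init.
  by apply: vnM => //; exact: vn_adj.
pose S := [set om (adj w * w) | w in adm s].
have hS : has_sup S.
  split; first by exists (om (adj 0 * 0)), 0.
  by exists C => _ [w /omi /andP[_ h] <-].
have sS w : adm s w -> om (adj w * w) <= sup S.
  by move=> hw; apply: sup_upper_bound => //; exists w.
have [s0|s0] := leP (sup S) 0.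
  exists 0 => _; split => // w' /sS h.
  by rewrite mulr0 om0 mulr0 (le_trans h).
have [_ [w hw <-] h] := sup_adherent (divr_gt0 s0 (ltr0Sn R 1)) hS.
by exists w => _; split => // w' /sS; lra.
Qed.

Let step s : bop := projT1 (cid (step_ex s)).
Let stepP s : state s -> adm s (step s) /\
  forall w', adm s w' -> om (adj w' * w') <= 2 * om (adj (step s) * step s).
Proof. by rewrite /step; case: cid. Qed.

Fixpoint cmp_seq (n : nat) : bop := if n is m.+1 then cmp_seq m + step (cmp_seq m) else 0.
Let sq := cmp_seq.

Let adm_orth s w : state s -> adm s w -> adj s * w = 0 /\ w * adj s = 0.
Proof.
move=> [As ps se fs] [Aw pw we fw].
have ps' := piso_adj ps; rewrite /piso adjK in ps'.
have h1 : s * adj s * w = 0.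
  have sf : s * adj s * f = s * adj s.
    by rewrite -mulrA; congr (_ * _); apply: adj_inj; rewrite adjM adjK (proj_adj pf).
  rewrite -fw mulrA mulrBr sf mulrA ps subrr mul0r//.
have h2 : w * (adj s * s) = 0.
  have es : e * (adj s * s) = adj s * s.
    by rewrite mulrA; congr (_ * _); apply: adj_inj; rewrite adjM adjK (proj_adj pe).
  by rewrite -we -mulrA mulrBl es mulrA ps' subrr mulr0.
split; first by rewrite -ps' -!mulrA [s * _]mulrA h1 mulr0.
by rewrite -ps' mulrA h2 mul0r.
Qed.

Let stateS s w : state s -> adm s w -> [/\ state (s + w),
    adj (s + w) * (s + w) = adj s * s + adj w * w
  & (s + w) * adj (s + w) = s * adj s + w * adj w].
Proof.
move=> hs hw; have [h1 h2] := adm_orth hs hw.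
case: (hs) (hw) => As ps se fs [Aw pw we fw].
have [h3 h4 h5] := pisoD ps pw h1 h2; split => //; split => //.
- exact: vnD.
- rewrite mulrDl se; congr (_ + _); rewrite -we -mulrA mulrBl (proj_idem pe).
  by rewrite -(mulrA (adj s)) se.
rewrite mulrDr fs; congr (_ + _); rewrite -fw mulrA mulrBr (proj_idem pf).
by rewrite mulrA fs.
Qed.

Let sq_state n : state (sq n).
Proof.
elim: n => [|n IH].
  by split; rewrite /sq /= ?mul0r ?mulr0//; [exact: vn0|exact: piso0].
by have [] := stateS IH (proj1 (stepP IH)).
Qed.

Let E n := adj (sq n) * sq n.

Let ES n : E n.+1 = E n + adj (step (sq n)) * step (sq n).
Proof. by have [] := stateS (sq_state n) (proj1 (stepP (sq_state n))). Qed.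

(** Later partial isometries extend earlier ones, which makes the products with the weak limit in
    [comparison] eventually constant. *)
Let sqE k m : (k <= m)%N -> sq m * E k = sq k /\ E m * E k = E k.
Proof.
move=> /subnKC <-; elim: (m - k)%N => [|j [IH1 IH2]].
  rewrite addn0; have [_ ps _ _] := sq_state k.
  by split; [rewrite /E mulrA | exact: proj_idem (piso_init ps)].
rewrite addnS ES; set m' := (k + j)%N in IH1 IH2 *.
have [h1 h2] := adm_orth (sq_state m') (proj1 (stepP (sq_state m'))).
have h3 : step (sq m') * E k = 0.
  by rewrite -IH2 mulrA /E [step _ * _]mulrA h2 !mul0r.
by rewrite /sq /= -/sq !mulrDl IH1 IH2 -mulrA h3 mulr0 !addr0.
Qed.

(** The weak limit [s] of the chosen sums is again a partial isometry. If it exhausted neither [e]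
    nor [f], a nonzero [w] between the remainders would have been admissible at every stage, against
    the greedy choice and the bound [C]. *)
Lemma comparison : exists v, [/\ el A v, v * e = v, f * v = v
  & adj v * v = e \/ v * adj v = f].
Proof.
have ub : ubnd sq 1 by move=> n; have [_ ps _ _] := sq_state n; exact: piso_bnd.
have [s ws bs] := wlim_ex ler01 ub.
have As : el A s by apply: (wlim_vn hA _ ws) => n; case: (sq_state n).
have se : s * e = s.
  apply: (wlim_unique _ ws).
  have -> : sq = fun n => sq n * e by apply/funext => n; case: (sq_state n).
  exact: wlimMr.
have fs : f * s = s.
  apply: (wlim_unique _ ws).
  have -> : sq = fun n => f * sq n by apply/funext => n; case: (sq_state n).
  exact: wlimMl.
have uE : ubnd E 1.
  by move=> n; have [_ ps _ _] := sq_state n; apply/proj_bnd/piso_init.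
have sE k : s * E k = sq k.
  apply: (wlim_eventually (wlimMr (E k) ws) (N := k)) => [n kn|].
    by case: (sqE kn).
  by exists (1 * 1) => n; apply: bndM.
have s's k : adj s * sq k = E k.
  apply: (wlim_eventually (wlimMr (sq k) (wlim_adj ub ws)) (N := k)) => [n kn|].
    by have [h1 h2] := sqE kn; rewrite -h1 mulrA.
  by exists (1 * 1) => n; apply: bndM => //; exact: bnd_adj.
have wE : wlim E (adj s * s).
  have -> : E = fun k => adj s * sq k by apply/funext => k; rewrite s's.
  exact: wlimMl.
have ps : piso s.
  rewrite /piso -mulrA; apply: (wlim_unique _ ws).
  have -> : sq = fun k => s * E k by apply/funext => k; rewrite sE.
  exact: wlimMl.
have pi := piso_init ps; have pfi := piso_final ps.
have e1 : e * (adj s * s) = adj s * s.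
  by rewrite mulrA; congr (_ * _); apply: adj_inj; rewrite adjM adjK (proj_adj pe).
have f1 : f * (s * adj s) = s * adj s by rewrite mulrA fs.
have e2 : adj s * s * e = adj s * s by rewrite -mulrA se.
have f2 : s * adj s * f = s * adj s.
  by rewrite -mulrA; congr (_ * _); apply: adj_inj; rewrite adjM adjK (proj_adj pf).
have As' := vn_adj hA As.
have [p0|p0] := pselect (e - adj s * s = 0).
  by exists s; split => //; left; apply/eqP; rewrite eq_sym -subr_eq0 p0.
have [q0|q0] := pselect (f - s * adj s = 0).
  by exists s; split => //; right; apply/eqP; rewrite eq_sym -subr_eq0 q0.
exfalso.
have hp : proj (e - adj s * s) by exact: projB.
have hq : proj (f - s * adj s) by exact: projB.
have [w [Aw pw w0 wp qw]] := piso_between hA hf (vnB hA Ae (vnM hA As' As))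
  (vnB hA Af (vnM hA As As')) hp hq p0 q0.
have admw k : adm (sq k) w.
  split => //.
    rewrite -{1}wp -mulrA; have -> : (e - adj s * s) * (e - adj (sq k) * sq k) =
      e - adj s * s; last exact: wp.
    rewrite mulrBr !mulrBl (proj_idem pe) e2 -/(E k) -mulrA sE s's.
    have -> : e * E k = E k; last by rewrite subrr subr0.
    rewrite /E mulrA; congr (_ * _); apply: adj_inj.
    by rewrite adjM adjK (proj_adj pe); case: (sq_state k).
  rewrite -{1}qw mulrA; have -> : (f - sq k * adj (sq k)) * (f - s * adj s) =
      f - s * adj s; last exact: qw.
  have g1 : sq k * adj (sq k) * f = sq k * adj (sq k).
    rewrite -mulrA; congr (_ * _); apply: adj_inj.
    by rewrite adjM adjK (proj_adj pf); case: (sq_state k).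
  have g2 : sq k * adj (sq k) * (s * adj s) = sq k * adj (sq k).
    have g3 : adj (sq k) * s = E k.
      by apply: adj_inj; rewrite adjM adjK s's /E adjM adjK.
    have g4 : sq k * E k = sq k by case: (sqE (leqnn k)).
    have g5 : E k * adj s = adj (sq k).
      by apply: adj_inj; rewrite adjM !adjK /E adjM adjK -/(E k) sE.
    by rewrite -mulrA [adj (sq k) * _]mulrA g3 g5.
  by rewrite mulrBl !mulrBr (proj_idem pf) f1 g1 g2 subrr subr0.
have Aw2 : el A (adj w * w) by apply: vnM => //; exact: vn_adj.
have we : adj w * w * e = adj w * w.
  by rewrite -mulrA -wp -mulrA mulrBl (proj_idem pe) e2.
have w2 : adj w * w <> 0 by move=> h; apply: w0; exact: piso_eq0 h.
have om1 := om_gt0 Aw2 (piso_init pw) we w2.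
(* [w] competes at every stage, so every stage adds at least half of [om (adj w * w)]. *)
have grow n : n%:R * (om (adj w * w) / 2) <= om (E n).
  elim: n => [|n IH].
    by rewrite mul0r /E /sq /= adj0 mulr0 om0.
  have := proj2 (stepP (sq_state n)) w (admw n).
  rewrite ES omD -[n.+1%:R]natr1; move: IH; set x := om (adj w * w).
  set y := om (E n); set z := om (adj (step (sq n)) * step (sq n)); lra.
have x0 : 0 < om (adj w * w) / 2 by rewrite divr_gt0.
have := grow (Num.truncn (C / (om (adj w * w) / 2))).+1.
have [AE pE _ _] := sq_state (Num.truncn (C / (om (adj w * w) / 2))).+1.
have : om (E (Num.truncn (C / (om (adj w * w) / 2))).+1) <= C.
  have /andP[] := om_ge0 (vnM hA (vn_adj hA AE) AE) (piso_init pE) => //.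
move=> h1 h2; have := le_trans h2 h1; rewrite -ler_pdivlMr//.
by rewrite leNgt truncnS_gt.
Qed.

End Comparison.

Section TraceComparison.
Context {R : realType} {H : hilbertType R}.
Local Notation bop := (bop H).
Variables (A : set bop) (t : bop -> R[i]).
Hypotheses (hA : vn A) (ht : tracial A t) (hf : fprop A).
Implicit Types (p q v : bop).

Lemma proj_tr_le1 p : el A p -> proj p -> 0 <= complex.Re (t p) <= 1.
Proof.
move=> Ap hp; rewrite Re_ge0/=; last exact: (tr_pos hA ht Ap (proj_pos hp)).
have -> : 1 = complex.Re (t 1) by rewrite (tr1 ht).
by apply: (tr_le hA ht Ap (vn1 hA)); apply/proj_pos/projC.
Qed.

Lemma proj_tr_gt0 p : el A p -> proj p -> p <> 0 -> 0 < complex.Re (t p).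
Proof.
move=> Ap hp p0; have /andP[h _] := proj_tr_le1 Ap hp.
rewrite lt0r h andbT; apply/eqP => h0; apply: p0.
apply: (tr_pos_eq0 hA ht Ap (proj_pos hp)).
by rewrite (ge0_ReC (tr_pos hA ht Ap (proj_pos hp))) h0.
Qed.

Lemma tr_compare p q : el A p -> el A q -> proj p -> proj q ->
  exists v, [/\ el A v, v * p = v, q * v = v & adj v * v = p \/ v * adj v = q].
Proof.
move=> Ap Aq hp hq.
apply: (@comparison R H A p q (fun a => complex.Re (t a)) 1) => //.
- by move=> a b; rewrite (trD ht) ReD.
- by move=> r Ar hr; exact: proj_tr_le1.
by move=> r Ar hr _; exact: proj_tr_gt0.
Qed.

(** If instead [q] is equivalent to a part of [p], the remainder of [p] has trace at most zero and
    vanishes by faithfulness. *)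
Lemma tr_subequiv p q : el A p -> el A q -> proj p -> proj q ->
  complex.Re (t p) <= complex.Re (t q) ->
  exists v, [/\ el A v, adj v * v = p & q * v = v].
Proof.
move=> Ap Aq hp hq hle; have [v [Av vp qv [h|h]]] := tr_compare Ap Aq hp hq.
  by exists v.
exists v; split => //; have Av' := vn_adj hA Av.
have pv : piso v.
  by rewrite -[v]adjK; apply/piso_adj/proj_piso; rewrite adjK h.
have pvv : p * (adj v * v) = adj v * v.
  by rewrite mulrA; congr (_ * _); apply: adj_inj; rewrite adjM adjK (proj_adj hp).
have hd := projB hp (piso_init pv) pvv.
have Ad : el A (p - adj v * v) by apply: vnB => //; exact: vnM.
apply/eqP; rewrite eq_sym -subr_eq0; apply/eqP.
apply: contrapT => /(proj_tr_gt0 Ad hd).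
by rewrite (trB ht) ReB (trC ht Av' Av) h; lra.
Qed.

End TraceComparison.

(** * Averaging over unitaries *)

Section Unitaries.
Context {R : realType} {H : hilbertType R}.
Local Notation bop := (bop H).
Implicit Types (a b c p q u v w x y z : bop) (A B : set bop).

Definition unitary A u := [/\ el A u, adj u * u = 1 & u * adj u = 1].

Lemma unitary1 A : vn A -> unitary A 1.
Proof. by move=> hA; split; rewrite ?adj1 ?mulr1//; exact: vn1. Qed.

Lemma unitaryM A u v : vn A -> unitary A u -> unitary A v -> unitary A (u * v).
Proof.
move=> hA [Au u1 u2] [Av v1 v2]; split; first exact: vnM.
  by rewrite adjM mulrA -[adj v * adj u * u]mulrA u1 mulr1.
by rewrite adjM mulrA -[u * v * adj v]mulrA v2 mulr1.
Qed.

Lemma unitary_bnd A u : unitary A u -> bnd u 1.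
Proof. by case=> _ h _; apply: bnd_sq => //; rewrite h expr1n; exact: bnd1. Qed.

Lemma conj_bnd A u a (k : R) : unitary A u -> 0 <= k -> bnd a k -> bnd (adj u * a * u) k.
Proof.
move=> hu k0 hk; have u1 := unitary_bnd hu.
rewrite -[k]mulr1 -[k * 1]mul1r mulrA; apply: bndM => //; first by rewrite mul1r.
by apply: bndM => //; exact: bnd_adj.
Qed.

(* A self-adjoint contraction [a] is the real part of the unitary
   [a + i sqrt(1 - a^2)]. *)
Lemma commute_unitaries A c : vn A -> (forall u, unitary A u -> u * c = c * u) ->
  forall a, el A a -> a * c = c * a.
Proof.
move=> hA hc.
have h1 a : el A a -> adj a = a -> bnd a 1 -> a * c = c * a.
  move=> Aa sa ba.
  have p1 : pos (1 - a * a).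
    have := @sa_bnd_pos _ _ (a * a) 1 _ _; rewrite scale1r; apply.
      by rewrite adjM sa.
    by rewrite -[1]mulr1; exact: bndM.
  have [w [pw w2 hw]] := sqrt_ex p1.
  have wa : w * a = a * w.
    by apply: hw; rewrite mulrBl mulrBr mul1r mulr1 mulrA.
  have Aw : el A w.
    apply: (vn_bicomm hA _ hw); apply: vnB => //; first exact: vn1.
    exact: vnM.
  have ii : 'i * 'i = -1 :> R[i] by rewrite -expr2 sqr_i.
  have ci : conjc 'i = - 'i :> R[i] by rewrite /conjc; simpc.
  have key : (a + 'i *: w) * (a + (- 'i) *: w) = 1 /\
             (a + (- 'i) *: w) * (a + 'i *: w) = 1.
    have e1 : a * a + w * w = 1 by rewrite w2 addrC subrK.
    split; rewrite mulrDl !mulrDr !scaleMl !scaleMr wa scalerA.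
      by rewrite mulrN ii opprK scale1r -[RHS]e1; lmod.
    by rewrite mulNr ii opprK scale1r -[RHS]e1; lmod.
  have ua : adj (a + 'i *: w) = a + (- 'i) *: w.
    by rewrite adjD sa adjZ ci (pos_adj pw).
  have u1 : unitary A (a + 'i *: w).
    by split; rewrite ?ua; [apply: vnD => //; exact: vnZ | case: key..].
  have u2 : unitary A (a + (- 'i) *: w).
    by rewrite -ua; split; rewrite ?adjK ?ua;
      [apply: vnD => //; exact: vnZ | case: key..].
  have := hc _ u1; have := hc _ u2.
  rewrite !mulrDl !mulrDr !scaleMl !scaleMr => e1 e2.
  have e3 : (a * c + a * c) = (c * a + c * a).
    have -> : a * c + a * c = (a * c + 'i *: (w * c)) + (a * c + (- 'i) *: (w * c)).
      by lmod.
    by rewrite e1 e2; lmod.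
  by rewrite -[a * c]half_half -[c * a]half_half -!scalerDr e3.
have h2 a : el A a -> adj a = a -> a * c = c * a.
  move=> Aa sa; have [k k0 hk] := bop_bnd a.
  have l1 : 0 < k + 1 by rewrite ltr_wpDl.
  have l0 : k + 1 != 0 by rewrite gt_eqF.
  have := h1 ((k + 1)^-1%:C *: a) (vnZ _ hA Aa).
  rewrite adjZr sa => /(_ erefl) h.
  have : ((k + 1)^-1)%:C *: a * c = c * ((k + 1)^-1%:C *: a).
    apply: h; apply: bnd_le (bndZ _ hk).
    rewrite cabs_real ger0_norm; last by rewrite invr_ge0; lra.
    by rewrite mulrC ler_pdivrMr; lra.
  rewrite scaleMl scaleMr => /(congr1 (fun x => (k + 1)%:C *: x)).
  by rewrite !scalerA -rmorphM divff// !scale1r.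
move=> a Aa; have Aa' := vn_adj hA Aa.
have e1 := h2 (a + adj a) (vnD hA Aa Aa') ltac:(by rewrite adjD adjK addrC).
have ci : conjc 'i = - 'i :> R[i] by rewrite /conjc; simpc.
have := h2 ('i *: (a - adj a)) (vnZ _ hA (vnB hA Aa Aa'))
  ltac:(by rewrite adjZ adjB adjK ci scaleNr -scalerN opprB).
rewrite scaleMl scaleMr => /(congr1 (fun x => - 'i *: x)).
rewrite !scalerA mulNr -expr2 sqr_i opprK !scale1r => e2.
have : a * c + a * c = c * a + c * a.
  have -> : a * c + a * c = (a + adj a) * c + (a - adj a) * c by bring.
  by rewrite e1 e2; bring.
by move=> e3; rewrite -[a * c]half_half -[c * a]half_half -!scalerDr e3.
Qed.

(* The convex hull of the unitary orbit, presented by its induction principle. *)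
Definition hull B a : set bop := [set b | forall X : set bop,
  (forall u, unitary B u -> X (adj u * a * u)) ->
  (forall (r : R) x y, 0 <= r <= 1 -> X x -> X y ->
     X (r%:C *: x + (1 - r)%:C *: y)) -> X b].

Lemma hull_orbit B a u : unitary B u -> hull B a (adj u * a * u).
Proof. by move=> hu X h _; exact: h. Qed.

Lemma hull_self B a : vn B -> hull B a a.
Proof.
by move=> hB; have := @hull_orbit B a 1 (unitary1 hB); rewrite adj1 mul1r mulr1.
Qed.

Lemma hull_convex B a (r : R) x y : 0 <= r <= 1 -> hull B a x -> hull B a y ->
  hull B a (r%:C *: x + (1 - r)%:C *: y).
Proof. by move=> hr hx hy X h1 h2; apply: (h2) => //; [exact: (hx X h1 h2)|exact: (hy X h1 h2)]. Qed.

Lemma hull_conj B a u b : vn B -> unitary B u -> hull B a b ->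
  hull B a (adj u * b * u).
Proof.
move=> hB hu hb; apply: (hb (fun b => hull B a (adj u * b * u))) => [v hv|r x y hr hx hy].
  have -> : adj u * (adj v * a * v) * u = adj (v * u) * a * (v * u).
    by rewrite adjM !mulrA.
  by apply: hull_orbit; exact: unitaryM.
have -> : adj u * (r%:C *: x + (1 - r)%:C *: y) * u =
   r%:C *: (adj u * x * u) + (1 - r)%:C *: (adj u * y * u) by bring.
exact: hull_convex.
Qed.

Lemma hull_trans B a b c : vn B -> hull B a b -> hull B b c -> hull B a c.
Proof.
move=> hB hab hbc; apply: hbc => [u hu|r x y hr hx hy].
  exact: hull_conj.
exact: hull_convex.
Qed.

Definition avg (us : seq bop) a : bop :=
  (size us)%:R^-1%:C *: \sum_(u <- us) adj u * a * u.

Lemma hull_avg B us a : vn B -> us != [::] -> (forall u, u \in us -> unitary B u) ->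
  hull B a (avg us a).
Proof.
move=> hB; case: us => // u us _ hus; elim/last_ind: us hus => [|us v IH] hus.
  rewrite /avg big_seq1 /= invr1 scale1r; apply: hull_orbit; apply: hus.
  by rewrite inE.
have hv : unitary B v by apply: hus; rewrite inE mem_rcons inE eqxx orbT.
have {}IH : hull B a (avg (u :: us) a).
  by apply: IH => w; rewrite inE => /orP[/eqP ->|h]; apply: hus;
    rewrite ?mem_head// inE mem_rcons inE h !orbT.
set n := size (u :: us) in IH.
have n0 : 0 < n%:R :> R by rewrite ltr0n.
pose r : R := n%:R / n.+1%:R.
have n10 : n.+1%:R != 0 :> R by rewrite pnatr_eq0.
have -> : avg (u :: rcons us v) a =
    r%:C *: avg (u :: us) a + (1 - r)%:C *: (adj v * a * v).
  have r1 : 1 - r = n.+1%:R^-1 :> R.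
    by rewrite /r -natr1; field; rewrite natr1.
  rewrite r1 /avg -rcons_cons size_rcons -cats1 big_cat big_seq1 scalerDr -/n.
  rewrite scalerA; congr (_ *: _ + _ *: _).
  by rewrite -rmorphM /= /r mulrAC divff ?gt_eqF// mul1r.
apply: hull_convex => //; last exact: hull_orbit.
by rewrite /r divr_ge0//= ler_pdivrMr ?ltr0n// mul1r ler_nat.
Qed.

Lemma hull_ind_in B A a : vn A -> (forall u, el B u -> el A u) -> el A a ->
  forall b, hull B a b -> el A b.
Proof.
move=> hA BA Aa b hb; apply: (hb (el A)) => [u [Bu _ _]|r x y _ hx hy].
  by have Au := BA u Bu; exact: vnM hA (vnM hA (vn_adj hA Au) Aa) Au.
by apply: vnD => //; exact: vnZ.
Qed.

Lemma hull_bnd B a (k : R) : 0 <= k -> bnd a k -> forall b, hull B a b -> bnd b k.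
Proof.
move=> k0 ha b hb; apply: (hb (fun b => bnd b k)) => [u hu|r x y /andP[r0 r1] hx hy].
  exact: conj_bnd hu k0 ha.
have -> : k = r * k + (1 - r) * k by ring.
by apply: bndD; apply: bnd_le (bndZ _ _); eauto; rewrite cabs_real ger0_norm//; lra.
Qed.

Lemma hull_tracial B A a (s : bop -> R[i]) : vn A -> (forall u, el B u -> el A u) ->
  el A a ->
  (forall (z : R[i]) a b, el A a -> el A b -> s (z *: a + b) = z * s a + s b) ->
  (forall a b, el A a -> el A b -> s (a * b) = s (b * a)) ->
  forall b, hull B a b -> s b = s a.
Proof.
move=> hA BA Aa sl sc b hb.
have A0 := vn0 hA.
have s0 : s 0 = 0 by have := sl (-1) 0 0 A0 A0; rewrite scaler0 addr0 mulN1r addNr.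
have sZ (z : R[i]) c : el A c -> s (z *: c) = z * s c.
  by move=> Ac; have := sl z c 0 Ac A0; rewrite !addr0 s0 addr0.
have : el A b /\ s b = s a; last by case.
apply: (hb (fun b => el A b /\ s b = s a)) => [u [/BA Au u1 u2]|r x y _ [Ax hx] [Ay hy]].
  have Au' := vn_adj hA Au.
  split; first by apply: vnM => //; exact: vnM.
  rewrite sc//; last exact: vnM.
  by rewrite !mulrA u2 mul1r.
split; first by apply: vnD; rewrite ?vnZ//; exact: vnZ.
rewrite sl//; last exact: vnZ.
by rewrite sZ// hx hy -mulrDl -rmorphD /= subrKC mul1r.
Qed.

End Unitaries.

(** * Averages of small norm and of small 2-norm *)

Section Averaging.
Context {R : realType} {H : hilbertType R}.
Local Notation bop := (bop H).
Implicit Types (a b c p q r u v w x y z : bop) (A B : set bop).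

Section Small.
Variables (A : set bop) (t : bop -> R[i]).
Hypotheses (hA : vn A) (ht : tracial A t) (hf : fprop A).

(** The self-adjoint unitary [v + adj v + (1 - p - v * adj v)] exchanges the orthogonal projections
    [p] and [v * adj v] and fixes their complement. *)
Lemma swap_unitary p v : el A v -> proj p -> adj v * v = p -> p * v = 0 ->
  exists2 u, unitary A u & adj u * p * u = v * adj v.
Proof.
move=> Av hp vp pv; have Av' := vn_adj hA Av.
have psv : piso v by apply: proj_piso; rewrite vp.
have v1 : v * p = v by rewrite -vp mulrA.
have v2 : adj v * p = 0 by apply: adj_inj; rewrite adjM adjK (proj_adj hp) pv adj0.
have v3 : p * adj v = adj v by apply: adj_inj; rewrite adjM adjK (proj_adj hp).
have v4 : v * v = 0 by rewrite -{1}v1 -mulrA pv mulr0.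
have v5 : adj v * adj v = 0 by apply: adj_inj; rewrite adjM adjK v4 adj0.
have v6 : v * adj v * v = v by [].
have v7 : adj v * (v * adj v) = adj v by rewrite mulrA vp v3.
have [g gE] : exists g, g = 1 - p - v * adj v by eexists.
have [u uE] : exists u, u = v + adj v + g by eexists.
have Ag : el A g.
  rewrite gE.
  by apply: vnB; [|apply: vnB|apply: vnM] => //; [exact: vn1|rewrite -vp; exact: vnM].
have sg : adj g = g by rewrite gE !adjB adj1 (proj_adj hp) adjM adjK.
have su : adj u = u by rewrite uE !adjD adjK sg [adj v + v]addrC.
have vg : v * g = 0 by rewrite gE !mulrBr mulr1 v1 mulrA v4 mul0r !subrr.
have gv : g * v = 0 by rewrite gE !mulrBl mul1r pv v6 subr0 subrr.
have v'g : adj v * g = 0 by apply: adj_inj; rewrite adjM sg adjK gv adj0.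
have gv' : g * adj v = 0 by apply: adj_inj; rewrite adjM sg adjK vg adj0.
have gp : g * p = 0.
  by rewrite gE !mulrBl mul1r (proj_idem hp) -mulrA v2 mulr0 subr0 subrr.
have gg : g * g = g.
  by rewrite {2}gE !mulrBr mulr1 gp subr0 mulrA gv mul0r subr0.
have uu : u * u = 1.
  rewrite {1}uE !mulrDl uE !mulrDr v4 v5 vg gv v'g gv' gg vp gE.
  by lmod.
have up : u * p = v by rewrite uE !mulrDl v1 v2 gp !addr0.
exists u; first by split; rewrite ?su//; rewrite uE; apply: vnD => //; exact: vnD.
by rewrite su up uE !mulrDr v4 vg add0r addr0.
Qed.

(** As long as the trace leaves room, [p] is equivalent to a part of [1 - r], and [swap_unitary]
    conjugates it there; the conjugates of [p] stay mutually orthogonal. *)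
Lemma orth_conj p n : el A p -> proj p -> n.+1%:R * complex.Re (t p) <= 1 ->
  exists us : seq bop, [/\ size us = n.+1, forall u, u \in us -> unitary A u
    & let r := \sum_(u <- us) adj u * p * u in
      [/\ el A r, proj r, r * p = p & complex.Re (t r) = n.+1%:R * complex.Re (t p)]].
Proof.
move=> Ap hp; elim: n => [_|n IH hn].
  exists [:: 1]; split => // [u|].
    by rewrite inE => /eqP ->; exact: unitary1.
  rewrite big_seq1 adj1 mul1r mulr1.
  by split; rewrite ?mul1r//; exact: proj_idem.
have /andP[p0 _] := proj_tr_le1 hA ht Ap hp.
have [|us [sz hus [Ar hr rp tr]]] := IH.
  by apply: le_trans hn; rewrite ler_wpM2r// ler_nat.
set r := \sum_(u <- us) _ in Ar hr rp tr.
have Ar' : el A (1 - r) by apply: vnB => //; exact: vn1.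
have pr : p * r = p by apply: adj_inj; rewrite adjM (proj_adj hp) (proj_adj hr).
have [|v [Av vp vr]] := tr_subequiv hA ht hf Ap Ar' hp (projC hr).
  by rewrite (trB ht) (tr1 ht) ReB tr; move: hn; rewrite -natr1 /=; lra.
have rv : r * v = 0 by rewrite -vr mulrA mulrBr mulr1 (proj_idem hr) subrr mul0r.
have pv : p * v = 0 by rewrite -pr -mulrA rv mulr0.
have [u hu upu] := swap_unitary Av hp vp pv.
exists (u :: us); split; first by rewrite /= sz.
  by move=> w; rewrite inE => /orP[/eqP ->|/hus].
rewrite big_cons -/r upu; have Av' := vn_adj hA Av.
have psv : piso v by apply: proj_piso; rewrite vp.
split.
- by apply: vnD => //; exact: vnM.
- rewrite addrC; apply: projD => //; first exact: piso_final.
  by rewrite mulrA rv mul0r.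
- rewrite mulrDl rp -mulrA; have -> : adj v * p = 0; last by rewrite mulr0 add0r.
  by apply: adj_inj; rewrite adjM adjK (proj_adj hp) pv adj0.
by rewrite (trD ht) ReD tr (trC ht Av Av') vp -[n.+2%:R]natr1; ring.
Qed.

Lemma avgD us x y : avg us (x + y) = avg us x + avg us y.
Proof.
rewrite /avg -scalerDr -big_split; congr (_ *: _); apply: eq_bigr => u _.
by rewrite mulrDr mulrDl.
Qed.
Lemma avgZ us (z : R[i]) x : avg us (z *: x) = z *: avg us x.
Proof.
rewrite /avg scalerA mulrC -scalerA; congr (_ *: _).
by rewrite scaler_sumr; apply: eq_bigr => u _; rewrite scaleMr scaleMl.
Qed.
Lemma avgB us x y : avg us (x - y) = avg us x - avg us y.
Proof. by rewrite -scaleN1r avgD avgZ scaleN1r. Qed.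
Lemma avg1 B us : us != [::] -> (forall u, u \in us -> unitary B u) -> avg us 1 = 1.
Proof.
move=> us0 hus; rewrite /avg (eq_big_seq (fun=> 1)); last first.
  by move=> u /hus[_ h _]; rewrite mulr1.
rewrite big_const_seq count_predT -Monoid.iteropE /=.
have -> : iterop (size us) +%R 1 0 = (size us)%:R%:C *: (1 : bop).
  by rewrite -[iterop _ _ _ _]/(1 *+ size us) -scaler_nat rmorph_nat.
rewrite scalerA -rmorphM /= mulVf ?scale1r// pnatr_eq0.
by rewrite size_eq0.
Qed.
Lemma avg_pos us x : pos x -> pos (avg us x).
Proof.
move=> hx; apply: posZ; first by rewrite invr_ge0.
by apply: pos_sum => u _; exact: pos_conj.
Qed.
Lemma avg_el us x : (forall u, u \in us -> unitary A u) -> el A x -> el A (avg us x).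
Proof.
move=> hus Ax; apply: vnZ => //; rewrite big_seq; apply: vn_sum => // u /hus[Au _ _].
by apply: vnM => //; apply: vnM => //; exact: vn_adj.
Qed.

Lemma tr_posM x y : el A x -> el A y -> pos x -> pos y -> 0 <= t (x * y).
Proof.
move=> Ax Ay px py; have [b [Ab pb <-]] := sqrt_vn hA Ax px.
rewrite -mulrA (trC ht)//; last exact: vnM.
apply: (tr_pos hA ht); first by apply: vnM => //; exact: vnM.
by rewrite -{2}(pos_adj pb); exact: pos_conj'.
Qed.

(** [z <= d + p] for the spectral projection [p] of [z] above [d], and [t p <= t z / d]. So [p] has
    [n + 1] orthogonal conjugates, whose average has norm at most [1 / (n + 1)]. *)
Lemma small_avg z (d : R) n : el A z -> pos z -> bnd z 1 -> 0 < d ->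
  n.+1%:R * complex.Re (t z) <= d ->
  exists us : seq bop, [/\ us != [::], forall u, u \in us -> unitary A u
    & pos ((d + n.+1%:R^-1)%:B - avg us z)].
Proof.
move=> Az pz bz d0 hz.
have Azd : el A (z - d%:B) by apply: vnB => //; apply: vnZ => //; exact: vn1.
have sazd : adj (z - d%:B) = z - d%:B by rewrite adjB adjZr adj1 (pos_adj pz).
have [p [hp Ap pc h1 h2]] := spectral_cut_vn hA Azd sazd.
have pz' : p * z = z * p.
  move: pc; rewrite mulrBr mulrBl scaleMr scaleMl mulr1 mul1r => e.
  by rewrite -[p * z](subrK (d%:C *: p)) e subrK.
have zp : pos (p - z * p).
  have -> : p - z * p = adj p * (1 - z) * p.
    rewrite (proj_adj hp) mulrBr mulr1 mulrBl (proj_idem hp) pz' -mulrA.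
    by rewrite (proj_idem hp).
  by apply: pos_conj; have := sa_bnd_pos (pos_adj pz) bz; rewrite scale1r.
have key : pos (d%:B + p - z).
  have -> : d%:B + p - z =
      (p - z * p) + d%:C *: p + - ((z - d%:B) * (1 - p)) by bring.
  apply: posD => //; apply: posD => //; apply: posZ; first exact: ltW.
  exact: proj_pos.
have tp : d * complex.Re (t p) <= complex.Re (t z).
  have Azp : el A (z * p) by exact: vnM.
  apply: (@le_trans _ _ (complex.Re (t (z * p)))).
    rewrite -ReZ -(trZ ht); apply: (tr_le hA ht) => //; first exact: vnZ.
  apply: (tr_le hA ht) => //.
  have -> : z - z * p = adj (1 - p) * z * (1 - p).
    rewrite (proj_adj (projC hp)).
    have -> : (1 - p) * z = z * (1 - p) by rewrite mulrBl mulrBr mul1r mulr1 pz'.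
    by rewrite -mulrA (proj_idem (projC hp)) mulrBr mulr1.
  exact: pos_conj.
have tp' : n.+1%:R * complex.Re (t p) <= 1.
  rewrite -(ler_pM2l d0) mulr1 mulrCA (le_trans _ hz)//.
  by rewrite ler_wpM2l.
have [us [sz hus [Ar hr _ _]]] := orth_conj Ap hp tp'.
have us0 : us != [::] by rewrite -size_eq0 sz.
exists us; split => //.
have := avg_pos us key; rewrite avgB avgD avgZ (avg1 us0 hus) => h.
apply: posB_trans h _.
have -> : (d + n.+1%:R^-1)%:B - (d%:B + avg us p) =
   n.+1%:R^-1%:C *: (1 - \sum_(u <- us) adj u * p * u).
  by rewrite /avg sz rmorphD scalerDl scalerBr; lmod.
apply: posZ; first by rewrite invr_ge0.
exact/proj_pos/projC.
Qed.

End Small.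

Section Weak.
Variables (N M : set bop) (t : bop -> R[i]).
Hypotheses (hN : vn N) (hM : vn M) (ht : tracial M t).
Hypothesis NM : forall a, el N a -> el M a.
Hypothesis irr : forall y, el M y -> (forall a, el N a -> a * y = y * a) ->
  exists z : R[i], y = z *: (1 : bop).

(* The element of minimal trace norm in the closed convex hull of the orbit is
   fixed by all conjugations, hence scalar. *)
Lemma weak_avg x (e : R) : el M x -> 0 < e ->
  exists2 b, hull N x b & q2 t (b - t x *: (1 : bop)) <= e.
Proof.
move=> Mx e0; have [k k0 hk] := bop_bnd x.
have hin := hull_ind_in hM NM Mx.
have [||a b ha hb|delta [u [hd Su du qu]]] :=
    @minimizing_sequence R bop (hull N x) (q2 t) (fun a b => q2 t (a - b)) x.
- exact: hull_self.
- by move=> a /hin Ma; exact: (q2_ge0 ht Ma).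
- exists (2^-1%:C *: a + (1 - 2^-1)%:C *: b).
    by apply: hull_convex => //; apply/andP; split; lra.
  have -> : 1 - 2^-1 = 2^-1 :> R by lra.
  have -> : 2^-1%:C *: a + 2^-1%:C *: b = 2^-1%:C *: (a + b) by rewrite scalerDr.
  rewrite (q2Zr ht).
  have := q2_parallelogram hM ht (hin _ ha) (hin _ hb); lra.
have Mu n : el M (u n) by exact: hin.
have cu : forall e, 0 < e -> exists N0, forall n m, (N0 <= n)%N -> (N0 <= m)%N ->
     q2 t (u n - u m) <= e.
  move=> d d0; have [N0 hN0] := invn_small (divr_gt0 d0 (ltr0Sn R 3)).
  exists N0 => n m nN mN; apply: le_trans (qu n m) _.
  have := hN0 _ nN; have := hN0 _ mN; set r := n.+1%:R^-1; set s := m.+1%:R^-1; lra.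
have ub : ubnd u k by move=> n; exact: hull_bnd (Su n).
have [y [My by_ wy hy]] := ball_complete hM ht k0 ub Mu cu.
have fixed v : unitary N v -> v * y = y * v.
  move=> hv; have [Nv v1 v2] := hv; have Mv := NM Nv; have Mv' := vn_adj hM Mv.
  have bv := unitary_bnd hv; have bv' := bnd_adj bv.
  have q2c a : el M a -> q2 t (adj v * a * v) <= q2 t a.
    move=> Ma; apply: le_trans (q2_Mr hM ht ler01 (vnM hM Mv' Ma) Mv bv) _.
    rewrite expr1n mul1r; apply: le_trans (q2_Ml hM ht ler01 Ma Mv' bv') _.
    by rewrite expr1n mul1r.
  have Mc a : el M a -> el M (adj v * a * v) by move=> Ma; apply: vnM => //; exact: vnM.
  suff : adj v * y * v = y.
    by move=> /(congr1 (fun a => v * a)); rewrite !mulrA v2 mul1r.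
  apply/eqP; rewrite -subr_eq0; apply/eqP; apply: (q2_eq0 ht).
    by apply: vnB => //; exact: Mc.
  apply/eqP; rewrite eq_le (q2_ge0 ht (vnB hM (Mc _ My) My)) andbT.
  apply: le_eps => d d0; rewrite add0r.
  have [N1 h1] := hy (d / 16) ltac:(lra).
  (* In [e2] the excess of [q2] over the infimum, at most [1 / (n + 1)], is multiplied by 4 and must
     not exceed [d / 16]. *)
  have [N2 h2] := invn_small (divr_gt0 d0 (ltr0Sn R 63)).
  set n := maxn N1 N2; have hn1 := h1 n (leq_maxl _ _).
  have hn2 := h2 n (leq_maxr _ _).
  set w := adj v * u n * v; have Mw : el M w by exact: Mc.
  have hw : hull N x w by apply: hull_conj.
  have e1 : q2 t (adj v * y * v - w) <= d / 16.
    have -> : adj v * y * v - w = adj v * (y - u n) * v by rewrite /w mulrBr mulrBl.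
    apply: le_trans (q2c _ (vnB hM My (Mu n))) _.
    by rewrite q2B.
  (* Both [w] and [u n] almost attain the infimum [delta], and so does their midpoint in the hull:
     parallelogram identity. *)
  have e2 : q2 t (w - u n) <= d / 16.
    have hm : hull N x (2^-1%:C *: w + (1 - 2^-1)%:C *: u n).
      by apply: hull_convex => //; apply/andP; split; lra.
    have := hd _ hm; have -> : 1 - 2^-1 = 2^-1 :> R by lra.
    have -> : 2^-1%:C *: w + 2^-1%:C *: u n = 2^-1%:C *: (w + u n).
      by rewrite scalerDr.
    rewrite (q2Zr ht).
    have := q2_parallelogram hM ht Mw (Mu n); have := q2c _ (Mu n); rewrite -/w.
    have := du n; move: hn2; set r := n.+1%:R^-1; lra.
  have := q2_triangleB hM ht (Mc _ My) Mw My.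
  have := q2_triangleB hM ht Mw (Mu n) My.
  by lra.
have [z yz] := irr My (commute_unitaries hN fixed).
have zE : z = t x.
  have : t y = t x.
    rewrite (tr_wlim ht k0 ub by_ wy) -[RHS]glim_cst; congr glim; apply/funext => n.
    by apply: (hull_tracial hM NM Mx _ (trC ht)) (Su n) => r a b _ _; exact: (tr_lin ht).
  by rewrite yz (trZ ht) (tr1 ht) mulr1.
have [n hn] := hy e e0; exists (u n) => //.
by rewrite -zE -yz; exact: hn.
Qed.

End Weak.
End Averaging.

(** * From the Pimsner-Popa inequality to the relative Dixmier property *)

Section Inclusion.
Context {R : realType} {H : hilbertType R}.
Local Notation bop := (bop H).
Implicit Types (a b c h k p q r u v w x y : bop).
Variables (N M : set bop) (t : bop -> R[i]).
Hypotheses (hN : vn N) (hM : vn M) (ht : tracial M t).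
Hypothesis NM : forall a, el N a -> el M a.

Lemma tracial_sub : tracial N t.
Proof.
split.
- exact: tr_lin ht.
- exact: tr1 ht.
- by move=> a /NM; exact: tr_pos2.
- by move=> a /NM; exact: tr_faith.
- by move=> a b /NM Ma /NM Mb; exact: trC Ma Mb.
- exact: tr_wlim ht.
exact: tr_bnd ht.
Qed.

Let htN := tracial_sub.

Lemma bilinear_opt (X Y C : R) : 0 <= C ->
  (forall s : R, 0 <= s ^+ 2 * X - 2 * s * Y + C) -> Y ^+ 2 <= C * X.
Proof.
move=> C0 h; have [X0|X0] := leP X 0.
  have Y0 : Y = 0.
    apply/eqP; apply: contraT => Yn.
    have := h ((C + 1) / (2 * Y)).
    have -> : 2 * ((C + 1) / (2 * Y)) * Y = C + 1 by field.
    have : 0 <= ((C + 1) / (2 * Y)) ^+ 2 by exact: sqr_ge0.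
    nra.
  have [->|Xn] := eqVneq X 0; first by rewrite Y0 mulr0 expr0n.
  have Xl : X < 0 by rewrite lt_neqAle Xn.
  have := h (Num.sqrt ((C + 1) / - X)); rewrite Y0 sqr_sqrtr; last first.
    by rewrite divr_ge0 ?addr_ge0// oppr_ge0.
  have -> : (C + 1) / - X * X = - (C + 1) by field.
  by rewrite mulr0 subr0; lra.
have := h (Y / X).
have -> : (Y / X) ^+ 2 * X - 2 * (Y / X) * Y + C = C - Y ^+ 2 / X.
  by field; rewrite gt_eqF.
by rewrite subr_ge0 ler_pdivrMr.
Qed.

Definition effects : set bop := [set k | [/\ el N k, pos k & pos (1 - k)]].

Lemma effect_bnd k : effects k -> bnd k 1.
Proof. by case=> _ p1 p2; apply: bnd_pos => //; rewrite scale1r. Qed.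

Lemma effects_convex (s : R) h k : 0 <= s <= 1 -> effects h -> effects k ->
  effects (h + s%:C *: (k - h)).
Proof.
move=> /andP[s0 s1] [Nh p1 p2] [Nk p3 p4].
have e1 : h + s%:C *: (k - h) = s%:C *: k + (1 - s)%:C *: h.
  by rewrite rmorphB; lmod.
have e2 : 1 - (h + s%:C *: (k - h)) = s%:C *: (1 - k) + (1 - s)%:C *: (1 - h).
  by rewrite rmorphB; lmod.
split; [rewrite e1|rewrite e1|rewrite e2].
- by apply: vnD => //; exact: vnZ.
- by apply: posD; apply: posZ => //; lra.
by apply: posD; apply: posZ => //; lra.
Qed.

(** A 2-norm limit of unrestricted elements of [N] might leave [N]. The effects are bounded in norm,
    so [ball_complete] applies; in return there is only a variational inequality instead of
    orthogonality. *)
Lemma nearest_effect y : el M y -> exists2 h, effects h &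
  forall k, effects k -> complex.Re (t ((k - h) * (y - h))) <= 0.
Proof.
move=> My.
have S0 : effects 0 by split; [exact: vn0|exact: pos0|rewrite subr0; exact: pos1].
have SM k : effects k -> el M k by case=> /NM.
have [|k hk|a b ha hb|delta [u [hd Su du qu]]] :=
    @minimizing_sequence R bop effects (fun k => q2 t (y - k)) (fun a b => q2 t (a - b)) 0.
- exact: S0.
- by apply: (q2_ge0 ht); apply: vnB => //; exact: SM.
- exists (a + 2^-1%:C *: (b - a)).
    by apply: effects_convex => //; apply/andP; split; lra.
  have Ma := SM _ ha; have Mb := SM _ hb.
  have := q2_parallelogram hM ht (vnB hM My Ma) (vnB hM My Mb).
  have -> : y - a - (y - b) = b - a by lmod.
  have -> : y - a + (y - b) = 2%:C *: (y - (a + 2^-1%:C *: (b - a))).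
    have hba := half_half (b - a); set h := 2^-1%:C *: (b - a) in hba *.
    rewrite (_ : 2%:C *: (y - (a + h)) = y + y - (a + a + (h + h))).
      by rewrite hba; lmod.
    by rewrite [2%:C]rmorphD scalerDl scale1r; lmod.
  by rewrite (q2Zr ht) (q2B t b a); lra.
have Nu n : el N (u n) by case: (Su n).
have ub : ubnd u 1 by move=> n; exact: effect_bnd.
have cu : forall e, 0 < e -> exists N0, forall n m, (N0 <= n)%N -> (N0 <= m)%N ->
     q2 t (u n - u m) <= e.
  move=> d d0; have [N0 hN0] := invn_small (divr_gt0 d0 (ltr0Sn R 3)).
  exists N0 => n m nN mN; apply: le_trans (qu n m) _.
  have := hN0 _ nN; have := hN0 _ mN; set r := n.+1%:R^-1; set s := m.+1%:R^-1; lra.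
have [h [Nh bh wh hh]] := ball_complete hN htN ler01 ub Nu cu.
have Sh : effects h.
  split => //; first by apply: (wlim_pos ub wh) => n; case: (Su n).
  have w1 : wlim (fun n => 1 + - u n) (1 - h).
    apply: (wlimD (k := 1) (l := 1)) => //; first by move=> n; exact: bnd1.
    - by move=> n; apply/bndN; exact: ub.
    - exact: wlim_cst.
    have -> : - h = (- 1) * h by rewrite mulNr mul1r.
    have -> : (fun n => - u n) = fun n => (- 1) * u n.
      by apply/funext => n; rewrite mulNr mul1r.
    exact: wlimMl.
  apply: (wlim_pos (k := 1 + 1) _ w1) => [n|n]; last by case: (Su n).
  by apply: bndB; [exact: bnd1 | exact: ub].
exists h => // k Sk.
have Mh := NM Nh; have Mk := SM _ Sk; have Mkh := vnB hM Mk Mh.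
have Myh := vnB hM My Mh.
have shk : adj (k - h) = k - h.
  by rewrite adjB; case: Sk Sh => _ pk _ [_ ph _]; rewrite !pos_adj.
have dh : q2 t (y - h) <= delta.
  apply: le_eps => e e0.
  have [C C0 hC] : exists2 C : R, 0 <= C & forall n, q2 t (y - u n) <= C.
    have [l l0 hl] := bop_bnd y; exists ((l + 1) ^+ 2); first exact: sqr_ge0.
    move=> n; apply: (q2_bnd hM ht); first lra.
      by apply: vnB => //; exact: NM.
    by apply: bndB => //; exact: ub.
  (* The square [q2 t (u n - h)] gets at most [e / 4], and the real cross term, by Cauchy-Schwarz,
     at most [e / 8]. *)
  pose d := Num.min (e / 4) (Num.min 1 ((e / 8) ^+ 2 / (C + 1))).
  have d0 : 0 < d.
    by rewrite !lt_min ltr01 divr_gt0 ?divr_gt0 ?exprn_gt0//; lra.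
  have [N1 h1] := hh d d0; have [N2 h2] := invn_small (divr_gt0 e0 (ltr0Sn R 3)).
  set n := maxn N1 N2; have hn1 := h1 n (leq_maxl _ _).
  have hn2 := h2 n (leq_maxr _ _).
  have Mun : el M (u n) by exact: NM.
  have -> : y - h = (y - u n) + (u n - h) by lmod.
  rewrite (q2D hM ht (vnB hM My Mun) (vnB hM Mun Mh)).
  have cs := Re_tr_sq hM ht (vnB hM My Mun) (vn_adj hM (vnB hM Mun Mh)).
  rewrite (q2_adj hM ht (vnB hM Mun Mh)) in cs.
  have hdn := du n; have hCn := hC n.
  set X := complex.Re _ in cs *; set Q := q2 t (u n - h) in hn1 cs *.
  have Q0 : 0 <= Q by apply: (q2_ge0 ht); exact: vnB.
  have d4 : d <= e / 4 by rewrite ge_min lexx.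
  have d3 : d <= (e / 8) ^+ 2 / (C + 1) by rewrite !ge_min lexx !orbT.
  have C1 : 0 < C + 1 by lra.
  rewrite ler_pdivlMr// in d3.
  have X1 : X <= e / 8.
    apply: le_of_sqr; first lra.
    apply: (le_trans cs); have P0 : 0 <= q2 t (y - u n).
      by apply: (q2_ge0 ht); exact: vnB.
    nra.
  move: hn2 hdn; set rn := n.+1%:R^-1; lra.
have key (s : R) : 0 <= s <= 1 ->
    2 * s * complex.Re (t ((k - h) * (y - h))) <= s ^+ 2 * q2 t (k - h).
  move=> hs; have := hd _ (effects_convex hs Sh Sk) => /(le_trans dh).
  have -> : y - (h + s%:C *: (k - h)) = (y - h) + (- s)%:C *: (k - h).
    by rewrite rmorphN; lmod.
  rewrite (q2D hM ht Myh (vnZ (- s)%:C hM Mkh)).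
  rewrite (q2Zr ht) sqrrN adjZr shk scaleMl (trZ ht) ReZ; lra.
rewrite leNgt; apply/negP => X0; set X := complex.Re _ in key X0.
set Q := q2 t (k - h) in key.
have Q0 : 0 <= Q by exact: (q2_ge0 ht).
pose s := Num.min 1 (X / (Q + 1)).
have Q1 : 0 < Q + 1 by lra.
have s0 : 0 < s by rewrite lt_min ltr01 divr_gt0.
have s1 : s <= 1 by rewrite ge_min lexx.
have s2 : s * (Q + 1) <= X by rewrite -ler_pdivlMr// ge_min lexx orbT.
have := key s; rewrite s1 (ltW s0) => /(_ isT); nra.
Qed.

(** The counterpart of [nearest_effect]: almost minimal over all self-adjoint elements of [N], hence
    almost orthogonal, and without a limit. [rn_unit] compares the two. *)
Lemma approx_expectation y (e : R) : el M y -> adj y = y -> 0 < e ->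
  exists b, [/\ el N b, adj b = b & forall n, el N n -> adj n = n ->
    complex.Re (t (n * (y - b))) ^+ 2 <= e * q2 t n].
Proof.
move=> My sy e0.
pose S := [set b | el N b /\ adj b = b].
pose D := [set q2 t (y - b) | b in S].
have hD : has_inf D.
  split; first by exists (q2 t (y - 0)), 0 => //; split; [exact: vn0|exact: adj0].
  by exists 0 => _ [b [Nb _] <-]; apply: (q2_ge0 ht); apply: vnB => //; exact: NM.
have [_ [b [Nb sb] <-] hb] := inf_adherent e0 hD.
exists b; split => // n Nn sn.
have Mn := NM Nn; have Mb := NM Nb; have Myb := vnB hM My Mb.
apply: bilinear_opt; first exact: ltW.
move=> s; have : inf D <= q2 t (y - (b + s%:C *: n)).
  apply: ge_inf; first by case: hD.
  exists (b + s%:C *: n) => //; split; first by apply: vnD => //; exact: vnZ.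
  by rewrite adjD adjZr sb sn.
have -> : y - (b + s%:C *: n) = (y - b) + (- s)%:C *: n by rewrite rmorphN; lmod.
rewrite (q2D hM ht Myb (vnZ (- s)%:C hM Mn)).
rewrite (q2Zr ht) sqrrN adjZr sn scaleMl (trZ ht) ReZ.
set Y := complex.Re _; set Q := q2 t n; move: hb; set Z := q2 t (y - b); lra.
Qed.

(* Radon-Nikodym: [h] is the conditional expectation of [y] onto [N]. *)
Lemma rn_unit y : el M y -> pos y -> pos (1 - y) ->
  exists2 h, effects h & forall n, el N n -> t (n * y) = t (n * h).
Proof.
move=> My py p1y; have sy := pos_adj py.
have [h Sh hh] := nearest_effect My; have [Nh ph p1h] := Sh.
have Mh := NM Nh; have sh := pos_adj ph.
exists h => //.
(* The almost orthogonal [b] is close to the nearest effect [h]. The variational inequality is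
   tested at the spectral projection [p] of [b - h], which is itself an effect. *)
have small (e : R) : 0 < e -> exists b, [/\ el N b, adj b = b,
    forall n, el N n -> adj n = n -> complex.Re (t (n * (y - b))) ^+ 2 <= e ^+ 2 * q2 t n
  & q2 t (b - h) <= 4 * e + e ^+ 2].
  move=> e0; have [b [Nb sb hb]] := approx_expectation My sy (exprn_gt0 2 e0).
  exists b; split => //; have Mb := NM Nb.
  have Na : el N (b - h) by exact: vnB.
  have sa : adj (b - h) = b - h by rewrite adjB sb sh.
  have [p [hp Np pc ap anp]] := spectral_cut_vn hN Na sa.
  have Sp : effects p by split => //; [exact: proj_pos|apply/proj_pos/projC].
  set a := b - h in Na sa pc ap anp *.
  have Ma := NM Na; have Mp := NM Np.
  (* Because [0 <= y <= 1], and [p] carries the positive part of [a]. *)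
  have e1 : complex.Re (t (a * y)) <= complex.Re (t (a * p)).
    have E1 : t (a * y) = t (a * p * y) - t (- (a * (1 - p)) * y).
      by rewrite -(trB ht); congr t; bring.
    have E2 : t (a * p) = t (a * p * y) + t (a * p * (1 - y)).
      by rewrite -(trD ht); congr t; bring.
    rewrite E1 E2 ReB ReD.
    have h1 := tr_posM hM ht (vnM hM Ma Mp) (vnB hM (vn1 hM) My) ap p1y.
    have h2 := tr_posM hM ht (vnN hM (vnM hM Ma (vnB hM (vn1 hM) Mp))) My anp py.
    by have := Re_ge0 h1; have := Re_ge0 h2; lra.
  have e2 := hh p Sp.
  have sph : adj (p - h) = p - h by rewrite adjB sh (proj_adj hp).
  have e3 := hb _ (vnB hN Np Nh) sph.
  have e4 := hb _ Na sa.
  have qph : q2 t (p - h) <= 2 ^+ 2.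
    apply: (q2_bnd hM ht) => //; first exact: vnB.
    have -> : 2 = 1 + 1 :> R by [].
    by apply: bndB; exact: effect_bnd.
  have qa : q2 t a = complex.Re (t (a * y)) - complex.Re (t (a * h)) -
      complex.Re (t (a * (y - b))).
    rewrite /q2 sa {2}/a -!ReB -!(trB ht); congr (complex.Re (t _)).
    by rewrite !mulrBr; lmod.
  have e5 : complex.Re (t (a * p)) - complex.Re (t (a * h)) =
      complex.Re (t ((p - h) * (y - h))) - complex.Re (t ((p - h) * (y - b))).
    rewrite -!ReB -!(trB ht) -!mulrBr.
    have -> : y - h - (y - b) = a by rewrite /a; lmod.
    by rewrite (trC ht) //; exact: vnB.
  have Y1 : - complex.Re (t ((p - h) * (y - b))) <= 2 * e.
    apply: le_of_sqr; first lra.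
    by rewrite sqrrN; nra.
  have X1 : - complex.Re (t (a * (y - b))) <= (e ^+ 2 + q2 t a) / 2.
    have Q0 : 0 <= q2 t a by exact: (q2_ge0 ht).
    apply: le_of_sqr; first by rewrite divr_ge0// addr_ge0// sqr_ge0.
    rewrite sqrrN (le_trans e4)//; have := sqr_ge0 (e ^+ 2 - q2 t a); lra.
  lra.
have main n : el N n -> adj n = n -> t (n * (y - h)) = 0.
  move=> Nn sn; have Mn := NM Nn; have Myh := vnB hM My Mh.
  have re0 : complex.Re (t (n * (y - h))) = 0.
    apply/eqP; rewrite -sqrf_eq0 eq_le sqr_ge0 andbT.
    apply: le_eps => e e0; rewrite add0r.
    have Q0 : 0 <= q2 t n by exact: (q2_ge0 ht).
    pose d := Num.min 1 (e / (12 * (q2 t n + 1))).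
    have q1 : 0 < 12 * (q2 t n + 1) by lra.
    have d0 : 0 < d by rewrite lt_min ltr01 divr_gt0.
    have d1 : d <= 1 by rewrite ge_min lexx.
    have d2 : d * (12 * (q2 t n + 1)) <= e by rewrite -ler_pdivlMr// ge_min lexx orbT.
    have d3 : d ^+ 2 <= d by rewrite expr2 ler_piMr// ltW.
    have [b [Nb sb hb qb]] := small d d0.
    have Mb := NM Nb; have Mbh := vnB hM Mb Mh.
    have := Re_tr_sq hM ht Mbh Mn; have := hb n Nn sn.
    have -> : n * (y - h) = n * (y - b) + n * (b - h) by bring.
    rewrite (trD ht) ReD; set X := complex.Re _; set Y := complex.Re _.
    have := q2_ge0 ht Mbh; move: qb; set Q := q2 t (b - h) => h1 h0 h2 h3.
    have : (X + Y) ^+ 2 <= 2 * X ^+ 2 + 2 * Y ^+ 2.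
      by have := sqr_ge0 (X - Y); lra.
    have : Q * q2 t n <= (5 * d) * q2 t n by apply: ler_wpM2r => //; lra.
    have : d ^+ 2 * q2 t n <= d * q2 t n by exact: ler_wpM2r.
    nra.
  have im0 : complex.Im (t (n * (y - h))) = 0.
    have : conjc (t (n * (y - h))) = t (n * (y - h)).
      rewrite -(tr_adj hM ht); last exact: vnM.
      by rewrite adjM adjB sy sh sn (trC ht).
    by case: (t _) => r s /= [] hs; lra.
  by move: re0 im0; case: (t _) => r s /= -> ->.
move=> n Nn; apply/eqP; rewrite -subr_eq0 -(trB ht) -mulrBr; apply/eqP.
have Nn' := vn_adj hN Nn.
have e1 := main (n + adj n) (vnD hN Nn Nn') ltac:(by rewrite adjD adjK addrC).
have ci : conjc 'i = - 'i :> R[i] by rewrite /conjc; simpc.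
have := main ('i *: (n - adj n)) (vnZ _ hN (vnB hN Nn Nn'))
  ltac:(by rewrite adjZ adjB adjK ci scaleNr -scalerN opprB).
rewrite scaleMl (trZ ht) => /eqP; rewrite mulf_eq0 => /orP[/eqP[] /eqP|/eqP e2].
  by rewrite oner_eq0.
have : t (n * (y - h)) + t (n * (y - h)) = 0.
  rewrite -(trD ht) (_ : _ + _ = (n + adj n) * (y - h) + (n - adj n) * (y - h)).
    by rewrite (trD ht) e1 e2 addr0.
  by bring.
by rewrite -mulr2n => /eqP; rewrite mulrn_eq0 => /eqP.
Qed.

Lemma rn y : el M y -> pos y ->
  exists h, [/\ el N h, pos h & forall n, el N n -> t (n * y) = t (n * h)].
Proof.
move=> My py; have [k k0 hk] := bop_bnd y.
have l0 : 0 < k + 1 by lra.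
have e1 : (k + 1)%:C * ((k + 1)^-1)%:C = 1 by rewrite -rmorphM /= divff// gt_eqF.
have e2 : ((k + 1)^-1)%:C * (k + 1)%:C = 1 by rewrite mulrC.
have [||h [Nh ph _] hh] := @rn_unit ((k + 1)^-1%:C *: y) (vnZ _ hM My).
- by apply: posZ => //; rewrite invr_ge0 ltW.
- have -> : 1 - (k + 1)^-1%:C *: y = (k + 1)^-1%:C *: ((k + 1)%:B - y).
    by rewrite scalerBr scalerA e2 scale1r.
  apply: posZ; first by rewrite invr_ge0 ltW.
  by apply: sa_bnd_pos; [exact: pos_adj | apply: bnd_le hk; lra].
exists ((k + 1)%:C *: h); split; first exact: vnZ.
  by apply: posZ => //; exact: ltW.
move=> n Nn; have := hh n Nn; rewrite !scaleMr !(trZ ht) => <-.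
by rewrite mulrA e1 mul1r.
Qed.

Lemma nm_sum_sq (s : seq bop) (f : bop -> H) :
  nm (\sum_(u <- s) f u) ^+ 2 <= (size s)%:R * \sum_(u <- s) nm (f u) ^+ 2.
Proof.
elim: s => [|u s IH]; first by rewrite !big_nil nm0 mulr0 expr0n.
rewrite !big_cons [size _]/= -natr1.
have h1 := nmD (f u) (\sum_(j <- s) f j).
have := nm_ge0 (f u); have := nm_ge0 (\sum_(j <- s) f j).
have := nm_ge0 (f u + \sum_(j <- s) f j).
have Q0 : 0 <= \sum_(j <- s) nm (f j) ^+ 2.
  by apply: sumr_ge0 => j _; rewrite exprn_ge0 ?nm_ge0.
move: IH Q0 h1; set S := nm (\sum_(j <- s) f j); set r := nm (f u).
set Q := \sum_(j <- s) _; set n := (size s)%:R; set Z := nm (_ + _).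
move=> IH Q0 h1 Z0 S0 r0.
have n0 : 0 <= n by rewrite /n.
have h2 : Z ^+ 2 <= (r + S) ^+ 2 by rewrite lerXn2r ?nnegrE// addr_ge0.
have h3 : 2 * r * S <= n * r ^+ 2 + Q.
  have [nz|np] := eqVneq n 0.
    have : S = 0 by apply/eqP; rewrite -sqrf_eq0 eq_le sqr_ge0 (le_trans IH)// nz mul0r.
    by move=> ->; rewrite mulr0 nz mul0r add0r.
  have npos : 0 < n by rewrite lt0r np.
  rewrite -(ler_pM2l npos); have : 0 <= (n * r - S) ^+ 2 by exact: sqr_ge0.
  nra.
nra.
Qed.

Lemma avg_schwarz (us : seq bop) y : us != [::] ->
  (forall u, u \in us -> unitary N u) ->
  pos (avg us (adj y * y) - adj (avg us y) * avg us y).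
Proof.
move=> us0 hus x.
have n0 : 0 < (size us)%:R :> R by rewrite ltr0n lt0n size_eq0.
rewrite opB opM hdotBl adjPr hdotxx /avg !opZ !op_sum hdotZl hdot_suml.
have -> : \sum_(u <- us) hdot ((adj u * (adj y * y) * u) x) x =
    (\sum_(u <- us) nm ((adj u * y * u) x) ^+ 2)%:C.
  rewrite rmorph_sum /= big_seq [RHS]big_seq; apply: eq_bigr => u /hus[_ u1 u2].
  rewrite -hdotxx -adjPr -opM; congr (hdot (opval _ x) x).
  rewrite !adjM adjK !mulrA; congr (_ * _).
  by rewrite -!mulrA; congr (_ * _); rewrite !mulrA -[adj y * u * adj u]mulrA u2 mulr1.
rewrite nmZr exprMn ger0_norm ?invr_ge0// -rmorphM -rmorphB /= lecR subr_ge0.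
rewrite expr2 -mulrA ler_pM2l ?invr_gt0// mulrC ler_pdivrMr// mulrC.
exact: nm_sum_sq.
Qed.

Hypothesis irr : forall y, el M y -> (forall a, el N a -> a * y = y * a) ->
  exists z : R[i], y = z *: (1 : bop).
Hypothesis hf : fprop N.
Variable lam : R.
Hypothesis lam0 : 0 < lam.
(** [h] is [E_N(y)]: the Pimsner-Popa inequality in the form that a norm bound [c] of [E_N(y)] gives
    [lam y <= c]. *)
Hypothesis PP : forall y h (c : R), el M y -> el N h -> 0 <= c -> pos y -> pos h ->
  (forall n, el N n -> t (n * y) = t (n * h)) -> bnd h c -> pos (c%:B - lam%:C *: y).

Lemma dixmier_inclusion x (e : R) : el M x -> 0 < e ->
  exists2 b, hull N x b & bnd (b - t x *: (1 : bop)) e.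
Proof.
move=> Mx e0.
pose x0 := x - t x *: (1 : bop).
have Mx0 : el M x0 by apply: vnB => //; apply: vnZ => //; exact: vn1.
have [k k0 hk] := bop_bnd x; pose K := k + cabs (t x) + 1.
have K0 : 0 < K by rewrite /K ltr_wpDl// addr_ge0// cabs_ge0.
(* [d] bounds the norm of the averaged expectation of [|y|^2 / K^2] *)
pose d := lam * e ^+ 2 / (2 * K ^+ 2).
have d0 : 0 < d by rewrite divr_gt0// ?mulr_gt0// exprn_gt0.
have dE : 2 * d * K ^+ 2 = lam * e ^+ 2 by rewrite /d; field; rewrite gt_eqF.
clearbody d.
have [n hn] := invn_small d0; have {}hn := hn n (leqnn n).
have n0 : 0 < n.+1%:R :> R by rewrite ltr0n.
(* The tolerance is the one that [small_avg] demands of [h], whose trace is [q2 t y / K ^+ 2]. *)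
have [y0 hy0 qy0] := weak_avg hN hM ht NM irr Mx
  (divr_gt0 (mulr_gt0 d0 (exprn_gt0 2 K0)) n0).
pose y := y0 - t x *: (1 : bop).
have My0 := hull_ind_in hM NM Mx hy0.
have My : el M y by apply: vnB => //; apply: vnZ => //; exact: vn1.
have by_ : bnd y K.
  apply: (@bnd_le _ _ _ (k + cabs (t x) * 1)); first by rewrite /K; lra.
  apply: bndB; first exact: hull_bnd hy0.
  by apply: bndZ; exact: bnd1.
have K2 : 0 < K ^+ 2 by rewrite exprn_gt0.
pose w := (K ^+ 2)^-1%:C *: (adj y * y).
have iK : ((K ^+ 2)^-1)%:C * (K ^+ 2)%:C = 1 :> R[i].
  by rewrite -rmorphM /= mulVf// gt_eqF.
have Mw : el M w by apply: vnZ => //; apply: vnM => //; exact: vn_adj.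
have pw : pos w by apply: posZ; [rewrite invr_ge0 ltW | exact: pos_adjM].
have p1w : pos (1 - w).
  have -> : 1 - w = (K ^+ 2)^-1%:C *: ((K ^+ 2)%:B - adj y * y).
    by rewrite scalerBr scalerA iK scale1r.
  apply: posZ; first by rewrite invr_ge0 ltW.
  by apply: sa_bnd_pos; [rewrite adjM adjK | apply: bnd_sqr => //; exact: ltW].
have [h Sh hh] := rn_unit Mw pw p1w; have [Nh ph p1h] := Sh.
have th : n.+1%:R * complex.Re (t h) <= d.
  have -> : complex.Re (t h) = (K ^+ 2)^-1 * q2 t y.
    have := hh 1 (vn1 hN); rewrite !mul1r => <-.
    by rewrite /w (trZ ht) ReZ.
  move: qy0; rewrite -/y ler_pdivlMr// => q.
  by rewrite mulrCA ler_pdivrMl//; lra.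
have [us [us0 hus pus]] := small_avg hN htN hf Nh ph (effect_bnd Sh) d0 th.
have Nh' := avg_el hN hus Nh.
have husM u : u \in us -> unitary M u by move=> /hus[/NM]; split.
have Mw' := avg_el hM husM Mw.
have c0 : 0 <= d + n.+1%:R^-1 by rewrite addr_ge0// ?ltW// invr_ge0.
(* The expectation onto [N] commutes with conjugation by unitaries of [N], so the average of [h] is
   the expectation of that of [w]. *)
have tavg m : el N m -> t (m * avg us w) = t (m * avg us h).
  move=> Nm; rewrite /avg !scaleMr !(trZ ht) !mulr_sumr !(tr_sum ht); congr (_ * _).
  rewrite big_seq [RHS]big_seq; apply: eq_bigr => u /hus[Nu _ _].
  have Nu' := vn_adj hN Nu; have [Mu Mu'] := (NM Nu, NM Nu').
  have Mm := NM Nm; have Mh := NM Nh.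
  have cyc c : el M c -> t (m * (adj u * c * u)) = t (u * m * adj u * c).
    move=> Mc; rewrite mulrA (trC ht (vnM hM Mm (vnM hM Mu' Mc)) Mu).
    by rewrite !mulrA.
  by rewrite !cyc// hh//; exact: vnM hN (vnM hN Nu Nm) Nu'.
have := PP Mw' Nh' c0 (avg_pos us pw) (avg_pos us ph) tavg
  (bnd_pos c0 (avg_pos us ph) pus).
rewrite /w avgZ scalerA => h1.
have us_ks := avg_schwarz y us0 hus.
(* [lam] times the average of [w] is at most [d + 1 / (n + 1) <= 2 d]; multiplied by [K ^+ 2] this
   is [lam * e ^+ 2] by the choice of [d]. *)
have h2 : pos ((lam * e ^+ 2)%:B - lam%:C *: (adj (avg us y) * avg us y)).
  apply: (@posB_trans _ _ _ (lam%:C *: avg us (adj y * y))).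
    by rewrite -scalerBr; apply: posZ => //; exact: ltW.
  have -> : (lam * e ^+ 2)%:B - lam%:C *: avg us (adj y * y) =
     (2 * d * K ^+ 2 - (d + n.+1%:R^-1) * K ^+ 2)%:B + (K ^+ 2)%:C *:
     ((d + n.+1%:R^-1)%:B - (lam%:C * ((K ^+ 2)^-1)%:C) *: avg us (adj y * y)).
    rewrite scalerBr !scalerA -dE.
    have -> : (K ^+ 2)%:C * (lam%:C * ((K ^+ 2)^-1)%:C) = lam%:C.
      by rewrite mulrCA [_ * _^-1%:C]mulrC iK mulr1.
    have -> : (2 * d * K ^+ 2)%:C = (2 * d * K ^+ 2 - (d + n.+1%:R^-1) * K ^+ 2)%:C +
        (K ^+ 2)%:C * (d + n.+1%:R^-1)%:C.
      by rewrite -rmorphM -rmorphD; congr (_%:C); ring.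
    by rewrite scalerDl addrA.
  apply: posD; last by apply: posZ => //; exact: ltW.
  apply: posZ; last exact: pos1.
  rewrite -mulrBl; apply: mulr_ge0; last exact: ltW.
  by rewrite subr_ge0 [leRHS](_ : _ = d + d) ?lerD2l//; ring.
have h3 : bnd (avg us y) e.
  apply: bnd_sq; first exact: ltW.
  apply: bnd_pos; [exact: sqr_ge0|exact: pos_adjM|].
  have := posZ (r := lam^-1) _ h2; rewrite scalerBr !scalerA -!rmorphM /=.
  rewrite mulrA mulVf ?gt_eqF// mul1r scale1r; apply.
  by rewrite invr_ge0 ltW.
exists (avg us y0); first by apply: hull_trans (hull_avg _ _ _).
by rewrite -(scale1r (1:bop)) -{1}(avg1 us0 hus) scale1r -avgZ -avgB.
Qed.

End Inclusion.

(** * Dixmier averaging in a factor and uniqueness of its trace *)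

Section UniqueTrace.
Context {R : realType} {H : hilbertType R}.
Local Notation bop := (bop H).
Variables (M : set bop) (t : bop -> R[i]).
Hypotheses (hM : vn M) (ht : tracial M t) (hf : fprop M).
Hypothesis center : forall y, el M y -> (forall a, el M a -> a * y = y * a) ->
  exists z : R[i], y = z *: (1 : bop).

(** The case [N = M]: the expectation is the identity, the constant is 1, and irreducibility is
    triviality of the center. *)
Lemma dixmier_factor (x : bop) (e : R) : el M x -> 0 < e ->
  exists2 b, hull M x b & bnd (b - t x *: (1 : bop)) e.
Proof.
apply: (dixmier_inclusion hM hM ht (fun _ => id) center hf ltr01) => y h c My Mh c0 py ph hyh bh.
have -> : y = h.
  apply/eqP; rewrite -subr_eq0; apply/eqP; apply: (tr_faith ht (vnB hM My Mh)).
  by rewrite mulrBr (trB ht) hyh ?subrr//; apply: vn_adj => //; exact: vnB.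
by rewrite scale1r; apply: sa_bnd_pos => //; exact: pos_adj.
Qed.

(** [s] is constant on the hull of an orbit and norm continuous, and the hull of [a] comes
    arbitrarily close to the scalar [t a]. *)
Lemma trace_unique (s : bop -> R[i]) :
  (forall (z : R[i]) a b, el M a -> el M b -> s (z *: a + b) = z * s a + s b) ->
  (forall a b, el M a -> el M b -> s (a * b) = s (b * a)) ->
  (exists2 C : R, 0 <= C & forall a k, el M a -> 0 <= k -> bnd a k ->
     cabs (s a) <= C * k) ->
  forall a, el M a -> s a = t a * s 1.
Proof.
move=> sl sc [C C0 hC] a Ma.
have M0 := vn0 hM.
have s0 : s 0 = 0 by have := sl (-1) 0 0 M0 M0; rewrite scaler0 addr0 mulN1r addNr.
have sZ (z : R[i]) c : el M c -> s (z *: c) = z * s c.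
  by move=> Mc; have := sl z c 0 Mc M0; rewrite !addr0 s0 addr0.
have sB c d : el M c -> el M d -> s (c - d) = s c - s d.
  move=> Mc Md; have := sl (-1) d c Md Mc.
  by rewrite scaleN1r addrC => ->; rewrite mulN1r addrC.
apply/eqP; rewrite -subr_eq0; apply/eqP/cabs_eq0/eqP.
rewrite eq_le cabs_ge0 andbT; apply: le_eps => e e0; rewrite add0r.
have e1 : 0 < e / (C + 1) by rewrite divr_gt0//; lra.
have [b hb bb] := dixmier_factor Ma e1.
have <- : s b = s a by exact: (hull_tracial hM (fun _ => id) Ma sl sc hb).
have Mb := hull_ind_in hM (fun _ => id) Ma hb; have Mt := vnZ (t a) hM (vn1 hM).
rewrite -(sZ _ _ (vn1 hM)) -sB// (le_trans (hC _ _ (vnB hM Mb Mt) (ltW e1) bb))//.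
have : e / (C + 1) * (C + 1) = e by field; lra.
move: e1; set d := e / _; nra.
Qed.

End UniqueTrace.

(** * The GNS space and the Pimsner-Popa inequality *)

Section TracePositivity.
Context {R : realType} {H : hilbertType R}.
Local Notation bop := (bop H).
Implicit Types (a b c m p : bop).
Variables (M : set bop) (t : bop -> R[i]).
Hypotheses (hM : vn M) (ht : tracial M t).

(** Testing with the spectral projection [m = 1 - p] shows that the negative part of [b] has trace
    zero. *)
Lemma pos_of_trace b : el M b -> adj b = b ->
  (forall m, el M m -> 0 <= complex.Re (t (m * b * adj m))) -> pos b.
Proof.
move=> Mb sb h; have [p [hp Mp pb bp bnp]] := spectral_cut_vn hM Mb sb.
have Mp' : el M (1 - p) by apply: vnB => //; exact: vn1.
have hp' := projC hp; set x := - (b * (1 - p)) in bnp.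
have Mx : el M x by apply: vnN => //; exact: vnM.
have x0 : x = 0.
  apply: (tr_pos_eq0 hM ht Mx bnp).
  have := h _ Mp'; rewrite (proj_adj hp').
  have -> : (1 - p) * b * (1 - p) = - x.
    have -> : (1 - p) * b = b * (1 - p) by rewrite mulrBl mulrBr mul1r mulr1 pb.
    by rewrite -mulrA (proj_idem hp') opprK.
  rewrite (trN ht) ReN => h1; have h2 := tr_pos hM ht Mx bnp.
  rewrite (ge0_ReC h2); have := Re_ge0 h2; move: h1.
  by rewrite oppr_ge0 => h1 h3; congr (_%:C); apply/eqP; rewrite eq_le h1 h3.
have -> : b = b * p - x by rewrite /x; bring.
by rewrite x0 subr0.
Qed.

End TracePositivity.

Section GNS.
Context {R : realType} {H K : hilbertType R}.
Implicit Types (a b c m n x y : bop H) (S T : bop K) (k : K).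

Record gns (M : set (bop H)) (t : bop H -> R[i]) (pi : bop H -> bop K) (Om : K) : Prop := {
  piL : forall z a b, el M a -> el M b -> pi (z *: a + b) = z *: pi a + pi b;
  piM : forall a b, el M a -> el M b -> pi (a * b) = pi a * pi b;
  piJ : forall a, el M a -> pi (adj a) = adj (pi a);
  pi1 : pi 1 = 1;
  piT : forall a, el M a -> hdot (pi a Om) Om = t a;
  piD : forall k, clo [set pi a Om | a in el M] k }.

Variables (M : set (bop H)) (t : bop H -> R[i]) (pi : bop H -> bop K) (Om : K).
Hypotheses (hM : vn M) (ht : tracial M t) (hg : gns M t pi Om).

Definition vec a : K := pi a Om.

Lemma pi0 : pi 0 = 0.
Proof.
have M0 := vn0 hM.
by have := piL hg (-1) M0 M0; rewrite scaler0 addr0 scaleN1r addNr.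
Qed.
Lemma piZ z a : el M a -> pi (z *: a) = z *: pi a.
Proof. by move=> Ma; have := piL hg z Ma (vn0 hM); rewrite !addr0 pi0 addr0. Qed.
Lemma piDD a b : el M a -> el M b -> pi (a + b) = pi a + pi b.
Proof. by move=> Ma Mb; have := piL hg 1 Ma Mb; rewrite !scale1r. Qed.
Lemma piB a b : el M a -> el M b -> pi (a - b) = pi a - pi b.
Proof.
by move=> Ma Mb; rewrite piDD//; [rewrite -scaleN1r piZ// scaleN1r | exact: vnN].
Qed.

Lemma vecL z a b : el M a -> el M b -> vec (z *: a + b) = z *: vec a + vec b.
Proof. by move=> Ma Mb; rewrite /vec (piL hg)// opL. Qed.
Lemma vecB a b : el M a -> el M b -> vec (a - b) = vec a - vec b.
Proof. by move=> Ma Mb; rewrite /vec piB// opB. Qed.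
Lemma pi_vec a b : el M a -> el M b -> pi a (vec b) = vec (a * b).
Proof. by move=> Ma Mb; rewrite /vec (piM hg). Qed.

Lemma vec_dot a b : el M a -> el M b -> hdot (vec a) (vec b) = t (adj b * a).
Proof.
move=> Ma Mb; have Mb' := vn_adj hM Mb; rewrite -(piT hg); last exact: vnM.
by rewrite (piM hg)// (piJ hg)// opM adjPr.
Qed.
Lemma vec_nm a : el M a -> nm (vec a) ^+ 2 = q2 t a.
Proof. by move=> Ma; rewrite nm_sq vec_dot. Qed.

Lemma eq_dense S T : (forall a, el M a -> S (vec a) = T (vec a)) -> S = T.
Proof.
move=> h; apply/eqP; rewrite -subr_eq0; apply/eqP/bopext => k.
apply: (clo_ker _ (piD hg k)) => _ [a Ma <-].
by rewrite opB h// subrr.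
Qed.

(** Right multiplication is bounded because [t] is a trace. All bounds [r] of [m] are treated at
    once, since [T] is determined on a dense set. *)
Lemma rho_ex m : exists T, el M m ->
  (forall a, el M a -> T (vec a) = vec (a * m)) /\
  (forall r : R, 0 <= r -> bnd m r -> bnd T r).
Proof.
have [Mm|] := pselect (el M m); last by exists 0.
have ext r : 0 <= r -> bnd m r ->
    exists2 T, bnd T r & forall a, el M a -> T (vec a) = vec (a * m).
  move=> r0 hr; have [||||T [bT hT _]] :=
    @extension R K (bop H) (el M) vec (fun a => vec (a * m)) r r0 (vn0 hM).
  - by move=> z x y Mx My; apply: vnD => //; exact: vnZ.
  - by move=> z x y Mx My; rewrite vecL.
  - by move=> z x y Mx My; rewrite mulrDl scaleMl vecL//; exact: vnM.
  - move=> a Ma; apply: le_of_sqr; first by rewrite mulr_ge0// nm_ge0.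
    rewrite exprMn !vec_nm//; last exact: vnM.
    exact: (q2_Mr hM ht).
  by exists T.
have [r r0 hr] := bop_bnd m; have [T bT hT] := ext r r0 hr.
exists T => _; split => // r' r'0 hr'; have [T' bT' hT'] := ext r' r'0 hr'.
suff -> : T = T' by [].
by apply: eq_dense => a Ma; rewrite hT// hT'.
Qed.

Definition rho m : bop K := projT1 (cid (rho_ex m)).

Lemma rhoE m a : el M m -> el M a -> rho m (vec a) = vec (a * m).
Proof. by move=> Mm Ma; rewrite /rho; case: cid => T /(_ Mm)[h _] /=; exact: h. Qed.
Lemma rho_bnd m (r : R) : el M m -> 0 <= r -> bnd m r -> bnd (rho m) r.
Proof. by move=> Mm; rewrite /rho; case: cid => T /(_ Mm)[_ h] /=; exact: h. Qed.
Lemma rhoM a b : el M a -> el M b -> rho (a * b) = rho b * rho a.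
Proof.
move=> Ma Mb; apply: eq_dense => c Mc.
by rewrite opM !rhoE ?mulrA//; exact: vnM.
Qed.
Lemma rhoL z a b : el M a -> el M b -> rho (z *: a + b) = z *: rho a + rho b.
Proof.
move=> Ma Mb; apply: eq_dense => c Mc; rewrite opL !rhoE//.
  by rewrite mulrDr scaleMr vecL//; exact: vnM.
by apply: vnD => //; exact: vnZ.
Qed.
Lemma rho1 : rho 1 = 1.
Proof. by apply: eq_dense => c Mc; rewrite rhoE ?mulr1//; exact: vn1. Qed.
Lemma rhoJ a : el M a -> rho (adj a) = adj (rho a).
Proof.
move=> Ma; have Ma' := vn_adj hM Ma.
apply: eq_dense => c Mc; apply/eqP; rewrite -subr_eq0 -opB; apply/eqP.
apply: hdot_eqr => k; rewrite hdot0r hdotC.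
have -> : hdot ((rho (adj a) - adj (rho a)) (vec c)) k = 0; last by rewrite conjc0.
apply: (clo_ortho _ (piD hg k)) => _ [b Mb <-]; rewrite -/(vec b).
rewrite opB hdotBl adjPr !rhoE// !vec_dot//; try exact: vnM.
by rewrite adjM mulrA -[adj a * adj b * c]mulrA -(trC ht) ?mulrA ?subrr//;
  apply: vnM => //; exact: vn_adj.
Qed.
Lemma rho_pi a b : el M a -> el M b -> rho a * pi b = pi b * rho a.
Proof.
move=> Ma Mb; apply: eq_dense => c Mc; rewrite !opM pi_vec// !rhoE// ?pi_vec//.
- by rewrite mulrA.
- exact: vnM.
exact: vnM.
Qed.

Variable (N : set (bop H)).
Hypotheses (hN : vn N) (NM : forall a, el N a -> el M a).

Definition piN : set (bop K) := [set pi a | a in el N].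
(** Up to the canonical conjugation of [L^2(M)] this is the basic construction of the inclusion; it
    contains [rho] of [M] and [eN]. *)
Definition commN := comm piN.

Lemma piN_star : star piN.
Proof.
move=> _ [a Na <-]; exists (adj a); first exact: vn_adj.
by rewrite (piJ hg)//; exact: NM.
Qed.
Lemma vnPN : vn commN. Proof. exact: vn_comm piN_star. Qed.

Lemma PP_comm T a : el commN T -> el N a -> pi a * T = T * pi a.
Proof. by move=> PT Na; apply: PT; exists a. Qed.

Lemma P_rho a : el M a -> el commN (rho a).
Proof. by move=> Ma _ [b Nb <-]; rewrite rho_pi//; exact: NM. Qed.

Definition VN : set K := [set vec a | a in el N].

Lemma VN_sub : lsub VN.
Proof.
split; first by exists 0; [exact: vn0 | rewrite /vec pi0].
move=> z _ _ [a Na <-] [b Nb <-]; exists (z *: a + b).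
  by apply: vnD => //; exact: vnZ.
by rewrite vecL//; exact: NM.
Qed.

(** The Jones projection. *)
Definition eN : bop K := projT1 (cid (projection_onto VN_sub)).

Lemma eN_spec : [/\ eN * eN = eN, adj eN = eN, forall k, clo VN (eN k),
      forall k, clo VN k -> eN k = k
    & forall k, (forall s, VN s -> hdot k s = 0) -> eN k = 0].
Proof. by rewrite /eN; case: cid. Qed.

Lemma eN_proj : proj eN. Proof. by case: eN_spec. Qed.
Lemma eN_vec a : el N a -> eN (vec a) = vec a.
Proof. by move=> Na; case: eN_spec => _ _ _ h _; apply: h; apply: sub_clo; exists a. Qed.

Lemma eN_comm T : (forall s, VN s -> VN (T s)) -> (forall s, VN s -> VN (adj T s)) ->
  eN * T = T * eN.
Proof. by case: eN_spec => _ s c f _ h1 h2; exact: (projection_comm s c f). Qed.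

Lemma eN_P : el commN eN.
Proof.
move=> _ [a Na <-]; have Na' := vn_adj hN Na; symmetry; apply: eN_comm.
  by move=> _ [b Nb <-]; exists (a * b); [exact: vnM|rewrite pi_vec//; exact: NM].
move=> _ [b Nb <-]; exists (adj a * b); first exact: vnM.
by rewrite -(piJ hg) ?pi_vec//; exact: NM.
Qed.

Lemma eN_rho a : el N a -> eN * rho a = rho a * eN.
Proof.
move=> Na; have Na' := vn_adj hN Na; apply: eN_comm.
  by move=> _ [b Nb <-]; exists (b * a); [exact: vnM|rewrite rhoE//; exact: NM].
move=> _ [b Nb <-]; exists (b * adj a); first exact: vnM.
by rewrite -rhoJ ?rhoE//; exact: NM.
Qed.

Lemma eN_agree S T : (forall a, el N a -> S (vec a) = T (vec a)) -> S * eN = T * eN.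
Proof.
move=> h; apply/eqP; rewrite -subr_eq0 -mulrBl; apply/eqP/bopext => k.
rewrite opM op0; case: eN_spec => _ _ hc _ _.
by apply: (clo_ker _ (hc k)) => _ [a Na <-]; rewrite opB h// subrr.
Qed.

Lemma eN_bnd T (r : R) : 0 <= r ->
  (forall a, el N a -> nm (T (vec a)) <= r * nm (vec a)) -> bnd (T * eN) r.
Proof.
move=> r0 h k; rewrite opM.
have bk : nm (eN k) <= nm k by have := proj_bnd eN_proj k; rewrite mul1r.
apply: (@le_trans _ _ (r * nm (eN k))); last by rewrite ler_wpM2l.
case: eN_spec => _ _ /(_ k) hk _ _; move: hk; move: (eN k) => v hv.
apply: le_eps => e e0; have [l l0 hl] := bop_bnd T.
have c0 : 0 < l + r + 1 by lra.
have [s [a Na <-] hs] := hv (e / (l + r + 1)) (divr_gt0 e0 c0).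
move: hs; rewrite ler_pdivlMr// => hs.
have h1 : nm (T v) <= nm (T (vec a)) + nm (T (v - vec a)).
  by rewrite (_ : T v = T (vec a) + T (v - vec a)) ?nmD// -opDx; congr opval; lmod.
have h2 : nm (vec a) <= nm v + nm (v - vec a).
  by rewrite {1}(_ : vec a = v - (v - vec a)) ?(le_trans (nmD _ _)) ?nmN//; lmod.
have := h a Na; have := hl (v - vec a); have := nm_ge0 (v - vec a).
move: hs h1 h2; set d := nm (v - vec a); nra.
Qed.

(** The relation [e x e = E(x) e] of the basic construction, where [g] is the expectation of [w]. *)
Lemma eN_compress w g : el M w -> el N g ->
  (forall n, el N n -> t (n * w) = t (n * g)) -> eN * rho w * eN = rho g * eN.
Proof.
move=> Mw Ng h; apply: eN_agree => n Nn.
have Mn := NM Nn; have Mg := NM Ng.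
rewrite opM !rhoE//; apply/eqP; rewrite -subr_eq0 -(eN_vec (vnM hN Nn Ng)) -opBx.
apply/eqP; case: eN_spec => _ _ _ _; apply => _ [n' Nn' <-].
have Mn' := NM Nn'; have Mna := vn_adj hM Mn'.
rewrite -vecB; [|exact: vnM|exact: vnM]; rewrite vec_dot//; last by apply: vnB => //; exact: vnM.
rewrite -mulrBr mulrA mulrBr (trB ht) h ?subrr//.
by apply: vnM => //; exact: vn_adj.
Qed.

(** * The Pimsner-Popa inequality from a trace on the commutant *)

Section FiniteIndex.
Variable s : bop K -> R[i].
Hypothesis hs : tracial commN s.
Hypothesis uniqN : forall f : bop H -> R[i],
  (forall (z : R[i]) a b, el N a -> el N b -> f (z *: a + b) = z * f a + f b) ->
  (forall a b, el N a -> el N b -> f (a * b) = f (b * a)) ->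
  (exists2 C : R, 0 <= C & forall a (r : R), el N a -> 0 <= r -> bnd a r ->
     cabs (f a) <= C * r) ->
  forall a, el N a -> f a = t a * f 1.
Hypothesis uniqM : forall f : bop H -> R[i],
  (forall (z : R[i]) a b, el M a -> el M b -> f (z *: a + b) = z * f a + f b) ->
  (forall a b, el M a -> el M b -> f (a * b) = f (b * a)) ->
  (exists2 C : R, 0 <= C & forall a (r : R), el M a -> 0 <= r -> bnd a r ->
     cabs (f a) <= C * r) ->
  forall a, el M a -> f a = t a * f 1.

(** [g |-> s (rho g * eN)] is a bounded tracial functional on [N], as [rho g] commutes with [eN];
    uniqueness of the trace identifies it. *)
Let sE g : el N g -> s (rho g * eN) = t g * s eN.
Proof.
move=> Ng; rewrite (uniqN (f := fun g => s (rho g * eN)))// ?rho1 ?mul1r//.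
- move=> z a b Na Nb; rewrite rhoL; [|exact: NM|exact: NM].
  by rewrite mulrDl scaleMl (tr_lin hs).
- move=> a b Na Nb; have Ma := NM Na; have Mb := NM Nb.
  have [Pa Pb] := (P_rho Ma, P_rho Mb); have Pe := eN_P.
  rewrite !rhoM// -mulrA -(eN_rho Na) mulrA (trC hs) ?mulrA//.
  exact: vnM vnPN Pb Pe.
have [C C0 hC] := tr_bnd hs; exists C => // a r Na r0 hr.
apply: hC => //; rewrite -[r]mulr1; apply: bndM => //; last exact: proj_bnd eN_proj.
by apply: rho_bnd => //; exact: NM.
Qed.

Let sM m : el M m -> s (rho m) = t m.
Proof.
move=> Mm; rewrite (uniqM (f := fun g => s (rho g)))// ?rho1 ?(tr1 hs) ?mulr1//.
- by move=> z a b Ma Mb; rewrite rhoL// (tr_lin hs).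
- by move=> a b Ma Mb; rewrite !rhoM// (trC hs)//; exact: P_rho.
have [C C0 hC] := tr_bnd hs; exists C => // a k Ma k0 hk.
by apply: hC => //; exact: rho_bnd.
Qed.

(** For [B = rho x * eN] with [x * x = y], the product [adj B * B] is [rho h * eN], hence
    [B * adj B <= c]. Compressing by [rho m] and applying [s] gives
    [lam t (m y adj m) <= c t (m adj m)] for every [m], and [pos_of_trace] concludes. *)
Lemma pimsner_popa y h (c : R) : el M y -> el N h -> 0 <= c -> pos y -> pos h ->
  (forall n, el N n -> t (n * y) = t (n * h)) -> bnd h c ->
  pos (c%:B - (complex.Re (s eN))%:C *: y).
Proof.
move=> My Nh c0 py ph yh hc; have Mh := NM Nh.
have [x [Mx px x2]] := sqrt_vn hM My py; have sx := pos_adj px.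
have Prx := P_rho Mx; have Pe := eN_P; have srx : adj (rho x) = rho x.
  by rewrite -rhoJ// sx.
pose B := rho x * eN.
have PB : el commN B by exact: vnM vnPN Prx Pe.
have bB : bnd B (Num.sqrt c).
  apply: eN_bnd; first exact: sqrtr_ge0.
  move=> n Nn; have Mn := NM Nn; have Mn' := vn_adj hM Mn.
  apply: le_of_sqr; first by rewrite mulr_ge0 ?sqrtr_ge0 ?nm_ge0.
  rewrite exprMn sqr_sqrtr// rhoE// !vec_nm//; last exact: vnM.
  have -> : q2 t (n * x) = complex.Re (t (n * h * adj n)).
    rewrite /q2 adjM sx; congr complex.Re.
    have -> : x * adj n * (n * x) = x * (adj n * n * x) by rewrite !mulrA.
    rewrite (trC ht) //; last by apply: vnM => //; exact: vnM.
    rewrite -mulrA x2 yh; last by apply: vnM => //; exact: vn_adj.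
    by rewrite -mulrA (trC ht) ?mulrA//; exact: vnM.
  have -> : c * q2 t n = complex.Re (t (c%:C *: (n * adj n))).
    by rewrite (trZ ht) ReZ /q2 (trC ht Mn' Mn).
  apply: (tr_le hM ht); first by apply: vnM => //; exact: vnM.
    by apply: vnZ => //; exact: vnM.
  have -> : c%:C *: (n * adj n) - n * h * adj n = n * (c%:B - h) * adj n by bring.
  by apply: pos_conj'; apply: sa_bnd_pos => //; exact: pos_adj.
have pB : pos (c%:B - B * adj B).
  apply: sa_bnd_pos; first by rewrite adjM adjK.
  by rewrite -(sqr_sqrtr c0) -{1}[B]adjK; apply: bnd_sqr (sqrtr_ge0 _) (bnd_adj bB).
set lam := complex.Re (s eN).
apply: (pos_of_trace hM ht).
- by apply: vnB => //; apply: vnZ => //; exact: vn1.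
- by rewrite adjB !adjZr adj1 (pos_adj py).
move=> m Mm; have Mm' := vn_adj hM Mm.
have Pm := P_rho Mm; have Pm' := P_rho Mm'; have PB' := vn_adj vnPN PB.
have rm : adj (rho m) = rho (adj m) by rewrite rhoJ.
have h1 : 0 <= complex.Re (s (adj (rho m) * (c%:B - B * adj B) * rho m)).
  apply/Re_ge0/(tr_pos vnPN hs); last exact: pos_conj.
  rewrite rm; apply: (vnM vnPN) => //; apply: (vnM vnPN) => //.
  apply: (vnB vnPN); first by apply: (vnZ _ vnPN); exact: vn1 vnPN.
  exact: vnM vnPN PB PB'.
(* By the trace property the term with [B] becomes [s (eN * rho w * eN)], which [eN_compress] and
   [sE] evaluate as [lam * t w]; and [t w = t (m y adj m)]. *)
pose w := x * adj m * m * x.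
have Mw : el M w by apply: vnM => //; apply: vnM => //; exact: vnM.
have pw : pos w.
  have -> : w = adj (m * x) * (m * x) by rewrite adjM sx /w !mulrA.
  exact: pos_adjM.
have [g [Ng pg hg']] := rn hN hM ht NM Mw pw.
have e1 : s (adj (rho m) * (B * adj B) * rho m) = (lam%:C * t w).
  have -> : adj (rho m) * (B * adj B) * rho m = (rho (adj m) * B) * (adj B * rho m).
    by rewrite rm !mulrA.
  rewrite (trC hs); [|exact: vnM vnPN Pm' PB|exact: vnM vnPN PB' Pm].
  have -> : adj B * rho m * (rho (adj m) * B) = eN * rho w * eN.
    rewrite /B adjM (proj_adj eN_proj) srx /w.
    rewrite (rhoM (vnM hM (vnM hM Mx Mm') Mm) Mx) (rhoM (vnM hM Mx Mm') Mm).
    by rewrite (rhoM Mx Mm') !mulrA.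
  rewrite (eN_compress Mw Ng hg') sE//.
  have -> : t g = t w by have := hg' 1 (vn1 hN); rewrite !mul1r.
  by rewrite mulrC /lam -ge0_ReC//; apply: (tr_pos vnPN hs) eN_P (proj_pos eN_proj).
have e2 : s (adj (rho m) * c%:B * rho m) = c%:C * t (m * adj m).
  rewrite scaleMr mulr1 scaleMl (trZ hs) rm -(rhoM Mm Mm') sM//; exact: vnM.
have e3 : t (m * (c%:B - lam%:C *: y) * adj m) = c%:C * t (m * adj m) - lam%:C * t w.
  rewrite mulrBr mulrBl (trB ht) !scaleMr mulr1 !scaleMl !(trZ ht); congr (_ - _ * _).
  rewrite -x2 /w.
  have -> : m * (x * x) * adj m = (m * x) * (x * adj m) by rewrite !mulrA.
  by rewrite (trC ht) ?mulrA//; exact: vnM.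
by rewrite e3 -e2 -e1 -(trB hs) -mulrBl -mulrBr.
Qed.

Lemma eN_trace_gt0 : 0 < complex.Re (s eN).
Proof.
apply: (proj_tr_gt0 vnPN hs eN_P eN_proj) => e0.
have := eN_vec (vn1 hN); rewrite e0 op0 => h.
have := vec_nm (vn1 hM); rewrite -h nm0 /q2 adj1 mulr1 (tr1 ht) expr0n /= => /eqP.
by rewrite eq_sym oner_eq0.
Qed.

End FiniteIndex.
End GNS.

(** * A trace on the relative commutant *)

Section RelativeCommutant.
Context {R : realType} {H K : hilbertType R}.
Implicit Types (a b c m n x y : bop H) (S T : bop K) (k : K).
Variables (M N : set (bop H)) (t : bop H -> R[i]) (pi : bop H -> bop K) (Om : K).
Hypotheses (hM : vn M) (ht : tracial M t) (hg : gns M t pi Om).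
Hypotheses (hN : vn N) (NM : forall a, el N a -> el M a).

Local Notation V := (vec pi Om).
Local Notation rh := (rho hM ht hg).
Local Notation e := (eN hM hg hN NM).
Local Notation PN := (commN pi N).

Lemma vec1 : V 1 = Om.
Proof. by rewrite /vec (pi1 hg). Qed.

Lemma vecJ T n : el PN T -> el N n -> T (V n) = pi n (T Om).
Proof. by move=> PT Nn; rewrite -opM (PP_comm PT Nn). Qed.

Lemma nm_clo_VN k (r : R) : 0 <= r -> clo (VN pi Om N) k ->
  (forall n, el N n -> cabs (hdot k (V n)) <= r * nm (V n)) -> nm k <= r.
Proof.
move=> r0 hk h; apply: le_eps => d d0.
have [->|k0] := eqVneq (nm k) 0; first by rewrite addr_ge0// ltW.
have kp : 0 < nm k by rewrite lt0r k0 nm_ge0.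
pose u := d * nm k / (nm k + r + 1).
have s0 : 0 < nm k + r + 1 by lra.
have u0 : 0 < u by rewrite divr_gt0// mulr_gt0.
have uE : u * (nm k + r + 1) = d * nm k by rewrite /u divfK// gt_eqF.
have [_ [n Nn <-] hn] := hk u u0.
have h1 : nm k ^+ 2 <= cabs (hdot k (V n)) + cabs (hdot k (k - V n)).
  have -> : nm k ^+ 2 = cabs (hdot k (V n) + hdot k (k - V n)).
    rewrite -hdotDr (_ : V n + (k - V n) = k); last by lmod.
    by rewrite hdotxx cabs_real ger0_norm// exprn_ge0 ?nm_ge0.
  exact: cabsD.
have h2 := CS k (k - V n); have h3 := h n Nn.
have h4 : nm (V n) <= nm k + nm (k - V n).
  by rewrite {1}(_ : V n = k - (k - V n)) ?(le_trans (nmD _ _)) ?nmN//; lmod.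
clearbody u; rewrite -(ler_pM2r kp).
have {}hn : nm (k - V n) <= u by exact: hn.
have := nm_ge0 (k - V n); move: hn h1 h2 h3 h4.
set q := nm (k - V n); set w := nm (V n); set A := cabs _; set B := cabs _.
move=> hn h1 h2 h3 h4 q0.
have : r * w <= r * (nm k + q) by rewrite ler_wpM2l//.
have : nm k * q <= nm k * u by exact: (ler_wpM2l (nm_ge0 k)).
have : r * q <= r * u by exact: ler_wpM2l.
nra.
Qed.

(** [e (T Om)] is approximated by some [V n] with [n] in [N]. Since [V n |-> V (adj n)] is
    isometric, [V (adj n)] approximates [e (adj T Om)] equally well. Both sides are then close to
    [<V n, adj S Om> = <S Om, V (adj n)>]. *)
Lemma exchange S T : el PN S -> el PN T ->
  hdot ((S * e * T) Om) Om = hdot ((T * e * S) Om) Om.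
Proof.
move=> PS PT; have hP := vnPN hg hN NM.
have [ee se ec ef eo] := eN_spec hM hg hN NM.
have PT' := vn_adj hP PT.
apply/eqP; rewrite -subr_eq0; apply/eqP/cabs_eq0/eqP.
rewrite eq_le cabs_ge0 andbT; apply: le_eps => d d0; rewrite add0r.
pose c := nm (adj S Om) + nm (S Om) + 1.
have c0 : 0 < c by rewrite ltr_wpDl// addr_ge0// nm_ge0.
have dc0 : 0 < d / c by rewrite divr_gt0.
have dcE : d / c * c = d by rewrite divfK// gt_eqF.
have [_ [n Nn <-] hn] := ec (T Om) (d / c) dc0.
have Nn' := vn_adj hN Nn; have Mn := NM Nn; have Mn' := NM Nn'.
have hn' : nm (e (adj T Om) - V (adj n)) <= d / c.
  apply: nm_clo_VN; first exact: ltW.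
    have hcl := lsub_clo (VN_sub hM hg hN NM).
    have hn0 : clo (VN pi Om N) (V (adj n)) by apply: sub_clo; exists (adj n).
    exact: (lsubB hcl (ec _) hn0).
  move=> m Nm; have Nm' := vn_adj hN Nm; have Mm := NM Nm; have Mm' := NM Nm'.
  have -> : hdot (e (adj T Om) - V (adj n)) (V m) = hdot (V (adj m)) (e (T Om) - V n).
    rewrite hdotBl hdotBr; congr (_ - _).
      rewrite -[in LHS]se adjPr (eN_vec hM hg hN NM Nm) adjPr (vecJ PT Nm).
      rewrite -[in RHS]se -adjP (eN_vec hM hg hN NM Nm').
      by rewrite -adjPr -(piJ hg)//.
    rewrite !(vec_dot hM hg)//; exact: (trC ht).
  rewrite (le_trans (CS _ _))// mulrC.
  have -> : nm (V (adj m)) = nm (V m).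
    apply/eqP; rewrite -(@eqrXn2 _ 2) ?nm_ge0//.
    by rewrite !(vec_nm hM hg)// (q2_adj hM ht).
  by rewrite ler_wpM2r ?nm_ge0.
have e1 : hdot ((S * e * T) Om) Om = hdot (e (T Om) - V n) (adj S Om) + hdot (V n) (adj S Om).
  by rewrite hdotBl subrK !opM adjP.
have e2 : hdot ((T * e * S) Om) Om =
    hdot (S Om) (e (adj T Om) - V (adj n)) + hdot (S Om) (V (adj n)).
  by rewrite hdotBr subrK !opM adjP adjP se.
have e3 : hdot (V n) (adj S Om) = hdot (S Om) (V (adj n)).
  by rewrite -adjP (vecJ PS Nn) -[in LHS](adjK n) (piJ hg)// adjPr.
have -> : hdot ((S * e * T) Om) Om - hdot ((T * e * S) Om) Om =
  hdot (e (T Om) - V n) (adj S Om) - hdot (S Om) (e (adj T Om) - V (adj n)).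
  by rewrite e1 e2 e3; ring.
rewrite (le_trans (cabsD _ _))// cabsN.
have h1 := CS (e (T Om) - V n) (adj S Om).
have h2 := CS (S Om) (e (adj T Om) - V (adj n)).
have := nm_ge0 (adj S Om); have := nm_ge0 (S Om).
move: h1 h2 hn hn' dcE; rewrite /c; set q := d / _.
set x1 := nm (e (T Om) - V n); set x2 := nm (e (adj T Om) - _).
set z1 := nm (adj S Om); set z2 := nm (S Om); set A := cabs _; set B := cabs _.
move=> h1 h2 hn hn' qE g2 g1.
have : x1 * z1 <= q * z1 by rewrite ler_wpM2r//.
have : z2 * x2 <= z2 * q by rewrite ler_wpM2l//.
move: dc0; rewrite -/c -/q; nra.
Qed.

Hypothesis uniqN : forall f : bop H -> R[i],
  (forall (z : R[i]) a b, el N a -> el N b -> f (z *: a + b) = z * f a + f b) ->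
  (forall a b, el N a -> el N b -> f (a * b) = f (b * a)) ->
  (exists2 C : R, 0 <= C & forall a (r : R), el N a -> 0 <= r -> bnd a r ->
     cabs (f a) <= C * r) ->
  forall a, el N a -> f a = t a * f 1.

Lemma nm_V1 : hdot (V 1) (V 1) = 1.
Proof. by rewrite (vec_dot hM hg) ?adj1 ?mulr1 ?(tr1 ht)//; exact: vn1. Qed.

(** For a central projection [z], the functional [a |-> <z (V a), Om>] is tracial on [N], hence
    [c t]. This forces [z Om = c Om], and [z] commutes with right multiplications, so [z] is the
    scalar [c]. *)
Lemma fprop_P : fprop PN.
Proof.
have hP := vnPN hg hN NM; have M1 := vn1 hM; have N1 := vn1 hN.
have [ee se ec ef eo] := eN_spec hM hg hN NM.
apply: fprop_of_center => // z [zz sz] Pz Cz.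
pose f a := hdot (z (V a)) Om; pose c := f 1.
have hf : forall a, el N a -> f a = t a * c.
  apply: uniqN.
  - by move=> w a b Na Nb; rewrite /f (vecL hg) ?bop_linear ?hdotDl ?hdotZl//; exact: NM.
  - move=> a b Na Nb; have Ma := NM Na; have Mb := NM Nb; rewrite /f.
    rewrite -(rhoE hM ht hg Mb Ma) -opM -(Cz _ (P_rho hM ht hg NM Mb)) opM.
    have := rhoE hM ht hg (vn_adj hM Mb) M1; rewrite vec1 mul1r => rb.
    rewrite adjP -(rhoJ hM ht hg Mb) rb /vec (piJ hg)// -adjP -/(V a) -opM.
    by rewrite (PP_comm Pz Nb) opM (pi_vec hg).
  exists (nm Om * nm Om); first by rewrite mulr_ge0 ?nm_ge0.
  move=> a r Na r0 ha; have Ma := NM Na.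
  rewrite /f (le_trans (CS _ _))// mulrAC ler_wpM2r ?nm_ge0//.
  have zb := proj_bnd (conj zz sz); rewrite (le_trans (zb _))// mul1r mulrC.
  have := rho_bnd hM ht hg Ma r0 ha (V 1).
  by rewrite (rhoE hM ht hg)// mul1r vec1.
have zOm : z (V 1) = c *: V 1.
  apply/eqP; rewrite -subr_eq0; apply/eqP; set w := z (V 1) - _.
  have we : e w = w.
    rewrite /w opBx opZx (eN_vec hM hg hN NM N1); congr (_ - _).
    by rewrite -opM (Cz _ (eN_P hM hg hN NM)) opM (eN_vec hM hg hN NM N1).
  rewrite -we; apply: eo => _ [m Nm <-]; have Nm' := vn_adj hN Nm; have Mm := NM Nm.
  have Mm' := NM Nm'; rewrite -/(V m) /w hdotBl hdotZl.
  have -> : hdot (z (V 1)) (V m) = f (adj m).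
    have e1 : V (adj m) = pi (adj m) (V 1) by rewrite (pi_vec hg) ?mulr1.
    by rewrite /f e1 -opM -(PP_comm Pz Nm') opM (piJ hg)// adjPr.
  by rewrite hf// (vec_dot hM hg)// mulr1 [c * _]mulrC subrr.
have zM m : el M m -> z (V m) = c *: V m.
  move=> Mm; have -> : V m = rh m (V 1) by rewrite (rhoE hM ht hg)// mul1r.
  by rewrite -opM -(Cz _ (P_rho hM ht hg NM Mm)) opM zOm opZx.
have cc : c * c = c.
  have : z (z (V 1)) = z (V 1) by rewrite -opM zz.
  rewrite {1}zOm opZx zOm scalerA => /(congr1 (fun k => hdot k (V 1))).
  by rewrite !hdotZl nm_V1 !mulr1.
have [c0|c1] : c = 0 \/ c = 1.
  have /eqP : c * (c - 1) = 0 by rewrite mulrBr cc mulr1 subrr.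
  by rewrite mulf_eq0 subr_eq0 => /orP[/eqP ->|/eqP ->]; [left|right].
  by left; apply: (eq_dense hg) => m Mm; rewrite zM// c0 scale0r op0.
by right; apply: (eq_dense hg) => m Mm; rewrite zM// c1 scale1r op1.
Qed.

Lemma P_separating T : el PN T -> T * e = T -> T Om = 0 -> T = 0.
Proof.
move=> PT Te h; rewrite -Te -[RHS](mul0r e); apply: eN_agree => n Nn.
by rewrite (vecJ PT Nn) h op0x op0.
Qed.

(** Comparison with [T |-> <T Om, Om>] as the functional: by [P_separating] it is positive on
    nonzero projections below [e], which is all that is required. *)
Lemma compare_eN f : el M f -> proj f -> exists v, [/\ el PN v, v * e = v,
  rh f * v = v & adj v * v = e \/ v * adj v = rh f].
Proof.
move=> Mf hf; have hP := vnPN hg hN NM.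
have prf : proj (rh f).
  by split; rewrite -?rhoJ// -?rhoM// ?(proj_idem hf) ?(proj_adj hf).
apply: (@comparison R K PN e (rh f) (fun T => complex.Re (hdot (T Om) Om)) (nm Om ^+ 2)) => //.
- exact: fprop_P.
- exact: eN_P.
- exact: P_rho.
- exact: eN_proj.
- by move=> S T; rewrite opD hdotDl ReD.
- move=> p _ hp; rewrite Re_ge0/=; last exact: proj_pos.
  rewrite (le_trans (Re_le_cabs _))// (le_trans (CS _ _))// expr2 ler_wpM2r ?nm_ge0//.
  by have := proj_bnd hp Om; rewrite mul1r.
move=> p Pp hp pe p0; rewrite lt0r Re_ge0 ?andbT; last exact: proj_pos.
apply/eqP => h; apply: p0; apply: P_separating => //.
apply: pos_ker; first exact: proj_pos.
by rewrite (ge0_ReC (proj_pos hp Om)) h.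
Qed.

Hypothesis hfM : fprop M.

(** Copies of [f] are split off from [r] as long as one fits; the final remainder is equivalent to a
    part of [f]. The trace of [f] bounds the number of copies. *)
Lemma cover f : el M f -> proj f -> f <> 0 -> forall r, el M r -> proj r ->
  exists ws : seq (bop H), (forall w, w \in ws -> el M w /\ w * f = w) /\
    \sum_(w <- ws) w * adj w = r.
Proof.
move=> Mf hf f0 r Mr hr; have tf := proj_tr_gt0 hM ht Mf hf f0.
have [n hn] : exists n : nat, complex.Re (t r) <= n%:R * complex.Re (t f).
  exists (Num.truncn (complex.Re (t r) / complex.Re (t f))).+1.
  by rewrite -ler_pdivrMr// ltW// truncnS_gt.
elim: n r Mr hr hn => [|n IH] r Mr hr hn.
  exists [::]; split=> //; rewrite big_nil; symmetry; apply: contrapT => r0.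
  by have := proj_tr_gt0 hM ht Mr hr r0; move: hn; rewrite mul0r; lra.
have [v [Mv vf rv [h|h]]] := tr_compare hM ht hfM Mf Mr hf hr; last first.
  exists [:: v]; split; first by move=> w; rewrite inE => /eqP ->.
  by rewrite big_seq1.
have Mv' := vn_adj hM Mv; have pv : piso v by apply: proj_piso; rewrite h.
have rvv : r * (v * adj v) = v * adj v by rewrite mulrA rv.
have Mr' : el M (r - v * adj v) by apply: vnB => //; exact: vnM.
have hr' := projB hr (piso_final pv) rvv.
have [|ws [h1 h2]] := IH _ Mr' hr'.
  by rewrite (trB ht) ReB (trC ht Mv Mv') h; move: hn; rewrite -natr1; lra.
exists (v :: ws); split; last by rewrite big_cons h2 addrC subrK.
by move=> w; rewrite inE => /orP[/eqP ->|/h1].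
Qed.

Definition vtrace (zs : seq K) T : R[i] := \sum_(z <- zs) hdot (T z) z.

(* If [rho f] is dominated by [e], finitely many translates of [e] cover the
   identity and the corresponding vectors implement a finite trace. *)
Lemma build_trace f v : el M f -> proj f -> f <> 0 -> el PN v -> v * e = v ->
  v * adj v = rh f ->
  exists zs : seq K, [/\ vtrace zs 1 = 1,
    forall S T, el PN S -> el PN T -> vtrace zs (S * T) = vtrace zs (T * S)
  & forall T, el PN T -> vtrace zs (adj T * T) = 0 -> T = 0].
Proof.
move=> Mf hf f0 Pv ve vv; have hP := vnPN hg hN NM; have M1 := vn1 hM.
have [ws [hws sws]] := cover Mf hf f0 M1 (@proj_one _ _).
(* [rho] reverses products, so [u w * adj (u w) = rh (w * f * adj w) = rh (w * adj w)]; these add up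
   to 1, and every [u w] starts below [e]. *)
pose u w := rh (adj w) * v.
have Pu w : w \in ws -> el PN (u w).
  by move=> /hws[Mw _]; exact: vnM hP (P_rho hM ht hg NM (vn_adj hM Mw)) Pv.
have ue w : u w * e = u w by rewrite /u -mulrA ve.
have su : \sum_(w <- ws) u w * adj (u w) = 1.
  rewrite -(rho1 hM ht hg) -sws.
  have rs : rh (\sum_(w <- ws) w * adj w) = \sum_(w <- ws) rh (w * adj w).
    have r0 : rh 0 = 0.
      have := rhoL hM ht hg (-1) (vn0 hM) (vn0 hM).
      by rewrite scaler0 addr0 scaleN1r addNr.
    elim: ws hws {sws Pu} => [|w l IH] hl; first by rewrite !big_nil.
    have Ml : el M (\sum_(j <- l) j * adj j).
      rewrite big_seq; apply: vn_sum => // j jl.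
      have [Mj _] := hl j (mem_behead (s := w :: l) jl).
      by apply: vnM => //; exact: vn_adj.
    have [Mw _] := hl w (mem_head _ _).
    have Mww : el M (w * adj w) by apply: vnM => //; exact: vn_adj.
    rewrite !big_cons -IH; last by move=> j jl; apply: hl; rewrite inE jl orbT.
    by have := rhoL hM ht hg 1 Mww Ml; rewrite !scale1r.
  rewrite rs big_seq [RHS]big_seq; apply: eq_bigr => w /hws[Mw wf].
  have Mw' := vn_adj hM Mw.
  rewrite /u adjM -(rhoJ hM ht hg Mw') adjK mulrA -[_ * v * adj v]mulrA vv.
  by rewrite -!rhoM// ?mulrA ?wf//; exact: vnM.
pose zs0 := [seq u w Om | w <- ws].
have tr0 T : vtrace zs0 T = \sum_(w <- ws) hdot ((adj (u w) * T * u w) Om) Om.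
  rewrite /vtrace big_map; apply: eq_bigr => w _.
  by rewrite !opM adjPr.
have tr_pos T : 0 <= vtrace zs0 (adj T * T).
  rewrite /vtrace sumr_ge0// => z _; rewrite opM adjPr hdotxx lecR.
  by rewrite exprn_ge0 ?nm_ge0.
have faith T : el PN T -> vtrace zs0 (adj T * T) = 0 -> T = 0.
  move=> PT h.
  have hz w : w \in ws -> T * u w = 0.
    move=> hw; apply: (P_separating (vnM hP PT (Pu _ hw))); first by rewrite -mulrA ue.
    apply/nm_eq0/eqP; rewrite -sqrf_eq0; apply/eqP/complexI; rewrite -hdotxx.
    have /eqP := h; rewrite /vtrace big_map psumr_eq0; last first.
      move=> j _; rewrite opM adjPr hdotxx lecR.
      by rewrite exprn_ge0 ?nm_ge0.
    by move=> /allP/(_ w hw)/= /eqP; rewrite opM adjPr -opM.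
  rewrite -[T]mulr1 -su mulr_sumr big_seq big1// => w hw.
  by rewrite mulrA hz// mul0r.
have tr_comm S T : el PN S -> el PN T -> vtrace zs0 (S * T) = vtrace zs0 (T * S).
  move=> PS PT.
  (* Inserting [1 = \sum_j u j * e * adj (u j)] between the factors gives terms to which [exchange]
     applies. *)
  have ex A B : el PN A -> el PN B -> vtrace zs0 (A * B) =
     \sum_(w <- ws) \sum_(j <- ws)
        hdot ((adj (u w) * A * u j * e * (adj (u j) * B * u w)) Om) Om.
    move=> PA PB; rewrite tr0; apply: eq_bigr => w _.
    rewrite -hdot_suml -op_sum; congr (hdot (opval _ Om) Om).
    rewrite -[A * B]/(A * B) -{1}[A]mulr1 -su mulr_sumr mulr_suml mulr_sumr mulr_suml.
    apply: eq_bigr => j _; rewrite -[adj (u w) * A * u j * e]mulrA ue.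
    by rewrite !mulrA.
  rewrite ex// [RHS]ex// exchange_big.
  rewrite big_seq [RHS]big_seq; apply: eq_bigr => w hw.
  rewrite big_seq [RHS]big_seq; apply: eq_bigr => j hj.
  have [Pw Pj] := (Pu _ hj, Pu _ hw).
  have [Pw' Pj'] := (vn_adj hP Pw, vn_adj hP Pj).
  have P1 := vnM hP (vnM hP Pw' PS) Pj; have P2 := vnM hP (vnM hP Pj' PT) Pw.
  by have := exchange P1 P2; rewrite !mulrA => ->.
have c_ge0 : 0 <= vtrace zs0 1 by have := tr_pos 1; rewrite adj1 mulr1.
pose c := complex.Re (vtrace zs0 1).
have cE : vtrace zs0 1 = c%:C by exact: ge0_ReC.
have c0 : 0 < c.
  rewrite lt0r Re_ge0// andbT; apply/eqP => h.
  have : (1 : bop K) = 0.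
    apply: faith; first exact: vn1.
    by rewrite adj1 mulr1 cE h.
  move=> /(congr1 (fun T : bop K => hdot (T (V 1)) (V 1))).
  by rewrite op1 op0 hdot0l nm_V1 => /eqP; rewrite oner_eq0.
(* Scaling every vector by [s] multiplies the functional by [s ^+ 2 = 1 / c], which makes it a
   state. *)
pose s := (Num.sqrt c)^-1.
have ss : s ^+ 2 * c = 1 by rewrite /s exprVn sqr_sqrtr ?mulVf ?gt_eqF// ltW.
exists [seq s%:C *: z | z <- zs0].
have E T : vtrace [seq s%:C *: z | z <- zs0] T = (s ^+ 2)%:C * vtrace zs0 T.
  rewrite /vtrace big_map mulr_sumr; apply: eq_bigr => z _.
  by rewrite opZx hdotZl hdotZr conjc_real mulrA -rmorphM expr2.
split.
- by rewrite E cE -rmorphM ss.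
- by move=> S T PS PT; rewrite !E tr_comm.
move=> T PT; rewrite E => /eqP; rewrite mulf_eq0 => /orP[/eqP[] h|/eqP /(faith _ PT)//].
by have := ss; rewrite h mul0r => /eqP; rewrite eq_sym oner_eq0.
Qed.

End RelativeCommutant.

(** * C*-irreducibility *)

Section NormClosed.
Context {R : realType} {H : hilbertType R}.
Local Notation bop := (bop H).
Implicit Types (a b c f n p q u x y : bop) (A D I S : set bop).

Definition ncl S : set bop :=
  [set a | forall e : R, 0 < e -> exists2 b, el S b & bnd (a - b) e].

Definition bsubspace S := el S 0 /\
  forall (z : R[i]) a b, el S a -> el S b -> el S (z *: a + b).

Definition cstar D := [/\ bsubspace D, forall a b, el D a -> el D b -> el D (a * b),
  star D & forall a, el (ncl D) a -> el D a].

Definition ideal D I := [/\ forall a, el I a -> el D a, bsubspace I,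
  forall a b, el D a -> el I b -> el I (a * b) /\ el I (b * a)
  & forall a, el (ncl I) a -> el I a].

Definition simple D := forall I, ideal D I ->
  (forall a, el I a -> a = 0) \/ (forall a, el D a -> el I a).

Definition simple_inclusion B A := forall D, cstar D ->
  (forall a, el B a -> el D a) -> (forall a, el D a -> el A a) -> simple D.

Lemma bsubspaceD S a b : bsubspace S -> el S a -> el S b -> el S (a + b).
Proof. by move=> [_ h] Sa Sb; rewrite -[a]scale1r; exact: h. Qed.

Lemma bsubspaceZ S (z : R[i]) a : bsubspace S -> el S a -> el S (z *: a).
Proof. by move=> [h0 h] Sa; rewrite -[_ *: _]addr0; exact: h. Qed.

Lemma sub_ncl S a : el S a -> el (ncl S) a.
Proof. by move=> Sa e e0; exists a => //; rewrite subrr; apply: bnd0; exact: ltW. Qed.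

Lemma ncl_ncl S a : el (ncl (ncl S)) a -> el (ncl S) a.
Proof.
move=> h e e0; have e2 : 0 < e / 2 by lra.
have [b hb ab] := h _ e2; have [c Sc bc] := hb _ e2; exists c => //.
have -> : a - c = (a - b) + (b - c) by lmod.
by have -> : e = e / 2 + e / 2 by [lra]; exact: bndD.
Qed.

Lemma bsubspace_ncl S : bsubspace S -> bsubspace (ncl S).
Proof.
move=> hS; split; first by apply: sub_ncl; case: hS.
move=> z a b ha hb e e0.
have c0 : 0 < cabs z + 1 by have := cabs_ge0 z; lra.
have e1 : 0 < e / 2 / (cabs z + 1) by rewrite !divr_gt0.
have e2 : 0 < e / 2 by lra.
have [a' Sa aa] := ha _ e1; have [b' Sb bb] := hb _ e2.
exists (z *: a' + b'); first by case: hS => _; apply.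
have -> : z *: a + b - (z *: a' + b') = z *: (a - a') + (b - b') by lmod.
apply: (bnd_le _ (bndD (bndZ z aa) bb)).
have : cabs z * (e / 2 / (cabs z + 1)) <= e / 2.
  by rewrite mulrA ler_pdivrMr// [X in X <= _]mulrC ler_wpM2l//; lra.
by lra.
Qed.

Lemma ncl_mull S D x : (forall a, el S a -> el D (x * a)) ->
  forall a, el (ncl S) a -> el (ncl D) (x * a).
Proof.
move=> h a ha e e0; have [k k0 xk] := bop_bnd x.
have k1 : 0 < k + 1 by lra.
have [b Sb ab] := ha (e / (k + 1)) (divr_gt0 e0 k1).
exists (x * b); first exact: h.
rewrite -mulrBr; apply: (bnd_le _ (bndM k0 xk ab)).
by rewrite mulrA ler_pdivrMr// [X in X <= _]mulrC ler_wpM2l// ?(ltW e0)//; lra.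
Qed.

Lemma ncl_adj S D : (forall a, el S a -> el D (adj a)) ->
  forall a, el (ncl S) a -> el (ncl D) (adj a).
Proof.
move=> h a ha e e0; have [b Sb ab] := ha e e0.
by exists (adj b); [exact: h|rewrite -adjB; exact: bnd_adj].
Qed.

Lemma ncl_mulr S D x : (forall a, el S a -> el D (a * x)) ->
  forall a, el (ncl S) a -> el (ncl D) (a * x).
Proof.
move=> h a ha e e0; have [k k0 xk] := bop_bnd x.
have k1 : 0 < k + 1 by lra.
have ek : 0 < e / (k + 1) by rewrite divr_gt0.
have [b Sb ab] := ha _ ek; exists (b * x); first exact: h.
rewrite -mulrBl; apply: (bnd_le _ (bndM (ltW ek) ab xk)).
by rewrite mulrAC ler_pdivrMr// ler_wpM2l// ?(ltW e0)//; lra.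
Qed.

Lemma ncl_mul S : (forall a b, el S a -> el S b -> el S (a * b)) ->
  forall a b, el (ncl S) a -> el (ncl S) b -> el (ncl S) (a * b).
Proof.
move=> h a b ha hb; apply: ncl_ncl; move: b hb.
apply: ncl_mull => b Sb; move: a ha; apply: ncl_mulr => a Sa; exact: h.
Qed.

Lemma vn_closed A a : vn A -> el (ncl A) a -> el A a.
Proof.
move=> hA ha; apply/(vnP hA) => b hb.
apply/eqP; rewrite -subr_eq0; apply/eqP/bnd0_eq0/bnd_eps => e e0; rewrite add0r.
have [k k0 bk] := bop_bnd b.
have k1 : 0 < 2 * k + 1 by lra.
have ek : 0 < e / (2 * k + 1) by rewrite divr_gt0.
have [c Ac ac] := ha _ ek.
have bc : b * c = c * b by exact: ((vnP hA c).1 Ac).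
have -> : b * a - a * b = b * (a - c) - (a - c) * b by rewrite ?bexp bc; lmod.
have := bndB (bndM k0 bk ac) (bndM (ltW ek) ac bk); apply: bnd_le.
have -> : k * (e / (2 * k + 1)) + e / (2 * k + 1) * k = e * (2 * k) / (2 * k + 1) by field; lra.
by rewrite ler_pdivrMr// ler_wpM2l// ?(ltW e0)//; lra.
Qed.

Lemma ideal_full D I : ideal D I -> el I 1 -> forall a, el D a -> el I a.
Proof. by move=> [_ _ h _] I1 a Da; rewrite -[a]mulr1; have [] := h _ _ Da I1. Qed.

Section Dixmier.
Variables (N M : set bop) (t : bop -> R[i]).
Hypotheses (hN : vn N) (hM : vn M) (ht : tracial M t).
Hypothesis NM : forall a, el N a -> el M a.

(** The trace is constant on the hull and norm continuous, so it determines the scalar; in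
    [dixmier_simple] this scalar is nonzero by faithfulness. *)
Lemma dixmier_scalar x (z : R[i]) : el M x ->
  (forall e : R, 0 < e -> exists2 b, hull N x b & bnd (b - z *: (1 : bop)) e) ->
  z = t x.
Proof.
move=> Mx h; apply/eqP; rewrite -subr_eq0; apply/eqP/cabs_eq0/eqP.
rewrite eq_le cabs_ge0 andbT; apply: le_eps => e e0; rewrite add0r.
have [C C0 hC] := tr_bnd ht.
have C1 : 0 < C + 1 by lra.
have ek : 0 < e / (C + 1) by rewrite divr_gt0.
have [b hb bz] := h _ ek.
have tb : t b = t x.
  by apply: (hull_tracial hM NM Mx) hb => *; [exact: (tr_lin ht)|exact: (trC ht)].
have := hC _ _ (ltW ek) bz; rewrite (trB ht) (trZ ht) (tr1 ht) tb mulr1 -cabsN opprB.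
move=> /le_trans; apply; rewrite mulrA ler_pdivrMr// [X in X <= _]mulrC.
by rewrite ler_wpM2l// ?(ltW e0)//; lra.
Qed.

Lemma dixmier_simple : (forall x, el M x -> exists z : R[i],
    forall e : R, 0 < e -> exists2 b, hull N x b & bnd (b - z *: (1 : bop)) e) ->
  simple_inclusion N M.
Proof.
move=> dix D [sD mD jD cD] ND DM I idl.
have [ID sI mI cI] := idl.
have [h|/existsNP[a /not_implyP[Ia /eqP a0]]] :=
  pselect (forall a, el I a -> a = 0); first by left.
right; apply: (ideal_full idl).
pose x := adj a * a.
have Ma : el M a by apply: DM; exact: ID.
have Ix : el I x by apply: (mI _ _ _ Ia).1; apply: jD; exact: ID.
have Mx : el M x by apply: DM; exact: ID.
have [z hz] := dix _ Mx; have zt := dixmier_scalar Mx hz.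
have z0 : z != 0.
  by apply: contra_neq a0 => zE; apply: (tr_faith ht Ma); rewrite -/x -zt zE.
have Iz : el I (z *: (1 : bop)).
  apply: cI => e e0; have [b hb bz] := hz e e0; exists b; last first.
    by rewrite -opprB; exact: bndN.
  apply: (hb I) => [u [Nu _ _]|r b1 b2 _ I1 I2].
    have Du := ND _ Nu.
    exact: (mI _ _ Du (mI _ _ (jD _ Du) Ix).1).2.
  by apply: sI.2 => //; exact: bsubspaceZ.
by rewrite -[1](scalerK z0); exact: bsubspaceZ.
Qed.

Lemma simple_irreducible : simple_inclusion N M ->
  forall y, el M y -> (forall a, el N a -> a * y = y * a) ->
  exists z : R[i], y = z *: (1 : bop).
Proof.
move=> simp.
have pr p : el M p -> proj p -> (forall a, el N a -> a * p = p * a) -> p = 0 \/ p = 1.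
  move=> Mp [pp sp] pN.
  pose D : set bop := [set d | el M d /\ d * p = p * d].
  pose I : set bop := [set d | el D d /\ d * p = d].
  have vD : vn (comm [set p]) by apply: vn_comm => _ ->; rewrite sp.
  have clD a : el (ncl D) a -> el D a.
    move=> ha; split.
      by apply: vn_closed => // e /ha[b [Mb _] ?]; exists b.
    have : el (comm [set p]) a; last by move=> /(_ p erefl).
    by apply: vn_closed => // e /ha[b [_ bp] ?]; exists b => // _ ->.
  have sD : bsubspace D.
    split; first by split; [exact: vn0|rewrite mulr0 mul0r].
    move=> z a b [Ma ap] [Mb bp]; split; first by apply: vnD => //; exact: vnZ.
    by rewrite mulrDl mulrDr scaleMl scaleMr ap bp.
  have cD : cstar D.
    split=> //.
      move=> a b [Ma ap] [Mb bp]; split; first exact: vnM.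
      by rewrite -mulrA bp mulrA ap mulrA.
    move=> a [Ma ap]; split; first exact: vn_adj.
    by have := congr1 adj ap; rewrite !adjM sp.
  have iI : ideal D I.
    split=> [a []//||a b Da [Db bp]|a ha].
    - split; first by split; [case: sD|rewrite mul0r].
      move=> z a b [Da ap] [Db bp]; split; first by apply: sD.2.
      by rewrite mulrDl scaleMl ap bp.
    - have [Ma ap] := Da; have [Mb bp'] := Db.
      have Dab : el D (a * b) by case: cD => _ h _ _; exact: h.
      have Dba : el D (b * a) by case: cD => _ h _ _; exact: h.
      by split; split=> //; rewrite -mulrA ?bp// ap mulrA bp.
    split; first by apply: clD => e /ha[b [Db _] ?]; exists b.
    apply/eqP; rewrite -subr_eq0; apply/eqP/bnd0_eq0/bnd_eps => e e0; rewrite add0r.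
    have e2 : 0 < e / 2 by lra.
    have [b [_ bp] ab] := ha _ e2.
    have -> : a * p - a = (a - b) * p - (a - b) by rewrite ?bexp bp; lmod.
    have -> : e = e / 2 * 1 + e / 2 by lra.
    apply: bndB => //; apply: bndM => //; first exact: ltW.
    exact: proj_bnd.
  have ND a : el N a -> el D a by move=> Na; split; [exact: NM|exact: pN].
  have [h|h] := simp D cD ND (fun a h => h.1) I iI.
    by left; apply: h; split.
  right; have D1 : el D 1 by apply: ND; exact: vn1.
  by have [_] := h _ D1; rewrite mul1r.
have sa y : el M y -> adj y = y -> (forall a, el N a -> a * y = y * a) ->
    exists z : R[i], y = z *: (1 : bop).
  move=> My sy yN; have tE := tr_sa hM ht My sy.
  set r := complex.Re (t y) in tE; exists r%:C.
  pose x := y - r%:B.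
  have M1 := vn1 hM.
  have Mx : el M x by apply: vnB => //; exact: vnZ.
  have sx : adj x = x by rewrite /x adjB adjZr adj1 sy.
  have tx : t x = 0 by rewrite (trB ht) (trZ ht) (tr1 ht) mulr1 tE subrr.
  (* [p] commutes with [N], so it is 0 or 1. Thus [y] minus its trace has a sign, and trace zero
     makes it vanish. *)
  have [p [pp pc p1 p2]] := spectral_cut sx.
  have Mp : el M p by exact: (vn_bicomm hM Mx).
  have pN a : el N a -> a * p = p * a.
    by move=> Na; symmetry; apply: pc; rewrite /x; rewrite ?bexp yN//; lmod.
  suff : x = 0 by move/eqP; rewrite subr_eq0 => /eqP.
  have [p0|pE] := pr p Mp pp pN.
    move: p2; rewrite p0 subr0 mulr1 => p2.
    apply/eqP; rewrite -oppr_eq0; apply/eqP; apply: (tr_pos_eq0 hM ht _ p2).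
      exact: vnN.
    by rewrite (trN ht) tx oppr0.
  by move: p1; rewrite pE mulr1 => p1; exact: (tr_pos_eq0 hM ht Mx p1 tx).
move=> y My yN; have My' := vn_adj hM My.
have yN' a : el N a -> a * adj y = adj y * a.
  by move=> Na; have := congr1 adj (yN _ (vn_adj hN Na)); rewrite !adjM adjK.
have [z1 h1] : exists z, y + adj y = z *: (1 : bop).
  apply: sa; first exact: vnD.
    by rewrite adjD adjK addrC.
  by move=> a Na; rewrite mulrDl mulrDr yN// yN'.
have [z2 h2] : exists z, 'i *: (y - adj y) = z *: (1 : bop).
  apply: sa; first by apply: vnZ => //; exact: vnB.
    rewrite adjZ adjB adjK (_ : conjc 'i = - 'i :> R[i]); last by apply/eqP; rewrite eq_complex /= oppr0 !eqxx.
    by lmod.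
  by move=> a Na; rewrite scaleMl scaleMr mulrDl mulrDr mulNr mulrN yN// yN'.
exists (2^-1 * (z1 - 'i * z2)); rewrite -scalerA scalerBl -scalerA -h1 -h2.
have ii : 'i * 'i = -1 :> R[i] by exact: sqr_i.
rewrite scalerA ii scaleN1r opprK -[LHS]half_half.
have -> : 2^-1%:C = 2^-1 :> R[i] by rewrite rmorphV ?unitfE ?pnatr_eq0// rmorph_nat.
by lmod.
Qed.

End Dixmier.
End NormClosed.

(** * Infinite index *)

Section SmallProjections.
Context {R : realType} {H : hilbertType R}.
Local Notation bop := (bop H).
Implicit Types (a b c f n p q u v w x y : bop).
Variables (M : set bop) (t : bop -> R[i]).
Hypotheses (hM : vn M) (ht : tracial M t) (hf : fprop M).

Definition minimal p := [/\ el M p, proj p, p <> 0 &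
  forall q, el M q -> proj q -> p * q = q -> q = 0 \/ q = p].

(** For self-adjoint [x], subtract from [p x p] the multiple of [p] with the same trace. By
    minimality the spectral cut of the difference is trivial below [p], so the difference has a sign
    and trace zero. *)
Lemma minimal_corner p x : minimal p -> el M x -> exists z : R[i], p * x * p = z *: p.
Proof.
move=> [Mp pp p0 pmin].
have [pI pJ] := pp.
have tp0 := proj_tr_gt0 hM ht Mp pp p0.
have tpE := tr_sa hM ht Mp pJ.
have sa y : el M y -> adj y = y -> exists z : R[i], p * y * p = z *: p.
  move=> My sy.
  pose x0 := p * y * p.
  have Mx0 : el M x0 by apply: (vnM hM) => //; exact: vnM.
  have sx0 : adj x0 = x0 by rewrite /x0 !adjM sy pJ mulrA.
  have tE := tr_sa hM ht Mx0 sx0.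
  set r := complex.Re (t x0) in tE.
  set s := complex.Re (t p) in tpE tp0.
  exists (r / s)%:C.
  pose x1 := x0 - (r / s)%:C *: p.
  have px1 : p * x1 = x1 by rewrite /x1 /x0 mulrBr !mulrA scaleMr !pI.
  have x1p : x1 * p = x1 by rewrite /x1 /x0 mulrBl -!mulrA scaleMl !pI.
  have Mx1 : el M x1 by apply: vnB => //; exact: vnZ.
  have sx1 : adj x1 = x1 by rewrite /x1 adjB adjZr pJ sx0.
  have tx1 : t x1 = 0.
    by rewrite (trB ht) (trZ ht) tE tpE -rmorphM divfK ?gt_eqF// subrr.
  have [q [pq qc q1 q2]] := spectral_cut sx1.
  have Mq : el M q by exact: (vn_bicomm hM Mx1).
  have qp : q * p = p * q by apply: qc; rewrite px1 x1p.
  have [qI qJ] := pq.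
  have pqp : proj (p * q).
    split; last by rewrite adjM qJ pJ qp.
    by rewrite mulrA -[p * q * p]mulrA qp mulrA pI -mulrA qI.
  suff : x1 = 0 by move/eqP; rewrite subr_eq0 => /eqP.
  have xq : x1 * q = x1 * (p * q) by rewrite mulrA x1p.
  have ppq : p * (p * q) = p * q by rewrite mulrA pI.
  have [e0|e0] := pmin _ (vnM hM Mp Mq) pqp ppq.
  - move: q2; rewrite mulrBr mulr1 xq e0 mulr0 subr0 => q2.
    apply/eqP; rewrite -oppr_eq0; apply/eqP; apply: (tr_pos_eq0 hM ht _ q2).
      exact: vnN.
    by rewrite (trN ht) tx1 oppr0.
  - move: q1; rewrite xq e0 x1p => q1.
    exact: (tr_pos_eq0 hM ht Mx1 q1 tx1).
move=> Mx; have Mx' := vn_adj hM Mx.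
have [z1 h1] : exists z : R[i], p * (x + adj x) * p = z *: p.
  by apply: sa; [exact: vnD|rewrite adjD adjK addrC].
have [z2 h2] : exists z : R[i], p * ('i *: (x - adj x)) * p = z *: p.
  apply: sa; first by apply: vnZ => //; exact: vnB.
  rewrite adjZ adjB adjK (_ : conjc 'i = - 'i :> R[i]); last first.
    by apply/eqP; rewrite eq_complex /= oppr0 !eqxx.
  by lmod.
exists (2^-1 * (z1 - 'i * z2)); rewrite -scalerA scalerBl -scalerA -h1 -h2.
have ii : 'i * 'i = -1 :> R[i] by exact: sqr_i.
rewrite scaleMr scaleMl scalerA ii scaleN1r opprK -[LHS]half_half.
have -> : 2^-1%:C = 2^-1 :> R[i] by rewrite rmorphV ?unitfE ?pnatr_eq0// rmorph_nat.
by bring.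
Qed.

Definition spanned (s : seq bop) x :=
  exists z : nat -> R[i], x = \sum_(i < size s) z i *: s`_i.

Lemma spannedL s (z : R[i]) x y : spanned s x -> spanned s y -> spanned s (z *: x + y).
Proof.
move=> [c ->] [d ->]; exists (fun i => z * c i + d i).
rewrite scaler_sumr -big_split; apply: eq_bigr => i _ /=.
by rewrite scalerA scalerDl.
Qed.

Lemma spanned_mem s x : x \in s -> spanned s x.
Proof.
move=> xs; exists (fun i => (i == index x s)%:R).
have iw : (index x s < size s)%N by rewrite index_mem.
rewrite (bigD1 (Ordinal iw))//= eqxx scale1r nth_index// big1 ?addr0// => i.
by rewrite -val_eqE/= => /negbTE ->; rewrite scale0r.
Qed.

Lemma spanned_sum (s : seq bop) (T : eqType) (l : seq T) (F : T -> bop) :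
  (forall i : T, i \in l -> spanned s (F i)) -> spanned s (\sum_(i <- l) F i).
Proof.
elim: l => [_|w l IH h].
  by exists (fun=> 0); rewrite big_nil big1// => i _; rewrite scale0r.
rewrite big_cons -[F w]scale1r; apply: spannedL; first by apply: h; exact: mem_head.
by apply: IH => j jl; apply: h; rewrite inE jl orbT.
Qed.

Definition infdim := forall s : seq bop, exists2 a, el M a & ~ spanned s a.

(** By [cover], 1 is a finite sum of [w * adj w] with [w * p = w]. Then [a] is the sum of the
    [w * (adj w * a * j) * adj j], whose middle factors are multiples of [p], so finitely many
    [w * adj j] span [M]. *)
Lemma no_minimal p : infdim -> ~ minimal p.
Proof.
move=> inf pm; have [Mp pp p0 pmin] := pm.
have [ws [hws sws]] := cover hM ht hf Mp pp p0 (vn1 hM) proj_one.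
have [a Ma] := inf [seq w * adj j | w <- ws, j <- ws]; apply.
rewrite -[a]mul1r -[_ * a]mulr1 -sws mulr_suml mulr_suml.
apply: spanned_sum => w hw; have [Mw wp] := hws _ hw.
rewrite mulr_sumr; apply: spanned_sum => j hj; have [Mj jp] := hws _ hj.
have pj : p * adj w = adj w by rewrite -{2}wp adjM (proj_adj pp).
have [z] := minimal_corner pm (vnM hM (vnM hM (vn_adj hM Mw) Ma) Mj).
rewrite !mulrA pj -[_ * j * p]mulrA jp => /(congr1 (fun x => w * x * adj j)).
rewrite scaleMr scaleMl !mulrA wp => ->; rewrite -[_ *: _]addr0.
apply: spannedL; first by apply: spanned_mem; exact: allpairs_f.
by exists (fun=> 0); rewrite big1// => i _; rewrite scale0r.
Qed.

(** Without minimal projections every nonzero [p] splits properly, and one of the parts has at most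
    half of its trace. *)
Lemma small_projection (d : R) : infdim -> 0 < d ->
  exists p, [/\ el M p, proj p, p <> 0 & complex.Re (t p) <= d].
Proof.
move=> inf d0.
have one0 : (1 : bop) <> 0.
  by move=> /(congr1 t); rewrite (tr1 ht) (tr0 ht) => /eqP; rewrite oner_eq0.
have h (n : nat) : exists p, [/\ el M p, proj p, p <> 0 & complex.Re (t p) <= 2^-1 ^+ n].
  elim: n => [|n [p [Mp pp p0 tp]]].
    by exists 1; split=> //; [exact: vn1|exact: proj_one|rewrite (tr1 ht)].
  have [q [Mq qq pq q0 qp]] : exists q, [/\ el M q, proj q, p * q = q, q <> 0 & q <> p].
    apply: contrapT => hn; apply: (no_minimal inf (p := p)); split=> // q Mq qq pq.
    have [|q0] := pselect (q = 0); first by left.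
    by have [|qp] := pselect (q = p); [right|case: hn; exists q].
  have pB := projB pp qq pq.
  have tE : complex.Re (t p) = complex.Re (t q) + complex.Re (t (p - q)).
    by rewrite (trB ht) ReB addrC subrK.
  have [hq|hq] := leP (complex.Re (t q)) (complex.Re (t (p - q))).
    by exists q; split=> //; rewrite exprS; lra.
  exists (p - q); split=> //; first exact: vnB.
    by move/eqP; rewrite subr_eq0 => /eqP /esym.
  by rewrite exprS; lra.
have [n hn] := invn_small d0; have [p [Mp pp p0 tp]] := h n; exists p; split=> //.
apply: (le_trans tp); apply: le_trans (hn _ (leqnn n)).
rewrite exprVn lef_pV2 ?posrE ?exprn_gt0// -natrX ler_nat.
exact: ltn_expl.
Qed.

(** Enlarges [p] to contain the range of [x]. The part to be added is the left support of
    [(1 - p) * x], equivalent to its right support, which lies below [f]. *)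
Lemma absorb p f x : el M p -> proj p -> el M f -> proj f -> el M x -> x * f = x ->
  exists q, [/\ el M q, proj q, q * p = p, q * x = x &
    complex.Re (t q) <= complex.Re (t p) + complex.Re (t f)].
Proof.
move=> Mp pp Mf pf Mx xf.
have [pI pJ] := pp; have [fI fJ] := pf.
pose a := (1 - p) * x.
have Ma : el M a by apply: vnM => //; apply: vnB => //; exact: vn1.
have [v [s [Mv Ms ps vs [as_ ker co va]]]] := polar hM Ma.
have pa : p * a = 0 by rewrite /a mulrA mulrBr mulr1 pI subrr mul0r.
have pv : p * v = 0.
  have := co (1 - p); rewrite !mulrBl !mul1r pa subr0 => /(_ erefl)/eqP.
  by rewrite -subr_eq0 addrAC subrr sub0r oppr_eq0 => /eqP.
have vp : adj v * p = 0 by rewrite -[p]pJ -adjM pv adj0.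
have qv : proj (v * adj v) by apply: piso_final; apply: proj_piso; rewrite vs.
have sf : s * f = s.
  apply/eqP; rewrite -subr_eq0 -opprB oppr_eq0 -{1}[s]mulr1 -mulrBr; apply/eqP.
  apply: bopext => k; rewrite opM op0; apply: ker.
  by rewrite -opM /a mulrBr mulr1 -mulrA xf subrr.
have fs : f * s = s by have := congr1 adj sf; rewrite adjM fJ (proj_adj ps).
have Mq : el M (v * adj v) by apply: (vnM hM) => //; exact: vn_adj.
exists (p + v * adj v); split.
- exact: vnD.
- by apply: projD => //; rewrite mulrA pv mul0r.
- by rewrite mulrDl pI -mulrA vp mulr0 addr0.
- have hx : x = p * x + a by rewrite /a mulrBl mul1r addrC subrK.
  have ha : v * adj v * x = a.
    by rewrite {1}hx mulrDr va !mulrA -(mulrA v) vp mulr0 mul0r add0r.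
  by rewrite mulrDl ha -hx.
rewrite (trD ht) ReD (trC ht Mv (vn_adj hM Mv)) vs lerD2l.
by apply: (tr_le hM ht) => //; apply: proj_pos; exact: projB.
Qed.

End SmallProjections.

(* If [y k] is asymptotically isometric under left multiplication by [N] while
   its right support shrinks, then the [x] with [x n y k -> 0] and
   [x^* n y k -> 0] for all [n] in [N] form an ideal of the C*-algebra it
   generates with [N]; it is nonzero but does not contain 1. *)
Section VanishingIdeal.
Context {R : realType} {H : hilbertType R}.
Local Notation bop := (bop H).
Implicit Types (a b c n p q u v w x : bop) (i j k : nat).
Variables (N M : set bop) (t : bop -> R[i]) (f y nn : nat -> bop).
Hypotheses (hN : vn N) (hM : vn M) (ht : tracial M t) (NM : forall a, el N a -> el M a).
Hypotheses (Mf : forall i, el M (f i)) (pf : forall i, proj (f i)).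
Hypotheses (My : forall i, el M (y i)) (yf : forall i, y i * f i = y i).
(* The weight [i + 1] pays for the [i + 1] vectors [nn j * y i], [j <= i], that
   have to be captured at stage [i]. *)
Hypothesis small_f : forall i, i.+1%:R * complex.Re (t (f i)) <= 2^-1 ^+ i.+2.

Definition vanish (r : nat -> R) := forall d : R, 0 < d ->
  exists k0, forall k, (k0 <= k)%N -> r k <= d.

Hypothesis asym : forall n, el N n -> vanish (fun k => `|q2 t (n * y k) - q2 t n|).
Hypothesis Nnn : forall j, el N (nn j).
Hypothesis dense : forall n (d : R), el N n -> bnd n 1 -> 0 < d ->
  exists j, q2 t (n - nn j) <= d.

Lemma vanish_le r s : (forall k, r k <= s k) -> vanish s -> vanish r.
Proof. by move=> h hs d /hs[k0 hk]; exists k0 => k /hk; exact: le_trans. Qed.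

Lemma vanishL (c : R) r s : 0 <= c -> vanish r -> vanish s ->
  vanish (fun k => c * r k + s k).
Proof.
move=> c0 hr hs d d0.
have c1 : 0 < c + 1 by lra.
have e0 : 0 < d / 2 / (c + 1) by rewrite !divr_gt0.
have [k1 h1] := hr _ e0; have [k2 h2] := hs _ (divr_gt0 d0 (ltr0n _ 2)).
exists (maxn k1 k2) => k; rewrite geq_max => /andP[/h1 {}h1 /h2 {}h2].
have : c * r k <= c * (d / 2 / (c + 1)) by rewrite ler_wpM2l//.
have : c * (d / 2 / (c + 1)) <= d / 2.
  by rewrite mulrA ler_pdivrMr// [X in X <= _]mulrC ler_wpM2l//; lra.
by lra.
Qed.

Definition annihilates x := forall n, el N n -> vanish (fun k => q2 t (x * n * y k)).

Let Mxny x n k : el M x -> el N n -> el M (x * n * y k).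
Proof. by move=> Mx Nn; apply: vnM => //; apply: vnM => //; exact: NM. Qed.

Lemma annihilates_mull x a : el M x -> el M a -> annihilates a -> annihilates (x * a).
Proof.
move=> Mx Ma La n Nn; have [r r0 xr] := bop_bnd x.
have h : vanish (fun k => r ^+ 2 * q2 t (a * n * y k) + 0).
  by apply: vanishL => //; [exact: exprn_ge0|exact: La|move=> d /ltW; exists 0%N].
apply: vanish_le h => k; rewrite addr0.
have -> : x * a * n * y k = x * (a * n * y k) by rewrite !mulrA.
exact: (q2_Ml hM ht r0 (Mxny k Ma Nn) Mx xr).
Qed.

Lemma annihilates_lin (z : R[i]) a b : el M a -> el M b ->
  annihilates a -> annihilates b -> annihilates (z *: a + b).
Proof.
move=> Ma Mb La Lb n Nn.
have Lza : annihilates (z *: a).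
  rewrite -[a]mul1r -scaleMl; apply: annihilates_mull => //.
  by apply: vnZ => //; exact: vn1.
have h : vanish (fun k => 2 * q2 t (z *: a * n * y k) + 2 * q2 t (b * n * y k)).
  apply: vanishL => //; first exact: Lza.
  have h : vanish (fun k => 2 * q2 t (b * n * y k) + 0).
    by apply: vanishL => //; [exact: Lb|move=> d /ltW; exists 0%N].
  by apply: vanish_le h => k; rewrite addr0.
apply: vanish_le h => k.
have -> : (z *: a + b) * n * y k = z *: a * n * y k + b * n * y k.
  by rewrite !mulrDl.
exact: (q2_triangle hM ht (Mxny k (vnZ z hM Ma) Nn) (Mxny k Mb Nn)).
Qed.

Lemma annihilates_mulr a n : el N n -> annihilates a -> annihilates (a * n).
Proof.
move=> Nn La m Nm d d0; have [k0 h] := La _ (vnM hN Nn Nm) _ d0.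
by exists k0 => k /h; rewrite !mulrA.
Qed.

Lemma annihilates_closed a : el M a -> (forall e : R, 0 < e ->
  exists b, [/\ el M b, annihilates b & bnd (a - b) e]) -> annihilates a.
Proof.
move=> Ma h n Nn d d0.
have Mn := NM Nn.
have qn := q2_ge0 ht Mn.
set q := q2 t n in qn.
(* This [e] is at most 1 and satisfies [4 * (e * (q + 1)) <= d]. *)
pose e := d / (4 * (q + 1) + d).
have s0 : 0 < 4 * (q + 1) + d by lra.
have e0 : 0 < e by rewrite divr_gt0.
have eE : e * (4 * (q + 1) + d) = d by rewrite /e divfK// gt_eqF.
have [b [Mb Lb ab]] := h _ e0.
have d4 : 0 < d / 4 by lra.
have [k1 h1] := Lb _ Nn _ d4; have [k2 h2] := asym Nn ltr01.
exists (maxn k1 k2) => k; rewrite geq_max => /andP[/h1 {}h1 /h2 {}h2].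
have -> : a * n * y k = (a - b) * (n * y k) + b * n * y k by bring.
have Mny : el M (n * y k) by exact: vnM.
apply: (le_trans (q2_triangle hM ht (vnM hM (vnB hM Ma Mb) Mny) (Mxny k Mb Nn))).
have h3 := q2_Ml hM ht (ltW e0) Mny (vnB hM Ma Mb) ab.
have h4 : q2 t (n * y k) <= q + 1 by move: h2; rewrite ler_norml -/q; lra.
have e1 : e <= 1.
  by rewrite /e ler_pdivrMr// mul1r; lra.
clearbody e q.
have h5 : e ^+ 2 * q2 t (n * y k) <= e * (q + 1).
  have : e ^+ 2 <= e by rewrite expr2 ler_piMr// ltW.
  have := sqr_ge0 e; move: h4; set X := q2 t _; set Y := e ^+ 2 => h4 Y0 Ye.
  by apply: (le_trans (ler_wpM2l Y0 h4)); apply: ler_wpM2r => //; lra.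
have : 4 * (e * (q + 1)) <= d.
  have : 0 <= e * d by rewrite mulr_ge0// ltW.
  by move=> ed; rewrite -[leRHS]eE mulrDr; lra.
move: h1 h3 h5; set X1 := q2 t _; set X2 := q2 t _; set X3 := _ * q2 t _.
by lra.
Qed.

Lemma absorb_list p g (xs : seq bop) : el M p -> proj p -> el M g -> proj g ->
  (forall x, x \in xs -> el M x /\ x * g = x) ->
  exists q, [/\ el M q, proj q, q * p = p, forall x, x \in xs -> q * x = x &
    complex.Re (t q) <= complex.Re (t p) + (size xs)%:R * complex.Re (t g)].
Proof.
move=> Mp pp Mg pg; elim: xs => [_|x xs IH h].
  by exists p; split=> //; [exact: proj_idem|rewrite mul0r addr0].
have [z hz|q [Mq pq qp qx tq]] := IH; first by apply: h; rewrite inE hz orbT.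
have [Mx xg] := h x (mem_head _ _).
have [s [Ms ps sq sx ts]] := absorb hM ht Mq pq Mg pg Mx xg.
exists s; split=> //.
- by rewrite -qp mulrA sq.
- by move=> z; rewrite inE => /orP[/eqP-> //|/qx hz]; rewrite -hz mulrA sq.
by rewrite /= -natr1 mulrDl mul1r; lra.
Qed.

(** Stage [k] absorbs [k + 1] vectors supported by [f k] and adds at most [2^-(k + 2)] to the trace,
    which thus stays below [1 / 2]. *)
Lemma capture k : exists p, [/\ el M p, proj p,
  complex.Re (t p) <= 2^-1 - 2^-1 ^+ k.+1
  & forall i j, (i < k)%N -> (j <= i)%N -> p * (nn j * y i) = nn j * y i].
Proof.
elim: k => [|k [p [Mp pp tp hp]]].
  exists 0; split; [exact: vn0| | |by []].
    by split; rewrite ?mulr0 ?adj0.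
  by rewrite (tr0 ht) expr1 subrr.
have [x|q [Mq pq qp qx tq]] := absorb_list (xs := [seq nn j * y k | j <- iota 0 k.+1])
    Mp pp (Mf k) (pf k).
  move=> /mapP[j _ ->]; split; last by rewrite -mulrA yf.
  by apply: vnM => //; exact: NM.
exists q; split=> //.
  rewrite size_map size_iota in tq; have := small_f k.
  rewrite (_ : 2^-1 ^+ k.+1 = 2 * 2^-1 ^+ k.+2) in tp; last by rewrite [in RHS]exprS; lra.
  by move: tq tp; set X := _ * complex.Re _; lra.
move=> i j; rewrite ltnS leq_eqVlt => /orP[/eqP->|ik] ji; last first.
  by rewrite -(hp i j)// mulrA qp.
by apply: qx; apply/mapP; exists j => //; rewrite mem_iota.
Qed.

(** The weak limit [b] of the capturing projections acts as the identity on all [nn j * y i] with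
    [j <= i], and [t b] has modulus at most [1 / 2]. Hence [1 - b] is nonzero and kills these
    products; density of [nn] and [asym] extend this asymptotically to all of [N]. *)
Lemma annihilates_nonzero : exists a, [/\ el M a, adj a = a, a <> 0 & annihilates a].
Proof.
have /choice[p hp] := capture.
have pu : ubnd p 1 by move=> k; apply: proj_bnd; case: (hp k).
have [b wb bb] := wlim_ex ler01 pu.
have Mb : el M b by apply: (wlim_vn hM _ wb) => k; case: (hp k).
have sb : adj b = b.
  have := wlim_adj pu wb.
  have -> : (fun k => adj (p k)) = p by apply/funext => k; case: (hp k) => _ [].
  by move=> h; exact: (wlim_unique h wb).
have b1 i j : (j <= i)%N -> b * (nn j * y i) = nn j * y i.
  move=> ji; have [r r0 hr] := bop_bnd (nn j * y i).
  apply: (wlim_eventually (N := i.+1) (wlimMr _ wb)) => [k ik|].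
    by case: (hp k) => _ _ _; apply.
  by exists (1 * r) => k; apply: bndM.
exists (1 - b); split.
- by apply: vnB => //; exact: vn1.
- by rewrite adjB adj1 sb.
- move=> /eqP; rewrite subr_eq0 => /eqP /(congr1 t); rewrite (tr1 ht).
  rewrite (tr_wlim ht ler01 pu bb wb) => tE.
  have : cabs (glim (fun k => t (p k))) <= 2^-1.
    have tp k : cabs (t (p k)) <= 2^-1.
      have [Mp pp tp _] := hp k.
      rewrite cabs_ge0_id; last by apply: (tr_pos hM ht) => //; exact: proj_pos.
      by apply: (le_trans tp); rewrite gerBl exprn_ge0// invr_ge0.
    by apply: (glim_bound (N := 0)) => //; exists 2^-1.
  by rewrite -tE cabs_real normr1; lra.
move=> n Nn d d0; have [r0' r0'0 nr] := bop_bnd n.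
pose r := r0' + 1; have r0 : 0 < r by rewrite /r; lra.
have {}nr : bnd n r by apply: bnd_le nr; rewrite /r; lra.
clearbody r.
have N1 : el N (r^-1%:C *: n) by exact: vnZ.
have bn1 : bnd (r^-1%:C *: n) 1.
  apply: bnd_le (bndZ _ nr); rewrite cabs_real.
  by rewrite ger0_norm ?mulVf ?gt_eqF// invr_ge0 ltW.
(* [1 - b] has norm at most 2, and [q2 t (m * y k)] is at most [q2 t m + dd <= 2 * dd]. *)
pose dd := d / 8.
have dd0 : 0 < dd by rewrite /dd; lra.
have [j hj] := dense N1 bn1 (divr_gt0 dd0 (exprn_gt0 2 r0)).
pose m := n - r%:C *: nn j.
have Nm : el N m by apply: vnB => //; exact: vnZ.
have qm : q2 t m <= dd.
  have -> : m = r%:C *: (r^-1%:C *: n - nn j).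
    by rewrite scalerBr scalerA -rmorphM mulfV ?gt_eqF// scale1r.
  by rewrite (q2Zr ht) mulrC -ler_pdivlMr// exprn_gt0.
have [k0 hk] := asym Nm dd0.
exists (maxn k0 j) => k; rewrite geq_max => /andP[/hk {}hk jk].
have -> : (1 - b) * n * y k = (1 - b) * (m * y k).
  have -> : m * y k = n * y k - r%:C *: (nn j * y k) by rewrite /m mulrBl scaleMl.
  rewrite -mulrA [RHS]mulrBr scaleMr [(1 - b) * (nn j * y k)]mulrBl mul1r b1//.
  by rewrite subrr scaler0 subr0.
have M1b : el M (1 - b) by apply: vnB => //; exact: vn1.
have b2 : bnd (1 - b) (1 + 1) by apply: bndB => //; exact: bnd1.
have Mmy : el M (m * y k) by apply: vnM => //; exact: NM.
have := q2_Ml hM ht (ler0n _ 2) Mmy M1b b2.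
move: hk; rewrite ler_norml /dd in qm *; set X := q2 t (m * _); set Y := q2 t m.
by rewrite /Y in qm *; lra.
Qed.

Lemma vanishing_not_simple : ~ simple_inclusion N M.
Proof.
move=> simp.
pose I : set bop := [set x | [/\ el M x, annihilates x & annihilates (adj x)]].
pose S : set bop := [set x | exists a b, [/\ el N a, el I b & x = a + b]].
have sI : bsubspace I.
  split.
    split; [exact: vn0| |rewrite adj0] => n Nn d d0; exists 0%N => k _;
      by rewrite !mul0r (q20 ht) ltW.
  move=> z a b [Ma La La'] [Mb Lb Lb']; split.
  - by apply: vnD => //; exact: vnZ.
  - exact: annihilates_lin.
  - by rewrite adjD adjZ; apply: annihilates_lin => //; exact: vn_adj.
have NI n x : el N n -> el I x -> el I (n * x).
  move=> Nn [Mx Lx Lx']; have Mn := NM Nn; split; first exact: vnM.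
    exact: annihilates_mull.
  by rewrite adjM; apply: annihilates_mulr => //; exact: vn_adj.
have IN n x : el N n -> el I x -> el I (x * n).
  move=> Nn [Mx Lx Lx']; have Mn := NM Nn; split; first exact: vnM.
    exact: annihilates_mulr.
  by rewrite adjM; apply: annihilates_mull => //; exact: vn_adj.
have II x x' : el I x -> el I x' -> el I (x * x').
  move=> [Mx Lx Lx'] [Mx' Lx1 Lx1']; split; first exact: vnM.
    exact: annihilates_mull.
  by rewrite adjM; apply: annihilates_mull => //; exact: vn_adj.
have sS : bsubspace S.
  split; first by exists 0, 0; split; [exact: vn0|case: sI|rewrite addr0].
  move=> z _ _ [a [b [Na Ib ->]]] [a' [b' [Na' Ib' ->]]].
  exists (z *: a + a'), (z *: b + b'); split; last by lmod.
    by apply: vnD => //; exact: vnZ.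
  exact: sI.2.
have mS a b : el S a -> el S b -> el S (a * b).
  move=> [c [d [Nc Id ->]]] [c' [d' [Nc' Id' ->]]].
  exists (c * c'), (c * d' + d * c' + d * d'); split; first exact: vnM.
    by do 2?[apply: bsubspaceD => //]; [exact: NI|exact: IN|exact: II].
  by bring.
have jS a : el S a -> el S (adj a).
  move=> [c [d [Nc [Md Ld Ld'] ->]]]; exists (adj c), (adj d); rewrite adjD.
  by split=> //; [exact: vn_adj|split; rewrite ?adjK//; exact: vn_adj].
have SM a : el S a -> el M a.
  by move=> [c [d [Nc [Md _ _] ->]]]; apply: vnD => //; exact: NM.
pose D := ncl S.
have DM a : el D a -> el M a.
  by move=> ha; apply: vn_closed => // e /ha[b /SM]; exists b.
have jD : star D by apply: ncl_adj.
have cD : cstar D.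
  by split; [exact: bsubspace_ncl|exact: ncl_mul|exact: jD|exact: ncl_ncl].
have ND a : el N a -> el D a.
  by move=> Na; apply: sub_ncl; exists a, 0; split=> //; [case: sI|rewrite addr0].
(* [annihilates] is stable under left factors from [M], but under right factors only from [N]; for
   right factors from [D] one writes [a] as a limit of sums of elements of [N] and of [I]. *)
have LD b a : el M b -> annihilates b -> el D a -> annihilates (b * a).
  move=> Mb Lb Da; apply: annihilates_closed => [|e e0]; first by apply: vnM => //; exact: DM.
  have [r r0 hr] := bop_bnd b.
  have r1 : 0 < r + 1 by lra.
  have [s Ss hs] := Da _ (divr_gt0 e0 r1); exists (b * s); split.
  - by apply: vnM => //; exact: SM.
  - move: Ss {hs} => [c [d [Nc [Md Ld Ld'] ->]]]; rewrite mulrDr -[b * c]scale1r.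
    apply: annihilates_lin; last exact: annihilates_mull.
    + by apply: vnM => //; exact: NM.
    + exact: vnM.
    + exact: annihilates_mulr.
  rewrite -mulrBr; apply: bnd_le (bndM r0 hr hs).
  by rewrite mulrA ler_pdivrMr// [X in X <= _]mulrC ler_wpM2l// ?(ltW e0)//; lra.
have iI : ideal D I.
  split=> //.
  - move=> a Ia; apply: sub_ncl; exists 0, a.
    by split=> //; [exact: vn0|rewrite add0r].
  - move=> a b Da [Mb Lb Lb']; have Ma := DM _ Da.
    have Ma' := vn_adj hM Ma; have Mb' := vn_adj hM Mb.
    split; split; rewrite ?adjM; try exact: vnM.
    + exact: annihilates_mull.
    + by apply: LD => //; exact: jD.
    + exact: LD.
    + exact: annihilates_mull.
  move=> a ha.
  have Ma : el M a by apply: vn_closed => // e /ha[b [Mb _ _]]; exists b.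
  split=> //; apply: annihilates_closed => //; first 1 last.
  - exact: vn_adj.
  - move=> e /ha[b [Mb Lb Lb'] ab]; exists (adj b).
    by split=> //; [exact: vn_adj|rewrite -adjB; exact: bnd_adj].
  - by move=> e /ha[b [Mb Lb Lb'] ab]; exists b.
have [h|h] := simp D cD ND DM I iI.
  have [a [Ma sa a0 La]] := annihilates_nonzero.
  by apply: a0; apply: h; split; rewrite ?sa.
(* If 1 belonged to [I], then [q2 t (y k)] would tend to 0, whereas by [asym] it tends to
   [q2 t 1 = 1]. *)
have [_ L1 _] := h _ (ND _ (vn1 hN)).
have h4 : 0 < 4^-1 :> R by rewrite invr_gt0.
have [k1 h1] := L1 _ (vn1 hN) _ h4; have [k2 h2] := asym (vn1 hN) h4.
have := h1 _ (leq_maxl k1 k2); have := h2 _ (leq_maxr k1 k2).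
rewrite !mul1r; have -> : q2 t 1 = 1 by rewrite /q2 adj1 mulr1 (tr1 ht).
by rewrite ler_norml; lra.
Qed.

End VanishingIdeal.

(** * Separability of the unit ball in the 2-norm *)

Section DenseSequence.
Context {R : realType} {H : hilbertType R}.
Local Notation bop := (bop H).
Implicit Types (a b n : bop).
Variables (N : set bop) (t : bop -> R[i]).
Hypotheses (hN : vn N) (ht : tracial N t).

(** An element [n] is viewed as the functional [a |-> t (a * n)]. For each pair [(m, k)] one element
    of the ball within [1 / (k + 1)] of [g m] is kept, if there is any. Two elements close to the
    same [g m] are close in 2-norm, by testing at half the adjoint of their difference. *)
Lemma dense_unit_ball (g : nat -> bop -> R[i]) :
  (forall n (d : R), el N n -> 0 < d -> exists m, forall a, el N a -> bnd a 1 ->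
     cabs (t (a * n) - g m a) <= d) ->
  exists nn : nat -> bop, (forall j, el N (nn j)) /\
    forall n (d : R), el N n -> bnd n 1 -> 0 < d -> exists j, q2 t (n - nn j) <= d.
Proof.
move=> sep.
pose near (j : nat * nat) n := [/\ el N n, bnd n 1 & forall a, el N a -> bnd a 1 ->
  cabs (t (a * n) - g j.1 a) <= j.2.+1%:R^-1].
have /choice[c hc] j : exists n, el N n /\ ((exists n, near j n) -> near j n).
  have [[n hn]|hn] := pselect (exists n, near j n).
    by exists n; split=> //; case: hn.
  by exists 0; split=> [|//]; exact: vn0.
exists (fun i => if unpickle i is Some j then c j else 0); split.
  by move=> i; case: unpickle => [j|]; [case: (hc j)|exact: vn0].
move=> n d Nn n1 d0.
have d4 : 0 < d / 4 by lra.
have [k /(_ k (leqnn k)) hk] := invn_small d4.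
have k0 : 0 < k.+1%:R^-1 :> R by rewrite invr_gt0.
have [m hm] := sep n _ Nn k0.
exists (pickle (m, k)); rewrite pickleK.
have [Nc /(_ _)[|_ c1 cm]] := hc (m, k); first by exists n.
set n' := c (m, k) in Nc c1 cm *.
pose a := 2^-1%:C *: adj (n - n').
have Nd : el N (n - n') by exact: vnB.
have Na : el N a by apply: vnZ => //; exact: vn_adj.
have a1 : bnd a 1.
  apply: bnd_le (bndZ _ (bnd_adj (bndB n1 c1))).
  by rewrite cabs_real ger0_norm ?invr_ge0//; lra.
have -> : q2 t (n - n') = 2 * complex.Re (t (a * n) - t (a * n')).
  rewrite -(trB ht) -mulrBr /a scaleMl (trZ ht) ReZ /q2 mulrA.
  by rewrite mulfV ?mul1r// pnatr_eq0.
have h1 := hm _ Na a1.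
have h2 : cabs (t (a * n') - g m a) <= k.+1%:R^-1 := cm _ Na a1.
have := Re_le_cabs (t (a * n) - t (a * n')).
have -> : t (a * n) - t (a * n') = (t (a * n) - g m a) - (t (a * n') - g m a).
  by ring.
have := cabsD (t (a * n) - g m a) (- (t (a * n') - g m a)); rewrite cabsN.
by move: h1 h2 hk; set i := k.+1%:R^-1; lra.
Qed.
End DenseSequence.

(** * From simplicity to a finite trace on the commutant *)

Section SimpleTrace.
Context {R : realType} {H K : hilbertType R}.
Implicit Types (a b c m n x y f : bop H) (S T : bop K) (k : K).
Variables (M N : set (bop H)) (t : bop H -> R[i]) (pi : bop H -> bop K) (Om : K).
Hypotheses (hM : vn M) (ht : tracial M t) (hg : gns M t pi Om).
Hypotheses (hN : vn N) (NM : forall a, el N a -> el M a).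
Hypothesis uniqN : forall f : bop H -> R[i],
  (forall (z : R[i]) a b, el N a -> el N b -> f (z *: a + b) = z * f a + f b) ->
  (forall a b, el N a -> el N b -> f (a * b) = f (b * a)) ->
  (exists2 C : R, 0 <= C & forall a (r : R), el N a -> 0 <= r -> bnd a r ->
     cabs (f a) <= C * r) ->
  forall a, el N a -> f a = t a * f 1.
Hypotheses (hfM : fprop M) (inf : infdim M).
Variable nn : nat -> bop H.
Hypothesis Nnn : forall j, el N (nn j).
Hypothesis dense : forall n (d : R), el N n -> bnd n 1 -> 0 < d ->
  exists j, q2 t (n - nn j) <= d.
Local Notation V := (vec pi Om).
Local Notation rh := (rho hM ht hg).
Local Notation e := (eN hM hg hN NM).

(** [w = v Om]: since [v] commutes with [pi n] and [adj v * v = e], [N] acts on [w] isometrically as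
    on [Om]. An approximating [V y] may be cut by [f] because [rh f * v = v]. *)
Lemma isometric_vector f v (d : R) : el M f -> proj f -> el (commN pi N) v -> v * e = v ->
  rh f * v = v -> adj v * v = e -> 0 < d ->
  exists w y, [/\ forall n, el N n -> nm (pi n w) = nm (V n), el M y, y * f = y
    & nm (V y - w) <= d].
Proof.
move=> Mf pf Pv ve fv vv d0.
have [y My hy] : exists2 y, el M y & nm (V y - v Om) <= d.
  by have [_ [y My <-] hy] := piD hg (v Om) d0; exists y; rewrite // nmB.
exists (v Om), (y * f); split.
- move=> n Nn; have [ee se ec ef eo] := eN_spec hM hg hN NM.
  rewrite -opM (PP_comm Pv Nn) opM -/(vec pi Om n).
  apply/eqP; rewrite -(eqrXn2 (n := 2)) ?nm_ge0//; apply/eqP.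
  by rewrite !nm_sq -adjPr -opM vv eN_vec.
- exact: vnM.
- by rewrite -mulrA (proj_idem pf).
rewrite -(rhoE hM ht hg) // -[in X in _ - X]fv opM -opBx.
have := rho_bnd hM ht hg Mf ler01 (proj_bnd pf) (V y - v Om); rewrite mul1r.
by move/le_trans; apply.
Qed.

Lemma simple_trace : simple_inclusion N M -> exists zs : seq K,
  [/\ vtrace zs 1 = 1,
    forall S T, el (commN pi N) S -> el (commN pi N) T -> vtrace zs (S * T) = vtrace zs (T * S)
  & forall T, el (commN pi N) T -> vtrace zs (adj T * T) = 0 -> T = 0].
Proof.
move=> simp; apply: contrapT => none; move: simp.
have iso f : el M f -> proj f -> f <> 0 -> forall d : R, 0 < d ->
    exists w y, [/\ forall n, el N n -> nm (pi n w) = nm (V n), el M y, y * f = y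
    & nm (V y - w) <= d].
  move=> Mf pf f0 d d0.
  have [v [Pv ve fv [vv|vv]]] := compare_eN hM ht hg hN NM uniqN Mf pf.
    exact: (isometric_vector Mf pf Pv ve fv vv).
  by case: none; exact: (build_trace hfM Mf pf f0 Pv ve vv).
(* The triple is [(f k, y k, w k)], with the approximation error [1 / (k + 1)] and the weighted
   bound on the trace of [f k]. *)
have /choice[s hs] (k : nat) : exists s : bop H * bop H * K,
   [/\ el M s.1.1, proj s.1.1, k.+1%:R * complex.Re (t s.1.1) <= 2^-1 ^+ k.+2,
     el M s.1.2 /\ s.1.2 * s.1.1 = s.1.2
   & (forall n, el N n -> nm (pi n s.2) = nm (V n)) /\ nm (V s.1.2 - s.2) <= k.+1%:R^-1].
  have d0 : 0 < 2^-1 ^+ k.+2 / k.+1%:R :> R by rewrite divr_gt0// exprn_gt0.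
  have [f [Mf pf f0 tf]] := small_projection hM ht hfM inf d0.
  have k0 : 0 < k.+1%:R^-1 :> R by rewrite invr_gt0.
  have [w [y [hw My yf wy]]] := iso f Mf pf f0 _ k0.
  by exists (f, y, w); split=> //=; rewrite mulrC -ler_pdivlMr.
pose f (k : nat) := (s k).1.1; pose y (k : nat) := (s k).1.2.
apply: (vanishing_not_simple (f := f) (y := y) (nn := nn) hN hM ht NM) => //.
- by move=> k; case: (hs k).
- by move=> k; case: (hs k).
- by move=> k; case: (hs k) => _ _ _ [].
- by move=> k; case: (hs k) => _ _ _ [].
- by move=> k; case: (hs k).
move=> n Nn d d0; have Mn := NM Nn.
have [r r0 hr] := bop_bnd (pi n).
set q := nm (V n).
have q0 : 0 <= q by exact: nm_ge0.
(* With [z] the norm of [n * y k] in [L^2(M)], [|z - q| <= r / (k + 1)] and [z + q <= 2 q + r] bound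
   [|z^2 - q^2|]. *)
pose C := r * (2 * q + r) + 1.
have C0 : 0 < C by rewrite /C; have := mulr_ge0 r0 q0; have := mulr_ge0 r0 r0; lra.
have [k0 hk] := invn_small (divr_gt0 d0 C0); exists k0 => k /hk {}hk.
have [_ _ _ [My _] [hw wy]] := hs k.
rewrite -!(vec_nm hM hg)//; last exact: vnM.
rewrite -(pi_vec hg)// -/q; set z := nm _.
have zq : `|z - q| <= r * k.+1%:R^-1.
  have h : nm (pi n (V (y k)) - pi n (s k).2) <= r * k.+1%:R^-1.
    by rewrite -opBx; apply: (le_trans (hr _)); rewrite ler_wpM2l.
  apply: le_trans h; rewrite /z /q -(hw _ Nn) ler_norml.
  have h1 := nmD (pi n (V (y k)) - pi n (s k).2) (pi n (s k).2).
  have h2 := nmD (pi n (s k).2 - pi n (V (y k))) (pi n (V (y k))).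
  rewrite !subrK in h1 h2; rewrite (nmB (pi n (s k).2)) in h2.
  by move: h1 h2; rewrite -/(y k); lra.
have i0 : 0 < k.+1%:R^-1 :> R by rewrite invr_gt0.
have i1 : k.+1%:R^-1 <= 1 :> R by rewrite invf_le1// ler1n.
move: hk; rewrite ler_pdivlMr// => hk.
have z0 : 0 <= z by exact: nm_ge0.
have -> : z ^+ 2 - q ^+ 2 = (z - q) * (z + q) by ring.
rewrite normrM (ger0_norm (addr_ge0 z0 q0)).
move: zq hk; rewrite /C; set i := k.+1%:R^-1 in i0 i1 *; clearbody i z q => zq hk.
have zb : z + q <= 2 * q + r.
  have : r * i <= r by rewrite ler_piMr.
  by move: zq; rewrite ler_norml; lra.
apply: (le_trans (ler_pM _ _ zq zb)) => //; first by rewrite addr_ge0.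
have -> : r * i * (2 * q + r) = i * (r * (2 * q + r)) by ring.
by apply: le_trans hk; rewrite ler_wpM2l ?(ltW i0)// lerDl.
Qed.

End SimpleTrace.

(** * The GNS construction *)

(** The form may be degenerate and is controlled on [ph_set] only, as [t (adj b * a)] is on [M]
    inside all bounded operators. *)
Record prehilbert (R : realType) (V : lmodType R[i]) := PreHilbert {
  ph_set : set V;
  ph_form : V -> V -> R[i];
  ph_psd : psd_form ph_set ph_form;
  ph_set0 : ph_set 0 }.

Section PreHilbert.
Context {R : realType} {V : lmodType R[i]} (X : prehilbert V).
Implicit Types (a b c : V) (f g : V -> R[i]^o) (z : R[i]).
Local Notation S := (ph_set X).
Local Notation q := (ph_form X).

Lemma phL z a b : S a -> S b -> S (z *: a + b).
Proof. by case: (ph_psd X) => h _ _ _; exact: h. Qed.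

Lemma phB a b : S a -> S b -> S (a - b).
Proof. by move=> Sa Sb; rewrite addrC -scaleN1r; exact: phL. Qed.

Lemma pqL z a b c : S a -> S b -> S c -> q (z *: a + b) c = z * q a c + q b c.
Proof. by case: (ph_psd X) => _ h _ _; exact: h. Qed.

Lemma pqC a b : S a -> S b -> q b a = conjc (q a b).
Proof. by case: (ph_psd X) => _ _ h _; exact: h. Qed.

Lemma pqR z a b c : S a -> S b -> S c -> q c (z *: a + b) = conjc z * q c a + q c b.
Proof.
move=> Sa Sb Sc; rewrite (pqC (phL z Sa Sb) Sc) pqL// rmorphD rmorphM /=.
by rewrite -(pqC Sa Sc) -(pqC Sb Sc).
Qed.

Lemma pq_ge0 a : S a -> 0 <= q a a.
Proof. by case: (ph_psd X) => _ _ _ h; exact: h. Qed.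

Lemma pq0l c : S c -> q 0 c = 0.
Proof.
move=> Sc; have S0 := ph_set0 X.
have := pqL (-1) S0 S0 Sc; rewrite scaler0 addr0 mulN1r addNr; exact.
Qed.

Lemma pqB a b c : S a -> S b -> S c -> q (a - b) c = q a c - q b c.
Proof. by move=> Sa Sb Sc; rewrite addrC -scaleN1r pqL// mulN1r addrC. Qed.

Definition pn a : R := Num.sqrt (complex.Re (q a a)).

Lemma pn_ge0 a : 0 <= pn a. Proof. exact: sqrtr_ge0. Qed.

Lemma pn_sq a : S a -> pn a ^+ 2 = complex.Re (q a a).
Proof. by move=> Sa; rewrite sqr_sqrtr//; apply: Re_ge0; exact: pq_ge0. Qed.

Lemma pq_pn a : S a -> q a a = (pn a ^+ 2)%:C.
Proof. by move=> Sa; rewrite pn_sq// [LHS]ge0_ReC//; exact: pq_ge0. Qed.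

Lemma pq_CS a b : S a -> S b -> cabs (q a b) <= pn a * pn b.
Proof.
move=> Sa Sb; apply: le_of_sqr; first by rewrite mulr_ge0 ?pn_ge0.
by rewrite exprMn !pn_sq//; exact: (psd_CS (ph_psd X)).
Qed.

Definition fbnd f (c : R) := forall b, S b -> cabs (f b) <= c * pn b.

(* The completion is realized inside the conjugate-linear functionals on the
   pre-Hilbert space, [a] being identified with [<a, .>]. *)
Definition approximable f := (forall b, ~ S b -> f b = 0) /\
  forall e : R, 0 < e -> exists2 a, S a &
    forall b, S b -> cabs (f b - q a b) <= e * pn b.

Definition is_cpl : {pred V -> R[i]^o} := fun f => `[< approximable f >].

Lemma is_cpl_closed : subsemimod_closed is_cpl.
Proof.
have lin z f g : approximable f -> approximable g ->
    approximable (fun b => z * f b + g b).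
  move=> [f0 hf] [g0 hg]; split; first by move=> b nb; rewrite f0// g0// mulr0 addr0.
  move=> e e0.
  have c0 : 0 < cabs z + 1 by have := cabs_ge0 z; lra.
  have e1 : 0 < e / 2 / (cabs z + 1) by rewrite !divr_gt0.
  have e2 : 0 < e / 2 by lra.
  have [a Sa ha] := hf _ e1; have [c Sc hc] := hg _ e2.
  exists (z *: a + c); first exact: phL.
  move=> b Sb; rewrite pqL//.
  have -> : z * f b + g b - (z * q a b + q c b) = z * (f b - q a b) + (g b - q c b).
    by ring.
  apply: (le_trans (cabsD _ _)); rewrite cabsM.
  have -> : e * pn b = (e / 2) * pn b + e / 2 * pn b by lra.
  apply: lerD; last exact: hc.
  apply: (le_trans (ler_wpM2l (cabs_ge0 z) (ha _ Sb))).
  rewrite mulrA ler_wpM2r ?pn_ge0// mulrA ler_pdivrMr// [X in X <= _]mulrC.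
  by rewrite ler_wpM2l ?(ltW e2)//; lra.
have h0 : approximable (0 : V -> R[i]^o).
  split=> // e e0; exists 0; first exact: ph_set0.
  by move=> b Sb; rewrite pq0l// subr0 cabs0 mulr_ge0 ?pn_ge0// ltW.
split; first split.
- exact/asboolP.
- move=> f g /asboolP hf /asboolP hg; apply/asboolP.
  have := lin 1 _ _ hf hg; congr approximable; apply/funext => b.
  by rewrite mul1r.
move=> k f /asboolP hf; apply/asboolP.
have := lin k _ _ hf h0; congr approximable; apply/funext => b.
by rewrite addr0.
Qed.

Record cpl := Cpl { cplval :> V -> R[i]^o; _ : is_cpl cplval }.

HB.instance Definition _ := [isSub for cplval].
HB.instance Definition _ := [Choice of cpl by <:].
HB.instance Definition _ :=
  GRing.SubChoice_isSubLmodule.Build R[i] (V -> R[i]^o) is_cpl cpl is_cpl_closed.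

End PreHilbert.
Arguments cplval {R V X} _ _ : simpl never.

Section Completion.
Context {R : realType} {V : lmodType R[i]} {X : prehilbert V}.
Implicit Types (a b c : V) (f g h : cpl X) (z : R[i]).
Local Notation S := (ph_set X).
Local Notation q := (ph_form X).
Local Notation n2 := (pn X).
Local Notation fb := (fbnd X).

Lemma cplP f : approximable X f.
Proof. by case: f => f hf; exact/asboolP. Qed.

Lemma cplext f g : (forall b, S b -> f b = g b) -> f = g.
Proof.
move=> h; apply: val_inj; apply/funext => b.
have [/h//|nb] := pselect (S b).
by have [f0 _] := cplP f; have [g0 _] := cplP g; rewrite /= f0// g0.
Qed.

Lemma cplL z f g b : (z *: f + g) b = z * f b + g b. Proof. by []. Qed.
Lemma cplD f g b : (f + g) b = f b + g b. Proof. by []. Qed.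
Lemma cplN f b : (- f) b = - f b. Proof. by []. Qed.
Lemma cplZ z f b : (z *: f) b = z * f b. Proof. by []. Qed.

Lemma ap_ex f (k : nat) : exists a, S a /\
  forall b, S b -> cabs (f b - q a b) <= k.+1%:R^-1 * n2 b.
Proof.
have k0 : 0 < k.+1%:R^-1 :> R by rewrite invr_gt0.
by have [_ /(_ _ k0)[a Sa ha]] := cplP f; exists a.
Qed.

Definition ap f k : V := projT1 (cid (ap_ex f k)).

Lemma apS f k : S (ap f k).
Proof. by rewrite /ap; case: cid => a []. Qed.

Lemma apP f k b : S b -> cabs (f b - q (ap f k) b) <= k.+1%:R^-1 * n2 b.
Proof. by rewrite /ap; case: cid => a /= [_]; exact. Qed.

Lemma cpl_bnd f : exists2 c : R, 0 <= c & fb f c.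
Proof.
exists (1 + n2 (ap f 0)); first by rewrite addr_ge0 ?pn_ge0.
move=> b Sb; have := apP f 0 Sb; rewrite invr1 => h.
have -> : f b = (f b - q (ap f 0) b) + q (ap f 0) b by rewrite subrK.
apply: (le_trans (cabsD _ _)); rewrite mulrDl; apply: lerD => //.
exact: pq_CS (apS f 0) Sb.
Qed.

Lemma near_pn f a (c e : R) : 0 <= c -> 0 <= e -> S a -> fb f c ->
  (forall b, S b -> cabs (f b - q a b) <= e * n2 b) -> n2 a <= c + e.
Proof.
move=> c0 e0 Sa fc ha; have [->|a0] := eqVneq (n2 a) 0; first by rewrite addr_ge0.
have ap0 : 0 < n2 a by rewrite lt0r a0 pn_ge0.
rewrite -(ler_pM2r ap0) -expr2.
have -> : n2 a ^+ 2 = cabs (f a - (f a - q a a)).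
  by rewrite subKr pq_pn// cabs_real ger0_norm// exprn_ge0 ?pn_ge0.
by apply: (le_trans (cabsD _ _)); rewrite cabsN mulrDl lerD// ?fc ?ha.
Qed.

Lemma ap_pn f k (c : R) : 0 <= c -> fb f c -> n2 (ap f k) <= c + k.+1%:R^-1.
Proof.
move=> c0 fc; apply: (near_pn c0 _ (apS f k) fc (apP f k)).
by rewrite invr_ge0.
Qed.

Lemma inv_le1 (k : nat) : k.+1%:R^-1 <= 1 :> R.
Proof. by rewrite invf_le1// ler1n. Qed.

Lemma cpl_linr f z a b : S a -> S b -> f (z *: a + b) = conjc z * f a + f b.
Proof.
move=> Sa Sb; apply/eqP; rewrite -subr_eq0; apply/eqP/cabs_eq0/eqP.
rewrite eq_le cabs_ge0 andbT; apply: le_eps => e e0; rewrite add0r.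
pose C := n2 (z *: a + b) + cabs z * n2 a + n2 b + 1.
have C0 : 0 < C.
  have := pn_ge0 X (z *: a + b); have := mulr_ge0 (cabs_ge0 z) (pn_ge0 X a).
  by have := pn_ge0 X b; rewrite /C; lra.
have [k0 /(_ _ (leqnn _)) hk] := invn_small (divr_gt0 e0 C0).
have h1 := apP f k0 (phL z Sa Sb); have h2 := apP f k0 Sa; have h3 := apP f k0 Sb.
have Sk := apS f k0; move: (ap f k0) Sk h1 h2 h3 => c Sc.
rewrite pqR//; set i := k0.+1%:R^-1 in hk *; move=> h1 h2 h3.
have -> : f (z *: a + b) - (conjc z * f a + f b) =
  (f (z *: a + b) - (conjc z * q c a + q c b)) - (conjc z * (f a - q c a) + (f b - q c b)).
  by ring.
apply: (le_trans (cabsD _ _)); rewrite cabsN.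
have h4 := cabsD (conjc z * (f a - q c a)) (f b - q c b).
rewrite cabsM cabs_conj in h4.
have h5 := ler_wpM2l (cabs_ge0 z) h2.
have i0 : 0 <= i by rewrite /i invr_ge0.
have h6 : i * n2 (z *: a + b) + cabs z * (i * n2 a) + i * n2 b + i <= e.
  by move: hk; rewrite ler_pdivlMr// /C !mulrDr mulr1 [i * (cabs z * _)]mulrCA.
apply: (le_trans (lerD h1 (le_trans h4 (lerD h5 h3)))).
by clearbody i; move: h6 i0; lra.
Qed.

(** The generalized limit makes this linear in [f] for any choice of the approximants [ap g k]. *)
Definition ip f g : R[i] := glim (fun k => f (ap g k)).

Lemma ip_bdd f g : bdd (fun k => f (ap g k)).
Proof.
have [c c0 fc] := cpl_bnd f; have [d d0 gd] := cpl_bnd g.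
exists (c * (d + 1)) => k; apply: (le_trans (fc _ (apS g k))); apply: ler_wpM2l => //.
by apply: (le_trans (ap_pn k d0 gd)); rewrite lerD2l inv_le1.
Qed.

Lemma ipL z f g h : ip (z *: f + g) h = z * ip f h + ip g h.
Proof.
rewrite /ip -glimZ; last exact: ip_bdd.
rewrite -glimD//; last exact: ip_bdd.
exact: (bddZ z (ip_bdd f h)).
Qed.

Lemma glim_eq (u v : nat -> R[i]) : bdd u -> bdd v -> ccvg (fun k => u k - v k) 0 ->
  glim u = glim v.
Proof.
move=> hu hv h; apply/eqP; rewrite -subr_eq0 -glimB//; apply/eqP.
by apply: glim_cvg => //; apply: bddD => //; have [c hc] := hv; exists c => n; rewrite cabsN.
Qed.

Lemma ap_small (u : nat -> R[i]) (c : R) : (forall k, cabs (u k) <= k.+1%:R^-1 * c) ->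
  ccvg u 0.
Proof.
move=> h e e0; have c0 : 0 <= c.
  by have := h 0%N; rewrite invr1 mul1r; apply: le_trans; exact: cabs_ge0.
have c1 : 0 < c + 1 by lra.
have [k0 hk] := invn_small (divr_gt0 e0 c1); exists k0 => k /hk {}hk; rewrite subr0.
apply: (le_trans (h k)); move: hk; rewrite ler_pdivlMr//; apply: le_trans.
by rewrite ler_wpM2l ?invr_ge0// lerDl.
Qed.

(** The symmetric expression, from which hermitian symmetry and positivity of [ip] are inherited. *)
Lemma ipE f g : ip f g = glim (fun k => q (ap f k) (ap g k)).
Proof.
have [c c0 fc] := cpl_bnd f; have [d d0 gd] := cpl_bnd g.
have nf k : n2 (ap f k) <= c + 1.
  by apply: (le_trans (ap_pn k c0 fc)); rewrite lerD2l inv_le1.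
have ng k : n2 (ap g k) <= d + 1.
  by apply: (le_trans (ap_pn k d0 gd)); rewrite lerD2l inv_le1.
apply: glim_eq; first exact: ip_bdd.
  exists ((c + 1) * (d + 1)) => k; apply: (le_trans (pq_CS (apS f k) (apS g k))).
  by apply: ler_pM => //; exact: pn_ge0.
apply: (ap_small (c := d + 1)) => k; apply: (le_trans (apP f k (apS g k))).
by apply: ler_wpM2l => //; rewrite invr_ge0.
Qed.

Lemma apq_bdd f g : bdd (fun k => q (ap f k) (ap g k)).
Proof.
have [c c0 fc] := cpl_bnd f; have [d d0 gd] := cpl_bnd g.
exists ((c + 1) * (d + 1)) => k; apply: (le_trans (pq_CS (apS f k) (apS g k))).
apply: ler_pM; rewrite ?pn_ge0//.
  by apply: (le_trans (ap_pn k c0 fc)); rewrite lerD2l inv_le1.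
by apply: (le_trans (ap_pn k d0 gd)); rewrite lerD2l inv_le1.
Qed.

Lemma ipC f g : ip g f = conjc (ip f g).
Proof.
rewrite !ipE -glim_conj; last exact: apq_bdd.
by congr glim; apply/funext => k; rewrite -pqC ?apS//; exact: apS.
Qed.

Lemma ip_ge0 f : 0 <= ip f f.
Proof.
rewrite ipE; apply: glim_ge0; first exact: apq_bdd.
by move=> k; apply: pq_ge0; exact: apS.
Qed.

Lemma emb_approx a : S a -> approximable X (fun b => if `[< S b >] then q a b else 0).
Proof.
move=> Sa; split; first by move=> b nb; rewrite asboolF.
move=> e e0; exists a => // b Sb; rewrite asboolT//.
by rewrite subrr cabs0 mulr_ge0 ?pn_ge0// ltW.
Qed.

Definition emb a : cpl X :=
  if pselect (S a) is left Sa then Cpl (asboolT (emb_approx Sa)) else 0.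

Lemma embE a b : S a -> S b -> emb a b = q a b.
Proof.
move=> Sa Sb; rewrite /emb; case: pselect => // h.
by rewrite -[LHS]/(if `[< S b >] then q a b else 0) asboolT.
Qed.

Lemma embL z a b : S a -> S b -> emb (z *: a + b) = z *: emb a + emb b.
Proof.
move=> Sa Sb; apply: cplext => c Sc; rewrite cplL !embE ?pqL//.
exact: phL.
Qed.

Lemma ip_emb f a : S a -> ip f (emb a) = f a.
Proof.
move=> Sa; apply: glim_cvg; first exact: ip_bdd.
have [c c0 fc] := cpl_bnd f.
suff : ccvg (fun k => f (ap (emb a) k) - f a) 0.
  by move=> h e /h[N hN]; exists N => n /hN; rewrite subr0.
apply: (ap_small (c := c)) => k.
have Sk := apS (emb a) k; have hk := apP (emb a) k.
move: (ap (emb a) k) Sk hk => b Sb hb.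
have Sba := phB Sb Sa.
have -> : f b - f a = f (b - a).
  rewrite (_ : b - a = -1 *: a + b); last by rewrite scaleN1r addrC.
  by rewrite cpl_linr// rmorphN1 mulN1r addrC.
apply: (le_trans (fc _ Sba)); rewrite mulrC; apply: ler_wpM2r => //.
have [->|ba0] := eqVneq (n2 (b - a)) 0; first by rewrite invr_ge0.
have ba1 : 0 < n2 (b - a) by rewrite lt0r ba0 pn_ge0.
rewrite -(ler_pM2r ba1); have := hb _ Sba; rewrite embE// -cabsN opprB -pqB//.
by rewrite pq_pn// cabs_real ger0_norm ?exprn_ge0 ?pn_ge0.
Qed.

Definition cnm f : R := Num.sqrt (complex.Re (ip f f)).

Lemma ip_psd : psd_form setT ip.
Proof.
by split=> //; [move=> *; exact: ipL|move=> *; exact: ipC|move=> *; exact: ip_ge0].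
Qed.

Lemma cnm_ge0 f : 0 <= cnm f. Proof. exact: sqrtr_ge0. Qed.

Lemma cnm_sq f : ip f f = (cnm f ^+ 2)%:C.
Proof. by rewrite sqr_sqrtr ?Re_ge0 ?ip_ge0// [LHS]ge0_ReC// ip_ge0. Qed.

Lemma ip_CS f g : cabs (ip f g) <= cnm f * cnm g.
Proof.
apply: le_of_sqr; first by rewrite mulr_ge0 ?cnm_ge0.
have h k : cnm k ^+ 2 = complex.Re (ip k k) by rewrite -[RHS]/(complex.Re _) cnm_sq.
by rewrite exprMn !h; exact: (psd_CS ip_psd).
Qed.

Lemma cnm_emb a : S a -> cnm (emb a) = n2 a.
Proof. by move=> Sa; rewrite /cnm ip_emb// embE. Qed.

Lemma cnm_fb f : fb f (cnm f).
Proof. by move=> b Sb; rewrite -ip_emb// -(cnm_emb Sb) ip_CS. Qed.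

(** With [cnm_fb], the Hilbert norm is the norm as a functional; the triangle inequality,
    homogeneity and completeness are read off from there. *)
Lemma cnm_le f (c : R) : 0 <= c -> fb f c -> cnm f <= c.
Proof.
move=> c0 fc; have h : cnm f ^+ 2 <= c * cnm f.
  apply: le_eps => e e0.
  have [k0 hk] := invn_small (divr_gt0 e0 (ltr_wpDl c0 ltr01)).
  have : cabs (ip f f) <= c * (cnm f + e / (c + 1)).
    apply: (glim_bound (N := k0)); first exact: ip_bdd.
    move=> k /hk {}hk; apply: (le_trans (fc _ (apS f k))); apply: ler_wpM2l => //.
    by apply: (le_trans (ap_pn k (cnm_ge0 f) (@cnm_fb f))); rewrite lerD2l.
  rewrite cnm_sq cabs_real ger0_norm ?exprn_ge0 ?cnm_ge0// => /le_trans; apply.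
  rewrite mulrDr lerD2l mulrA ler_pdivrMr; last by lra.
  by rewrite mulrC ler_wpM2l ?(ltW e0)//; lra.
have [->//|n0] := eqVneq (cnm f) 0.
by rewrite -(ler_pM2r (x := cnm f)) -?expr2// lt0r n0 cnm_ge0.
Qed.

Lemma ipR z f g h : ip h (z *: f + g) = conjc z * ip h f + ip h g.
Proof. by rewrite [LHS]ipC ipL rmorphD rmorphM /= (ipC f h) (ipC g h). Qed.

Lemma cnmD f g : cnm (f + g) <= cnm f + cnm g.
Proof.
apply: cnm_le; first by rewrite addr_ge0 ?cnm_ge0.
move=> b Sb; rewrite cplD mulrDl; apply: (le_trans (cabsD _ _)).
by apply: lerD; exact: cnm_fb.
Qed.

Lemma cnmZ z f : cnm (z *: f) = cabs z * cnm f.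
Proof.
have le w h : cnm (w *: h) <= cabs w * cnm h.
  apply: cnm_le; first by rewrite mulr_ge0 ?cabs_ge0 ?cnm_ge0.
  by move=> b Sb; rewrite cplZ cabsM -mulrA ler_wpM2l ?cabs_ge0 ?cnm_fb.
apply/eqP; rewrite eq_le le/=.
have [->|z0] := eqVneq z 0; first by rewrite cabs0 mul0r cnm_ge0.
have := ler_wpM2l (cabs_ge0 z) (le z^-1 (z *: f)); rewrite scalerA mulVf// scale1r.
by rewrite mulrA -cabsM divff// /cabs normr1 mul1r.
Qed.

Lemma cnm_eq0 f : cnm f = 0 -> f = 0.
Proof.
move=> h; apply: cplext => b Sb; apply/cabs_eq0/eqP.
by rewrite eq_le cabs_ge0 andbT (le_trans (cnm_fb f Sb))// h mul0r.
Qed.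

Let cn f : R[i] := (cnm f)%:C.

Let cnD f g : cn (f + g) <= cn f + cn g.
Proof. by rewrite -rmorphD lecR cnmD. Qed.

Let cnZ z f : cn (z *: f) = `|z| * cn f.
Proof. by rewrite cabsE /cn cnmZ rmorphM. Qed.

Let cn_eq0 f : cn f = 0 -> f = 0.
Proof. by move=> /complexI; exact: cnm_eq0. Qed.

HB.instance Definition _ := Lmodule_isNormed.Build R[i] (cpl X) cnD cnZ cn_eq0.

End Completion.

Section CompletionHilbert.
Context {R : realType} {V : lmodType R[i]} {X : prehilbert V}.
Implicit Types (a b c : V) (f g h : cpl X) (z : R[i]).
Local Notation S := (ph_set X).
Local Notation q := (ph_form X).

Lemma cpl_normE f : `|f| = (cnm f)%:C. Proof. by []. Qed.

Lemma cnmN f : cnm (- f) = cnm f.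
Proof. by rewrite -scaleN1r cnmZ cabsN /cabs normr1 mul1r. Qed.

Lemma cnm_sub f g : cnm (f - g) = cnm (g - f).
Proof. by rewrite -cnmN opprB. Qed.

Lemma cpl_seq_complete (u : nat -> cpl X) :
  (forall k m, (k <= m)%N -> cnm (u m - u k) <= k.+1%:R^-1) ->
  exists f, forall k, cnm (u k - f) <= k.+1%:R^-1.
Proof.
move=> hu.
pose ff b : R[i]^o := if `[< S b >] then glim (fun k => u k b) else 0.
have bd b : bdd (fun k => u k b).
  have [c c0 hc] := cpl_bnd (u 0); have [Sb|nb] := pselect (S b); last first.
    by exists 0 => k; have [h _] := cplP (u k); rewrite h// cabs0.
  exists (c * pn X b + 1 * pn X b) => k.
  have -> : u k b = u 0%N b + (u k - u 0%N) b by rewrite cplD cplN addrC subrK.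
  apply: (le_trans (cabsD _ _)); apply: lerD; first exact: hc.
  apply: (le_trans (cnm_fb _ Sb)); rewrite ler_wpM2r ?pn_ge0//.
  by apply: (le_trans (hu 0%N k (leq0n k))); rewrite invr1.
have near k b : S b -> cabs (ff b - u k b) <= k.+1%:R^-1 * pn X b.
  move=> Sb; rewrite /ff asboolT// -[u k b](glim_cst) -glimB//; last exact: bdd_cst.
  apply: (glim_bound (N := k)).
    by apply: bddD => //; exact: bdd_cst.
  move=> m km; rewrite -[_ - _]/((u m - u k) b).
  by apply: (le_trans (cnm_fb _ Sb)); rewrite ler_wpM2r ?pn_ge0// hu.
have hf : approximable X ff.
  split; first by move=> b nb; rewrite /ff asboolF.
  move=> e e0; have e2 : 0 < e / 2 by lra.
  have [k /(_ k (leqnn k)) hk] := invn_small e2.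
  have [_ /(_ _ e2)[a Sa ha]] := cplP (u k); exists a => // b Sb.
  have -> : ff b - q a b = (ff b - u k b) + (u k b - q a b) by rewrite addrA subrK.
  apply: (le_trans (cabsD _ _)).
  have -> : e * pn X b = e / 2 * pn X b + e / 2 * pn X b by lra.
  apply: lerD; last exact: ha.
  by apply: (le_trans (near k b Sb)); rewrite ler_wpM2r ?pn_ge0.
exists (Cpl (asboolT hf)) => k; rewrite cnm_sub.
by apply: cnm_le; rewrite ?invr_ge0// => b Sb; exact: near.
Qed.

Lemma cpl_complete (F : set_system (cpl X)) : ProperFilter F -> cauchy F -> cvg F.
Proof.
move=> FF /cauchyP cF.
have /choice[u hu] (k : nat) : exists f, F [set g | cnm (f - g) <= k.+1%:R^-1 / 2].
  have d0 : 0 < k.+1%:R^-1 / 2 :> R by rewrite divr_gt0// invr_gt0.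
  have [|f hf] := cF (k.+1%:R^-1 / 2)%:C; first by rewrite ltcR.
  exists f; apply: filterS hf => g.
  by rewrite -ball_normE /= cpl_normE ltcR => /ltW.
have [f hf] : exists f, forall k, cnm (u k - f) <= k.+1%:R^-1.
  apply: cpl_seq_complete => k m km.
  have [g [gk gm]] := filter_ex (filterI (hu k) (hu m)).
  have -> : u m - u k = (u m - g) + (g - u k) by rewrite addrA subrK.
  apply: (le_trans (cnmD _ _)); rewrite (cnm_sub g).
  have : m.+1%:R^-1 <= k.+1%:R^-1 :> R by rewrite lef_pV2 ?posrE// ler_nat ltnS.
  move: gk gm => /= gk gm mk; apply: (le_trans (lerD gm gk)).
  by set x := m.+1%:R^-1 in mk *; set y := k.+1%:R^-1 in mk *; lra.
apply: (cvgP f); apply/cvg_ballP => e e0.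
have er : 0 < complex.Re e by move: e0; rewrite ltcE => /andP[].
have eE : e = (complex.Re e)%:C by rewrite RRe_real// gtr0_real.
have e2 : 0 < complex.Re e / 2 by lra.
have [k /(_ k (leqnn k)) hk] := invn_small e2.
apply: filterS (hu k) => g /= gk.
rewrite -ball_normE /= cpl_normE eE ltcR.
have -> : f - g = (f - u k) + (u k - g) by rewrite addrA subrK.
apply: (le_lt_trans (cnmD _ _)); rewrite (cnm_sub f).
apply: (le_lt_trans (lerD (hf k) gk)).
by set x := k.+1%:R^-1 in hk *; lra.
Qed.

HB.instance Definition _ := Uniform_isComplete.Build (cpl X) cpl_complete.

Lemma ip_bilinear : bilinear_for *%R (@Num.conj R[i] \; *%R) (@ip R V X).
Proof.
split=> h z f g; first exact: ipL.
exact: ipR.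
Qed.

HB.instance Definition _ := bilinear_isBilinear.Build R[i] (cpl X) (cpl X) R[i] *%R
  (@Num.conj R[i] \; *%R) (@ip R V X) ip_bilinear.

Lemma ip_herm (f g : cpl X) : ip f g = (-1) ^+ false * @Num.conj R[i] (ip g f).
Proof. by rewrite expr0 mul1r; exact: ipC. Qed.

HB.instance Definition _ := isHermitianSesquilinear.Build R[i] (cpl X) false
  (@Num.conj R[i]) (@ip R V X) ip_herm.

Lemma ip_gt0 f : f != 0 -> 0 < ip f f.
Proof.
move=> f0; rewrite cnm_sq ltcR exprn_gt0// lt0r cnm_ge0 andbT.
by apply: contra_neq f0; exact: cnm_eq0.
Qed.

HB.instance Definition _ := isDotProduct.Build R[i] (cpl X) (@ip R V X) ip_gt0.

Lemma cpl_norm_sq f : `|f| ^+ 2 = ip f f.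
Proof. by rewrite cpl_normE cnm_sq rmorphXn. Qed.

HB.instance Definition _ := CompleteNormedModule_isHilbert.Build R (cpl X)
  cpl_norm_sq.

End CompletionHilbert.

Section GNSConstruction.
Context {R : realType} {H : hilbertType R}.
Implicit Types (a b c m : bop H).
Variables (M : set (bop H)) (t : bop H -> R[i]).
Hypotheses (hM : vn M) (ht : tracial M t).

Let X : prehilbert (bop H) := PreHilbert (tr_psd hM ht) (vn0 hM).
Let K : hilbertType R := cpl X.
Let emb : bop H -> K := @emb R (bop H) X.

Let hdot_emb (f : K) b : el M b -> hdot f (emb b) = (f : cpl X) b.
Proof. exact: (@ip_emb R (bop H) X f b). Qed.

Let hdot_embs a b : el M a -> el M b -> hdot (emb a) (emb b) = t (adj b * a).
Proof. by move=> Ma Mb; rewrite hdot_emb//; exact: (@embE R (bop H) X a b). Qed.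

Let eq_emb (f g : K) : (forall b, el M b -> hdot f (emb b) = hdot g (emb b)) -> f = g.
Proof. by move=> h; apply: cplext => b Mb; rewrite -!hdot_emb// h. Qed.

Let emb_dense (f : K) : clo [set emb a | a in el M] f.
Proof.
move=> e e0; have [_ /(_ _ e0)[a Ma ha]] := cplP (f : cpl X).
exists (emb a); first by exists a.
apply: (@cnm_le R (bop H) X (f - emb a)); first exact: ltW.
by move=> b Mb; rewrite cplD cplN [emb a b](@embE R (bop H) X)//; exact: ha.
Qed.

Let nm_emb a : el M a -> nm (emb a) ^+ 2 = q2 t a.
Proof. by move=> Ma; rewrite nm_sq hdot_embs. Qed.

Let emb_lin (z : R[i]) a b : el M a -> el M b -> emb (z *: a + b) = z *: emb a + emb b.
Proof. exact: (@embL R (bop H) X). Qed.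

Let pi_ex a : exists T : bop K, el M a -> forall b, el M b -> T (emb b) = emb (a * b).
Proof.
have [Ma|nMa] := pselect (el M a); last by exists 0.
have [k k0 ak] := bop_bnd a.
have [//|z x y Mx My|z x y Mx My|s Ms|T [_ hT _]] :=
    @extension R K (bop H) (el M) emb (fun b => emb (a * b)) k k0 (vn0 hM).
- by move=> z x y Mx My; apply: vnD => //; exact: vnZ.
- exact: emb_lin.
- by rewrite mulrDr scaleMr; apply: emb_lin; exact: vnM.
- apply: le_of_sqr; first by rewrite mulr_ge0 ?nm_ge0.
  by rewrite exprMn !nm_emb//; [exact: (q2_Ml hM ht)|exact: vnM].
by exists T => _.
Qed.

Let pi a : bop K := projT1 (cid (pi_ex a)).

Let piE a b : el M a -> el M b -> pi a (emb b) = emb (a * b).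
Proof. by move=> Ma Mb; rewrite /pi; case: cid => T /= h; exact: h. Qed.

Let eq_on_emb (S T : bop K) : (forall b, el M b -> S (emb b) = T (emb b)) -> S = T.
Proof.
move=> h; apply/eqP; rewrite -subr_eq0; apply/eqP/bopext => f; rewrite op0.
apply: clo_ker (emb_dense f) => _ [b Mb <-].
by rewrite opB h// subrr.
Qed.

Lemma gns_exists : exists (K : hilbertType R) (pi : bop H -> bop K) (Om : K),
  gns M t pi Om.
Proof.
have M1 := vn1 hM.
exists K, pi, (emb 1); split.
- move=> z a b Ma Mb; apply: eq_on_emb => c Mc.
  rewrite opL !piE//; last by apply: vnD => //; exact: vnZ.
  by rewrite mulrDl scaleMl emb_lin//; exact: vnM.
- move=> a b Ma Mb; apply: eq_on_emb => c Mc.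
  by rewrite opM !piE// ?mulrA//; exact: vnM.
- move=> a Ma; have Ma' := vn_adj hM Ma; apply: eq_on_emb => c Mc.
  apply: eq_emb => b Mb; rewrite adjPr !piE//.
  by rewrite !hdot_embs ?adjM ?mulrA//; exact: vnM.
- by apply: eq_on_emb => b Mb; rewrite piE// mul1r op1.
- by move=> a Ma; rewrite piE// hdot_embs ?mulr1 ?adj1 ?mul1r.
move=> f e /(emb_dense f)[_ [a Ma <-] h]; exists (emb a) => //.
by exists a => //; rewrite piE// mulr1.
Qed.

End GNSConstruction.

(** * Operators as maps *)

Section Lift.
Context {R : realType} {H : hilbertType R}.
Implicit Types (A B D I M N : set (H -> H)) (a b c : bop H).

Definition lift A : set (bop H) := [set a | A (opval a)].

Lemma opval_inj : injective (@opval R H).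
Proof. exact: val_inj. Qed.

Lemma bopE (a : H -> H) : bounded_op a -> exists b : bop H, opval b = a.
Proof. by move=> ha; exists (mkbop ha). Qed.

Lemma adjointE a b : adjoint a b <-> b = adj a.
Proof. by split=> [|-> x y]; [exact: adj_uniq|exact: adjP]. Qed.

Lemma opnorm_leE a (e : R) : opnorm_le a e%:C <-> bnd a e.
Proof.
by split=> h x; have := h x; rewrite !nmE -rmorphM lecR.
Qed.

Lemma scalar_opE (z : R[i]) : (fun x : H => z *: x) = opval (z *: (1 : bop H)).
Proof. by []. Qed.

Lemma gt0_real (e : R[i]) : 0 < e -> 0 < complex.Re e /\ e = (complex.Re e)%:C.
Proof.
move=> e0; have e0R : 0 < complex.Re e by move: e0; rewrite ltcE => /andP[].
by split=> //; rewrite RRe_real// gtr0_real.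
Qed.

Lemma lift_commutant A : A `<=` bounded_op ->
  forall b, el (lift (commutant A)) b <-> el (comm (lift A)) b.
Proof.
move=> hA b; split=> [[_ h] a Aa|h].
  by apply: opval_inj; exact: h.
split; first exact: bopP.
by move=> a Aa; have [a' aE] := bopE (hA _ Aa); rewrite -aE -!val_bmul h// /el/lift/= aE.
Qed.

Lemma commutant_bounded A : commutant A `<=` bounded_op.
Proof. by move=> a []. Qed.

Lemma vN_bounded A : von_neumann A -> A `<=` bounded_op.
Proof. by move=> [_ <-]; exact: commutant_bounded. Qed.

Lemma lift_star A : A `<=` bounded_op -> star_closed A -> star (lift A).
Proof.
move=> bA sA a Aa; have [b Ab] := sA _ Aa; have [b' b'E] := bopE (bA _ Ab).
by rewrite -b'E => /adjointE h; rewrite /el /lift /= -h b'E.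
Qed.

Lemma lift_vn A : von_neumann A -> vn (lift A).
Proof.
move=> vA; have bA := vN_bounded vA; have [sA AA] := vA; split; first exact: lift_star.
move=> a ha; rewrite /el /lift /= -AA; split; first exact: bopP.
move=> c cA; have [c' c'E] := bopE (commutant_bounded cA); rewrite -c'E in cA *.
rewrite -!val_bmul; congr opval; apply: ha.
exact/(lift_commutant bA).
Qed.

Lemma lift_scalar A : Defs.factor A -> forall y, el (lift A) y ->
  (forall a, el (lift A) a -> a * y = y * a) -> exists z : R[i], y = z *: (1 : bop H).
Proof.
move=> [vA hA] y Ay hy; have bA := vN_bounded vA.
have : (A `&` commutant A) (opval y) by split=> //; exact/(lift_commutant bA).
by rewrite hA => -[z zE]; exists z; exact: opval_inj.
Qed.

Lemma lift_fprop A : Defs.factor A -> fprop (lift A).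
Proof.
move=> fA; have vA := lift_vn fA.1; apply: (fprop_of_center vA) => z [zz _] Az hz.
have [c zE] := lift_scalar fA Az hz.
have [c0|c0] := eqVneq c 0; first by left; rewrite zE c0 scale0r.
right; rewrite -[LHS](scalerK c0); move: zz; rewrite {1}zE scaleMl mul1r => ->.
by rewrite zE scalerK.
Qed.

Lemma lift_infdim A : infinite_dimensional A -> A `<=` bounded_op -> infdim (lift A).
Proof.
move=> inf bA s; have [a Aa ha] := inf (size s) (fun i => opval s`_i).
have [a' a'E] := bopE (bA _ Aa); rewrite -a'E in Aa ha.
exists a' => // -[z zE]; apply: (ha (fun i => z i)).
apply/funext => x; rewrite zE op_sum fct_sumE.
by apply: eq_bigr.
Qed.

Lemma square_summableE (xi : nat -> H) : square_summable xi -> sqsum xi.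
Proof.
move=> [c hc]; exists (complex.Re c) => n; have /Re_le := hc n.
rewrite Re_sum; apply: le_trans; apply: ler_sum => i _.
by rewrite nmE -rmorphXn.
Qed.

Lemma sqsumE (xi : nat -> H) : sqsum xi -> square_summable xi.
Proof.
move=> [c hc]; exists c%:C => n.
have -> : \sum_(i < n) `|xi i| ^+ 2 = (\sum_(i < n) nm (xi i) ^+ 2)%:C.
  by rewrite rmorph_sum; apply: eq_bigr => i _; rewrite nmE rmorphXn.
by rewrite lecR.
Qed.

Lemma cvg_ccvg (u : nat -> R[i]^o) (l : R[i]^o) : (u @ \oo --> l) <-> ccvg u l.
Proof.
split=> [/cvgrPdist_le h e e0|h].
  have [|N _ hN] := h e%:C; first by rewrite ltcR.
  by exists N => n /hN /=; rewrite cabsE lecR -cabsN opprB.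
apply/cvgrPdist_le => e /gt0_real[er eE]; have [N hN] := h _ er.
exists N => // n /= /hN; rewrite eE cabsE lecR.
by rewrite -cabsN opprB.
Qed.

Lemma series_psum (xi eta : nat -> H) a :
  series (fun n => hdot (a (xi n)) (eta n) : R[i]^o) = psum xi eta a.
Proof. by apply/funext => n; rewrite /series /psum /= big_mkord. Qed.

Lemma normal_nf A f : normal_functional A f -> exists xi eta : nat -> H,
  [/\ sqsum xi, sqsum eta & forall a, el (lift A) a -> f (opval a) = nf xi eta a].
Proof.
move=> [xi [eta [/square_summableE hx /square_summableE he h]]].
exists xi, eta; split=> // a Aa; symmetry; apply: glim_cvg; first exact: psum_bdd.
by have := h _ Aa; rewrite series_psum => /cvg_ccvg.
Qed.

(** [tau] is meaningful only on [A]; the vectors of its series define the [nf] that agrees with it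
    there and is linear and normal everywhere. *)
Lemma lift_tracial A tau : A `<=` bounded_op -> vn (lift A) -> tracial_state A tau ->
  exists t, tracial (lift A) t /\ forall a, el (lift A) a -> tau (opval a) = t a.
Proof.
move=> bA vA [/normal_nf[xi [eta [hx he hnf]]] t1 tp tf tc].
exists (nf xi eta); split=> //; split.
- by move=> z a b; exact: nf_lin.
- by rewrite -hnf ?t1//; exact: vn1.
- move=> a Aa; have Aa' := vn_adj vA Aa.
  by rewrite -hnf; [exact/tp/adjointE|exact: (vnM vA)].
- move=> a Aa; have Aa' := vn_adj vA Aa.
  rewrite -hnf; last exact: (vnM vA).
  by move=> h; apply: opval_inj; apply: (tf _ _ Aa Aa' _ h); exact/adjointE.
- move=> a b Aa Ab; rewrite -!hnf; [exact: tc|exact: (vnM vA)..].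
- by move=> u a k k0 uk ak ua; exact: (nf_wlim hx he k0 uk ak ua).
exact: nf_bound.
Qed.

End Lift.

(** * Convex hulls and the relative Dixmier property for sets of maps *)

Section Hulls.
Context {R : realType} {H : hilbertType R}.
Implicit Types (A B D I M N : set (H -> H)) (a b c : bop H).

(** Induction on the number of terms: the other weights are divided by their sum [T], and [T = 0] is
    treated apart. *)
Lemma convex_sum (V : lmodType R[i]) (X : set V) :
  (forall (r : R) x y, 0 <= r <= 1 -> X x -> X y -> X (r%:C *: x + (1 - r)%:C *: y)) ->
  forall n (t : 'I_n -> R[i]) (s : 'I_n -> V), (forall i, 0 <= t i) ->
    \sum_i t i = 1 -> (forall i, X (s i)) -> X (\sum_i t i *: s i).
Proof.
move=> cX; elim=> [t s _|n IH t s t0 t1 Xs].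
  by rewrite big_ord0 => /eqP; rewrite eq_sym oner_eq0.
rewrite big_ord_recr /= in t1; rewrite big_ord_recr /=.
set T := \sum_(i < n) _ in t1.
have T0 : 0 <= T by apply: sumr_ge0.
set r := t ord_max in t1 *; have r0 : 0 <= r by exact: t0.
have TE := ge0_ReC T0; have rE := ge0_ReC r0.
have Tr : complex.Re T + complex.Re r = 1 by rewrite -ReD t1.
have [Tz|Tn] := eqVneq T 0.
  have tz i : t (widen_ord (leqnSn n) i) = 0.
    have /eqP := Tz; rewrite psumr_eq0// => /allP/(_ i (mem_index_enum i))/=.
    by move/eqP.
  rewrite big1; last by move=> i _; rewrite tz scale0r.
  by have -> : r = 1 by [rewrite -t1 Tz add0r]; rewrite add0r scale1r.
have -> : \sum_(i < n) t (widen_ord (leqnSn n) i) *: s (widen_ord (leqnSn n) i) =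
    T *: \sum_(i < n) (T^-1 * t (widen_ord (leqnSn n) i)) *: s (widen_ord (leqnSn n) i).
  by rewrite scaler_sumr; apply: eq_bigr => i _; rewrite scalerA mulrA mulfV// mul1r.
have -> : r = (1 - complex.Re T)%:C by rewrite -Tr addrC addKr.
rewrite {1}TE; apply: cX => //.
  by rewrite Re_ge0//= -Tr lerDl Re_ge0.
apply: IH => // [i|]; first by rewrite mulr_ge0// invr_ge0.
by rewrite -mulr_sumr mulVf.
Qed.

Lemma convex_hull_convex (S : set (H -> H)) (r : R) (x y : H -> H) : 0 <= r <= 1 ->
  convex_hull S x -> convex_hull S y -> convex_hull S (r%:C *: x + (1 - r)%:C *: y).
Proof.
move=> /andP[r0 r1] [n [t [s [t0 t1 Ss ->]]]] [m [t' [s' [t0' t1' Ss' ->]]]].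
exists (n + m)%N, (fun i : 'I_(n + m) =>
    match fintype.split i with inl j => r%:C * t j | inr j => (1 - r)%:C * t' j end),
  (fun i : 'I_(n + m) => match fintype.split i with inl j => s j | inr j => s' j end); split.
- by move=> i; case: fintype.split => j; rewrite mulr_ge0// lecR// subr_ge0.
- rewrite big_split_ord /=.
  under eq_bigr do rewrite (unsplitK (inl _)).
  under [X in _ + X]eq_bigr do rewrite (unsplitK (inr _)).
  by rewrite -!mulr_sumr t1 t1' !mulr1 -rmorphD addrC subrK.
- by move=> i; case: fintype.split.
rewrite big_split_ord /=.
under [X in _ = X + _]eq_bigr do rewrite (unsplitK (inl _)) -scalerA.
under [X in _ = _ + X]eq_bigr do rewrite (unsplitK (inr _)) -scalerA.
by rewrite -!scaler_sumr.
Qed.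

Lemma unitary_lift B u v : unitary_in B (opval u) (opval v) ->
  unitary (lift B) u /\ v = adj u.
Proof.
move=> [Bu Bv /adjointE vE uv vu]; split=> //; split=> //; rewrite -vE;
  exact: opval_inj.
Qed.

Lemma lift_unitary B u : vn (lift B) -> unitary (lift B) u ->
  unitary_in B (opval u) (opval (adj u)).
Proof.
move=> vB [Bu uu uu']; split=> //; [exact: (vn_adj vB Bu)|exact/adjointE| |].
  by rewrite -val_bmul uu'.
by rewrite -val_bmul uu.
Qed.

Lemma relative_DixmierE N M : N `<=` bounded_op -> vn (lift N) -> M `<=` bounded_op ->
  relative_Dixmier N M <-> forall x, el (lift M) x -> exists z : R[i],
    forall e : R, 0 < e -> exists2 b, hull (lift N) x b & bnd (b - z *: (1 : bop H)) e.
Proof.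
move=> bN vN bM; split=> h x Mx.
  have [y [[_ hz] [z yE]]] := h _ Mx; rewrite {}yE in hz; exists z => e e0.
  have [|w [n [t [s [t0 t1 Ss wE]]]]] := hz e%:C; rewrite ?ltcR// {}wE.
  have /choice[s' hs'] i : exists b : bop H, hull (lift N) x b /\ opval b = s i.
    have [u [v [uv sE]]] := Ss i; have [Nu Nv _ _ _] := uv.
    have [u' u'E] := bopE (bN _ Nu); have [v' v'E] := bopE (bN _ Nv).
    rewrite -u'E -v'E in uv sE; have [Uu vE] := unitary_lift uv.
    by exists (adj u' * x * u'); split; [exact: hull_orbit|rewrite sE vE].
  have -> : \sum_i t i *: s i = opval (\sum_i t i *: s' i).
    apply/funext => k; rewrite fct_sumE op_sum; apply: eq_bigr => i _.
    have [_ sE] := hs' i. by rewrite -sE.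
  rewrite scalar_opE => hb.
  have {}hb := (opnorm_leE (z *: (1 : bop H) - \sum_i t i *: s' i) e).1 hb.
  exists (\sum_i t i *: s' i).
    apply: convex_sum => // [r a b r01|i]; first exact: hull_convex.
    by case: (hs' i).
  by rewrite -opprB; exact: bndN.
have [x' x'E] := bopE (bM _ Mx); rewrite -x'E in Mx *.
have [z hz] := h _ Mx; exists (opval (z *: (1 : bop H))); split; last by exists z.
split; first exact: bopP.
move=> e /gt0_real[e0 eE]; have [b hb bz] := hz _ e0; exists (opval b); last first.
  rewrite eE; apply: (opnorm_leE (z *: (1 : bop H) - b) _).2.
  by rewrite -opprB; exact: bndN.
apply: (hb (fun b => convex_hull (unitary_orbit N (opval x')) (opval b))).
  move=> u Uu; exists 1%N, (fun=> 1), (fun=> opval (adj u * x' * u)); split=> //.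
  - by rewrite big_ord1.
  - by move=> _; exists (opval u), (opval (adj u)); split=> //; exact: lift_unitary.
  - by rewrite big_ord1 scale1r.
by move=> r a c r01 ha hc; exact: convex_hull_convex.
Qed.

End Hulls.

(** * Ideals, simplicity and irreducibility for sets of maps *)

Section Simplicity.
Context {R : realType} {H : hilbertType R}.
Implicit Types (A B D I M N : set (H -> H)) (a b c : bop H).

Definition opset (D : set (bop H)) : set (H -> H) := [set a | exists2 b, el D b & a = opval b].

Lemma lift_opset (D : set (bop H)) a : el (lift (opset D)) a <-> el D a.
Proof. by split=> [[b Db /opval_inj ->]//|Da]; exists a. Qed.

Lemma opset_bounded (D : set (bop H)) : opset D `<=` bounded_op.
Proof. by move=> _ [b _ ->]; exact: bopP. Qed.

Lemma opset_subspace (D : set (bop H)) : bsubspace D -> Defs.subspace (opset D).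
Proof.
move=> [D0 DL]; split; first by exists 0.
by move=> z _ _ [a Da ->] [b Db ->]; exists (z *: a + b) => //; exact: DL.
Qed.

Lemma opset_closed (D : set (bop H)) : (forall a, el (ncl D) a -> el D a) ->
  op_closure (opset D) `<=` opset D.
Proof.
move=> cD x [bx hx]; have [a aE] := bopE bx; rewrite -aE in hx *.
exists a => //; apply: cD => e e0; have [|_ [b Db ->] ab] := hx e%:C.
  by rewrite ltcR.
by exists b => //; exact: (opnorm_leE (a - b) e).1.
Qed.

Lemma lift_sub D : Defs.subspace D -> bsubspace (lift D).
Proof. by move=> [D0 DL]; split => // z a b; exact: DL. Qed.

Lemma lift_closed D : op_closure D `<=` D ->
  forall a, el (ncl (lift D)) a -> el (lift D) a.
Proof.
move=> cD a ha; apply: cD; split; first exact: bopP.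
move=> e /gt0_real[e0 eE]; have [b Db ab] := ha _ e0; exists (opval b) => //.
by rewrite eE; exact: (opnorm_leE (a - b) _).2.
Qed.

Lemma lift_cstar D : cstar_algebra D -> cstar (lift D).
Proof.
move=> [bD sD mD jD cD]; split; [exact: lift_sub| |exact: lift_star|exact: lift_closed].
by move=> a b; exact: mD.
Qed.

Lemma opset_cstar (D : set (bop H)) : cstar D -> cstar_algebra (opset D).
Proof.
move=> [sD mD jD cD]; split.
- exact: opset_bounded.
- exact: opset_subspace.
- by move=> _ _ [a Da ->] [b Db ->]; exists (a * b) => //; exact: mD.
- move=> _ [a Da ->]; exists (opval (adj a)); last exact/adjointE.
  by exists (adj a) => //; exact: jD.
- exact: opset_closed.
Qed.

Lemma lift_ideal D I : closed_ideal D I -> ideal (lift D) (lift I).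
Proof.
move=> [ID sI mI cI]; split; [|exact: lift_sub| |exact: lift_closed].
  by move=> a; exact: ID.
by move=> a b Da Ib; exact: mI.
Qed.

Lemma opset_ideal (D I : set (bop H)) : ideal D I -> closed_ideal (opset D) (opset I).
Proof.
move=> [ID sI mI cI]; split.
- by move=> _ [a /ID Da ->]; exists a.
- exact: opset_subspace.
- move=> _ _ [a Da ->] [b Ib ->]; have [h1 h2] := mI _ _ Da Ib.
  by split; [exists (a * b)|exists (b * a)].
- exact: opset_closed.
Qed.

Lemma cstar_irreducibleE N M : N `<=` bounded_op ->
  cstar_irreducible N M <-> simple_inclusion (lift N) (lift M).
Proof.
move=> bN; split=> simp D cD ND DM I iI.
  have [||h|h] := simp _ (opset_cstar cD) _ _ _ (opset_ideal iI).
  - by move=> a Na; have [a' a'E] := bopE (bN _ Na); exists a' => //; apply: ND; rewrite /el /lift /= a'E.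
  - by move=> _ [a Da ->]; exact: DM.
  - left=> a Ia; have : opset I (opval a) by exists a.
    by rewrite h => aE; exact: opval_inj.
  - right=> a Da; have : opset D (opval a) by exists a.
    by rewrite -h => /(lift_opset I a).
have bD : D `<=` bounded_op by case: cD.
have bI : I `<=` bounded_op by case: iI => ID _ _ _ a /ID /bD.
have [||h|h] := simp _ (lift_cstar cD) _ _ _ (lift_ideal iI).
- by move=> a; exact: ND.
- by move=> a; exact: DM.
- left; apply/seteqP; split=> a; last by move=> ->; case: iI => _ [].
  by move=> Ia; have [a' a'E] := bopE (bI _ Ia); rewrite -a'E in Ia *; rewrite (h _ Ia).
right; apply/seteqP; split=> a; first by case: iI => ID _ _ _ /ID.
by move=> Da; have [a' a'E] := bopE (bD _ Da); rewrite -a'E in Da *; exact: h.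
Qed.

Lemma irreducible_inclusionE N M : N `<=` bounded_op -> M `<=` bounded_op ->
  vn (lift M) ->
  irreducible_inclusion N M <-> forall y, el (lift M) y ->
    (forall a, el (lift N) a -> a * y = y * a) -> exists z : R[i], y = z *: (1 : bop H).
Proof.
move=> bN bM vM; split=> h.
  move=> y My hy; have : (commutant N `&` M) (opval y).
    by split=> //; exact/(lift_commutant bN).
  by rewrite h => -[z zE]; exists z; exact: opval_inj.
apply/seteqP; split=> y [].
  move=> cy My; have [y' y'E] := bopE (bM _ My); rewrite -y'E in cy My *.
  have [z ->] := h _ My ((lift_commutant bN _).1 cy).
  by exists z.
move=> z ->; rewrite scalar_opE; split.
  by apply/(lift_commutant bN) => a Na; rewrite scaleMl scaleMr mulr1 mul1r.
by have : el (lift M) (z *: (1 : bop H)) by apply: vnZ => //; exact: vn1.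
Qed.

End Simplicity.

(** * The Jones index for sets of maps *)

Section FiniteIndex.
Context {R : realType} {H : hilbertType R}.
Implicit Types (A B D I M N : set (H -> H)) (a b c : bop H).

(* Unbounded maps are sent to 0. *)
Definition oprep {K : hilbertType R} (pi : bop H -> bop K) (a : H -> H) : K -> K :=
  if pselect (bounded_op a) is left ha then opval (pi (mkbop ha)) else 0.

Lemma oprepE {K : hilbertType R} (pi : bop H -> bop K) a : oprep pi (opval a) = opval (pi a).
Proof.
rewrite /oprep; case: pselect => [h|/(_ (bopP a))//].
by congr (opval (pi _)); exact: opval_inj.
Qed.

Lemma gns_GNS_triple M tau t {K : hilbertType R} (pi : bop H -> bop K) Om :
  M `<=` bounded_op -> vn (lift M) -> (forall a, el (lift M) a -> tau (opval a) = t a) ->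
  gns (lift M) t pi Om -> GNS_triple M tau (oprep pi) Om.
Proof.
move=> bM vM tE hg.
have ex (x : H -> H) : M x -> exists2 a, el (lift M) a & x = opval a.
  by move=> Mx; have [a aE] := bopE (bM _ Mx); rewrite -aE in Mx *; exists a.
split.
- split=> [_ /ex[a Ma ->]|]; first by rewrite oprepE; exact: bopP.
  by rewrite -[@id H]/(opval (1 : bop H)) oprepE (pi1 hg).
- move=> z _ _ /ex[a Ma ->] /ex[b Mb ->].
  have -> : z *: opval a + opval b = opval (z *: a + b) by [].
  rewrite !oprepE. by rewrite (piL hg).
- move=> _ _ /ex[a Ma ->] /ex[b Mb ->].
  by rewrite -val_bmul !oprepE (piM hg).
- move=> _ _ /ex[a Ma ->] /ex[b Mb ->] /adjointE ->.
  by rewrite !oprepE (piJ hg)//; exact/adjointE.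
split=> [_ /ex[a Ma ->]|]; first by rewrite oprepE (piT hg)// tE.
apply/seteqP; split=> // k _; apply: clo_closure => e e0.
have [_ [a Ma <-] h] := piD hg k e0.
by exists (pi a Om) => //; exists (opval a) => //; rewrite oprepE.
Qed.

Lemma GNS_triple_gns M tau t {K : hilbertType R} (pi : (H -> H) -> (K -> K)) Om :
  M `<=` bounded_op -> vn (lift M) -> (forall a, el (lift M) a -> tau (opval a) = t a) ->
  GNS_triple M tau pi Om -> exists pi' : bop H -> bop K,
    gns (lift M) t pi' Om /\ forall a, el (lift M) a -> opval (pi' a) = pi (opval a).
Proof.
move=> bM vM tE [[pb p1] pL pM pJ [pT pD]].
have /choice[pi' pE] a : exists b : bop K, el (lift M) a -> opval b = pi (opval a).
  have [Ma|nM] := pselect (el (lift M) a); last by exists 0.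
  by have [b bE] := bopE (pb _ Ma); exists b.
exists pi'; split=> //; split.
- move=> z a b Ma Mb; apply: opval_inj; rewrite pE.
    by rewrite [LHS]pL// -!pE.
  by apply: vnD => //; exact: vnZ.
- move=> a b Ma Mb; apply: opval_inj; rewrite pE; last exact: vnM.
  by rewrite val_bmul pM// -!pE.
- move=> a Ma; have Ma' := vn_adj vM Ma.
  apply/adjointE; rewrite !pE//; apply: pJ => //; exact/adjointE.
- by apply: opval_inj; rewrite pE; [exact: p1|exact: vn1].
- by move=> a Ma; rewrite -tE// -pT// -pE.
move=> k; have : closure [set pi a Om | a in M] k by rewrite pD.
move=> /closure_clo h e /h[_ [a Ma <-] ha].
have [a' a'E] := bopE (bM _ Ma); rewrite -a'E in Ma ha.
by exists (pi' a' Om); [exists a'|rewrite pE].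
Qed.

Lemma lift_commutant_pi N {K : hilbertType R} (pi : (H -> H) -> (K -> K))
    (pi' : bop H -> bop K) : N `<=` bounded_op ->
  (forall a, el (lift N) a -> opval (pi' a) = pi (opval a)) ->
  lift (commutant (pi @` N)) = commN pi' (lift N).
Proof.
move=> bN pE; apply/seteqP; split=> b.
  move=> [_ h] _ [a Na <-]; apply: opval_inj; rewrite !val_bmul pE//.
  by apply: h; exists (opval a).
move=> h; split; first exact: bopP.
move=> _ [x Nx <-]; have [a aE] := bopE (bN _ Nx); rewrite -aE in Nx *.
by rewrite -pE// -!val_bmul h//; exists a.
Qed.

Lemma factor_trace_unique A t : Defs.factor A -> tracial (lift A) t ->
  forall f : bop H -> R[i],
  (forall (z : R[i]) a b, el (lift A) a -> el (lift A) b -> f (z *: a + b) = z * f a + f b) ->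
  (forall a b, el (lift A) a -> el (lift A) b -> f (a * b) = f (b * a)) ->
  (exists2 C : R, 0 <= C & forall a (r : R), el (lift A) a -> 0 <= r -> bnd a r ->
     cabs (f a) <= C * r) ->
  forall a, el (lift A) a -> f a = t a * f 1.
Proof.
move=> fA ht f; exact: (trace_unique (lift_vn fA.1) ht (lift_fprop fA) (lift_scalar fA)).
Qed.

Lemma Dixmier_of_index N M : Defs.factor N -> Defs.factor M -> N `<=` M ->
  irreducible_inclusion N M -> finite_Jones_index N M -> relative_Dixmier N M.
Proof.
move=> fN fM NM irr [r [tau [K [pi [Om [htau hG coup]]]]]].
have [vN vM] := (lift_vn fN.1, lift_vn fM.1).
have [bN bM] := (vN_bounded fN.1, vN_bounded fM.1).
have [t [ht tE]] := lift_tracial bM vM htau.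
have [pi' [hg pE]] := GNS_triple_gns bM vM tE hG.
have NM' a : el (lift N) a -> el (lift M) a by exact: NM.
have PE : lift (commutant (pi @` N)) = commN pi' (lift N).
  by apply: lift_commutant_pi => // a /NM'; exact: pE.
case: coup => [[_ //]|[_ [tau' [_ [_ [_ [_ htau' _ _ _]]]]]]].
have vP := vnPN hg vN NM'.
have [s [hs _]] : exists s, tracial (commN pi' (lift N)) s /\
    forall T, el (commN pi' (lift N)) T -> tau' (opval T) = s T.
  rewrite -PE in vP *.
  exact: (lift_tracial (@commutant_bounded _ _ _) vP htau').
have hN' := tracial_sub ht NM'.
have uN := factor_trace_unique fN hN'; have uM := factor_trace_unique fM ht.
have irr' := (irreducible_inclusionE bN bM vM).1 irr.
apply: (relative_DixmierE bN vN bM).2 => x Mx; exists (t x) => e e0.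
apply: (dixmier_inclusion vN vM ht NM' irr' (lift_fprop fN)
  (eN_trace_gt0 vM ht hg vN NM' hs)) => //.
exact: (pimsner_popa vM ht hg vN NM' hs uN uM).
Qed.

(** Lets a finite list serve as a square summable sequence, continued by the default value 0 of
    [nth]. *)
Lemma sum_nth (K : zmodType) (V : zmodType) (zs : seq V) (F : V -> K) k : F 0 = 0 ->
  \sum_(i < size zs + k) F zs`_i = \sum_(z <- zs) F z.
Proof.
move=> F0; elim: k => [|k IH].
  by rewrite addn0 [RHS](big_nth 0) big_mkord.
by rewrite addnS big_ord_recr /= IH nth_default ?leq_addr// F0 addr0.
Qed.

Lemma list_normal {K : hilbertType R} (A : set (K -> K)) (zs : seq K) : A `<=` bounded_op ->
  normal_functional A (fun T => \sum_(z <- zs) hdot (T z) z).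
Proof.
move=> bA; exists (fun n => zs`_n), (fun n => zs`_n).
have sq : square_summable (fun n => zs`_n).
  apply: sqsumE; exists (\sum_(z <- zs) nm z ^+ 2) => n.
  rewrite -(sum_nth zs n (F := fun z => nm z ^+ 2)); last by rewrite nm0 expr0n.
  rewrite addnC big_split_ord /= lerDl sumr_ge0// => i _.
  by rewrite exprn_ge0 ?nm_ge0.
split=> // x Ax; have [T TE] := bopE (bA _ Ax); rewrite -TE in Ax *.
rewrite series_psum; apply/cvg_ccvg => e e0; exists (size zs) => n /subnKC <-.
rewrite /psum (sum_nth zs _ (F := fun z => hdot (T z) z)); last by rewrite hdot0r.
by rewrite subrr cabs0 ltW.
Qed.

Lemma cyclic_projection_exists {K : hilbertType R} (A : set (K -> K)) (xi : K) :
  Defs.subspace A -> exists p, cyclic_projection A xi p.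
Proof.
move=> [A0 AL]; pose S : set K := [set a xi | a in A].
have lS : lsub S.
  split; first by exists 0.
  by move=> z _ _ [a Aa <-] [b Ab <-]; exists (z *: a + b) => //; exact: AL.
have [p [pp sp pc cp _]] := projection_onto lS.
exists (opval p); split; first exact: bopP.
  by move=> x; apply: clo_closure; exact: pc.
move=> x a Aa; rewrite hdotBl -{1}sp adjPr cp ?subrr//.
by apply: sub_clo; exists a.
Qed.

Lemma finite_index_of_simple N M : II1_factor N -> II1_factor M ->
  separable_predual N -> N `<=` M -> simple_inclusion (lift N) (lift M) ->
  finite_Jones_index N M.
Proof.
move=> [fN _ _] [fM infM [tau htau]] [g [gn gd]] NM simp.
have [vN vM] := (lift_vn fN.1, lift_vn fM.1).
have [bN bM] := (vN_bounded fN.1, vN_bounded fM.1).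
have [t [ht tE]] := lift_tracial bM vM htau.
have NM' a : el (lift N) a -> el (lift M) a by exact: NM.
have hN' := tracial_sub ht NM'.
have uN := factor_trace_unique fN hN'.
have [K [pi [Om hg]]] := gns_exists vM ht.
have [nn [Nnn dense]] : exists nn : nat -> bop H, (forall j, el (lift N) (nn j)) /\
    forall n (d : R), el (lift N) n -> bnd n 1 -> 0 < d -> exists j, q2 t (n - nn j) <= d.
  apply: (dense_unit_ball vN hN' (g := fun m a => g m (opval a))) => n d Nn d0.
  (* Right multiplication by [n] replaces the vectors [xi k] of the series of [tau] by [n (xi k)];
     the dense sequence of the predual thus approximates these functionals. *)
  have nf : normal_functional N (fun x => tau (x \o opval n)).
    have [[xi [eta [hx he h]]] _ _ _ _] := htau.
    exists (fun k => n (xi k)), eta; split=> //.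
      have [c c0 nc] := bop_bnd n; have [b hb] := square_summableE hx.
      apply: sqsumE; exists (c ^+ 2 * b) => m.
      apply: le_trans (ler_wpM2l (exprn_ge0 2 c0) (hb m)).
      rewrite mulr_sumr; apply: ler_sum => i _; rewrite -exprMn.
      by rewrite ler_pXn2r ?nnegrE ?nm_ge0 ?mulr_ge0 ?nm_ge0.
    move=> x Nx; have [x' x'E] := bopE (bN _ Nx); rewrite -x'E in Nx *.
    apply: h; apply: NM; exact: (vnM vN Nx Nn).
  have [|m hm] := gd _ nf d%:C; first by rewrite ltcR.
  exists m => a Na a1.
  have := hm _ Na ((opnorm_leE a 1).2 a1).
  by rewrite cabsE lecR -val_bmul tE//; apply: NM'; exact: vnM.
have [zs [z1 zC zf]] := simple_trace vM ht hg vN NM' uN (lift_fprop fM)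
  (lift_infdim infM bM) Nnn dense simp.
have pE a : el (lift N) a -> opval (pi a) = oprep pi (opval a) by rewrite oprepE.
pose A := oprep pi @` N.
have exA (x : K -> K) : A x -> exists2 a, el (lift N) a & x = opval (pi a).
  move=> [y Ny <-]; have [a aE] := bopE (bN _ Ny); rewrite -aE in Ny *.
  by exists a; rewrite ?oprepE.
have bA : A `<=` bounded_op by move=> x /exA[a _ ->]; exact: bopP.
have PE : lift (commutant A) = commN pi (lift N) by exact: lift_commutant_pi.
have exC (x : K -> K) : commutant A x -> exists2 T, el (commN pi (lift N)) T & x = opval T.
  move=> cx; have [T TE] := bopE (commutant_bounded cx); exists T => //.
  by rewrite -PE /el /lift /= TE.
have Om1 : hdot Om Om = 1 by rewrite -{1}[Om]op1 -(pi1 hg) (piT hg) ?(tr1 ht)//; exact: vn1.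
have tA : tracial_state A (fun T => \sum_(z <- [:: Om]) hdot (T z) z).
  split; first exact: list_normal.
  - by rewrite big_seq1.
  - move=> _ _ /exA[a Na ->] /exA[b Nb ->] /adjointE ->; rewrite big_seq1 /=.
    by rewrite adjPr hdotxx lecR exprn_ge0 ?nm_ge0.
  - move=> _ _ /exA[a Na ->] /exA[b Nb ->] /adjointE ->; rewrite big_seq1 /=.
    have Ma := NM' _ Na; rewrite -(piJ hg)// -opM -(piM hg)//; last exact: (vn_adj vM).
    rewrite (piT hg); last by apply: (vnM vM) => //; exact: (vn_adj vM).
    move=> /(tr_faith ht Ma) ->; have := piL hg (-1) (vn0 vM) (vn0 vM).
    by rewrite scaler0 addr0 scaleN1r addNr => ->.
  move=> _ _ /exA[a Na ->] /exA[b Nb ->]; rewrite !big_seq1 -!val_bmul.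
  have [Ma Mb] := (NM' _ Na, NM' _ Nb).
  have [Mab Mba] := (vnM vM Ma Mb, vnM vM Mb Ma).
  by rewrite -(piM hg Ma Mb) -(piM hg Mb Ma) (piT hg Mab) (piT hg Mba) (trC ht).
have tC : tracial_state (commutant A) (fun T => \sum_(z <- zs) hdot (T z) z).
  split; first exact: list_normal (@commutant_bounded _ _ _).
  - exact: z1.
  - move=> _ _ /exC[S PS ->] /exC[T PT ->] /adjointE ->; rewrite sumr_ge0// => z _ /=.
    by rewrite adjPr hdotxx lecR exprn_ge0 ?nm_ge0.
  - by move=> _ _ /exC[S PS ->] /exC[T PT ->] /adjointE -> /(zf _ PS) ->.
  - by move=> _ _ /exC[S PS ->] /exC[T PT ->]; exact: zC.
have sA : Defs.subspace A.
  split; first by exists 0; [exact: (vn0 vN)|rewrite -[0]/(opval (0 : bop H)) oprepE (pi0 vM hg)].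
  move=> z _ _ /exA[a Na ->] /exA[b Nb ->]; exists (opval (z *: a + b)).
    by apply: (vnD vN) => //; exact: (vnZ _ vN).
  by rewrite oprepE (piL hg)//; exact: NM'.
have sC : Defs.subspace (commutant A).
  have vP := vnPN hg vN NM'.
  have PC T : el (commN pi (lift N)) T -> commutant A (opval T) by rewrite -PE.
  split; first by apply: (PC 0); exact: vn0 vP.
  move=> z _ _ /exC[S PS ->] /exC[T PT ->]; apply: (PC (z *: S + T)).
  by apply: (vnD vP) => //; exact: (vnZ _ vP).
have [p hp] := cyclic_projection_exists Om sC.
have [q hq] := cyclic_projection_exists Om sA.
(* The index is the quotient computed at the vector [Om]; that it is a real number is all that is
   claimed. *)
eexists; exists tau, K, (oprep pi), Om; split=> //.
  exact: (gns_GNS_triple bM vM tE hg).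
right; eexists; eexists; exists Om, p, q; split; [exact: tA|exact: tC| |by []|by []].
by apply/eqP => Om0; have := Om1; rewrite Om0 hdot0l => /eqP; rewrite eq_sym oner_eq0.
Qed.

End FiniteIndex.

Theorem theorem4p4 (R : realType) (H : hilbertType R) (N M : set (H -> H))
  (hN : II1_factor N) (hM : II1_factor M)
  (sN : separable_predual N) (sM : separable_predual M) (hNM : N `<=` M) :
  (cstar_irreducible N M <-> relative_Dixmier N M) /\
  (relative_Dixmier N M <->
     (irreducible_inclusion N M /\ finite_Jones_index N M)).
Proof.
have [[fN _ _] [fM _ [tau htau]]] := (hN, hM).
have [vN vM] := (lift_vn fN.1, lift_vn fM.1).
have [bN bM] := (vN_bounded fN.1, vN_bounded fM.1).
have [t [ht _]] := lift_tracial bM vM htau.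
have NM' a : el (lift N) a -> el (lift M) a by exact: hNM.
have i_iii : cstar_irreducible N M -> irreducible_inclusion N M /\ finite_Jones_index N M.
  move=> /(cstar_irreducibleE _ bN) simp; split; last exact: finite_index_of_simple.
  apply: (irreducible_inclusionE bN bM vM).2.
  exact: (simple_irreducible vN vM ht NM' simp).
have iii_ii : irreducible_inclusion N M /\ finite_Jones_index N M -> relative_Dixmier N M.
  by move=> [irr idx]; exact: Dixmier_of_index.
have ii_i : relative_Dixmier N M -> cstar_irreducible N M.
  move=> /(relative_DixmierE bN vN bM) dix; apply: (cstar_irreducibleE _ bN).2.
  exact: (dixmier_simple vM ht NM' dix).
split; first by split=> [/i_iii/iii_ii|/ii_i].
by split=> [/ii_i/i_iii|/iii_ii].
Qed.
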